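(* Let $n\ge1$ be an integer, $0<\alpha<1$, $T>0$, and let $c^\nu>0$ be a constant. Consider the Cauchy problem $${}_0D_t^\alpha N(x,t)=c^\nu\Delta N(x,t),\qquad x\in\mathbb{R}^n,\ 0<t\le T,$$ with $$N(x,t=0)=\delta(x),\quad x\in\mathbb{R}^n,\qquad \lim_{|x|\to\infty}N(x,t)=0,$$ where ${}_0D_t^\alpha$ is the regularized Caputo partial fractional derivative with respect to $t$, $\Delta$ is the Laplacian in $x$, and $\delta$ is the Dirac delta. The fundamental solution of this Cauchy problem is given by $$N(x,t)=|x|^{-n}\pi^{-n/2}\,H^{2,0}_{1,2}\left[\frac{|x|^2t^{-\alpha}}{4c^\nu}\,\middle|\,{(1,\alpha)\atop (n/2,1),(1,1)}\right].$$
   Context: The regularized Caputo partial fractional derivative with respect to $t$, for $0<\alpha<1$, is $${}_0D_t^\alpha N(x,t)=\frac{1}{\Gamma(1-\alpha)}\left[\frac{\partial}{\partial t}\int_0^t\frac{N(x,s)\,ds}{(t-s)^\alpha}-\frac{N(x,0)}{t^\alpha}\right].$$ The H-function appearing in the claim is given, for $z>0$, by the Mellin-Barnes integral $$H^{2,0}_{1,2}\left[z\,\middle|\,{(a,A)\atop (b_1,B_1),(b_2,B_2)}\right]=\frac{1}{2\pi i}\int_L\frac{\Gamma(b_1-B_1s)\,\Gamma(b_2-B_2s)}{\Gamma(a-As)}\,z^s\,ds,$$ where $L$ is a contour from $-i\infty$ to $+i\infty$ (here a vertical line $\operatorname{Re}s=\sigma$ with $\sigma<\min(n/2,1)$) having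 all poles of $\Gamma(b_1-B_1s)\Gamma(b_2-B_2s)$ to its right. The formula is for $x\neq0$. *)

(* Defs.v *)
From HB Require Import structures.
From mathcomp Require Import all_boot all_order all_algebra.
From mathcomp Require Import complex.
From mathcomp Require Import all_classical all_reals all_analysis.

Set Implicit Arguments.
Unset Strict Implicit.
Unset Printing Implicit Defensive.

Import Order.TTheory GRing.Theory Num.Theory.
Import numFieldNormedType.Exports.

Local Open Scope classical_set_scope.
Local Open Scope ring_scope.
Local Open Scope complex_scope.

Local Notation Re := complex.Re.
Local Notation Im := complex.Im.

Definition cexp (R : realType) (w : R[i]) : R[i] :=
  (expR (Re w) * cos (Im w)) +i* (expR (Re w) * sin (Im w)).

(* [z ^ w] for real [z > 0], principal branch. *)
Definition cpowR (R : realType) (z : R) (w : R[i]) : R[i] :=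
  cexp (w * (ln z)%:C).

Definition cintegral (R : realType) (D : set R) (f : R -> R[i]) : R[i] :=
  (\int[lebesgue_measure]_(u in D) Re (f u)) +i*
  (\int[lebesgue_measure]_(u in D) Im (f u)).

Definition euler_integral (R : realType) (w : R[i]) : R[i] :=
  cintegral `]0, +oo[ (fun u => cpowR u (w - 1) * (expR (- u))%:C).

(* Euler's integral, continued to [Re w <= 0] by the functional equation:
   [m] is the least natural number with [Re (w + m) > 0].  Because [0^-1 = 0],
   [cGamma] is [0] at its poles, so that [(cGamma w)^-1] is the entire function
   [1 / Gamma] at every [w]. *)
Definition cGamma (R : realType) (w : R[i]) : R[i] :=
  let m := if 0 < Re w then 0%N else (Num.truncn (- Re w)).+1 in
  euler_integral (w + m%:R) / \prod_(k < m) (w + k%:R).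

Definition Gamma (R : realType) (x : R) : R := Re (cGamma x%:C).

(* [H^{2,0}_{1,2}[z | (a,A); (b1,B1),(b2,B2)]] along the upward vertical line
   [Re s = sigma]; the factor ['i] inside the integral is [ds = 'i dtau]. *)
Definition foxH2012 (R : realType) (sigma a A b1 B1 b2 B2 z : R) : R[i] :=
  (2 * pi%:C * 'i%C)^-1 *
  cintegral setT (fun tau =>
    let s := sigma +i* tau in
    cGamma (b1%:C - B1%:C * s) * cGamma (b2%:C - B2%:C * s)
      / cGamma (a%:C - A%:C * s) * cpowR z s * 'i%C).

Definition tcons (R : realType) (n : nat)
    (p : measurableTypeR R * n.-tuple (measurableTypeR R)) :
  n.+1.-tuple (measurableTypeR R) := [tuple of p.1 :: p.2].

Fixpoint lebn (R : realType) (n : nat) :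
    set (n.-tuple (measurableTypeR R)) -> \bar R :=
  match n with
  | 0 => dirac [tuple]
  | m.+1 => pushforward (lebesgue_measure \x @lebn R m)%E (@tcons R m)
  end.

Lemma measurable_tcons (R : realType) (n : nat) :
  measurable_fun setT (@tcons R n).
Proof. exact: measurable_cons. Qed.

Lemma product_sigma_finite d1 d2 (T1 : measurableType d1)
    (T2 : measurableType d2) (R : realType)
    (m1 : {sigma_finite_measure set T1 -> \bar R})
    (m2 : {sigma_finite_measure set T2 -> \bar R}) :
  sigma_finite setT (m1 \x m2)%E.
Proof.
have /sigma_finiteP[F [TF ndF Foo]] := sigma_finiteT m1.
have /sigma_finiteP[G [TG ndG Goo]] := sigma_finiteT m2.
exists (fun n => F n `*` G n).
  rewrite -setXTT TF TG predeqE => -[x y]; split.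
    move=> [/= [n _ Fnx] [k _ Gky]]; exists (maxn n k) => //; split.
    - by move: x Fnx; exact/subsetPset/ndF/leq_maxl.
    - by move: y Gky; exact/subsetPset/ndG/leq_maxr.
  by move=> [n _ []/= ? ?]; split; exists n.
move=> k; have [? ?] := Foo k; have [? ?] := Goo k.
split; first exact: measurableX.
by rewrite product_measure1E// lte_mul_pinfty// ge0_fin_numE.
Qed.

Lemma lebn_packed (R : realType) (n : nat) :
  exists mu : {sigma_finite_measure set (n.-tuple (measurableTypeR R)) -> \bar R},
    @lebn R n = mu.
Proof.
elim: n => [|n [mu E]] /=.
  by exists (dirac [tuple]).
rewrite E.
pose p := [the {measure set _ -> \bar R} of (lebesgue_measure \x mu)%E].
pose mf := @measurable_tcons R n.
pose q : {measure set _ -> \bar R} :=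
  @measure_function_pushforward__canonical__measure_function_Measure
    _ _ _ _ R p (@tcons R n) mf.
have sq : sigma_finite setT q.
  have [F FT Fs] : sigma_finite setT p by exact: product_sigma_finite.
  pose g (u : n.+1.-tuple (measurableTypeR R)) :
    measurableTypeR R * n.-tuple (measurableTypeR R) :=
    (thead u, [tuple of behead u]).
  have gK : cancel (@tcons R n) g.
    by move=> [x u]; rewrite /g /tcons /= theadE; congr pair; apply: val_inj.
  have mg : measurable_fun setT g.
    apply/measurable_fun_pairP; split.
      exact: (@measurable_tnth _ (measurableTypeR R) n.+1 ord0).
    exact: measurable_behead.
  exists (fun i => g @^-1` F i).
    by rewrite -preimage_bigcup -FT preimage_setT.
  move=> i; have [mFi Fioo] := Fs i; split.
    by rewrite -[X in measurable X]setTI; exact: mg.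
  rewrite /q /= /pushforward -comp_preimage.
  by rewrite (_ : g \o @tcons R n = id) //; apply/funext => z /=; exact: gK.
pose sm := @Measure_isSigmaFinite.Build _ _ R (q : set _ -> \bar R) sq.
pose r : {sigma_finite_measure set (n.+1.-tuple (measurableTypeR R)) -> \bar R}
  := HB.pack (q : set _ -> \bar R) q sm.
by exists r.
Qed.

Lemma lebn0 (R : realType) (n : nat) : @lebn R n set0 = 0%E.
Proof. by have [mu ->] := lebn_packed R n; exact: measure0. Qed.

Lemma lebn_ge0 (R : realType) (n : nat) A : (0 <= @lebn R n A)%E.
Proof. by have [mu ->] := lebn_packed R n; exact: measure_ge0. Qed.

Lemma lebn_semi_sigma_additive (R : realType) (n : nat) :
  semi_sigma_additive (@lebn R n).
Proof.
by have [mu ->] := lebn_packed R n; exact: measure_semi_sigma_additive.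
Qed.

HB.instance Definition _ (R : realType) (n : nat) :=
  isMeasure.Build _ _ _ (@lebn R n) (lebn0 R n) (@lebn_ge0 R n)
    (@lebn_semi_sigma_additive R n).

Lemma lebn_sigma_finite (R : realType) (n : nat) :
  sigma_finite setT (@lebn R n).
Proof. by have [mu ->] := lebn_packed R n; exact: sigma_finiteT. Qed.

HB.instance Definition _ (R : realType) (n : nat) :=
  Measure_isSigmaFinite.Build _ _ _ (@lebn R n) (@lebn_sigma_finite R n).

Definition row_of_tuple (R : realType) (n : nat)
    (u : n.-tuple (measurableTypeR R)) : 'rV[R]_n :=
  \row_(i < n) tnth u i.

Definition integrableRn (R : realType) (n : nat) (f : 'rV[R]_n -> R) : Prop :=
  (@lebn R n).-integrable setT (fun u => (f (row_of_tuple u))%:E).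

Definition intRn (R : realType) (n : nat) (f : 'rV[R]_n -> R) : R :=
  \int[@lebn R n]_u f (row_of_tuple u).

(* The library norm on ['rV[R]_n] is the sup norm; [|x|] is Euclidean here. *)
Definition enorm (R : realType) (n : nat) (x : 'rV[R]_n) : R :=
  Num.sqrt (\sum_(i < n) x 0 i ^+ 2).

Definition pderiv (R : realType) (n : nat) (i : 'I_n) (f : 'rV[R]_n -> R) :
  'rV[R]_n -> R := 'D_(delta_mx 0 i) f.

Definition pderivable (R : realType) (n : nat) (i : 'I_n)
    (f : 'rV[R]_n -> R) (x : 'rV[R]_n) : Prop :=
  derivable f x (delta_mx 0 i).

Definition laplacian (R : realType) (n : nat) (f : 'rV[R]_n -> R)
    (x : 'rV[R]_n) : R :=
  \sum_(i < n) pderiv i (pderiv i f) x.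

(* All iterated partial derivatives exist and are continuous. *)
Definition smooth (R : realType) (n : nat) (f : 'rV[R]_n -> R) : Prop :=
  forall s : seq 'I_n, let g := foldr (@pderiv R n) f s in
    continuous g /\ forall i x, pderivable i g x.

Definition test_function (R : realType) (n : nat) (phi : 'rV[R]_n -> R) :
    Prop :=
  smooth phi /\ exists r : R, forall x, r < enorm x -> phi x = 0.

Definition abel_integral (R : realType) (alpha : R) (g : R -> R) (t : R) : R :=
  \int[lebesgue_measure]_(s in `[0, t]) (g s / (t - s) `^ alpha).

(* [is_caputo T alpha g t l]: the regularized Caputo derivative of order
   [alpha] of [g : [0, T] -> R] exists at [t] and equals [l].  The derivative
   [d/dt] is taken relative to [(0, T]], hence one-sided at [t = T]; the values
   of [g] outside [[0, T]] are irrelevant. *)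
Definition is_caputo (R : realType) (T alpha : R) (g : R -> R) (t l : R) :
    Prop :=
  exists2 d : R,
    (abel_integral alpha g s - abel_integral alpha g t) / (s - t)
      @[s --> within [set s | 0 < s <= T] t^'] --> d &
    l = (Gamma (1 - alpha))^-1 * (d - g 0 / t `^ alpha).

(* [t |-> <N(., t), phi>] on [[0, T]], where [N(., 0)] is the Dirac delta. *)
Definition pairing (R : realType) (n : nat) (N : 'rV[R]_n -> R -> R)
    (phi : 'rV[R]_n -> R) (t : R) : R :=
  if t == 0 then phi 0 else intRn (fun x => N x t * phi x).

(* The datum is a distribution, so [D_t^alpha N = cnu Delta N] and
   [N(., 0) = delta] are required on all of R^n in the sense of distributions
   in [x] ([fs_weak_*]): the Caputo operator acts on [t |-> <N(., t), phi>],
   continuous on [[0, T]] with value [phi 0] at [t = 0].  Away from [x = 0],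
   where [delta] vanishes, the equation and the datum are also required
   pointwise ([fs_init], [fs_regular], [fs_eq]); these clauses alone would not
   see the point source.  [fs_mass] fixes the solution class: [N(., t)] is
   bounded in [L^1(R^n)] uniformly in [t]. *)
Record fundamental_solution (R : realType) (n : nat) (alpha cnu T : R)
    (N : 'rV[R]_n -> R -> R) : Prop := FundamentalSolution {
  fs_mass : exists M : R, forall t, 0 < t <= T ->
    integrableRn (N ^~ t) /\ intRn (fun x => `|N x t|) <= M;
  fs_weak_init : forall phi, test_function phi ->
    {within `[0, T], continuous (pairing N phi)};
  fs_weak_eq : forall phi t, test_function phi -> 0 < t <= T ->
    is_caputo T alpha (pairing N phi) t
      (cnu * intRn (fun x => N x t * laplacian phi x));
  fs_init : forall x, x != 0 ->
    N x 0 = 0 /\ {within `[0, T], continuous (N x)};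
  fs_regular : forall x t, x != 0 -> 0 < t <= T ->
    {for x, continuous (N ^~ t)} /\
    forall i, pderivable i (N ^~ t) x /\ pderivable i (pderiv i (N ^~ t)) x;
  fs_eq : forall x t, x != 0 -> 0 < t <= T ->
    is_caputo T alpha (N x) t (cnu * laplacian (N ^~ t) x);
  fs_decay : forall t, 0 < t <= T -> forall e : R, 0 < e ->
    exists r : R, forall x, r < enorm x -> `|N x t| < e
}.

(* Main.v *)
From HB Require Import structures.
From mathcomp Require Import all_boot all_order all_algebra.
From mathcomp Require Import complex.
From mathcomp Require Import all_classical all_reals all_analysis.
From mathcomp Require Import ring lra.
From mathcomp Require Import measurable_realfun.
Require Import Defs.
Set Implicit Arguments.
Unset Strict Implicit.
Unset Printing Implicit Defensive.
Import Order.TTheory GRing.Theory Num.Theory.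
Import numFieldNormedType.Exports.
Local Open Scope classical_set_scope.
Local Open Scope ring_scope.
Local Open Scope complex_scope.

(** The solution is the heat flow run with a random clock. Let [mfun] be the
    Wright M-function of order alpha, whose Mellin transform is

      int_0^oo M(u) u^(-p) du = Gamma(1 - p) / Gamma(1 - alpha p),  Re p < 1,

    and let G(x, v) be the heat kernel of R^n at time v. Then

      N(x, t) = int_0^oo M(u) G(x, cnu u t^alpha) du

    is a fundamental solution ([subord], [sol]).

    Existence. Let P be a bounded function of the flow time with derivative Q, and
    p(t) = int_0^oo M(u) P(c u t^alpha) du. An integration by parts expresses p
    through Q and the tail of M ([subord_tail]), so that applying the Abel
    integral to p amounts to applying it to that tail. By [Abel_mtail] the result
    is Gamma(1 - alpha) times a primitive of int M(u) Q(c u s^alpha) du, up to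
    the constant c and the contribution of P(0); differentiated, this says that the
    Caputo derivative of p is c int M(u) Q(c u t^alpha) du ([caputo_subord]).
    Both sides of [Abel_mtail] are multiplicative convolutions; their Mellin
    transforms agree by the formula above and Euler's Beta integral, and the Mellin
    transform is injective ([Mellin_unique]). For P the heat kernel at a fixed
    x <> 0, with Q its Laplacian, this is the equation off the origin; for P the
    heat flow of a test function, observed at the origin, it is the weak equation,
    point source included ([sol_fundamental]).

    The M-function itself is a Laplace inversion integral on a vertical line. Its
    Mellin transform follows by rotating the ray in the Gamma integral
    ([gam_clog]) and from Hankel's formula for 1 / Gamma ([Hankel_vertical]).
    Contours are never deformed: rotation is a differential equation in the
    direction, and Hankel's formula, the Cahen-Mellin integral and Mellin
    uniqueness are three instances of one theorem on pointwise Fourier inversion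
    ([fourier_inversion]).

    The H-function. Write z for its argument |x|^2 t^(-alpha) / (4 cnu). In the
    Mellin-Barnes integrand the quotient Gamma(1 - s) / Gamma(1 - alpha s) is the
    Mellin transform of M, and the integral of Gamma(n/2 - s) against a power is
    the Cahen-Mellin integral. Fubini's theorem turns the contour integral into
    int_0^oo M(u) (z/u)^(n/2) exp(- z/u) du, which is N(x, t) up to the factor
    |x|^(-n) pi^(-n/2) ([foxH_mixture], [sol_foxH]).

    Uniqueness. Let W be the difference of two fundamental solutions and
    w_phi(t) the integral of W(., t) phi. For a test function phi the delta
    functions cancel, and the weak equation integrates to
    Abel(w_phi)(t) = Gamma(1 - alpha) cnu int_0^t w_(Laplacian phi)
    ([caputo_volterra]). Since the mass of W(., t) is bounded, test functions may be
    replaced by plane waves, by means of slowly varying cut-offs. Waves are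
    eigenfunctions of the Laplacian, so there remains a homogeneous Abel equation
    for w_phi, which forces int_0^t w_phi = 0 for all t ([abel_unique]). Bounded
    limits of products of cosines are Gaussians; hence for almost every t, W(., t)
    is orthogonal to all the Gaussians exp(- m |x - y|^2), and it vanishes at y
    ([gauss_concentration]). Continuity in time removes the exceptional set
    ([solution_unique]). *)

(** * Real-valued integration *)
Section real_integration.
Context {R : realType}.
Notation mu := (@lebesgue_measure R).

Lemma is_derive_continuous (f : R -> R) (x d : R) : is_derive x 1 f d ->
  {for x, continuous f}.
Proof.
move=> df; apply: differentiable_continuous; apply/derivable1_diffP.
exact: ex_derive.
Qed.

Lemma is_derive_comp (f g : R -> R) (x a b : R) : is_derive (g x) 1 f a ->
  is_derive x 1 g b -> is_derive x 1 (fun t => f (g t)) (a * b).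
Proof. exact: is_derive1_comp. Qed.

Lemma measurable_invr : measurable_fun setT (fun x : R => x^-1).
Proof.
have m0 : measurable [set (0 : R)] by [].
rewrite -(setUv [set (0:R)]); apply/measurable_funU => //; first exact: measurableC.
split; first by apply: measurable_fun_set1.
apply: open_continuous_measurable_fun.
  by apply: closed_openC; exact: closed_eq.
by move=> x; rewrite inE /= => /eqP x0; exact: inv_continuous.
Qed.

Section general_measure.
Context d (T : measurableType d) (m : {measure set T -> \bar R}) (D : set T).
Hypothesis mD : measurable D.
Implicit Types f g : T -> R.

Lemma integrable_dom f g : measurable_fun D f ->
  (forall x, D x -> `|f x| <= g x) ->
  m.-integrable D (EFin \o g) -> m.-integrable D (EFin \o f).
Proof.
move=> mf fg ig; apply: (le_integrable mD _ _ ig); first exact/measurable_EFinP.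
by move=> x Dx /=; rewrite lee_fin (le_trans (fg _ Dx))// ler_norm.
Qed.

Lemma integrableST (f : T -> \bar R) : m.-integrable setT f -> m.-integrable D f.
Proof. by move=> h; apply: integrableS h => //; exact: subsetT. Qed.

Lemma integrable_normr f : m.-integrable D (EFin \o f) ->
  m.-integrable D (EFin \o (fun x => `|f x|)).
Proof. by move=> h; exact: (integrable_norm h). Qed.

Lemma normr_Rintegral_le f g : m.-integrable D (EFin \o f) ->
  m.-integrable D (EFin \o g) -> (forall x, D x -> `|f x| <= g x) ->
  `|\int[m]_(x in D) f x| <= \int[m]_(x in D) g x.
Proof.
move=> h1 h2 fg; apply: (le_trans (le_normr_Rintegral mD h1)).
by apply: le_Rintegral => //; exact: integrable_normr.
Qed.

Lemma Rintegral_split (A : set T) f : measurable A -> A `<=` D ->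
  m.-integrable D (EFin \o f) ->
  \int[m]_(x in D) f x =
  \int[m]_(x in A) f x + \int[m]_(x in D `\` A) f x.
Proof.
move=> mA AD intf; rewrite -[in LHS](setDUK AD) Rintegral_setU//.
- exact: measurableD.
- by rewrite setDUK.
- by apply/disj_setPS => u [? []].
Qed.

Lemma integrableRD f g : m.-integrable D (EFin \o f) ->
  m.-integrable D (EFin \o g) ->
  m.-integrable D (EFin \o (fun x => f x + g x)).
Proof.
move=> h1 h2; rewrite (_ : _ \o _ = ((EFin \o f) \+ (EFin \o g))%E)//.
exact: integrableD.
Qed.

Lemma integrableRB f g : m.-integrable D (EFin \o f) ->
  m.-integrable D (EFin \o g) ->
  m.-integrable D (EFin \o (fun x => f x - g x)).
Proof.
move=> h1 h2; rewrite (_ : _ \o _ = ((EFin \o f) \- (EFin \o g))%E)//.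
exact: integrableB.
Qed.

Lemma integrableRZ (a : R) f : m.-integrable D (EFin \o f) ->
  m.-integrable D (EFin \o (fun x => a * f x)).
Proof.
move=> h1; rewrite (_ : _ \o _ = (fun x => a%:E * (EFin \o f) x)%E)//.
exact: integrableZl.
Qed.

Lemma Rintegral_dct (f_ : nat -> T -> R) f g :
  (forall n, measurable_fun D (f_ n)) ->
  (forall x, D x -> f_ n x @[n --> \oo] --> f x) ->
  m.-integrable D (EFin \o g) -> (forall n x, D x -> `|f_ n x| <= g x) ->
  m.-integrable D (EFin \o f) /\
  \int[m]_(x in D) f_ n x @[n --> \oo] --> \int[m]_(x in D) f x.
Proof.
move=> mf ff ig fg.
have mlim : measurable_fun D f by exact: (measurable_fun_cvg mf).
have [//|//||||h1 _ h2] := @dominated_convergence _ _ _ m D mD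
  (fun n => EFin \o f_ n) (EFin \o f) (EFin \o g).
- by move=> n; exact/measurable_EFinP.
- exact/measurable_EFinP.
- by apply/aeW => x Dx; apply: cvg_EFin; [exact: nearW|exact: ff].
- by [].
- by apply/aeW => x n Dx; rewrite /= lee_fin; exact: fg.
split => //; apply: fine_cvg => //.
by rewrite fineK//; exact: integrable_fin_num.
Qed.

(** Inner integrals arise as extended reals; an integrable function is finite
    almost everywhere, so the passage to real values loses nothing. *)
Lemma integrable_fine (g : T -> \bar R) : m.-integrable D g ->
  m.-integrable D (EFin \o (fine \o g)) /\
  (\int[m]_(x in D) g x = \int[m]_(x in D) (fine (g x))%:E)%E.
Proof.
move=> ig; have mg := measurable_int _ ig.
have mfg : measurable_fun D (EFin \o (fine \o g)).
  by apply/measurable_EFinP; apply: measurableT_comp.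
split.
  apply: (le_integrable mD _ _ ig) => // x Dx /=.
  by case: (g x) => [r| |] //=; rewrite ?normr0 ?leey.
apply: ae_eq_integral => //.
apply: filterS (integrable_ae mD ig) => x h Dx.
by rewrite fineK//; exact: h.
Qed.

End general_measure.

Section fubini.
Context d1 d2 (T1 : measurableType d1) (T2 : measurableType d2).
Variables (m1 : {sigma_finite_measure set T1 -> \bar R})
  (m2 : {sigma_finite_measure set T2 -> \bar R}).
Variables (D1 : set T1) (D2 : set T2) (f : T1 * T2 -> R) (h : T2 -> R).
Hypotheses (mD1 : measurable D1) (mD2 : measurable D2)
  (mf : measurable_fun setT f) (ih : m2.-integrable D2 (EFin \o h))
  (fh : forall y, D2 y ->
     (\int[m1]_(x in D1) (`|f (x, y)|)%:E <= (h y)%:E)%E).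

Let F := f \_ (D1 `*` D2).

Let FE1 x : D1 x -> (fun y => (F (x, y))%:E) = ((fun y => (f (x, y))%:E) \_ D2).
Proof.
move=> Dx; apply/funext => y; rewrite /F !patchE.
have [|/negP] := boolP (y \in D2); rewrite inE /= => h0.
  by rewrite mem_set.
by rewrite memNset// => -[].
Qed.

Let FE2 y : D2 y -> (fun x => (F (x, y))%:E) = ((fun x => (f (x, y))%:E) \_ D1).
Proof.
move=> Dy; apply/funext => x; rewrite /F !patchE.
have [|/negP] := boolP (x \in D1); rewrite inE /= => h0.
  by rewrite mem_set.
by rewrite memNset// => -[].
Qed.

Let F01 x y : ~ D1 x -> F (x, y) = 0.
Proof. by move=> nD; rewrite /F patchE memNset// => -[]. Qed.

Let F02 x y : ~ D2 y -> F (x, y) = 0.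
Proof. by move=> nD; rewrite /F patchE memNset// => -[]. Qed.

Let G1 : fubini_F m2 (EFin \o F) =
  (fun x => \int[m2]_(y in D2) (f (x, y))%:E)%E \_ D1.
Proof.
apply/funext => x; rewrite /fubini_F patchE.
have [|/negP] := boolP (x \in D1); rewrite inE /= => h0.
  by rewrite [RHS]integral_mkcond -FE1.
by apply: integral0_eq => y _ /=; rewrite F01.
Qed.

Let G2 : fubini_G m1 (EFin \o F) =
  (fun y => \int[m1]_(x in D1) (f (x, y))%:E)%E \_ D2.
Proof.
apply/funext => y; rewrite /fubini_G patchE.
have [|/negP] := boolP (y \in D2); rewrite inE /= => h0.
  by rewrite [RHS]integral_mkcond -FE2.
by apply: integral0_eq => x _ /=; rewrite F02.
Qed.

Let iF : (m1 \x m2)%E.-integrable setT (EFin \o F).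
Proof.
have mF : measurable_fun setT (EFin \o F).
  have mDD : measurable (D1 `*` D2) by exact: measurableX.
  apply/measurable_EFinP; apply: (measurable_restrictT f mDD).1.
  by apply: measurable_funS mf.
apply/(integrable21ltyP m1 m2 mF).
apply: (@le_lt_trans _ _ (\int[m2]_(y in D2) (h y)%:E)%E); last first.
  exact: (integrable_lty mD2 ih).
rewrite [leRHS]integral_mkcond.
apply: ge0_le_integral => //.
- by move=> y _; exact: integral_ge0.
- apply: (measurable_fun_fubini_tonelli_G (abse \o (EFin \o F))) => //.
  exact: measurableT_comp.
  by move=> z; exact: abse_ge0.
- by apply: ((measurable_restrictT _ mD2).1 (measurable_int _ ih)).
move=> y _; rewrite patchE.
have [|/negP] := boolP (y \in D2); rewrite inE /= => h0; last first.
  by rewrite integral0_eq// => x _ /=; rewrite F02// normr0.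
apply: le_trans (fh h0); rewrite [leRHS]integral_mkcond.
rewrite le_eqVlt; apply/orP; left; apply/eqP; apply: eq_integral => x _.
have /(congr1 (fun k => k x)) /= := FE2 h0.
by rewrite !patchE; case: ifPn => // _ [->]//; rewrite normr0.
Qed.

(** Fubini's theorem in the form in which it is applied to explicit kernels:
    a bound of the inner absolute integral in one order is enough. *)
Lemma Fubini_dominated :
  [/\ m1.-integrable D1 (EFin \o (fun x => \int[m2]_(y in D2) f (x, y))),
      m2.-integrable D2 (EFin \o (fun y => \int[m1]_(x in D1) f (x, y))) &
      \int[m1]_(x in D1) \int[m2]_(y in D2) f (x, y) =
      \int[m2]_(y in D2) \int[m1]_(x in D1) f (x, y)].
Proof.
have := integrable_fubini_F iF; rewrite G1 -integrable_mkcond// => i1.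
have i2 : m2.-integrable D2 (fun y => \int[m1]_(x in D1) (f (x, y))%:E)%E.
  have mG := measurable_fubini_G iF; rewrite G2 in mG.
  apply: (le_integrable mD2 _ _ ih); first exact/(measurable_restrictT _ mD2).2.
  move=> y Dy; apply: le_trans (le_abse_integral m1 mD1 _) _.
    by apply/measurable_EFinP/measurable_funTS; exact: measurableT_comp.
  apply: le_trans (fh Dy) _; rewrite lee_fin; exact: ler_norm.
have [j1 e1] := integrable_fine mD1 i1.
have [j2 e2] := integrable_fine mD2 i2.
split => //; rewrite /Rintegral -e1 -e2; congr fine.
have := Fubini iF; rewrite -/(fubini_F m2 (EFin \o F)) -/(fubini_G m1 _).
transitivity (\int[m1]_x fubini_F m2 (EFin \o F) x)%E.
  by rewrite G1 [LHS]integral_mkcond.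
by rewrite [RHS]integral_mkcond -G2.
Qed.

End fubini.

Lemma FTC_cc (F f : R -> R) (a b : R) : a < b ->
  (forall x, a <= x <= b -> is_derive x 1 F (f x)) ->
  (forall x, a <= x <= b -> {for x, continuous f}) ->
  mu.-integrable `[a, b] (EFin \o f) /\
  \int[mu]_(x in `[a, b]) f x = F b - F a.
Proof.
move=> ab dF cf.
have cw : {within `[a, b], continuous f}.
  by apply/continuous_in_subspaceT => x; rewrite inE /= in_itv /=; exact: cf.
split.
  by apply: continuous_compact_integrable => //; exact: segment_compact.
have cF x : a <= x <= b -> F y @[y --> x] --> F x.
  by move=> /dF; exact: is_derive_continuous.
rewrite /Rintegral (@continuous_FTC2 _ f F)//.
- split.
  + by move=> x /subset_itv_oo_cc; rewrite in_itv /= => /dF [].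
  + by apply: cvg_at_right_filter; apply: cF; rewrite lexx ltW.
  + by apply: cvg_at_left_filter; apply: cF; rewrite lexx ltW.
- move=> x /subset_itv_oo_cc; rewrite in_itv /= => xab; rewrite derive1E.
  by apply: derive_val; exact: dF.
Qed.

(** The fundamental theorem of calculus on an arbitrary interval [D], exhausted
    by the compact intervals from [a n] to [b n]: dominated convergence when [f]
    is integrable, Fatou's lemma to show that it is. *)
Section ftc_interval.
Variables (D : set R) (F f : R -> R) (a b : nat -> R).
Hypotheses (mD : measurable (D : set (measurableTypeR R))) (ab : forall n, a n < b n)
  (abD : forall n x, a n <= x <= b n -> D x)
  (Dab : forall x, D x -> \forall n \near \oo, a n <= x <= b n)
  (dF : forall x, D x -> is_derive x 1 F (f x))
  (cf : forall x, D x -> {for x, continuous f}).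

Let I n := [set` `[a n, b n]].

Let mI n : measurable (I n : set (measurableTypeR R)). Proof. exact: measurable_itv. Qed.

Let FTC_compact n : (\int[mu]_(x in I n) (f x)%:E = (F (b n) - F (a n))%:E)%E.
Proof.
have h1 x : a n <= x <= b n -> is_derive x 1 F (f x) by move=> /abD; exact: dF.
have h2 x : a n <= x <= b n -> {for x, continuous f} by move=> /abD; exact: cf.
have [i1 <-] := FTC_cc (ab n) h1 h2.
by rewrite /Rintegral fineK//; exact: integrable_fin_num.
Qed.

Let mf : measurable_fun D f.
Proof.
apply: (@measurable_fun_cvg _ _ _ D (fun n => f \_ (I n))).
  move=> n; apply: measurable_funTS; apply: (measurable_restrictT f (mI n)).1.
  apply: subspace_continuous_measurable_fun; first exact: mI.
  apply: continuous_in_subspaceT => x; rewrite inE /I /= in_itv/= => /abD; exact: cf.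
move=> x Dx; apply: (@cvg_trans _ (f x @[n --> \oo])); last exact: cvg_cst.
apply: near_eq_cvg; near=> n; rewrite patchE mem_set// /I /= in_itv/=.
by near: n; exact: Dab.
Unshelve. all: end_near. Qed.

Let mfI n : measurable_fun setT (f \_ (I n)).
Proof.
apply: (measurable_restrictT f (mI n)).1.
by apply: (measurable_funS mD _ mf) => x; rewrite /I /= in_itv/=; exact: abD.
Qed.

Let RintI n : \int[mu]_(x in D) (f \_ (I n)) x = F (b n) - F (a n).
Proof.
rewrite -Rintegral_mkcondr (_ : _ `&` _ = I n).
  by rewrite /Rintegral FTC_compact.
by rewrite setIidr// => x; rewrite /I /= in_itv /=; exact: abD.
Qed.

Let cvgI x : D x -> (f \_ (I n)) x @[n --> \oo] --> f x.
Proof.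
move=> Dx; apply: (@cvg_trans _ (f x @[n --> \oo])); last exact: cvg_cst.
apply: near_eq_cvg; near=> n; rewrite patchE mem_set// /I /= in_itv/=.
by near: n; exact: Dab.
Unshelve. all: end_near. Qed.

Lemma FTC_interval (A B : R) : mu.-integrable D (EFin \o f) ->
  F (a n) @[n --> \oo] --> A -> F (b n) @[n --> \oo] --> B ->
  \int[mu]_(x in D) f x = B - A.
Proof.
move=> intf FA FB.
have [||||_] := @Rintegral_dct _ _ mu D mD (fun n => f \_ (I n)) f (fun x => `|f x|).
- by move=> n; exact: (measurable_funTS (mfI n)).
- exact: cvgI.
- exact: integrable_norm.
- by move=> n x Dx; rewrite patchE; case: ifPn => // _; rewrite normr0.
under eq_fun do rewrite RintI.
by move=> h; apply/esym/(cvg_unique _ (cvgB FB FA)).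
Qed.

Lemma FTC_integrable (K : R) : (forall x, D x -> 0 <= f x) ->
  (forall n, F (b n) - F (a n) <= K) -> mu.-integrable D (EFin \o f).
Proof.
move=> f0 FK; apply/integrableP; split; first exact/measurable_EFinP.
have := @fatou _ _ _ mu D mD (fun n => EFin \o (f \_ (I n))).
have mm n : measurable_fun D (EFin \o (f \_ (I n))).
  by apply/measurable_EFinP; exact: (measurable_funTS (mfI n)).
have f0' n x : D x -> (0%R <= (EFin \o (f \_ (I n))) x)%E.
  by move=> Dx; rewrite /= lee_fin patchE; case: ifPn => // _; exact: f0.
move=> /(_ mm f0') h.
apply: (@le_lt_trans _ _ K%:E); last by rewrite ltry.
rewrite (_ : \int[mu]_(x in D) _ =
    \int[mu]_(x in D) limn_einf (fun n => (EFin \o (f \_ (I n))) x))%E; last first.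
  apply: eq_integral => x; rewrite inE => Dx.
  have c : (EFin \o (f \_ (I n))) x @[n --> \oo] --> (f x)%:E.
    by apply: cvg_EFin; [exact: nearW|exact: cvgI].
  rewrite is_cvg_limn_einfE; last by apply/cvg_ex; exists (f x)%:E.
  by rewrite (cvg_lim _ c)//= ger0_norm// f0.
apply: (le_trans h); rewrite limn_einf_lim; apply: lime_le.
  exact: is_cvg_einfs.
apply: nearW => n; apply: (@le_trans _ _ (\int[mu]_(x in D) (EFin \o f \_ (I n)) x)%E).
  by apply: ereal_inf_lbound; exists n => //=.
rewrite integral_mkcond (_ : (_ \_ D) = (EFin \o f) \_ (I n)).
  by rewrite -integral_mkcond FTC_compact lee_fin.
apply/funext => x; rewrite !patchE /= patchE.
case: (boolP (x \in I n)) => xI; last by case: ifP.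
by rewrite mem_set//; apply: (abD (n := n)); move: xI; rewrite inE /I /= in_itv.
Qed.

End ftc_interval.

(** ** Half-line and line *)
Let cvg_Sinv : (n.+1%:R^-1 : R) @[n --> \oo] --> 0^'+.
Proof.
move=> A [e /= e0 eA]; suff: \forall n \near \oo, A (n.+1%:R^-1) by [].
near=> n; have h : (0 : R) < n.+1%:R^-1 by rewrite invr_gt0.
apply: eA => //.
rewrite /= sub0r normrN gtr0_norm ?invr_gt0//.
near: n; exact: near_infty_natSinv_lt (PosNum e0).
Unshelve. all: end_near. Qed.

Let cvg_S2 : (n.+2%:R : R) @[n --> \oo] --> +oo.
Proof.
apply/cvgryPge => A; near=> n; apply: (@le_trans _ _ (n%:R : R)); last by rewrite ler_nat ltnW.
by near: n; exact: nbhs_infty_ger.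
Unshelve. all: end_near. Qed.

Let posx (n : nat) : (n.+1%:R^-1 : R) < n.+2%:R.
Proof.
rewrite (@le_lt_trans _ _ 1)//; last by rewrite ltr1n.
by rewrite invf_le1// ler1n.
Qed.

Let near_0y (x : R) : 0 < x -> \forall n \near \oo, n.+1%:R^-1 <= x <= n.+2%:R.
Proof.
move=> x0; near=> n; apply/andP; split; apply: ltW.
  near: n; exact: near_infty_natSinv_lt (PosNum x0).
by near: n; have /cvgryPgt := cvg_S2; apply.
Unshelve. all: end_near. Qed.

Let near_T (x : R) : \forall n \near \oo, - n.+2%:R <= x <= n.+2%:R.
Proof.
near=> n; rewrite -ler_norml; apply: ltW.
by near: n; have /cvgryPgt := cvg_S2; apply.
Unshelve. all: end_near. Qed.

Let in_0y (n : nat) (x : R) : n.+1%:R^-1 <= x <= n.+2%:R -> `]0, +oo[%classic x.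
Proof.
by move=> /andP[h _]; rewrite /= in_itv /= andbT (lt_le_trans _ h)// invr_gt0.
Qed.

Lemma FTC_0y (F f : R -> R) (A B : R) :
  (forall x : R, 0 < x -> is_derive x 1 F (f x)) ->
  (forall x : R, 0 < x -> {for x, continuous f}) ->
  mu.-integrable `]0, +oo[ (EFin \o f) ->
  F x @[x --> 0^'+] --> A -> F x @[x --> +oo] --> B ->
  \int[mu]_(x in `]0, +oo[) f x = B - A.
Proof.
move=> dF cf intf FA FB.
apply: (@FTC_interval _ F f (fun n => n.+1%:R^-1) (fun n => n.+2%:R)) => //.
- by move=> x; rewrite /= in_itv /= andbT; exact: near_0y.
- by move=> x; rewrite /= in_itv /= andbT; exact: dF.
- by move=> x; rewrite /= in_itv /= andbT; exact: cf.
- exact: (cvg_comp _ _ cvg_Sinv).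
- exact: (cvg_comp _ _ cvg_S2).
Qed.

Lemma FTC_0y_integrable (F f : R -> R) (K : R) :
  (forall x : R, 0 < x -> is_derive x 1 F (f x)) ->
  (forall x : R, 0 < x -> {for x, continuous f}) ->
  (forall x, 0 < x -> 0 <= f x) -> (forall x, 0 < x -> `|F x| <= K) ->
  mu.-integrable `]0, +oo[ (EFin \o f).
Proof.
move=> dF cf f0 FK.
apply: (@FTC_integrable _ F f (fun n => n.+1%:R^-1) (fun n => n.+2%:R) _ _ _ _ _ _ (K + K)) => //.
- by move=> x; rewrite /= in_itv /= andbT; exact: near_0y.
- by move=> x; rewrite /= in_itv /= andbT; exact: dF.
- by move=> x; rewrite /= in_itv /= andbT; exact: cf.
- by move=> x; rewrite /= in_itv /= andbT; exact: f0.
move=> n; apply: (le_trans (ler_norm _)); apply: (le_trans (ler_normB _ _)).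
by apply: lerD; apply: FK; rewrite ?invr_gt0.
Qed.

Lemma FTC_T_integrable (F f : R -> R) (K : R) :
  (forall x : R, is_derive x 1 F (f x)) -> continuous f ->
  (forall x, 0 <= f x) -> (forall x, `|F x| <= K) ->
  mu.-integrable setT (EFin \o f).
Proof.
move=> dF cf f0 FK.
apply: (@FTC_integrable _ F f (fun n => - n.+2%:R) (fun n => n.+2%:R) _ _ _ _ _ _ (K + K)) => //.
- by move=> n; rewrite gt0_cp.
- by move=> x _; exact: cf.
move=> n; apply: (le_trans (ler_norm _)); apply: (le_trans (ler_normB _ _)).
exact: lerD.
Qed.

(** ** Affine changes of variables *)
(** The image of Lebesgue measure under [x |-> a * x + b], scaled by [|a|], has
    the right value on half-open intervals, hence is Lebesgue measure. *)
Section affine.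
Variables (a b : R).
Hypothesis a0 : a != 0.

Let g (x : R) := a * x + b.

Let mg : measurable_fun setT g.
Proof. by apply: continuous_measurable_fun => x; apply: cvgD; [exact: mulrl_continuous|exact: cvg_cst]. Qed.

Let push : {measure set (measurableTypeR R) -> \bar R} :=
  @measure_function_pushforward__canonical__measure_function_Measure
    _ _ (measurableTypeR R) (measurableTypeR R) R mu g mg.

Let nu : {measure set (measurableTypeR R) -> \bar R} :=
  [the {measure set (measurableTypeR R) -> \bar R} of
    mscale (NngNum (normr_ge0 a)) push].

Let nuE A : measurable A -> mu A = nu A.
Proof.
apply: lebesgue_measure_unique => X /ocitvP[->|[[x y] /= xy ->]].
  by rewrite !measure0.
rewrite /nu /mscale /= /pushforward lebesgue_measure_itv /= lte_fin xy.
have [a1|a1] := ltP 0 a.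
  rewrite (_ : g @^-1` _ = `](x - b) / a, (y - b) / a]%classic); last first.
    apply/seteqP; split => z /=; rewrite !in_itv /= /g ltr_pdivrMr// ler_pdivlMr//; lra.
  rewrite lebesgue_measure_itv /= lte_fin ltr_pM2r ?invr_gt0// ltrD2r xy.
  rewrite gtr0_norm// -!EFinD -EFinM; congr (_%:E); field.
  by rewrite gt_eqF.
have {}a1 : a < 0 by rewrite lt_neqAle a0.
rewrite (_ : g @^-1` _ = `[(y - b) / a, (x - b) / a[%classic); last first.
  by apply/seteqP; split => z /=; rewrite !in_itv /= /g ltr_ndivlMr// ler_ndivrMr//; lra.
rewrite lebesgue_measure_itv /= lte_fin ltr_nM2r ?invr_lt0// ltrD2r xy.
rewrite ltr0_norm// -!EFinD -EFinM; congr (_%:E); field.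
by rewrite lt_eqF.
Qed.

Lemma ge0_integral_affine (f : R -> \bar R) : measurable_fun setT f ->
  (forall x, 0 <= f x)%E ->
  (\int[mu]_x f x = `|a|%:E * \int[mu]_x f (a * x + b)%R)%E.
Proof.
move=> mf f0; rewrite (eq_measure_integral nu); last by move=> A mA _; exact: nuE.
by rewrite ge0_integral_mscale//= ge0_integral_pushforward.
Qed.

Lemma Rintegral_affine (f : R -> R) : measurable_fun setT f ->
  \int[mu]_x f (a * x + b) = `|a|^-1 * \int[mu]_x f x.
Proof.
move=> mf; rewrite /Rintegral.
have mEf : measurable_fun setT (EFin \o f) by exact/measurable_EFinP.
pose p := (\int[mu]_x ((EFin \o f)^\+)%E (a * x + b)%R)%E.
pose q := (\int[mu]_x ((EFin \o f)^\-)%E (a * x + b)%R)%E.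
have -> : (\int[mu]_x (f (a * x + b))%:E = p - q)%E.
  rewrite (@integralE _ _ R mu setT (fun x => (f (a * x + b))%:E)).
  apply: (congr2 (fun u v => u - v)%E).
  by apply: eq_integral => x _; rewrite ?funeposE ?funenegE.
  by apply: eq_integral => x _; rewrite ?funeposE ?funenegE.
rewrite [in RHS]integralE.
rewrite (ge0_integral_affine (measurable_funepos mEf))//.
rewrite (ge0_integral_affine (measurable_funeneg mEf))// -/p -/q.
have p0 : (0 <= p)%E by exact: integral_ge0.
have q0 : (0 <= q)%E by exact: integral_ge0.
have a1 : (0 < `|a|%:E)%E by rewrite lte_fin normr_gt0.
move: (p) (q) p0 q0 => [{}p| |] [{}q| |] // _ _;
  rewrite ?gt0_muley//= ?mulr0//.
by rewrite -mulrBr mulKf// normr_eq0.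
Qed.

Lemma integrable_affine (f : R -> R) : mu.-integrable setT (EFin \o f) ->
  mu.-integrable setT (EFin \o (fun x => f (a * x + b))).
Proof.
move=> /integrableP[mf fi]; apply/integrableP; split.
  by apply/measurable_EFinP; apply: measurableT_comp => //; exact/measurable_EFinP.
move: fi; rewrite ge0_integral_affine//; last exact: measurableT_comp.
have a1 : (0 < `|a|%:E)%E by rewrite lte_fin normr_gt0.
set X := (\int[mu]_x _)%E => XX; change (X < +oo)%E; move: XX.
have : (0 <= X)%E by exact: integral_ge0.
by case: (X) => [r| |] // _; rewrite ?ltry// gt0_muley.
Qed.

End affine.
End real_integration.

(** * Complex-valued functions of a real variable *)
Section complex_calculus.
Context {R : realType}.
Local Notation Re := complex.Re.
Local Notation Im := complex.Im.
Local Notation C := R[i].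
Local Notation normc := ComplexField.Normc.normc.
Notation mu := (@lebesgue_measure R).

Lemma ReM (a b : C) : Re (a * b) = Re a * Re b - Im a * Im b.
Proof. by case: a => a1 a2; case: b. Qed.

Lemma ImM (a b : C) : Im (a * b) = Re a * Im b + Im a * Re b.
Proof. by case: a => a1 a2; case: b. Qed.

Lemma ReD (a b : C) : Re (a + b) = Re a + Re b.
Proof. by case: a => a1 a2; case: b. Qed.

Lemma ImD (a b : C) : Im (a + b) = Im a + Im b.
Proof. by case: a => a1 a2; case: b. Qed.

Lemma ReN (a : C) : Re (- a) = - Re a. Proof. by case: a. Qed.

Lemma ImN (a : C) : Im (- a) = - Im a. Proof. by case: a. Qed.

Lemma complex_ext (a b : C) : Re a = Re b -> Im a = Im b -> a = b.
Proof. by case: a => a1 a2; case: b => b1 b2 /= -> ->. Qed.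

Definition csimp := (ReM, ImM, ReD, ImD, ReN, ImN).

Lemma normr_Re_le (a : C) : `|Re a| <= normc a.
Proof.
case: a => a b; rewrite -sqrtr_sqr ler_sqrt ?lerDl ?sqr_ge0//.
by rewrite addr_ge0 ?sqr_ge0.
Qed.

Lemma normr_Im_le (a : C) : `|Im a| <= normc a.
Proof.
case: a => a b; rewrite -sqrtr_sqr ler_sqrt ?lerDr ?sqr_ge0//.
by rewrite addr_ge0 ?sqr_ge0.
Qed.

Lemma normc_ge0 (a : C) : 0 <= normc a.
Proof. by case: a => a b; exact: sqrtr_ge0. Qed.

Lemma normc_real (x : R) : normc x%:C = `|x|.
Proof. by rewrite /= expr0n /= addr0 sqrtr_sqr. Qed.

Lemma normc_le_add (a : C) : normc a <= `|Re a| + `|Im a|.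
Proof.
case: a => a b /=; rewrite -[leRHS]ger0_norm ?addr_ge0// -sqrtr_sqr ler_sqrt.
  rewrite sqrrD -!normrX ger0_norm ?sqr_ge0// (ger0_norm (sqr_ge0 b)).
  by rewrite lerD2r lerDl mulrn_wge0// mulr_ge0.
exact: sqr_ge0.
Qed.

(** ** The exponential *)
Lemma cexpD (a b : C) : cexp (a + b) = cexp a * cexp b.
Proof.
by apply: complex_ext; rewrite !csimp /= !csimp expRD ?cosD ?sinD; ring.
Qed.

Lemma cexp0 : cexp (0 : C) = 1.
Proof. by apply: complex_ext; rewrite /= ?cos0 ?sin0 expR0 ?mulr1 ?mulr0. Qed.

Lemma normc_cexp (a : C) : normc (cexp a) = expR (Re a).
Proof.
rewrite /cexp /= !exprMn -mulrDr cos2Dsin2 mulr1 sqrtr_sqr ger0_norm// expR_ge0.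
Qed.

Lemma cexp_neq0 (a : C) : cexp a != 0.
Proof.
apply/eqP => h; have := normc_cexp a; rewrite h ComplexField.Normc.normc0.
by move=> /eqP; rewrite lt_eqF// expR_gt0.
Qed.

Lemma cexpN (a : C) : cexp (- a) = (cexp a)^-1.
Proof.
apply: (mulfI (cexp_neq0 a)); rewrite divff ?cexp_neq0//.
by rewrite -cexpD subrr cexp0.
Qed.

Lemma cexp_real (x : R) : cexp x%:C = (expR x)%:C.
Proof. by apply: complex_ext; rewrite /= ?cos0 ?sin0 ?mulr1 ?mulr0. Qed.

Lemma cexp_conj (a : C) : cexp (conjc a) = conjc (cexp a).
Proof. by case: a => a b; apply: complex_ext => /=; rewrite ?cosN ?sinN ?mulrN. Qed.

(** ** Derivatives *)
(** Derivatives and integrals of complex functions are taken componentwise, so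
    that the real theory applies as it stands. *)
Definition cder (f : R -> C) (x : R) (d : C) : Prop :=
  is_derive x 1 (fun t => Re (f t)) (Re d) /\
  is_derive x 1 (fun t => Im (f t)) (Im d).

Lemma cder_eq (f : R -> C) x d e : cder f x d -> d = e -> cder f x e.
Proof. by move=> h <-. Qed.

Lemma cderD (f g : R -> C) x d e : cder f x d -> cder g x e ->
  cder (fun t => f t + g t) x (d + e).
Proof.
move=> [f1 f2] [g1 g2]; split; rewrite ?csimp.
  by rewrite (_ : (fun _ => _) = (fun t => Re (f t)) + (fun t => Re (g t)));
    [exact: is_deriveD|apply/funext => t; rewrite !csimp].
by rewrite (_ : (fun _ => _) = (fun t => Im (f t)) + (fun t => Im (g t)));
  [exact: is_deriveD|apply/funext => t; rewrite !csimp].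
Qed.

Lemma is_derive_mul (f g : R -> R) (x df dg : R) : is_derive x 1 f df ->
  is_derive x 1 g dg -> is_derive x 1 (fun t => f t * g t) (df * g x + f x * dg).
Proof.
move=> h1 h2; apply: (is_derive_eq (is_deriveM h1 h2)).
by rewrite /GRing.scale /= addrC (mulrC df).
Qed.

Lemma is_derive_mulr_cst (k x : R) : is_derive x 1 (fun t => t * k) k.
Proof.
apply: (is_derive_eq (is_derive_mul (is_derive_id x 1) (is_derive_cst k x 1))).
by rewrite mul1r mulr0 addr0.
Qed.

Lemma cderM (f g : R -> C) x d e : cder f x d -> cder g x e ->
  cder (fun t => f t * g t) x (d * g x + f x * e).
Proof.
move=> [f1 f2] [g1 g2]; split.
  under [X in is_derive _ _ X _]eq_fun do rewrite csimp.
  apply: (is_derive_eq (is_deriveB (is_derive_mul f1 g1) (is_derive_mul f2 g2))).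
  by rewrite !csimp; ring.
under [X in is_derive _ _ X _]eq_fun do rewrite csimp.
apply: (is_derive_eq (is_deriveD (is_derive_mul f1 g2) (is_derive_mul f2 g1))).
by rewrite !csimp; ring.
Qed.

Lemma cder_cst (a : C) x : cder (fun=> a) x 0.
Proof. by split; exact: is_derive_cst. Qed.

Lemma cder_real (f : R -> R) (x d : R) : is_derive x 1 f d ->
  cder (fun t => (f t)%:C) x d%:C.
Proof. by move=> df; split => //=; exact: is_derive_cst. Qed.

Lemma cderZ (a : C) (f : R -> C) x d : cder f x d ->
  cder (fun t => a * f t) x (a * d).
Proof.
by move=> df; apply: cder_eq (cderM (cder_cst a x) df) _; rewrite mul0r add0r.
Qed.

Lemma cder_cexp (f : R -> C) x d : cder f x d ->
  cder (fun t => cexp (f t)) x (d * cexp (f x)).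
Proof.
move=> [f1 f2]; split; rewrite !csimp /=.
  rewrite (_ : (fun _ => _) = (expR \o (fun t => Re (f t))) *
     (cos \o (fun t => Im (f t)))) //.
  by apply: is_derive_eq; rewrite /GRing.scale /=; ring.
rewrite (_ : (fun _ => _) = (expR \o (fun t => Re (f t))) *
   (sin \o (fun t => Im (f t)))) //.
by apply: is_derive_eq; rewrite /GRing.scale /=; ring.
Qed.

(** ** Measurability *)
Definition cmeasurable d (T : measurableType d) (f : T -> C) : Prop :=
  measurable_fun setT (fun t => Re (f t)) /\
  measurable_fun setT (fun t => Im (f t)).

Section cmeasurable.
Context d (T : measurableType d).
Implicit Types f g : T -> C.

Lemma cmeasurableM f g : cmeasurable f -> cmeasurable g ->
  cmeasurable (fun t => f t * g t).
Proof.
move=> [f1 f2] [g1 g2]; split.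
  under eq_fun do rewrite !csimp.
  by apply: measurable_funB; apply: measurable_funM.
under eq_fun do rewrite !csimp.
by apply: measurable_funD; apply: measurable_funM.
Qed.

Lemma cmeasurableD f g : cmeasurable f -> cmeasurable g ->
  cmeasurable (fun t => f t + g t).
Proof.
move=> [f1 f2] [g1 g2]; split.
  by under eq_fun do rewrite !csimp; apply: measurable_funD.
by under eq_fun do rewrite !csimp; apply: measurable_funD.
Qed.

Lemma cmeasurable_cst (a : C) : cmeasurable (fun _ : T => a).
Proof. by split; exact: measurable_cst. Qed.

Lemma cmeasurable_real (f : T -> R) : measurable_fun setT f ->
  cmeasurable (fun t => (f t)%:C).
Proof. by move=> mf; split => //=; exact: measurable_cst. Qed.

Lemma cmeasurable_cexp f : cmeasurable f -> cmeasurable (fun t => cexp (f t)).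
Proof.
move=> [f1 f2].
have mc : measurable_fun setT (@cos R).
  by apply: continuous_measurable_fun; exact: continuous_cos.
have ms : measurable_fun setT (@sin R).
  by apply: continuous_measurable_fun; exact: continuous_sin.
by split => /=; apply: measurable_funM; apply: measurableT_comp => //.
Qed.

Lemma cmeasurable_comp d' (T' : measurableType d') (h : T' -> T) f :
  measurable_fun setT h -> cmeasurable f -> cmeasurable (fun t => f (h t)).
Proof. by move=> mh [f1 f2]; split; [exact: (measurableT_comp f1)|exact: (measurableT_comp f2)]. Qed.

End cmeasurable.

(** ** Integrals *)
Definition cintegrable (D : set R) (f : R -> C) : Prop :=
  mu.-integrable D (EFin \o (fun t => Re (f t))) /\
  mu.-integrable D (EFin \o (fun t => Im (f t))).

Section cintegral.
Variable D : set R.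
Hypothesis mD : measurable D.
Implicit Types f g : R -> C.

Lemma cintegrable_dom f (g : R -> R) : cmeasurable f ->
  (forall x, D x -> normc (f x) <= g x) -> mu.-integrable D (EFin \o g) ->
  cintegrable D f.
Proof.
move=> [f1 f2] fg ig; split.
  apply: (@integrable_dom _ _ _ mu D mD _ g (measurable_funTS f1) _ ig) => x Dx.
  exact: le_trans (normr_Re_le _) (fg _ Dx).
apply: (@integrable_dom _ _ _ mu D mD _ g (measurable_funTS f2) _ ig) => x Dx.
exact: le_trans (normr_Im_le _) (fg _ Dx).
Qed.

Lemma eq_cintegral f g : (forall x, D x -> f x = g x) ->
  cintegral D f = cintegral D g.
Proof.
move=> fg; apply: complex_ext; apply: eq_Rintegral => x; rewrite inE => Dx;
  by rewrite fg.
Qed.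

Lemma cintegrableD f g : cintegrable D f -> cintegrable D g ->
  cintegrable D (fun x => f x + g x).
Proof.
move=> [f1 f2] [g1 g2]; split.
  by under eq_fun do rewrite ReD; exact: integrableRD.
by under eq_fun do rewrite ImD; exact: integrableRD.
Qed.

Lemma cintegralD f g : cintegrable D f -> cintegrable D g ->
  cintegral D (fun x => f x + g x) = cintegral D f + cintegral D g.
Proof.
move=> [f1 f2] [g1 g2]; apply: complex_ext; rewrite ?csimp /=.
  by under eq_Rintegral do rewrite csimp; exact: RintegralD.
by under eq_Rintegral do rewrite csimp; exact: RintegralD.
Qed.

Lemma cintegrableZ (a : C) f : cintegrable D f -> cintegrable D (fun x => a * f x).
Proof.
move=> [f1 f2]; split.
  under eq_fun do rewrite csimp.
  by apply: integrableRB => //; exact: integrableRZ.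
under eq_fun do rewrite csimp.
by apply: integrableRD => //; exact: integrableRZ.
Qed.

Lemma cintegralZ (a : C) f : cintegrable D f ->
  cintegral D (fun x => a * f x) = a * cintegral D f.
Proof.
move=> [f1 f2]; apply: complex_ext; rewrite ?csimp /=.
  under eq_Rintegral do rewrite csimp.
  rewrite RintegralB//; try exact: integrableRZ.
  by rewrite !RintegralZl.
under eq_Rintegral do rewrite csimp.
rewrite RintegralD//; try exact: integrableRZ.
by rewrite !RintegralZl.
Qed.

Lemma cintegral_real (f : R -> R) :
  cintegral D (fun x => (f x)%:C) = (\int[mu]_(x in D) f x)%:C.
Proof. by apply: complex_ext => //=; rewrite Rintegral_cst// mul0r. Qed.

Lemma cintegralZ_real (a : C) (f : R -> R) : mu.-integrable D (EFin \o f) ->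
  cintegral D (fun x => a * (f x)%:C) = a * (\int[mu]_(x in D) f x)%:C.
Proof.
move=> intf; rewrite cintegralZ ?cintegral_real//; split => //=.
rewrite (_ : _ \o _ = cst 0%E)//; exact: integrable0.
Qed.

End cintegral.

Lemma cintegral_dct (D : set R) (f_ : nat -> R -> C) (f : R -> C) (g : R -> R) :
  measurable D -> (forall n, cmeasurable (f_ n)) ->
  (forall x, D x -> Re (f_ n x) @[n --> \oo] --> Re (f x)) ->
  (forall x, D x -> Im (f_ n x) @[n --> \oo] --> Im (f x)) ->
  mu.-integrable D (EFin \o g) ->
  (forall n x, D x -> normc (f_ n x) <= g x) ->
  Re (cintegral D (f_ n)) @[n --> \oo] --> Re (cintegral D f) /\
  Im (cintegral D (f_ n)) @[n --> \oo] --> Im (cintegral D f).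
Proof.
move=> mD mf f1 f2 ig fg.
have [||_ h1] := @Rintegral_dct _ _ _ mu _ mD (fun n x => Re (f_ n x)) _ g _ f1 ig.
- by move=> n; apply: measurable_funTS; have [] := mf n.
- by move=> n x Dx; exact: le_trans (normr_Re_le _) (fg _ _ Dx).
have [||_ h2] := @Rintegral_dct _ _ _ mu _ mD (fun n x => Im (f_ n x)) _ g _ f2 ig.
- by move=> n; apply: measurable_funTS; have [] := mf n.
- by move=> n x Dx; exact: le_trans (normr_Im_le _) (fg _ _ Dx).
by split.
Qed.

Lemma cFubini (D1 D2 : set R) (f : R -> R -> C) (k : R * R -> R) (h : R -> R) :
  measurable D1 -> measurable D2 ->
  cmeasurable (fun z : R * R => f z.1 z.2) ->
  measurable_fun setT k ->
  (forall x y, D1 x -> D2 y -> normc (f x y) <= k (x, y)) ->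
  (forall y, D2 y -> mu.-integrable D1 (fun x => (k (x, y))%:E)) ->
  (forall y, D2 y -> \int[mu]_(x in D1) k (x, y) <= h y) ->
  mu.-integrable D2 (EFin \o h) ->
  [/\ cintegrable D1 (fun x => cintegral D2 (f x)),
      cintegrable D2 (fun y => cintegral D1 (f^~ y)) &
      cintegral D1 (fun x => cintegral D2 (f x)) =
      cintegral D2 (fun y => cintegral D1 (f^~ y))].
Proof.
move=> mD1 mD2 [f1 f2] mk fk ik kh ih.
have key (g : R * R -> R) : measurable_fun setT g ->
    (forall x y, D1 x -> D2 y -> `|g (x, y)| <= k (x, y)) ->
    forall y, D2 y -> (\int[mu]_(x in D1) `|g (x, y)|%:E <= (h y)%:E)%E.
  move=> mg gk y Dy; apply: (@le_trans _ _ (\int[mu]_(x in D1) (k (x, y))%:E)%E).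
    apply: ge0_le_integral => //.
    - apply/measurable_EFinP/measurable_funTS; apply: measurableT_comp => //.
      exact: measurable_fun_pair1.
    - by apply: measurable_int (ik _ Dy).
    - by move=> x Dx; rewrite lee_fin; exact: gk.
  have := kh _ Dy; rewrite -lee_fin /Rintegral fineK//.
  exact: integrable_fin_num (ik _ Dy).
have [a1 b1 e1] := Fubini_dominated (m1 := mu) (m2 := mu) mD1 mD2 f1 ih
  (key _ f1 (fun x y Dx Dy => le_trans (normr_Re_le _) (fk _ _ Dx Dy))).
have [a2 b2 e2] := Fubini_dominated (m1 := mu) (m2 := mu) mD1 mD2 f2 ih
  (key _ f2 (fun x y Dx Dy => le_trans (normr_Im_le _) (fk _ _ Dx Dy))).
split; [exact: conj a1 a2|exact: conj b1 b2|].
by apply: complex_ext; [exact: e1|exact: e2].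
Qed.

Lemma cFTC_0y (F f : R -> C) (A B : C) :
  (forall x : R, 0 < x -> cder F x (f x)) ->
  (forall x : R, 0 < x -> {for x, continuous (fun t => Re (f t))} /\
     {for x, continuous (fun t => Im (f t))}) ->
  cintegrable `]0, +oo[ f ->
  Re (F x) @[x --> 0^'+] --> Re A -> Im (F x) @[x --> 0^'+] --> Im A ->
  Re (F x) @[x --> +oo] --> Re B -> Im (F x) @[x --> +oo] --> Im B ->
  cintegral `]0, +oo[ f = B - A.
Proof.
move=> dF cf [i1 i2] A1 A2 B1 B2; apply: complex_ext; rewrite !csimp /=.
  by apply: FTC_0y A1 B1 => // x x0; [have [] := dF _ x0|have [] := cf _ x0].
by apply: FTC_0y A2 B2 => // x x0; [have [] := dF _ x0|have [] := cf _ x0].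
Qed.

Lemma cder_continuous (f : R -> C) x d : cder f x d ->
  {for x, continuous (fun t => Re (f t))} /\
  {for x, continuous (fun t => Im (f t))}.
Proof.
by move=> [h1 h2]; split; exact: is_derive_continuous.
Qed.

End complex_calculus.

(** * Fourier inversion at a point *)
Section fourier_inversion.
Context {R : realType}.
Local Notation Re := complex.Re.
Local Notation Im := complex.Im.
Local Notation C := R[i].
Local Notation normc := ComplexField.Normc.normc.
Notation mu := (@lebesgue_measure R).
Local Notation D := (`]0, +oo[%classic : set R).

Let mD : measurable (D : set (measurableTypeR R)). Proof. exact: measurable_itv. Qed.

Lemma ge0_sqr_le_expR (x : R) : 0 <= x -> x ^+ 2 <= 4 * expR x.
Proof.
move=> x0; have h := expR_ge1Dx (x / 2).
have -> : expR x = expR (x / 2) ^+ 2 by rewrite -expRM_natl -mulr_natl; congr expR; field.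
have h2 : 0 <= expR (x / 2) - x / 2 by lra.
have h3 : 0 <= x / 2 by lra.
nra.
Qed.

Lemma integrable_invDx2 :
  mu.-integrable setT (EFin \o (fun x : R => (1 + x ^+ 2)^-1)).
Proof.
have p (x : R) : 0 < 1 + x ^+ 2 by rewrite ltr_pwDl// sqr_ge0.
apply: (@FTC_T_integrable _ atan _ (pi / 2)).
- move=> x; have x0 : 1 + x ^+ 2 != 0 by rewrite gt_eqF.
  have d2 : is_derive x 1 (fun t : R => 1 + t ^+ 2) (2 * x).
    by apply: is_derive_eq; rewrite /GRing.scale /=; ring.
  apply: (@is_derive_continuous _ _ _ (- (1 + x ^+ 2) ^- 2 *: (2 * x))).
  exact: is_deriveV.
- by move=> x; rewrite invr_ge0 ltW.
- move=> x; rewrite ler_norml; apply/andP; split; apply: ltW.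
    exact: atan_gtNpi2.
  exact: atan_ltpi2.
Qed.

Lemma integrable_expNabs (e : R) : 0 < e ->
  mu.-integrable setT (EFin \o (fun x : R => expR (- (e * `|x|)))).
Proof.
move=> e0.
apply: (@integrable_dom _ _ _ mu setT _ _
  (fun x => (1 + 4 / e ^+ 2) * (1 + x ^+ 2)^-1)) => //.
- apply: measurableT_comp => //; apply: measurableT_comp => //.
  by apply: measurable_funM => //; exact: measurableT_comp.
- move=> x _; rewrite ger0_norm ?expR_ge0// expRN.
  have x0 : 0 <= e * `|x| by rewrite mulr_ge0// ltW.
  have := ge0_sqr_le_expR x0; rewrite exprMn real_normK ?num_real// => h.
  have h1 : 1 <= expR (e * `|x|) by rewrite -expR0 ler_expR.
  have p : 0 < 1 + x ^+ 2 by rewrite ltr_pwDl// sqr_ge0.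
  rewrite -[leLHS]div1r ler_pdivrMr ?expR_gt0// mulrAC ler_pdivlMr// mul1r.
  have e2 : 0 < e ^+ 2 by rewrite exprn_gt0.
  have : x ^+ 2 <= 4 / e ^+ 2 * expR (e * `|x|).
    by rewrite mulrAC ler_pdivlMr// mulrC.
  nra.
- by apply: integrableRZ => //; exact: integrable_invDx2.
Qed.

Lemma Rintegral_reflect (f : R -> R) : measurable_fun setT f ->
  \int[mu]_x f (- x) = \int[mu]_x f x.
Proof.
move=> mf; have a0 : (-1 : R) != 0 by rewrite oppr_eq0 oner_eq0.
have := Rintegral_affine 0 a0 mf; rewrite normrN1 invr1 mul1r => <-.
by apply: eq_Rintegral => x _; rewrite mulN1r addr0.
Qed.

Lemma Rintegral_odd (f : R -> R) : measurable_fun setT f ->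
  (forall x, f (- x) = - f x) -> mu.-integrable setT (EFin \o f) ->
  \int[mu]_x f x = 0.
Proof.
move=> mf fN intf; have := Rintegral_reflect mf.
under eq_Rintegral do rewrite fN -mulN1r.
by rewrite RintegralZl// mulN1r => h; lra.
Qed.

(** Brings integrals of even functions over the line to the half line, where an
    elementary primitive is at hand. *)
Lemma Rintegral_fold (f : R -> R) : measurable_fun setT f ->
  mu.-integrable setT (EFin \o f) ->
  \int[mu]_x f x = \int[mu]_(x in D) (f x + f (- x)).
Proof.
move=> mf intf.
have iN : mu.-integrable setT (EFin \o (fun x => f (- x))).
  have a0 : (-1 : R) != 0 by rewrite oppr_eq0 oner_eq0.
  have := integrable_affine 0 a0 intf.
  by under [X in _.-integrable _ (_ \o X) -> _]eq_fun do rewrite mulN1r addr0.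
have i1 := @integrableST _ _ _ mu D mD _ intf.
have i2 := @integrableST _ _ _ mu D mD _ iN.
rewrite RintegralD//.
rewrite -(setUv D) Rintegral_setU//; last 3 first.
- exact: measurableC.
- by rewrite setUv.
- exact/disj_setPCl.
congr (_ + _).
rewrite Rintegral_mkcond -Rintegral_reflect; last first.
  by apply: (measurable_restrictT _ (measurableC mD)).1; exact: measurable_funTS.
rewrite (_ : (fun x => _) = (fun x => f (- x)) \_ `[0, +oo[%classic); last first.
  apply/funext => x; rewrite !patchE.
  suff -> : (- x \in ~` D) = (x \in `[0, +oo[%classic) by [].
  apply/idP/idP; rewrite !inE /= !in_itv /= !andbT oppr_gt0 leNgt => /negP//.
by rewrite -Rintegral_mkcond Rintegral_itv_obnd_cbnd.
Qed.

(** The Fourier transform of [exp (- e * |tau|)], the Abel regularizer of the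
    inversion integral. *)
Definition poisson (e d : R) : R := 2 * e / (e ^+ 2 + d ^+ 2).

Let poisson_half (e d : R) : 0 < e ->
  \int[mu]_(x in D) (2 * (expR (- (e * x)) * cos (x * d))) = poisson e d.
Proof.
move=> e0; have q0 : 0 < e ^+ 2 + d ^+ 2.
  by rewrite ltr_pwDl ?sqr_ge0// exprn_gt0.
pose F (x : R) := 2 / (e ^+ 2 + d ^+ 2) *
  (expR (- (e * x)) * (d * sin (x * d) - e * cos (x * d))).
pose G (x : R) := 2 * (expR (- (e * x)) * cos (x * d)).
have dF (x : R) : is_derive x 1 F (G x).
  rewrite /F /G; apply: is_derive_eq.
  by rewrite /GRing.scale /=; field; rewrite gt_eqF.
have cG : continuous G.
  move=> x; have dG : is_derive x 1 G (2 * (- e * expR (- (e * x)) * cos (x * d) -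
      expR (- (e * x)) * (d * sin (x * d)))).
    by rewrite /G; apply: is_derive_eq; rewrite /GRing.scale /=; ring.
  exact: is_derive_continuous dG.
have mG : measurable_fun setT G by exact: continuous_measurable_fun.
have cF : F x @[x --> 0^'+] --> F 0.
  apply: cvg_at_right_filter; exact: is_derive_continuous (dF 0).
rewrite (_ : poisson e d = 0 - F 0); last first.
  rewrite /F mulr0 mul0r sin0 cos0 oppr0 expR0 /poisson; field.
  by rewrite gt_eqF.
apply: (@FTC_0y _ F G) => //.
- by move=> x _; exact: cG.
- apply: (@integrable_dom _ _ _ mu D mD G (fun x => 2 * expR (- (e * `|x|)))).
  - exact: measurable_funTS.
  - move=> x; rewrite /= in_itv /= andbT => x0.
    rewrite /G normrM ger0_norm// ler_wpM2l// normrM ger0_norm ?expR_ge0//.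
    by rewrite (gtr0_norm x0) ler_piMr ?expR_ge0// cos_max.
  - apply: integrableRZ => //; apply: (@integrableS _ _ _ mu setT D) => //; exact: integrable_expNabs.
- apply/cvgr0Pnorm_le => r r0; near=> x.
have x0 : 0 < x by near: x; exact: nbhs_pinfty_gt.
have ex : 1 + e * x <= expR (e * x) by exact: expR_ge1Dx.
rewrite /F normrM ger0_norm; last by rewrite divr_ge0// ltW.
rewrite normrM ger0_norm ?expR_ge0// expRN.
have b : `|d * sin (x * d) - e * cos (x * d)| <= `|d| + e.
  apply: (le_trans (ler_normB _ _)); rewrite !normrM (gtr0_norm e0).
  by apply: lerD; rewrite ler_piMr ?sin_max ?cos_max// ltW.
apply: (@le_trans _ _ (2 / (e ^+ 2 + d ^+ 2) * ((expR (e * x))^-1 * (`|d| + e)))).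
  apply: ler_wpM2l; first by rewrite divr_ge0// ltW.
  by apply: ler_wpM2l; rewrite // invr_ge0 expR_ge0.
have x1 : 2 / (e ^+ 2 + d ^+ 2) * (`|d| + e) / (r * e) <= x.
  by near: x; apply: nbhs_pinfty_ge; rewrite num_real.
rewrite mulrCA ler_pdivrMl ?expR_gt0//.
have : 2 / (e ^+ 2 + d ^+ 2) * (`|d| + e) <= x * (r * e).
  by rewrite -ler_pdivrMr// mulr_gt0.
have : r * (1 + e * x) <= r * expR (e * x) by rewrite ler_pM2l.
by move=> h1 h2; nra.
Unshelve. all: end_near. Qed.

Lemma fourier_expNabs (e d : R) : 0 < e ->
  cintegral setT (fun x => (expR (- (e * `|x|)))%:C * cexp (0 +i* (x * d))) =
  (poisson e d)%:C.
Proof.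
move=> e0.
have me : measurable_fun setT (fun x : R => expR (- (e * `|x|))).
  have := measurable_int _ (integrable_expNabs e0).
  by move/measurable_EFinP.
have mc : measurable_fun setT (fun x : R => cos (x * d)).
  apply: continuous_measurable_fun => x; apply: continuous_comp.
    exact: mulrr_continuous.
  exact: continuous_cos.
have ms : measurable_fun setT (fun x : R => sin (x * d)).
  apply: continuous_measurable_fun => x; apply: continuous_comp.
    exact: mulrr_continuous.
  exact: continuous_sin.
apply: complex_ext => /=.
  rewrite -(poisson_half d e0).
  transitivity (\int[mu]_x (expR (- (e * `|x|)) * cos (x * d))).
    by apply: eq_Rintegral => x _ /=; rewrite expR0 !mul1r mul0r subr0.
  rewrite Rintegral_fold; last 2 first.
  - exact: measurable_funM.
  - apply: (integrable_dom _ _ _ (integrable_expNabs e0)) => //.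
      exact: measurable_funM.
    by move=> x _; rewrite normrM ger0_norm ?expR_ge0// ler_piMr ?expR_ge0// cos_max.
  apply: eq_Rintegral => x; rewrite inE /= in_itv /= andbT => x0.
  by rewrite normrN mulNr cosN gtr0_norm// mulr_natl mulr2n.
transitivity (\int[mu]_x (expR (- (e * `|x|)) * sin (x * d))).
  by apply: eq_Rintegral => x _ /=; rewrite expR0 !mul1r mul0r addr0.
apply: Rintegral_odd; first exact: measurable_funM.
  by move=> x; rewrite normrN mulNr sinN mulrN.
apply: (integrable_dom _ _ _ (integrable_expNabs e0)) => //.
  exact: measurable_funM.
by move=> x _; rewrite normrM ger0_norm ?expR_ge0// ler_piMr ?expR_ge0// sin_max.
Qed.

Let poisson_ge0 (e d : R) : 0 < e -> 0 <= poisson e d.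
Proof.
by move=> /ltW e0; rewrite /poisson divr_ge0 ?mulr_ge0// addr_ge0 ?sqr_ge0.
Qed.

Let poisson_le (e d h : R) : 0 < e -> 0 < h -> h <= `|d| ->
  poisson e d <= 2 * e / h ^+ 2.
Proof.
move=> e0 h0 hd; rewrite /poisson ler_pdivrMr ?ltr_pwDl ?sqr_ge0 ?exprn_gt0//.
rewrite mulrAC ler_pdivlMr ?exprn_gt0// ler_wpM2l ?mulr_ge0 ?(ltW e0)//.
rewrite -[d ^+ 2]real_normK ?num_real//; have := sqr_ge0 e; nra.
Qed.

(** An approximate identity in the variable [psi u]. The phase [psi] is kept
    general: [psi u = u] gives Fourier inversion, [psi = ln] Mellin inversion. *)
Section poisson_limit.
Variables (psi dpsi : R -> R) (y : R).
Hypotheses (y0 : 0 < y)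
  (mpsi : measurable_fun setT psi)
  (dpsiP : forall u : R, 0 < u -> is_derive u 1 psi (dpsi u))
  (cdpsi : forall u : R, 0 < u -> {for u, continuous dpsi})
  (dpsi_gt0 : forall u, 0 < u -> 0 < dpsi u)
  (psi_incr : forall u v, 0 < u -> u < v -> psi u < psi v).

Let eps (n : nat) : R := n.+1%:R^-1.
Let eps_gt0 n : 0 < eps n. Proof. by rewrite /eps invr_gt0. Qed.
Let P n u := poisson (eps n) (psi u - psi y).

Let mP n : measurable_fun setT (P n).
Proof.
apply: measurable_funM => //; apply: measurableT_comp; first exact: measurable_invr.
apply: measurable_funD => //; apply: measurable_funX.
exact: measurable_funB.
Qed.

(** An arctangent is an exact primitive once the Poisson kernel is weighted by
    the Jacobian [dpsi]. *)
Let near_mass (d : R) n : 0 < d < y ->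
  mu.-integrable `[y - d, y + d] (EFin \o (fun u => dpsi u * P n u)) /\
  \int[mu]_(u in `[y - d, y + d]) (dpsi u * P n u) =
  2 * atan ((psi (y + d) - psi y) / eps n) -
  2 * atan ((psi (y - d) - psi y) / eps n).
Proof.
move=> /andP[d0 dy].
pose F u := 2 * atan ((psi u - psi y) / eps n).
have dF (u : R) : 0 < u -> is_derive u 1 F (dpsi u * P n u).
  move=> u0; have h := dpsiP u0.
  have h1 : is_derive u 1 (fun u : R => (psi u - psi y) / eps n) (dpsi u / eps n).
    by apply: is_derive_eq; rewrite /GRing.scale /=; ring.
  have h2 := is_derive_comp (is_derive1_atan _) h1.
  have h3 : is_derive u 1 F (2 *: ((1 + ((psi u - psi y) / eps n) ^+ 2)^-1 * (dpsi u / eps n))).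
    exact: is_deriveZ.
  apply: (is_derive_eq h3); rewrite /GRing.scale /= /P /poisson; field.
  have e0 := eps_gt0 n; rewrite (gt_eqF e0) /= andbT.
  by rewrite gt_eqF// ltr_pwDl ?sqr_ge0// exprn_gt0.
have cP (u : R) : 0 < u -> {for u, continuous (fun u => dpsi u * P n u)}.
  move=> u0; apply: cvgM; first exact: cdpsi.
  apply: cvgM; first exact: cvg_cst.
  apply: cvgV; first by rewrite gt_eqF// ltr_pwDl ?sqr_ge0// exprn_gt0// eps_gt0.
  apply: cvgD; first exact: cvg_cst.
  apply: (@continuous_comp _ _ _ (fun u => psi u - psi y) (fun z => z ^+ 2)).
    apply: cvgB; last exact: cvg_cst.
    exact: is_derive_continuous (dpsiP u0).
  exact: exprn_continuous.
have inI (x : R) : y - d <= x <= y + d -> 0 < x.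
  by move=> /andP[+ _]; apply: lt_le_trans; rewrite subr_gt0.
by apply: (@FTC_cc _ F) => [|x /inI|x /inI]; [lra|exact: dF|exact: cP].
Qed.

Let mass_limit (d : R) : 0 < d < y ->
  2 * atan ((psi (y + d) - psi y) / eps n) -
  2 * atan ((psi (y - d) - psi y) / eps n) @[n --> \oo] --> 2 * pi.
Proof.
move=> /andP[d0 dy].
have at_lim (h : R) : 0 < h -> atan (h / eps n) @[n --> \oo] --> pi / 2.
  move=> h0; apply: (cvg_comp _ _ _ (@cvgy_atan R)).
  apply/cvgryPge => A; near=> n; rewrite /eps invrK mulrC -ler_pdivrMr//.
  apply: (@le_trans _ _ (n%:R)); last by rewrite ler_nat.
  by near: n; exact: nbhs_infty_ger.
rewrite (_ : 2 * pi = 2 * (pi / 2) - 2 * (- (pi / 2))); last by field.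
apply: cvgB; apply: cvgM; [exact: cvg_cst| |exact: cvg_cst|].
  by apply: at_lim; rewrite subr_gt0 psi_incr// ltrDl.
under eq_fun do rewrite -opprB mulNr atanN.
apply: cvgN; apply: at_lim; rewrite subr_gt0 psi_incr ?subr_gt0//.
by rewrite ltrBlDr ltrDl.
Unshelve. all: end_near. Qed.

Let far (d : R) : 0 < d < y -> exists2 h, 0 < h &
  forall u, 0 < u -> ~ `[y - d, y + d]%classic u -> h <= `|psi u - psi y|.
Proof.
move=> /andP[d0 dy].
have h1 : psi y < psi (y + d) by rewrite psi_incr// ltrDl.
have h2 : psi (y - d) < psi y by rewrite psi_incr ?subr_gt0// ltrBlDr ltrDl.
exists (Num.min (psi (y + d) - psi y) (psi y - psi (y - d))).
  by rewrite lt_min !subr_gt0 h1.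
move=> u u0; rewrite /= in_itv /= => /negP; rewrite negb_and -!ltNge => /orP[uy|uy].
  rewrite ge_min; apply/orP; right; rewrite distrC.
  have : psi u < psi (y - d) by exact: psi_incr.
  by move=> h3; rewrite ger0_norm; lra.
rewrite ge_min; apply/orP; left.
have : psi (y + d) < psi u by apply: psi_incr => //; lra.
by move=> h3; rewrite ger0_norm; lra.
Qed.

(** The kernels have mass [2 * pi] with respect to [dpsi u * du], so [g] is
    compared near [y] with the multiple [c * dpsi] that takes the value [g y] at
    [y]; away from [y] the kernels are [O(1 / n)] uniformly. *)
Lemma poisson_limit (g : R -> R) : measurable_fun setT g ->
  mu.-integrable D (EFin \o g) -> {for y, continuous g} ->
  \int[mu]_(u in D) (g u * poisson (n.+1%:R^-1) (psi u - psi y)) @[n --> \oo] -->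
  2 * pi * g y / dpsi y.
Proof.
move=> mg ig cg.
have third0 (r a b : R) : 0 < b -> a * (r / (3 * b)) = r / 3 * (a / b).
  by move=> b0; field; rewrite gt_eqF.
have sixth (r a b : R) : 0 < b + 1 ->
    2 * (r * a / (6 * (b + 1))) * b = r / 3 * a * (b / (b + 1)).
  by move=> b0; field; rewrite gt_eqF.
pose c := g y / dpsi y.
have py0 := dpsi_gt0 y0.
apply/cvgrPdist_le => r r0.
have third := third0 r.
have r3 : r / 3 + r / 3 + r / 3 <= r by lra.
pose r' := r / (3 * (2 * pi + 1)).
have pi0 := @pi_gt0 R.
have pi1 : 0 < 2 * (pi : R) + 1 by rewrite addr_gt0// mulr_gt0.
have r'0 : 0 < r' by rewrite divr_gt0// mulr_gt0.
have r'E : r / 3 = (2 * pi + 1) * r'.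
  by rewrite third// divff ?mulr1// lt0r_neq0.
have cgc : {for y, continuous (fun u => g u - c * dpsi u)}.
  apply: cvgB => //; apply: cvgM; first exact: cvg_cst.
  exact: cdpsi.
have gc0 : g y - c * dpsi y = 0 by rewrite /c divfK ?subrr// gt_eqF.
have y2 : 0 < dpsi y / 2 by rewrite divr_gt0.
have ry2 : 0 < r' * (dpsi y / 2) by rewrite mulr_gt0.
have : \forall u \near y, `|g u - c * dpsi u| < r' * (dpsi y / 2).
  move/cvgrPdist_lt : cgc => /(_ (r' * (dpsi y / 2))).
  rewrite gc0 => /(_ ry2).
  by apply: filterS => u; rewrite sub0r normrN.
have : \forall u \near y, dpsi y / 2 < dpsi u.
  have /cvgrPdist_lt := cdpsi y0 => /(_ _ y2).
  by apply: filterS => u; rewrite ltr_distlC => /andP[+ _]; lra.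
move=> /nbhs_ballP[d1 /= d10 b1] /nbhs_ballP[d2 /= d20 b2].
pose d := Num.min (Num.min d1 d2) y / 2.
have d0 : 0 < d by rewrite divr_gt0// !lt_min d10 d20.
have dd : d < d1 /\ d < d2 /\ d < y.
  have h : d < Num.min (Num.min d1 d2) y by rewrite /d; move: d0; rewrite /d; lra.
  by move: h; rewrite !lt_min => /andP[/andP[-> ->] ->].
have [dd1 [dd2 ddy]] := dd.
have dI : 0 < d < y by rewrite d0.
pose I : set R := `[y - d, y + d]%classic.
have mI : measurable (I : set (measurableTypeR R)) by exact: measurable_itv.
have ID : I `<=` D.
  move=> u; rewrite /I /= !in_itv /= andbT => /andP[+ _].
  by apply: lt_le_trans; rewrite subr_gt0.
have gI u : I u -> `|g u - c * dpsi u| <= r' * dpsi u.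
  rewrite /I /= in_itv /= => /andP[h1 h2].
  have hb e : d < e -> ball y e u.
    by move=> de; rewrite /ball /= ltr_distlC; apply/andP; split; lra.
  have := b1 _ (hb _ dd1); have := b2 _ (hb _ dd2) => /= h3 h4.
  by apply: ltW; apply: (lt_le_trans h3); rewrite ler_wpM2l ?ltW.
have [h h0 hfar] := far dI.
have Pb n u : `|P n u| <= 2 / eps n.
  have e0 := eps_gt0 n; rewrite ger0_norm ?poisson_ge0// /P /poisson.
  rewrite ler_pdivrMr ?ltr_pwDl ?sqr_ge0 ?exprn_gt0// mulrAC ler_pdivlMr//.
  by have := sqr_ge0 (psi u - psi y); nra.
have igP n : mu.-integrable D (EFin \o (fun u => g u * P n u)).
  apply: (@integrable_dom _ _ _ mu D mD _ (fun u => 2 / eps n * `|g u|)).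
  - by apply: measurable_funTS; exact: (measurable_funM mg (mP n)).
  - by move=> u _; rewrite normrM mulrC; apply: ler_wpM2r.
  - by apply: integrableRZ => //; exact: (integrable_norm ig).
pose K := \int[mu]_(u in D) `|g u|.
have K0 : 0 <= K by exact: Rintegral_ge0.
pose A n := \int[mu]_(u in I) (dpsi u * P n u).
have mDI : measurable (D `\` I : set (measurableTypeR R)) by exact: measurableD.
have split_int n : \int[mu]_(u in D) (g u * P n u) =
    \int[mu]_(u in I) (g u * P n u) + \int[mu]_(u in D `\` I) (g u * P n u).
  exact: (Rintegral_split mD mI ID (igP n)).
have igI n : mu.-integrable I (EFin \o (fun u => g u * P n u)).
  exact: integrableS (igP n).
have near_est n : `|\int[mu]_(u in I) (g u * P n u) - c * A n| <= r' * A n.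
  have [iA _] := near_mass n dI.
  rewrite /A -!RintegralZl// -RintegralB//; last exact: integrableRZ.
  apply: normr_Rintegral_le => //.
  - by apply: integrableRB => //; exact: integrableRZ.
  - exact: integrableRZ.
  - move=> u Iu; rewrite mulrA -mulrBl normrM [X in _ * X]ger0_norm ?poisson_ge0//.
    by rewrite mulrA ler_wpM2r ?poisson_ge0// gI.
have far_est n : `|\int[mu]_(u in D `\` I) (g u * P n u)| <= 2 * eps n / h ^+ 2 * K.
  have igDI : mu.-integrable (D `\` I) (EFin \o (fun u => g u * P n u)).
    by apply: integrableS (igP n) => //; exact: subDsetl.
  have iK : mu.-integrable D (EFin \o (fun u => `|g u|)) by exact: integrable_normr.
  apply: (@le_trans _ _ (\int[mu]_(u in D `\` I) (2 * eps n / h ^+ 2 * `|g u|))).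
    apply: normr_Rintegral_le => //.
    - apply: integrableRZ => //; apply: integrableS iK => //; exact: subDsetl.
    - move=> u [Du Iu]; rewrite normrM mulrC ler_wpM2r//.
      rewrite ger0_norm ?poisson_ge0// poisson_le//; apply: hfar => //.
      by move: Du; rewrite /= in_itv /= andbT.
  rewrite RintegralZl//; last by apply: integrableS iK => //; exact: subDsetl.
  have q : 0 <= 2 * eps n / h ^+ 2 by rewrite divr_ge0 ?sqr_ge0// mulr_ge0// ltW.
  apply: ler_wpM2l => //.
  by rewrite /K (Rintegral_split mD mI ID iK) lerDr Rintegral_ge0.
have Alim : A n @[n --> \oo] --> 2 * pi.
  rewrite (_ : A = fun n => 2 * atan ((psi (y + d) - psi y) / eps n) -
     2 * atan ((psi (y - d) - psi y) / eps n)); first exact: mass_limit.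
  by apply/funext => n; have [] := near_mass n dI.
have c1 : 0 < `|c| + 1 by rewrite ltr_wpDl.
have K1 : 0 < K + 1 by rewrite ltr_wpDl.
have q : 0 < r * h ^+ 2 / (6 * (K + 1)) by rewrite divr_gt0 ?mulr_gt0 ?exprn_gt0.
near=> n.
have a1 : `|2 * pi - A n| <= 1.
  by near: n; move/cvgrPdist_le : Alim; apply.
have a2 : `|2 * pi - A n| <= r / (3 * (`|c| + 1)).
  near: n; move/cvgrPdist_le : Alim; apply; by rewrite divr_gt0// mulr_gt0.
have a3 : eps n <= r * h ^+ 2 / (6 * (K + 1)).
  by apply: ltW; near: n; exact: (near_infty_natSinv_lt (PosNum q)).
(* defect of mass, error near [y], and contribution far from [y] *)
have -> : 2 * pi * g y / dpsi y - \int[mu]_(u in D) (g u * poisson n.+1%:R^-1 (psi u - psi y)) =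
   c * (2 * pi - A n) - (\int[mu]_(u in I) (g u * P n u) - c * A n)
   - \int[mu]_(u in D `\` I) (g u * P n u).
  by rewrite -/(P n) split_int /c; ring.
have e1 : `|c * (2 * pi - A n)| <= r / 3.
  rewrite normrM; apply: (@le_trans _ _ (`|c| * (r / (3 * (`|c| + 1))))).
    by rewrite ler_wpM2l.
  rewrite (third _ _ c1).
  rewrite ler_piMr ?divr_ge0 ?(ltW r0)//.
  by rewrite ler_pdivrMr// mul1r lerDl.
have e2 : r' * A n <= r / 3.
  rewrite r'E mulrC.
  by apply: ler_wpM2r; [exact: ltW|move: a1; by rewrite ler_distlC => /andP[]].
have e3 : 2 * eps n / h ^+ 2 * K <= r / 3.
  have h2 : 0 < h ^+ 2 by rewrite exprn_gt0.
  rewrite mulrAC ler_pdivrMr//.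
  have : 2 * eps n * K <= 2 * (r * h ^+ 2 / (6 * (K + 1))) * K.
    by rewrite ler_wpM2r// ler_wpM2l.
  move/le_trans; apply.
  have -> : 2 * (r * h ^+ 2 / (6 * (K + 1))) * K = r / 3 * h ^+ 2 * (K / (K + 1)).
    exact: sixth.
  have p0 : 0 <= r / 3 * h ^+ 2 by rewrite mulr_ge0 ?(ltW h2)// divr_ge0// ltW.
  rewrite ler_piMr//.
  by rewrite ler_pdivrMr// mul1r lerDl.
have := near_est n; have := far_est n => f1 f2.
apply: (le_trans (ler_normB _ _)); apply: (@le_trans _ _ (r / 3 + r / 3 + r / 3)); last exact: r3.
apply: lerD; last exact: le_trans f1 e3.
apply: (le_trans (ler_normB _ _)); apply: lerD => //.
exact: le_trans f2 e2.
Unshelve. all: end_near. Qed.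

(** Pointwise inversion of the transform [int g u exp (- i tau psi u) du]:
    insert the Abel factor [exp (- e |tau|)], exchange the integrals, and let
    [e] tend to [0]. *)
Lemma fourier_inversion (g : R -> C) (G H : R -> R) :
  cmeasurable g -> measurable_fun setT G ->
  (forall u, 0 < u -> normc (g u) <= G u) ->
  mu.-integrable D (EFin \o G) ->
  {for y, continuous (fun u => Re (g u))} ->
  {for y, continuous (fun u => Im (g u))} ->
  let hat tau := cintegral D (fun u => g u * cexp (0 +i* (- (tau * psi u)))) in
  (forall tau, normc (hat tau) <= H tau) -> mu.-integrable setT (EFin \o H) ->
  cintegral setT (fun tau => hat tau * cexp (0 +i* (tau * psi y))) =
  (2 * pi / dpsi y)%:C * g y.
Proof.
move=> mg mG gG iG c1 c2 hat hatH iH.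
have ig : cintegrable D g.
  apply: (cintegrable_dom mD mg _ iG) => x.
  by rewrite /= in_itv /= andbT; exact: gG.
pose F n (tau u : R) : C :=
  (expR (- (eps n * `|tau|)))%:C * cexp (0 +i* (tau * (psi y - psi u))) * g u.
have meps n : measurable_fun setT (fun tau : R => expR (- (eps n * `|tau|))).
  by have := measurable_int _ (integrable_expNabs (eps_gt0 n)); move/measurable_EFinP.
have mF n : cmeasurable (fun z : R * R => F n z.1 z.2).
  apply: cmeasurableM; last by apply: cmeasurable_comp mg; exact: measurable_snd.
  apply: cmeasurableM.
    by apply: cmeasurable_real; apply: (measurableT_comp (meps n)); exact: measurable_fst.
  apply: cmeasurable_cexp; split => /=; first exact: measurable_cst.
  apply: measurable_funM; first exact: measurable_fst.
  apply: measurable_funB; first exact: measurable_cst.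
  by apply: (measurableT_comp mpsi); exact: measurable_snd.
pose k n (z : R * R) := expR (- (eps n * `|z.1|)) * G z.2.
have mk n : measurable_fun setT (k n).
  apply: measurable_funM; last by apply: (measurableT_comp mG); exact: measurable_snd.
  by apply: (measurableT_comp (meps n)); exact: measurable_fst.
have Fk n tau u : setT tau -> D u -> normc (F n tau u) <= k n (tau, u).
  move=> _; rewrite /= in_itv /= andbT => u0.
  rewrite /F !ComplexField.Normc.normcM normc_cexp normc_real /= expR0 mulr1.
  by rewrite /k ger0_norm ?expR_ge0// ler_wpM2l ?expR_ge0// gG.
have iexp n := integrable_expNabs (eps_gt0 n).
have ik n u : D u -> mu.-integrable setT (fun tau => (k n (tau, u))%:E).
  move=> _; rewrite (_ : (fun _ => _) =
    EFin \o (fun tau => G u * expR (- (eps n * `|tau|)))).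
    exact: integrableRZ.
  by apply/funext => tau; rewrite /= /k mulrC.
have kh n u : D u -> \int[mu]_(tau in setT) k n (tau, u) <=
    (\int[mu]_tau expR (- (eps n * `|tau|))) * G u.
  move=> _; rewrite mulrC -RintegralZl//.
  by rewrite le_eqVlt; apply/orP; left; apply/eqP/eq_Rintegral => tau _; rewrite /k mulrC.
have ih n : mu.-integrable D (EFin \o (fun u =>
    (\int[mu]_tau expR (- (eps n * `|tau|))) * G u)) by exact: integrableRZ.
have fub n := cFubini (@measurableT _ _) mD (mF n) (mk n) (Fk n) (ik n) (kh n) (ih n).
pose fn n tau := (expR (- (eps n * `|tau|)))%:C * (hat tau * cexp (0 +i* (tau * psi y))).
have fnE n tau : cintegral D (F n tau) = fn n tau.
  rewrite (_ : fn n tau = (expR (- (eps n * `|tau|)))%:C *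
    cexp (0 +i* (tau * psi y)) * hat tau); last by rewrite /fn; ring.
  rewrite /hat -(cintegralZ mD).
    apply: eq_cintegral => u _; rewrite /F.
    rewrite (_ : 0 +i* (tau * (psi y - psi u)) =
       0 +i* (- (tau * psi u)) + 0 +i* (tau * psi y)).
      by rewrite cexpD; ring.
    by apply: complex_ext; rewrite !csimp /=; ring.
  apply: (cintegrable_dom mD _ _ iG).
    apply: cmeasurableM => //; apply: cmeasurable_cexp; split => /=.
      exact: measurable_cst.
    by apply: measurableT_comp => //; exact: measurable_funM.
  move=> u; rewrite /= in_itv /= andbT => u0.
  by rewrite ComplexField.Normc.normcM normc_cexp /= expR0 mulr1 gG.
have rhsE n : cintegral D (fun u => cintegral setT ((F n)^~ u)) =
   cintegral D (fun u => g u * (poisson (eps n) (psi u - psi y))%:C).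
  apply: eq_cintegral => u _.
  rewrite (_ : poisson _ _ = poisson (eps n) (psi y - psi u)); last first.
    by rewrite /poisson -[psi u - psi y]opprB sqrrN.
  rewrite -fourier_expNabs// -cintegralZ//.
    by apply: eq_cintegral => tau _; rewrite /F mulrC.
  apply: (cintegrable_dom _ _ _ (iexp n)) => //.
    apply: cmeasurableM; first exact: cmeasurable_real.
    apply: cmeasurable_cexp; split => /=; first exact: measurable_cst.
    exact: measurable_funM.
  move=> tau _; rewrite ComplexField.Normc.normcM normc_cexp normc_real /= expR0 mulr1.
  by rewrite ger0_norm ?expR_ge0.
have eqn n : cintegral setT (fn n) =
    cintegral D (fun u => g u * (poisson (eps n) (psi u - psi y))%:C).
  have [_ _ e] := fub n; rewrite -rhsE -e.
  by apply: eq_cintegral => tau _; rewrite fnE.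
have mfn n : cmeasurable (fn n).
  have [[a1 a2] _ _] := fub n; rewrite (_ : fn n = fun tau => cintegral D (F n tau)).
    by split; apply/measurable_EFinP; [exact: measurable_int a1|exact: measurable_int a2].
  by apply/funext => tau; rewrite fnE.
have elim tau : expR (- (eps n * `|tau|)) @[n --> \oo] --> (1 : R).
  rewrite -[X in _ --> X]expR0; apply: continuous_cvg; first exact: continuous_expR.
  rewrite -[X in _ --> X]oppr0; apply: cvgN; rewrite -[X in _ --> X](mul0r `|tau|).
  apply: cvgM; last exact: cvg_cst.
  exact: cvg_harmonic.
have [||||L1 L2] := @cintegral_dct _ setT fn
    (fun tau => hat tau * cexp (0 +i* (tau * psi y))) H _ mfn _ _ iH _ => //.
- move=> tau _; rewrite -[X in _ --> X]mul1r.
  by under eq_fun do rewrite /fn ReM /= mul0r subr0; apply: cvgM => //; exact: cvg_cst.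
- move=> tau _; rewrite -[X in _ --> X]mul1r.
  by under eq_fun do rewrite /fn ImM /= mul0r addr0; apply: cvgM => //; exact: cvg_cst.
- move=> n tau _; rewrite /fn !ComplexField.Normc.normcM normc_cexp normc_real /= expR0 mulr1.
  rewrite ger0_norm ?expR_ge0//; apply: le_trans (hatH tau).
  by rewrite ler_piMl ?normc_ge0// -[leRHS]expR0 ler_expR oppr_le0 mulr_ge0// ltW.
have [mg1 mg2] := mg; have [ig1 ig2] := ig.
have P1 := poisson_limit mg1 ig1 c1; have P2 := poisson_limit mg2 ig2 c2.
have E1 : (fun n => Re (cintegral setT (fn n))) =
    (fun n => \int[mu]_(u in D) (Re (g u) * poisson (eps n) (psi u - psi y))).
  by apply/funext => n; rewrite eqn; apply: eq_Rintegral => u _; rewrite csimp /= mulr0 subr0.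
have E2 : (fun n => Im (cintegral setT (fn n))) =
    (fun n => \int[mu]_(u in D) (Im (g u) * poisson (eps n) (psi u - psi y))).
  by apply/funext => n; rewrite eqn; apply: eq_Rintegral => u _; rewrite csimp /= mulr0 add0r.
rewrite E1 in L1; rewrite E2 in L2.
apply: complex_ext.
  by rewrite csimp /= mul0r subr0 mulrAC; exact: (cvg_unique _ L1 P1).
by rewrite csimp /= mul0r addr0 mulrAC; exact: (cvg_unique _ L2 P2).
Qed.

End poisson_limit.

End fourier_inversion.

(** * Euler's integral in the right half-plane *)
Section parameter_integrals.
Context {R : realType}.
Notation mu := (@lebesgue_measure R).
Local Notation D := (`]0, +oo[%classic : set R).

Let mD : measurable (D : set (measurableTypeR R)). Proof. exact: measurable_itv. Qed.

Lemma is_derive_under_integral d (Y : measurableType d)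
    (m : {measure set Y -> \bar R}) (B : set Y) (f df : R -> Y -> R) (G : Y -> R)
    (a u v : R) : measurable B -> u < a < v ->
  (forall x, u < x < v -> m.-integrable B (EFin \o f x)) ->
  (forall x y, u < x < v -> B y -> is_derive x 1 (f^~ y) (df x y)) ->
  m.-integrable B (EFin \o G) ->
  (forall x y, u < x < v -> B y -> `|df x y| <= G y) ->
  is_derive a 1 (fun x => \int[m]_(y in B) f x y) (\int[m]_(y in B) df a y).
Proof.
move=> mB auv intf dff iG dfG.
have Ia : `]u, v[%classic a by rewrite /= in_itv.
have i1 x : `]u, v[%classic x -> m.-integrable B (EFin \o f x).
  by rewrite /= in_itv; exact: intf.
have d1 x y : `]u, v[%classic x -> B y -> derivable (f^~ y) x 1.
  by rewrite /= in_itv /= => h By; have [] := dff _ _ h By.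
have p1 x y : u < x < v -> B y -> partial1of2 f x y = df x y.
  by move=> h By; rewrite partial1of2E; have [] := dff _ _ h By.
have G0 y : 0 <= `|G y| by [].
have iG' : m.-integrable B (EFin \o (fun y => `|G y|)) by exact: integrable_normr.
have b1 x y : `]u, v[%classic x -> B y -> `|partial1of2 f x y| <= `|G y|.
  rewrite /= in_itv /= => h By; rewrite p1//.
  exact: le_trans (dfG _ _ h By) (ler_norm _).
apply: DeriveDef.
  exact: (derivable_under_integral mB Ia i1 d1 G0 iG' b1).
rewrite -derive1E (differentiation_under_integral mB Ia i1 d1 G0 iG' b1).
by apply: eq_Rintegral => y; rewrite inE => By; rewrite p1.
Qed.

Lemma is_derive_lnf (f : R -> R) (x d : R) : 0 < f x -> is_derive x 1 f d ->
  is_derive x 1 (fun t => ln (f t)) (d / f x).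
Proof.
move=> fx0 df; rewrite mulrC.
exact: (is_derive_comp (is_derive1_ln fx0) df).
Qed.

Lemma is_derive_invf (f : R -> R) (x d : R) : f x != 0 -> is_derive x 1 f d ->
  is_derive x 1 (fun t => (f t)^-1) (- d * (f x)^-1 ^+ 2).
Proof.
move=> fx0 df; apply: (is_derive_eq (is_deriveV fx0 df)).
by rewrite /GRing.scale /= exprVn; ring.
Qed.

Lemma is_derive_atanf (f : R -> R) (x d : R) : is_derive x 1 f d ->
  is_derive x 1 (fun t => atan (f t)) (d / (1 + f x ^+ 2)).
Proof.
move=> df; rewrite mulrC; exact: (is_derive_comp (is_derive1_atan _) df).
Qed.

Lemma Rintegral_scale (a : R) (f : R -> R) : 0 < a -> measurable_fun setT f ->
  \int[mu]_(u in D) f (a * u) = a^-1 * \int[mu]_(u in D) f u.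
Proof.
move=> a0 mf; rewrite [in LHS]Rintegral_mkcond [in RHS]Rintegral_mkcond.
have mfD : measurable_fun setT (f \_ D).
  by apply: (measurable_restrictT f (measurable_itv _)).1; exact: measurable_funTS.
rewrite -[in RHS](gtr0_norm a0) -(Rintegral_affine 0 _ mfD) ?gt_eqF//.
apply: eq_Rintegral => u _; rewrite addr0 !patchE.
suff -> : (a * u \in D) = (u \in D) by [].
by apply/idP/idP; rewrite !inE /= !in_itv /= !andbT pmulr_rgt0.
Qed.

Lemma integrable_even (f : R -> R) : measurable_fun setT f ->
  (forall x, f (- x) = f x) -> mu.-integrable D (EFin \o f) ->
  mu.-integrable setT (EFin \o f).
Proof.
move=> mf fN /integrableP[_ fD].
have mn : measurable_fun setT (fun x => `|f x|%:E).
  by apply/measurable_EFinP; exact: measurableT_comp.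
apply/integrableP; split; first exact/measurable_EFinP.
rewrite -(setUv D) ge0_integral_setU//=; last 3 first.
- exact: measurableC.
- by rewrite setUv.
- exact/disj_setPCl.
apply: lte_add_pinfty => //.
have a0 : (-1 : R) != 0 by rewrite oppr_eq0 oner_eq0.
rewrite integral_mkcond (ge0_integral_affine 0 a0); last 2 first.
- by apply: (measurable_restrictT _ (measurableC (mD))).1; exact: measurable_funTS.
- by move=> x; rewrite patchE; case: ifP.
rewrite normrN1 mul1e.
rewrite (_ : (\int[mu]_x _)%E = (\int[mu]_(x in `[0%R, +oo[) `|f x|%:E)%E); last first.
  rewrite [RHS]integral_mkcond; apply: eq_integral => x _; rewrite mulN1r addr0 !patchE fN.
  suff -> : (- x \in ~` D) = (x \in `[0, +oo[%classic) by [].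
  by apply/idP/idP; rewrite !inE /= !in_itv /= !andbT oppr_gt0 leNgt => /negP//.
rewrite -integral_itv_obnd_cbnd//; exact: measurable_funTS.
Qed.

(** By comparison with [(1 + x) ^ (- p)], which has an elementary primitive. *)
Lemma integrable_invDx2_powr (p : R) : 1 < p ->
  mu.-integrable setT (EFin \o (fun x => expR (- (p / 2) * ln (1 + x ^+ 2)))).
Proof.
move=> p1.
have mf : measurable_fun setT (fun x : R => expR (- (p / 2) * ln (1 + x ^+ 2))).
  apply: measurableT_comp => //; apply: measurable_funM => //.
  apply: (measurableT_comp (@measurable_ln R)); apply: measurable_funD => //.
apply: integrable_even => //; first by move=> x; rewrite sqrrN.
pose g (x : R) : R := expR (- p * ln (x + 1)).
pose F (x : R) : R := - (p - 1)^-1 * expR ((1 - p) * ln (x + 1)).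
have dl (x : R) : 0 < x -> is_derive x 1 (fun x => ln (x + 1)) (x + 1)^-1.
  move=> x0; have h : is_derive x 1 (fun x : R => x + 1) 1.
    by apply: is_derive_eq; rewrite addr0.
  have x1 : 0 < x + 1 by rewrite addr_gt0.
  by have := @is_derive_lnf (fun t => t + 1) x 1 x1 h; rewrite mul1r.
have ig : mu.-integrable D (EFin \o g).
  apply: (@FTC_0y_integrable R F g (p - 1)^-1).
  - move=> x x0; have h := dl x x0; rewrite /F; apply: is_derive_eq.
    have x1 : 0 < x + 1 by rewrite addr_gt0.
    rewrite /GRing.scale /= /g.
    have -> : - p * ln (x + 1) = (1 - p) * ln (x + 1) - ln (x + 1) by ring.
    rewrite expRD expRN lnK ?posrE//; field; rewrite (gt_eqF x1) /= gt_eqF//.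
    by rewrite subr_gt0.
  - move=> x x0; have h := dl x x0.
    have dg : is_derive x 1 g (- p * (x + 1)^-1 * g x).
      by rewrite /g; apply: is_derive_eq; rewrite /GRing.scale /=; ring.
    exact: is_derive_continuous dg.
  - by move=> x _; exact: expR_ge0.
  - move=> x x0; have q : 0 <= (p - 1)^-1 by rewrite invr_ge0 subr_ge0 ltW.
    rewrite /F normrM normrN ger0_norm// ger0_norm ?expR_ge0// ler_piMr//.
    rewrite -[leRHS]expR0 ler_expR nmulr_rle0 ?subr_lt0// ln_ge0//.
    by rewrite lerDr ltW.
apply: (@integrable_dom _ _ _ mu D mD _ (fun x => expR (p / 2 * ln 2) * g x)).
- exact: measurable_funTS.
- move=> x; rewrite /= in_itv /= andbT => x0; rewrite ger0_norm ?expR_ge0//.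
  have x2 : 0 < 1 + x ^+ 2 by rewrite ltr_wpDr ?sqr_ge0.
  have x1 : 0 < x + 1 by rewrite addr_gt0.
  rewrite /g -expRD ler_expR.
  have h : 2 * ln (x + 1) <= ln 2 + ln (1 + x ^+ 2).
    rewrite mulr_natl mulr2n -!lnM ?posrE// ler_ln ?posrE ?mulr_gt0//.
    by have := sqr_ge0 (1 - x); nra.
  have : 0 <= p / 2 by lra.
  nra.
- exact: integrableRZ.
Qed.

End parameter_integrals.

Section gamma.
Context {R : realType}.
Local Notation Re := complex.Re.
Local Notation Im := complex.Im.
Local Notation C := R[i].
Local Notation normc := ComplexField.Normc.normc.
Notation mu := (@lebesgue_measure R).
Local Notation D := (`]0, +oo[%classic : set R).

Let mD : measurable (D : set (measurableTypeR R)). Proof. exact: measurable_itv. Qed.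

(** Euler's integral with a complex decay rate [m]. Powers are written as
    exponentials of logarithms, so that every manipulation of them is an identity
    between exponents. *)
Definition gint (w m : C) (u : R) : C := cexp ((w - 1) * (ln u)%:C - m * u%:C).
Definition gam (w m : C) : C := cintegral D (gint w m).

Lemma normc_gint (w m : C) u :
  normc (gint w m u) = expR ((Re w - 1) * ln u - Re m * u).
Proof. by rewrite normc_cexp !csimp /=; congr expR; ring. Qed.

Lemma ln_le_affine (p c : R) : 0 < p -> 0 < c ->
  exists K, forall u, 0 < u -> p * ln u <= c * u + K.
Proof.
move=> p0 c0; exists (- p * (1 + ln (c / p))) => u u0.
have h := expR_ge1Dx (ln (c / p * u)).
have cp : 0 < c / p by rewrite divr_gt0.
have cpu : 0 < c / p * u by rewrite mulr_gt0.
rewrite lnK ?posrE// lnM ?posrE// in h.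
have : p * (1 + (ln (c / p) + ln u)) <= p * (c / p * u) by rewrite ler_pM2l.
have -> : p * (c / p * u) = c * u by field; rewrite gt_eqF.
lra.
Qed.

(** The integrand is dominated by a multiple of the derivative of
    [- (1 + u ^ a)^-1 / a], which behaves like it at [0] and is bounded. *)
Lemma integrable_gamma (a c : R) : 0 < a -> 0 < c ->
  mu.-integrable D (EFin \o (fun u => expR ((a - 1) * ln u - c * u))).
Proof.
move=> a0 c0.
pose q (u : R) : R := expR (a * ln u).
have q0 u : 0 < q u by exact: expR_gt0.
have q1 u : 0 < 1 + q u by rewrite addr_gt0.
have dln (u : R) : 0 < u -> is_derive u 1 (@ln R) u^-1 by exact: is_derive1_ln.
have dq (u : R) : 0 < u -> is_derive u 1 q (a / u * q u).
  move=> u0; have h := dln u u0; rewrite /q; apply: is_derive_eq.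
  by rewrite /GRing.scale /=; ring.
pose g (u : R) : R := expR ((a - 1) * ln u) * (1 + q u)^-1 ^+ 2.
pose F (u : R) : R := - a^-1 * (1 + q u)^-1.
have d1 (u : R) : 0 < u ->
    is_derive u 1 (fun u => (1 + q u)^-1) (- (a / u * q u) * (1 + q u)^-1 ^+ 2).
  move=> u0; have h := dq u u0.
  have h2 : is_derive u 1 (fun u => 1 + q u) (a / u * q u).
    by apply: (is_derive_eq (is_deriveD (is_derive_cst (1 : R) u 1) h)); rewrite add0r.
  exact: (@is_derive_invf _ (fun u => 1 + q u) u _ (lt0r_neq0 (q1 u)) h2).
have ig : mu.-integrable D (EFin \o g).
  apply: (@FTC_0y_integrable R F g a^-1).
  - move=> u u0; have h := d1 u u0; rewrite /F.
    apply: (is_derive_eq (is_deriveZ (- a^-1) h)); rewrite /GRing.scale /= /g.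
    have -> : (a - 1) * ln u = a * ln u - ln u by ring.
    rewrite expRD expRN lnK ?posrE// -/(q u); field.
    by rewrite (gt_eqF a0) (gt_eqF u0) (gt_eqF (q1 u)).
  - move=> u u0; apply: cvgM.
      have h := dln u u0.
      have h2 : is_derive u 1 (fun u => expR ((a - 1) * ln u)) ((a - 1) / u * expR ((a - 1) * ln u)).
        by apply: is_derive_eq; rewrite /GRing.scale /=; ring.
      exact: is_derive_continuous h2.
    apply: (@continuous_comp _ _ _ (fun u => (1 + q u)^-1) (fun z => z ^+ 2)).
      exact: is_derive_continuous (d1 u u0).
    exact: exprn_continuous.
  - by move=> u u0; rewrite mulr_ge0 ?expR_ge0 ?sqr_ge0.
  - move=> u u0; rewrite /F normrM normrN.
    rewrite [`|(1 + q u)^-1|]ger0_norm ?invr_ge0 ?(ltW (q1 u))//.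
    rewrite gtr0_norm ?invr_gt0// ler_piMr ?invr_ge0 ?(ltW a0)//.
    by rewrite invf_le1// lerDl ltW.
have [K HK] := @ln_le_affine (2 * a) c (mulr_gt0 (ltr0n _ 2) a0) c0.
apply: (@integrable_dom _ _ _ mu D mD _ (fun u => (4 + 4 * expR K) * g u)).
- apply: measurable_funTS; apply: measurableT_comp => //; apply: measurable_funB.
    by apply: measurable_funM => //; exact: measurable_ln.
  by apply: measurable_funM.
- move=> u; rewrite /= in_itv /= andbT => u0; rewrite ger0_norm ?expR_ge0//.
  have gq : expR ((a - 1) * ln u) = (1 + q u) ^+ 2 * g u.
    by rewrite /g; field; rewrite gt_eqF.
  have g0 : 0 <= g u by rewrite mulr_ge0 ?expR_ge0 ?sqr_ge0.
  rewrite expRB gq mulrAC ler_wpM2r// ler_pdivrMr ?expR_gt0//.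
  have qb : q u ^+ 2 <= expR K * expR (c * u).
    by rewrite /q -expRM_natl -expRD ler_expR addrC mulrA HK.
  have e1 : 1 <= expR (c * u) by rewrite -[leLHS]expR0 ler_expR mulr_ge0 ?ltW.
  have := q0 u; have := expR_gt0 K; have := sqr_ge0 (1 - q u); nra.
- exact: integrableRZ.
Qed.

Lemma cmeasurable_gint (w m : C) : cmeasurable (gint w m).
Proof.
apply: cmeasurable_cexp; split => /=; under eq_fun do rewrite !csimp /=.
  apply: measurable_funB; apply: measurable_funB; apply: measurable_funM => //; exact: measurable_ln.
apply: measurable_funB; apply: measurable_funD; apply: measurable_funM => //; exact: measurable_ln.
Qed.

Lemma cintegrable_gint (w m : C) : 0 < Re w -> 0 < Re m ->
  cintegrable D (gint w m).
Proof.
move=> w0 m0; apply: (cintegrable_dom mD (cmeasurable_gint w m) _ (integrable_gamma w0 m0)).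
by move=> u _; rewrite normc_gint.
Qed.

Let gexp (w m : C) (u : R) : C := cexp (w * (ln u)%:C - m * u%:C).

Let gintE (w m : C) u : 0 < u -> gint w m u = (u^-1)%:C * gexp w m u.
Proof.
move=> u0; rewrite /gint /gexp.
have -> : (w - 1) * (ln u)%:C - m * u%:C =
  (- ln u)%:C + (w * (ln u)%:C - m * u%:C) by rewrite rmorphN /=; ring.
by rewrite cexpD cexp_real expRN lnK.
Qed.

Let gint1E (w m : C) u : gint (w + 1) m u = gexp w m u.
Proof. by rewrite /gint addrK. Qed.

Let cder_gexp (w m : C) u : 0 < u ->
  cder (gexp w m) u (w * gint w m u - m * gint (w + 1) m u).
Proof.
move=> u0.
have h : cder (fun t => w * (ln t)%:C + (- m) * t%:C) u (w * (u^-1)%:C + - m * (1 : R)%:C).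
  apply: cderD; apply: cderZ; apply: cder_real => //.
  by have := is_derive1_ln u0.
have := cder_cexp h.
rewrite (_ : (fun _ => _) = gexp w m); last first.
  by apply/funext => t; rewrite /gexp mulNr.
move/cder_eq; apply; rewrite gint1E gintE//.
rewrite (_ : cexp _ = gexp w m u); first by ring.
by rewrite /gexp mulNr.
Qed.

Let cder_gint (w m : C) u : 0 < u -> exists d, cder (gint w m) u d.
Proof. by move=> u0; eexists; exact: cder_gexp. Qed.

Lemma continuous_gint (w m : C) u : 0 < u ->
  {for u, continuous (fun t => Re (gint w m t))} /\
  {for u, continuous (fun t => Im (gint w m t))}.
Proof. by move=> u0; have [d hd] := @cder_gint w m u u0; exact: cder_continuous hd. Qed.

Let gexp_at0 (w m : C) r : 0 < Re w -> 0 <= Re m -> 0 < r ->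
  \forall x \near (0 : R)^'+, normc (gexp w m x) <= r.
Proof.
move=> w0 m0 r0; near=> x.
have x0 : 0 < x by near: x; exact: nbhs_right_gt.
have xr : x <= expR (ln r / Re w).
  near: x; apply: nbhs_right_le; exact: expR_gt0.
rewrite -gint1E normc_gint ReD /= addrK -[leRHS]lnK ?posrE// ler_expR.
apply: (@le_trans _ _ (Re w * ln x)).
  by rewrite lerBlDr lerDl mulr_ge0 ?(ltW x0).
rewrite mulrC -ler_pdivlMr// -[leRHS]expRK ler_ln ?posrE ?expR_gt0//.
Unshelve. all: end_near. Qed.

Let gexp_aty (w m : C) r : 0 < Re w -> 0 < Re m -> 0 < r ->
  \forall x \near +oo, normc (gexp w m x) <= r.
Proof.
move=> w0 m0 r0; have w1 : 0 < Re w + 1 by rewrite addr_gt0.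
have [K HK] := ln_le_affine w1 m0.
near=> x.
have x0 : 0 < x by near: x; apply: nbhs_pinfty_gt; rewrite num_real.
have xr : expR K / r <= x by near: x; apply: nbhs_pinfty_ge; rewrite num_real.
rewrite -gint1E normc_gint ReD /= addrK.
apply: (@le_trans _ _ (expR (K - ln x))).
  by rewrite ler_expR; have := HK _ x0; lra.
by rewrite expRB lnK ?posrE// ler_pdivrMr// mulrC -ler_pdivrMr.
Unshelve. all: end_near. Qed.

(** The functional equation: integrate the derivative of
    [u ^ w exp (- m u)]. *)
Lemma gam_rec (w m : C) : 0 < Re w -> 0 < Re m ->
  w * gam w m = m * gam (w + 1) m.
Proof.
move=> w0 m0; have w1 : 0 < Re (w + 1) by rewrite ReD /= addr_gt0.
have i1 := cintegrable_gint w0 m0; have i2 := cintegrable_gint w1 m0.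
have j1 := cintegrableZ mD w i1; have j2 := cintegrableZ mD (- m) i2.
have := @cFTC_0y _ (gexp w m) (fun u => w * gint w m u + - m * gint (w + 1) m u) 0 0.
rewrite (cintegralD mD j1 j2) !cintegralZ// subr0 mulNr => h.
apply/eqP; rewrite -subr_eq0; apply/eqP; apply: h.
- by move=> x x0; rewrite mulNr; exact: cder_gexp.
- move=> x x0; have [d1 h1] := @cder_gint w m x x0.
  have [d2 h2] := @cder_gint (w + 1) m x x0.
  exact: cder_continuous (cderD (cderZ w h1) (cderZ (- m) h2)).
- exact: cintegrableD.
- apply/cvgr0Pnorm_le => r r0; near=> x; apply: (le_trans (normr_Re_le _)).
  by near: x; apply: gexp_at0 => //; exact: ltW.
- apply/cvgr0Pnorm_le => r r0; near=> x; apply: (le_trans (normr_Im_le _)).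
  by near: x; apply: gexp_at0 => //; exact: ltW.
- apply/cvgr0Pnorm_le => r r0; near=> x; apply: (le_trans (normr_Re_le _)).
  by near: x; exact: gexp_aty.
- apply/cvgr0Pnorm_le => r r0; near=> x; apply: (le_trans (normr_Im_le _)).
  by near: x; exact: gexp_aty.
Unshelve. all: end_near. Qed.

(** ** Rotation of the ray of integration *)
(** The principal logarithm on the right half-plane, where the argument is an
    arctangent. *)
Definition clog (m : C) : C :=
  (ln (Re m ^+ 2 + Im m ^+ 2) / 2) +i* atan (Im m / Re m).

Lemma cder_clog (a y : R) : 0 < a ->
  cder (fun t => clog (a +i* t)) y ((0 +i* 1) / (a +i* y)).
Proof.
move=> a0; have q0 (t : R) : 0 < a ^+ 2 + t ^+ 2.
  by rewrite ltr_pwDl ?sqr_ge0// exprn_gt0.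
have -> : (0 +i* 1) / (a +i* y) =
    (y / (a ^+ 2 + y ^+ 2)) +i* (a / (a ^+ 2 + y ^+ 2)).
  have n0 : (a +i* y : C) != 0 by rewrite eq_complex /= gt_eqF.
  apply: (mulIf n0); rewrite divfK//.
  apply: complex_ext; rewrite !csimp /=; field; rewrite gt_eqF//.
split => /=.
  have h : is_derive y 1 (fun t : R => a ^+ 2 + t ^+ 2) (2 * y).
    by apply: is_derive_eq; rewrite /GRing.scale /=; ring.
  have h2 := @is_derive_lnf _ (fun t : R => a ^+ 2 + t ^+ 2) y _ (q0 y) h.
  rewrite (_ : (fun _ => _) = (fun t => 2^-1 * ln (a ^+ 2 + t ^+ 2))); last first.
    by apply/funext => t; rewrite mulrC.
  apply: (is_derive_eq (is_deriveZ 2^-1 h2)); rewrite /GRing.scale /=; field.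
  by rewrite gt_eqF.
have h : is_derive y 1 (fun t : R => t / a) a^-1.
  exact: is_derive_mulr_cst.
apply: (is_derive_eq (is_derive_atanf h)); field.
by rewrite (gt_eqF a0) /= !gt_eqF// ?exprn_gt0// -?exprMn addrC.
Qed.

(** Differentiation under the integral sign; the derivative of [exp (- m * u)] in
    [m] raises the exponent [w] by one. *)
Lemma cder_gam (w : C) (a y : R) : 0 < Re w -> 0 < a ->
  cder (fun t => gam w (a +i* t)) y (- (0 +i* 1) * gam (w + 1) (a +i* y)).
Proof.
move=> w0 a0; have w1 : 0 < Re (w + 1) by rewrite ReD /= addr_gt0.
pose df (x u : R) : C := - (0 +i* 1) * gint (w + 1) (a +i* x) u.
have dgint (x u : R) : 0 < u -> cder (fun t => gint w (a +i* t) u) x (df x u).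
  move=> u0.
  have h1 : cder (fun t => a +i* t) x (0 +i* 1).
    by split => /=; [exact: is_derive_cst|exact: is_derive_id].
  have h2 := cderD (cder_cst ((w - 1) * (ln u)%:C) x)
    (cderM h1 (cder_cst (- u%:C) x)).
  have := cder_cexp h2.
  rewrite (_ : (fun _ => _) = (fun t => gint w (a +i* t) u)); last first.
    by apply/funext => t; rewrite /gint mulrN.
  move/cder_eq; apply; rewrite /df gint1E mulr0 addr0 add0r.
  rewrite mulrN (_ : cexp _ = gint w (a +i* x) u); last by rewrite /gint mulrN.
  rewrite gintE// mulrA; congr (_ * _).
  by rewrite -mulNr -mulrA -rmorphM /= divff ?mulr1// gt_eqF.
have iG := integrable_gamma w1 a0.
have bd (x u : R) : normc (df x u) <= expR ((Re (w + 1) - 1) * ln u - a * u).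
  rewrite /df ComplexField.Normc.normcM normc_gint /=.
  by rewrite oppr0 expr0n /= add0r sqrrN expr1n sqrtr1 mul1r.
have yy : y - 1 < y < y + 1 by rewrite ltrBlDr ltrDl ltr01.
have ii x := @cintegrable_gint w (a +i* x) w0 a0.
have jj := @cintegrable_gint (w + 1) (a +i* y) w1 a0.
rewrite /gam -(cintegralZ mD _ jj); split => /=.
  apply: (@is_derive_under_integral _ _ _ mu D (fun x u => Re (gint w (a +i* x) u))
    (fun x u => Re (df x u)) _ y (y - 1) (y + 1) mD yy _ _ iG).
  - by move=> x _; have [] := ii x.
  - move=> x u _; rewrite /= in_itv /= andbT => u0.
    by have [] := dgint x u u0.
  - by move=> x u _ _; exact: le_trans (normr_Re_le _) (bd x u).
apply: (@is_derive_under_integral _ _ _ mu D (fun x u => Im (gint w (a +i* x) u))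
  (fun x u => Im (df x u)) _ y (y - 1) (y + 1) mD yy _ _ iG).
- by move=> x _; have [] := ii x.
- move=> x u _; rewrite /= in_itv /= andbT => u0.
  by have [] := dgint x u u0.
- by move=> x u _ _; exact: le_trans (normr_Im_le _) (bd x u).
Qed.

Let cder0_cst (f : R -> C) x y : (forall t, cder f t 0) -> f x = f y.
Proof.
move=> h; apply: complex_ext.
  by apply: (@is_derive_0_is_cst _ (fun t => Re (f t))) => t; have [] := h t.
by apply: (@is_derive_0_is_cst _ (fun t => Im (f t))) => t; have [] := h t.
Qed.

(** By the functional equation the derivative along a vertical line vanishes;
    this replaces Cauchy's theorem. *)
Let gam_vertical (w : C) (a y : R) : 0 < Re w -> 0 < a ->
  cexp (w * clog (a +i* y)) * gam w (a +i* y) =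
  cexp (w * clog a%:C) * gam w a%:C.
Proof.
move=> w0 a0; pose f t := cexp (w * clog (a +i* t)) * gam w (a +i* t).
apply: (@cder0_cst f y 0) => t.
have n0 : (a +i* t : C) != 0 by rewrite eq_complex /= gt_eqF.
apply: (cder_eq (cderM (cder_cexp (cderZ w (cder_clog t a0))) (cder_gam t w0 a0))).
have r : 0 < Re (a +i* t) by [].
have := gam_rec w0 r => /(congr1 (fun z => (a +i* t)^-1 * z)).
rewrite mulKf// => <-; field.
exact: n0.
Qed.

Let gam_scale (w : C) (a : R) : 0 < Re w -> 0 < a ->
  gam w a%:C = cexp (- (w * (ln a)%:C)) * gam w 1.
Proof.
move=> w0 a0.
have key : cintegral D (fun u => gint w 1 (a * u)) = (a^-1)%:C * gam w 1.
  have [m1 m2] := cmeasurable_gint w 1.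
  apply: complex_ext; rewrite csimp /= mul0r ?subr0 ?addr0.
    exact: (Rintegral_scale a0 m1).
  exact: (Rintegral_scale a0 m2).
have e (u : R) : 0 < u -> gint w 1 (a * u) = cexp ((w - 1) * (ln a)%:C) * gint w a%:C u.
  move=> u0; rewrite /gint -cexpD lnM ?posrE// rmorphD rmorphM /=; congr cexp; ring.
have key2 : cexp ((w - 1) * (ln a)%:C) * gam w a%:C = (a^-1)%:C * gam w 1.
  rewrite -key /gam -cintegralZ//; last exact: cintegrable_gint.
  by apply: eq_cintegral => u; rewrite /= in_itv /= andbT => /e ->.
apply: (mulfI (cexp_neq0 ((w - 1) * (ln a)%:C))); rewrite key2 mulrA -cexpD.
rewrite (_ : _ - _ = (- ln a)%:C); first by rewrite cexp_real expRN lnK.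
by rewrite rmorphN /=; ring.
Qed.

(** First move vertically to the positive real axis, then scale. *)
Lemma gam_clog (w m : C) : 0 < Re w -> 0 < Re m ->
  gam w m = cexp (- (w * clog m)) * gam w 1.
Proof.
case: m => a y w0 /= a0.
apply: (mulfI (cexp_neq0 (w * clog (a +i* y)))); rewrite gam_vertical//.
rewrite gam_scale// !mulrA -!cexpD subrr cexp0 mul1r (_ : _ + _ = 0).
  by rewrite cexp0 mul1r.
rewrite (_ : clog a%:C = (ln a)%:C) ?subrr//.
apply: complex_ext => /=; last by rewrite mul0r atan0.
rewrite expr0n addr0 /= -[a ^+ 2]/(a * a) lnM ?posrE//.
by field.
Qed.

(** ** Hankel's integral on a vertical line, and the zero-freeness of Gamma *)
Lemma clog_vertical (y : R) : clog (1 +i* y) = (ln (1 + y ^+ 2) / 2) +i* atan y.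
Proof. by rewrite /clog /= expr1n divr1. Qed.

Lemma normc_power_vertical (w : C) (y : R) :
  normc (cexp (- (w * clog (1 +i* y)))) <=
  expR (`|Im w| * pi) * expR (- (Re w / 2) * ln (1 + y ^+ 2)).
Proof.
rewrite normc_cexp ReN ReM clog_vertical /= -expRD ler_expR opprB.
apply: lerD; last by rewrite le_eqVlt; apply/orP; left; apply/eqP; ring.
apply: (le_trans (ler_norm _)); rewrite normrM ler_wpM2l//.
rewrite ler_norml; have := atan_gtNpi2 y; have := atan_ltpi2 y; have := @pi_gt0 R.
move=> h1 h2 h3; apply/andP; split; lra.
Qed.

(** On the line [Re m = 1], [gam w m] is the Fourier transform of
    [u ^ (w - 1) exp (- u)], and [gam_clog] evaluates it; Fourier inversion at
    [u = 1] gives Hankel's formula for the reciprocal of Gamma. The condition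
    [1 < Re w] makes the integral absolutely convergent. *)
Lemma Hankel_vertical (w : C) : 1 < Re w ->
  gam w 1 * cintegral setT (fun y => cexp ((1 +i* y) - w * clog (1 +i* y))) =
  (2 * pi)%:C.
Proof.
move=> w1; have w0 : 0 < Re w by rewrite (lt_trans ltr01).
have hatE (tau : R) : cintegral D (fun u => gint w 1 u * cexp (0 +i* (- (tau * u)))) =
    cexp (- (w * clog (1 +i* tau))) * gam w 1.
  rewrite -gam_clog//; apply: eq_cintegral => u _.
  rewrite /gint -cexpD; congr cexp; apply: complex_ext; rewrite !csimp /=; ring.
have iH : mu.-integrable setT (EFin \o (fun y => (normc (gam w 1) * expR (`|Im w| * pi)) *
    expR (- (Re w / 2) * ln (1 + y ^+ 2)))).
  by apply: integrableRZ => //; exact: integrable_invDx2_powr.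
have [c1 c2] := @continuous_gint w 1 1 ltr01.
have mG : measurable_fun setT (fun u => expR ((Re w - 1) * ln u - 1 * u)).
  apply: measurableT_comp => //; apply: measurable_funB.
    by apply: measurable_funM => //; exact: measurable_ln.
  exact: measurable_funM.
have := @fourier_inversion R idfun (fun=> 1) 1 ltr01 _ _ _ _ _ (gint w 1)
  (fun u => expR ((Re w - 1) * ln u - 1 * u)) _ (cmeasurable_gint w 1) mG _
  (integrable_gamma w0 ltr01) c1 c2 _ iH.
move=> h.
have {}h : cintegral setT (fun tau => cexp (- (w * clog (1 +i* tau))) * gam w 1 *
    cexp (0 +i* (tau * 1))) = (2 * pi / 1)%:C * gint w 1 1.
  transitivity (cintegral setT (fun tau => cintegral D (fun u => gint w 1 u *
      cexp (0 +i* (- (tau * idfun u)))) * cexp (0 +i* (tau * idfun 1)))).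
    by apply: eq_cintegral => tau _; rewrite hatE.
  apply: h => //.
  - exact: measurable_id.
  - by move=> u _; exact: cvg_cst.
  - by move=> u u0; rewrite normc_gint.
  - move=> tau; rewrite hatE ComplexField.Normc.normcM mulrC -mulrA ler_wpM2l ?normc_ge0//.
    exact: normc_power_vertical.
have g1 : gint w 1 1 = cexp (-1).
  by rewrite /gint ln1; congr cexp; ring.
have me : cintegrable setT (fun y => cexp ((1 +i* y) - w * clog (1 +i* y))).
  have iK : mu.-integrable setT (EFin \o (fun y => (expR 1 * expR (`|Im w| * pi)) *
      expR (- (Re w / 2) * ln (1 + y ^+ 2)))).
    by apply: integrableRZ => //; exact: integrable_invDx2_powr.
  apply: (cintegrable_dom (@measurableT _ _) _ _ iK).
    apply: cmeasurable_cexp; under eq_fun do rewrite clog_vertical.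
    have mln : measurable_fun setT (fun y : R => ln (1 + y ^+ 2) / 2).
      apply: measurable_funM => //; apply: (measurableT_comp (@measurable_ln R)).
      exact: measurable_funD.
    have mat : measurable_fun setT (@atan R).
      by apply: continuous_measurable_fun; exact: continuous_atan.
    split; under eq_fun do rewrite !csimp /=.
      by apply: measurable_funB => //; apply: measurable_funB; exact: measurable_funM.
    by apply: measurable_funB => //; apply: measurable_funD; exact: measurable_funM.
  move=> y _; rewrite cexpD ComplexField.Normc.normcM normc_cexp /= -mulrA.
  by rewrite ler_wpM2l ?expR_ge0// normc_power_vertical.
have e : cintegral setT (fun tau => cexp (- (w * clog (1 +i* tau))) * gam w 1 *
    cexp (0 +i* (tau * 1))) = gam w 1 * cexp (-1) *
    cintegral setT (fun y => cexp ((1 +i* y) - w * clog (1 +i* y))).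
  rewrite -cintegralZ//; apply: eq_cintegral => y _.
  have -> : 1 +i* y = 1 + (0 +i* (y * 1)) :> C.
    by apply: complex_ext; rewrite !csimp /=; ring.
  rewrite !cexpD (cexpN 1); field.
  exact: cexp_neq0.
move: h; rewrite e g1 divr1 => /(congr1 (fun z => z * cexp 1)).
have ee : cexp (-1) * cexp 1 = 1 :> C by rewrite -cexpD addNr cexp0.
rewrite -[(2 * pi)%:C * _ * _]mulrA ee mulr1 => <-.
set I := cintegral _ _.
have -> : gam w 1 * cexp (-1) * I * cexp 1 = gam w 1 * I * (cexp (-1) * cexp 1) by ring.
by rewrite ee mulr1.
Qed.

(** Immediate from [Hankel_vertical] when [1 < Re w]; the functional equation
    carries it down to the right half-plane. *)
Lemma gam_neq0 (w : C) : 0 < Re w -> gam w 1 != 0.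
Proof.
move=> w0; have w1 : 1 < Re (w + 1) by rewrite ReD /= ltrDr.
have := Hankel_vertical w1; apply: contra_eq_neq => g0.
have := @gam_rec w 1 w0 ltr01; rewrite g0 mulr0 mul1r => <-.
rewrite mul0r; apply/eqP => -[/esym /eqP]; rewrite mulf_eq0 => /orP[/eqP|/eqP].
  by move/eqP; rewrite pnatr_eq0.
by apply/eqP; rewrite gt_eqF// pi_gt0.
Qed.

(** ** The Cahen-Mellin integral *)
Lemma normc_gam_le (w : C) : 0 < Re w ->
  normc (gam w 1) <= 2 * \int[mu]_(u in D) expR ((Re w - 1) * ln u - 1 * u).
Proof.
move=> w0; have [i1 i2] := cintegrable_gint w0 (m := 1) ltr01.
have iG := integrable_gamma w0 ltr01.
apply: (le_trans (normc_le_add _)); rewrite mulr_natl mulr2n.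
apply: lerD; apply: normr_Rintegral_le => // u _.
  by apply: (le_trans (normr_Re_le _)); rewrite normc_gint.
by apply: (le_trans (normr_Im_le _)); rewrite normc_gint.
Qed.

Let normcE2 (z : C) : normc z ^+ 2 = Re z ^+ 2 + Im z ^+ 2.
Proof. by case: z => a b; rewrite /= sqr_sqrtr// addr_ge0 ?sqr_ge0. Qed.

(** Two applications of the functional equation bring in a factor of size
    [|tau| ^ (- 2)], which is all the decay that the inversion integrals need. *)
Lemma gam_decay (b : R) : 0 < b -> exists K, forall tau,
  normc (gam (b +i* tau) 1) <= K * (1 + tau ^+ 2)^-1.
Proof.
move=> b0.
pose G := 2 * \int[mu]_(u in D) expR ((b + 1 + 1 - 1) * ln u - 1 * u).
pose q : R := Num.min (b ^+ 2) 1.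
have q0 : 0 < q by rewrite lt_min exprn_gt0//=.
exists (G / q) => tau; set w : C := b +i* tau.
have r1 := @gam_rec w 1 b0 ltr01.
have w1 : 0 < Re (w + 1) by rewrite ReD /= addr_gt0.
have r2 := gam_rec w1 (m := 1) ltr01.
have w2 : 0 < Re (w + 1 + 1) by rewrite ReD /= addr_gt0.
have := normc_gam_le w2.
have -> : Re (w + 1 + 1) = b + 1 + 1 by rewrite !ReD.
rewrite -/G; rewrite !mul1r in r1 r2; rewrite -r2 -r1.
rewrite !ComplexField.Normc.normcM => h.
have nw : q * (1 + tau ^+ 2) <= normc w ^+ 2.
  rewrite normcE2 /= mulrDr mulr1; apply: lerD; first by rewrite ge_min lexx.
  by rewrite ler_piMl ?sqr_ge0// ge_min lexx orbT.
have nw1 : normc w <= normc (w + 1).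
  rewrite -(ler_pXn2r (n := 2))// ?nnegrE ?normc_ge0// !normcE2 !csimp /= addr0.
  by rewrite lerD2r; nra.
have t0 : 0 < 1 + tau ^+ 2 by rewrite ltr_wpDr ?sqr_ge0.
rewrite ler_pdivlMr// ler_pdivlMr//; apply: (le_trans _ h).
have -> : normc (gam w 1) * (1 + tau ^+ 2) * q = q * (1 + tau ^+ 2) * normc (gam w 1).
  by rewrite mulrC mulrA mulrAC.
rewrite mulrA; apply: ler_wpM2r; first exact: normc_ge0.
apply: (le_trans nw); rewrite expr2; apply: ler_wpM2r => //; exact: normc_ge0.
Qed.

Let ln_inc (u v : R) : 0 < u -> u < v -> ln u < ln v.
Proof. by move=> u0 uv; rewrite ltr_ln ?posrE// (lt_trans u0). Qed.

Let cvg_invx (u : R) : 0 < u -> {for u, continuous (fun x : R => x^-1)}.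
Proof. by move=> u0; apply: inv_continuous; rewrite gt_eqF. Qed.

(** Fourier inversion with phase [ln]: the transform of [u ^ (b - 1) exp (- u)] is
    Gamma on a vertical line. *)
Lemma Cahen_Mellin (b z : R) : 0 < b -> 0 < z ->
  cintegral setT (fun tau => gam (b +i* (- tau)) 1 * cexp (0 +i* (tau * ln z))) =
  (2 * pi * z)%:C * gint b%:C 1 z.
Proof.
move=> b0 z0; have [K HK] := gam_decay b0.
have [c1 c2] := @continuous_gint b%:C 1 z z0.
have iH : mu.-integrable setT (EFin \o (fun y : R => K * (1 + y ^+ 2)^-1)).
  by apply: integrableRZ => //; exact: integrable_invDx2.
have [mG1 _] := cmeasurable_gint b%:C 1.
have mG : measurable_fun setT (fun u => expR ((b - 1) * ln u - 1 * u)).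
  apply: measurableT_comp => //; apply: measurable_funB.
    by apply: measurable_funM => //; exact: measurable_ln.
  exact: measurable_funM.
have hatE (tau : R) : cintegral D (fun u => gint b%:C 1 u * cexp (0 +i* (- (tau * ln u)))) =
    gam (b +i* (- tau)) 1.
  apply: eq_cintegral => u _; rewrite /gint -cexpD; congr cexp.
  by apply: complex_ext; rewrite !csimp /=; ring.
have := @fourier_inversion R (@ln R) (fun u => u^-1) z z0 (@measurable_ln R)
  (@is_derive1_ln R) cvg_invx _ ln_inc (gint b%:C 1) _ _
  (cmeasurable_gint b%:C 1) mG _ (integrable_gamma b0 ltr01) c1 c2 _ iH.
rewrite invrK => h.
transitivity (cintegral setT (fun tau => cintegral D (fun u => gint b%:C 1 u *
   cexp (0 +i* (- (tau * ln u)))) * cexp (0 +i* (tau * ln z)))).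
  by apply: eq_cintegral => tau _; rewrite hatE.
apply: h => //.
- by move=> u u0; rewrite invr_gt0.
- by move=> u u0; rewrite normc_gint.
- by move=> tau; rewrite hatE -[tau ^+ 2]sqrrN.
Qed.

(** Fourier inversion with phase [ln] and transform [0]. *)
Lemma Mellin_unique (g : R -> R) (y : R) : 0 < y -> measurable_fun setT g ->
  mu.-integrable D (EFin \o g) -> {for y, continuous g} ->
  (forall tau, cintegral D (fun u => (g u)%:C * cexp (0 +i* (- (tau * ln u)))) = 0) ->
  g y = 0.
Proof.
move=> y0 mg ig cg hat0.
have iN := integrable_normr ig.
have i0 : mu.-integrable setT (EFin \o (fun=> 0 : R)) by exact: integrable0.
have mN : measurable_fun setT (fun u => `|g u|) by exact: measurableT_comp.
have := @fourier_inversion R (@ln R) (fun u => u^-1) y y0 (@measurable_ln R)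
  (@is_derive1_ln R) cvg_invx _ ln_inc (fun u => (g u)%:C) (fun u => `|g u|) (fun=> 0)
  (cmeasurable_real mg) mN _ iN cg (cvg_cst _) _ i0.
rewrite invrK => h.
have {}h : 0 = (2 * pi * y)%:C * (g y)%:C.
  rewrite -h//.
  - rewrite (@eq_cintegral _ _ _ (fun=> 0)); last first.
      by move=> tau _; rewrite hat0 mul0r.
    by apply: complex_ext; rewrite /= Rintegral_cst// mul0r.
  - by move=> u u0; rewrite invr_gt0.
  - by move=> u u0; rewrite normc_real.
  - by move=> tau; rewrite hat0 ComplexField.Normc.normc0.
move: h => /(congr1 (fun z : C => Re z)); rewrite csimp /= mul0r subr0.
move=> /esym /eqP; rewrite mulf_eq0 => /orP[|/eqP//].
by rewrite !mulf_eq0 pnatr_eq0 /= (gt_eqF y0) orbF gt_eqF// pi_gt0.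
Qed.

End gamma.

(** * The M-function and its Mellin transform *)
Section continuity.
Context {R : realType}.

Lemma near_eq_continuous (T : topologicalType) (f g : R -> T) (u : R) :
  (\forall t \near u, f t = g t) -> {for u, continuous f} -> {for u, continuous g}.
Proof.
move=> fg cf; have e0 : f u = g u by exact: (nbhs_singleton fg).
move: cf; rewrite /prop_for /continuous_at e0 => cf.
by apply: cvg_trans cf; apply: near_eq_cvg; exact: fg.
Qed.

Lemma continuous_Rintegral d (Y : measurableType d)
    (m : {measure set Y -> \bar R}) (B : set Y) (f : R -> Y -> R) (G : Y -> R)
    (a u v : R) : measurable B -> u < a < v ->
  (forall x, u < x < v -> measurable_fun B (f x)) ->
  (forall x y, u < x < v -> B y -> {for x, continuous (f^~ y)}) ->
  m.-integrable B (EFin \o G) ->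
  (forall x y, u < x < v -> B y -> `|f x y| <= G y) ->
  {for a, continuous (fun x => \int[m]_(y in B) f x y)}.
Proof.
move=> mB auv mf cf iG fG.
have h := @continuity_under_integral R d Y m f B mB u v.
apply: (h _ _ G iG).
- move=> x; rewrite /= in_itv /= => xuv.
  exact: (@integrable_dom _ _ _ m B mB _ G (mf x xuv) (fun y => fG x y xuv) iG).
- apply: aeW => y By x; rewrite inE /= in_itv /= => xuv; exact: cf.
- move=> x; rewrite /= in_itv /= => xuv; apply: aeW => y By; exact: fG.
- by rewrite inE /= in_itv.
Qed.

End continuity.

Section mainardi.
Context {R : realType}.
Local Notation Re := complex.Re.
Local Notation Im := complex.Im.
Local Notation C := R[i].
Local Notation normc := ComplexField.Normc.normc.
Notation mu := (@lebesgue_measure R).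
Local Notation D := (`]0, +oo[%classic : set R).

Let mD : measurable (D : set (measurableTypeR R)). Proof. exact: measurable_itv. Qed.

Lemma normc_le_normD (a b : C) : normc (a + b) <= normc a + normc b.
Proof.
have := ler_normD a b.
rewrite !normc_def -rmorphD /= lecR.
by case: a => a1 a2; case: b.
Qed.

Lemma eq_cintegrable (B : set R) (f g : R -> C) :
  measurable (B : set (measurableTypeR R)) ->
  (forall x, B x -> f x = g x) -> cintegrable B f -> cintegrable B g.
Proof.
move=> mB fg [i1 i2]; split.
  apply: (@eq_integrable _ _ _ mu B mB (EFin \o (fun t => Re (f t))) _ _ i1) => x.
  by rewrite inE => Bx; rewrite /= fg.
apply: (@eq_integrable _ _ _ mu B mB (EFin \o (fun t => Im (f t))) _ _ i2) => x.
by rewrite inE => Bx; rewrite /= fg.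
Qed.

Lemma clog_cexp (x t : R) : - (pi / 2) < t < pi / 2 ->
  clog (cexp (x +i* t)) = x +i* t.
Proof.
move=> ht; have c0 := cos_gt0_pihalf ht.
rewrite /clog /cexp /=; apply: complex_ext => /=.
  by rewrite !exprMn -mulrDr cos2Dsin2 mulr1 -expRM_natl expRK; field.
by rewrite -mulf_div divff ?gt_eqF ?expR_gt0// mul1r -/(tan t) tanK// in_itv /=.
Qed.

Variable alpha : R.
Hypothesis a01 : 0 < alpha < 1.

Let a0 : 0 < alpha. Proof. by case/andP: a01. Qed.
Let a1 : alpha < 1. Proof. by case/andP: a01. Qed.

Let L (y : R) : C := clog (1 +i* y).
Let lr (y : R) : R := ln (1 + y ^+ 2) / 2.

Let LE y : L y = lr y +i* atan y. Proof. exact: clog_vertical. Qed.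

Let lr_ge0 y : 0 <= lr y.
Proof. by rewrite divr_ge0// ln_ge0// lerDl sqr_ge0. Qed.

(** The cosine of the largest argument of [lambda ^ alpha] on the right
    half-plane; it is the rate at which [exp (- u * lambda ^ alpha)] decays. *)
Definition kappa : R := cos (alpha * (pi / 2)).

Let angle y : - (pi / 2) < alpha * atan y < pi / 2.
Proof.
have := atan_gtNpi2 y; have := atan_ltpi2 y; have := a0; have := a1.
by have := @pi_gt0 R => *; apply/andP; split; nra.
Qed.

Lemma kappa_gt0 : 0 < kappa.
Proof.
apply: cos_gt0_pihalf; have := a0; have := a1.
by have := @pi_gt0 R => *; apply/andP; split; nra.
Qed.

Lemma cos_sector y : kappa <= cos (alpha * atan y).
Proof.
rewrite /kappa -[leRHS]cos_norm normrM (gtr0_norm a0).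
have h : `|atan y| <= pi / 2.
  rewrite ler_norml; apply/andP; split; apply: ltW.
    exact: atan_gtNpi2.
  exact: atan_ltpi2.
have p0 := @pi_gt0 R; have := a0; have := a1 => q1 q0.
have b1 : 0 <= alpha * (pi / 2) <= pi by apply/andP; split; nra.
have b2 : 0 <= alpha * `|atan y| <= pi.
  by have := normr_ge0 (atan y) => *; apply/andP; split; nra.
by rewrite leNgt ltr_cos ?in_itv //= -leNgt ler_pM2l.
Qed.

(** The M-function is the inverse Laplace integral, on the line
    [lambda = 1 + i * y], of [lambda ^ (alpha - 1) * exp (- u * lambda ^ alpha)]
    evaluated at time one. The integrand below results from one integration by
    parts, which makes it absolutely integrable uniformly down to [u = 0]. *)
Definition mker (u y : R) : C :=
  cexp ((1 +i* y) - u%:C * cexp (alpha%:C * L y)) *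
  ((1 - alpha)%:C * cexp ((alpha - 2)%:C * L y) +
   (u * alpha)%:C * cexp ((2 * alpha - 2)%:C * L y)).

Let rho (y : R) : R := expR (- ((2 - alpha) / 2) * ln (1 + y ^+ 2)).
Let K : R := expR 1 * (1 + 2 / kappa).
Let c : R := kappa / 2.

(** Half of the decay rate [kappa] pays for the polynomial factor [1 + u * E], with
    [E = |lambda| ^ alpha >= 1]. *)
Lemma normc_mker u y : 0 < u -> normc (mker u y) <= expR (- (c * u)) * (K * rho y).
Proof.
move=> u0; have k0 := kappa_gt0.
rewrite /mker ComplexField.Normc.normcM normc_cexp.
have E1 : 1 <= expR (alpha * lr y) by rewrite -[leLHS]expR0 ler_expR mulr_ge0// ltW.
set E := expR (alpha * lr y) in E1.
have x0 : 0 <= u * E by rewrite mulr_ge0 ?ltW// (lt_le_trans ltr01).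
have re : Re ((1 +i* y) - u%:C * cexp (alpha%:C * L y)) <= 1 - kappa * (u * E).
  rewrite LE !csimp /= !mul0r !subr0 addr0 lerD2l lerN2 -/E mulrCA mulrC.
  rewrite [leLHS]mulrC ler_pM2l// mulrC.
  have := cos_sector y; have : 0 < E by exact: lt_le_trans E1.
  by move=> E0 ?; rewrite ler_pM2l.
have nn : normc ((1 - alpha)%:C * cexp ((alpha - 2)%:C * L y) +
   (u * alpha)%:C * cexp ((2 * alpha - 2)%:C * L y)) <= rho y * (1 + u * E).
  apply: (le_trans (normc_le_normD _ _)).
  rewrite !ComplexField.Normc.normcM !normc_real !normc_cexp LE !csimp /=.
  rewrite !mul0r !subr0 ger0_norm ?subr_ge0// ?(ltW a1)// ger0_norm ?mulr_ge0// ?(ltW u0) ?(ltW a0)//.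
  have -> : expR ((alpha - 2) * lr y) = rho y by congr expR; rewrite /lr; field.
  have -> : expR ((2 * alpha - 2) * lr y) = E * rho y.
    by rewrite /E /rho -expRD; congr expR; rewrite /lr; field.
  have r0 : 0 <= rho y by exact: expR_ge0.
  have -> : (1 - alpha) * rho y + u * alpha * (E * rho y) =
    rho y * (1 - alpha + alpha * (u * E)) by ring.
  by apply: ler_wpM2l => //; have := a0; have := a1 => *; nra.
apply: (@le_trans _ _ (expR (1 - kappa * (u * E)) * (rho y * (1 + u * E)))).
  by apply: ler_pM; rewrite ?expR_ge0 ?normc_ge0 ?ler_expR.
have r0 : 0 <= rho y by exact: expR_ge0.
have key : expR (- (kappa * (u * E))) * (1 + u * E) <= (1 + 2 / kappa) * expR (- (c * u)).
  have e1 := expR_ge1Dx (c * (u * E)).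
  have cE : 0 <= c * (u * E) by rewrite mulr_ge0// divr_ge0// ltW.
  have -> : - (kappa * (u * E)) = - (c * (u * E)) - c * (u * E) by rewrite /c; field.
  rewrite expRD -mulrA mulrC.
  apply: ler_pM => //; rewrite ?expR_ge0 ?mulr_ge0 ?expR_ge0 ?addr_ge0//.
    rewrite expRN mulrC ler_pdivrMr ?expR_gt0//.
    have wE : u * E = 2 / kappa * (c * (u * E)) by rewrite /c; field; rewrite gt_eqF.
    rewrite [X in 1 + X <= _]wE; have : 0 < 2 / kappa by rewrite divr_gt0.
    nra.
  rewrite ler_expR lerN2 ler_pM2l ?divr_gt0//.
  by rewrite ler_peMr// ltW.
have -> : expR (1 - kappa * (u * E)) * (rho y * (1 + u * E)) =
  (expR 1 * rho y) * (expR (- (kappa * (u * E))) * (1 + u * E)).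
  by rewrite expRD; ring.
have -> : expR (- (c * u)) * (K * rho y) = expR 1 * rho y * ((1 + 2 / kappa) * expR (- (c * u))).
  by rewrite /K; ring.
by apply: ler_wpM2l => //; rewrite mulr_ge0 ?expR_ge0.
Qed.

Let irho : mu.-integrable setT (EFin \o (fun y => K * rho y)).
Proof.
apply: integrableRZ => //; apply: integrable_invDx2_powr.
by have := a1 => *; lra.
Qed.

Let cmeasurable_L : cmeasurable L.
Proof.
split; under eq_fun do rewrite LE /=.
  apply: measurable_funM => //; apply: (measurableT_comp (@measurable_ln R)).
  exact: measurable_funD.
by apply: continuous_measurable_fun; exact: continuous_atan.
Qed.

Lemma cmeasurable_mker : cmeasurable (fun z : R * R => mker z.1 z.2).
Proof.
have mL (k : C) : cmeasurable (fun z : R * R => cexp (k * L z.2)).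
  apply: cmeasurable_cexp; apply: cmeasurableM; first exact: cmeasurable_cst.
  exact: (cmeasurable_comp (@measurable_snd _ _ _ _) cmeasurable_L).
have m1 : cmeasurable (fun z : R * R => z.1%:C).
  by apply: cmeasurable_real; exact: measurable_fst.
apply: cmeasurableM.
  apply: cmeasurable_cexp; apply: cmeasurableD.
    by split => /=; [exact: measurable_cst|exact: measurable_snd].
  rewrite (_ : (fun _ => _) = fun z : R * R => (- z.1)%:C * cexp (alpha%:C * L z.2)).
    apply: cmeasurableM => //; apply: cmeasurable_real.
    by apply: measurableT_comp => //; exact: measurable_fst.
  by apply/funext => z; rewrite rmorphN mulNr.
have mk : cmeasurable (fun _ : R * R => (1 - alpha)%:C) by exact: cmeasurable_cst.
apply: cmeasurableD; apply: cmeasurableM => //.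
apply: cmeasurable_real; apply: measurable_funM => //; exact: measurable_fst.
Qed.

Let cmeasurable_mker1 u : cmeasurable (mker u).
Proof.
apply: (cmeasurable_comp _ cmeasurable_mker (h := fun y => (u, y))).
exact: measurable_pair1.
Qed.

Lemma cintegrable_mker u : 0 < u -> cintegrable setT (mker u).
Proof.
move=> u0; apply: (cintegrable_dom (@measurableT _ _) (cmeasurable_mker1 u) (g := fun y => expR (- (c * u)) * (K * rho y))).
  by move=> y _; exact: normc_mker.
exact: integrableRZ.
Qed.

(** The imaginary part of [mker u] is odd, so the contour integral is real. *)
Definition mfun (u : R) : R :=
  if 0 < u then (2 * pi)^-1 * Re (cintegral setT (mker u)) else 0.

Let mker_conj u y : mker u (- y) = conjc (mker u y).
Proof.
have LN : L (- y) = conjc (L y).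
  by apply: complex_ext; rewrite !LE /lr /= ?sqrrN// atanN.
have cr (x : R) : conjc x%:C = x%:C by apply: complex_ext; rewrite /= ?oppr0.
have eM (p q : C) : conjc (p * q) = conjc p * conjc q by exact: rmorphM.
have e (k : R) : cexp (k%:C * L (- y)) = conjc (cexp (k%:C * L y)).
  by rewrite -cexp_conj eM cr LN.
have eD (p q : C) : conjc (p + q) = conjc p + conjc q by exact: rmorphD.
have eN (p : C) : conjc (- p) = - conjc p by exact: rmorphN.
by rewrite /mker !e [RHS]eM -[in RHS]cexp_conj !(eD, eM, eN, cr).
Qed.

Lemma cintegral_mker u : 0 < u -> cintegral setT (mker u) = (2 * pi * mfun u)%:C.
Proof.
move=> u0; have p0 : (2 * pi : R) != 0 by rewrite mulf_neq0 ?pnatr_eq0// gt_eqF ?pi_gt0.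
rewrite /mfun u0 mulVKf//; apply: complex_ext; first by [].
have [_ m2] := cmeasurable_mker1 u; have [_ i2] := cintegrable_mker u0.
apply: (@Rintegral_odd _ (fun y => Im (mker u y)) m2 _ i2) => y.
by rewrite mker_conj; case: (mker u y).
Qed.

Definition mbound : R := (2 * pi)^-1 * \int[mu]_y (K * rho y).

Lemma mfun_bound u : `|mfun u| <= mbound * expR (- (c * u)).
Proof.
have p0 : 0 < (2 * pi : R)^-1 by rewrite invr_gt0 mulr_gt0// pi_gt0.
have r0 : 0 <= \int[mu]_y (K * rho y).
  apply: Rintegral_ge0 => // y _; rewrite !mulr_ge0 ?expR_ge0//.
  by rewrite addr_ge0// divr_ge0// ltW// kappa_gt0.
rewrite /mfun; case: ifPn => u0; last by rewrite normr0 !mulr_ge0 ?expR_ge0// ltW.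
rewrite normrM gtr0_norm// -mulrA ler_pM2l// mulrC -RintegralZl//.
have [i1 _] := cintegrable_mker u0.
apply: normr_Rintegral_le => //; first exact: integrableRZ.
by move=> y _; exact: le_trans (normr_Re_le _) (normc_mker _ u0).
Qed.

Let mrho : measurable_fun setT (fun y => K * rho y).
Proof.
apply: measurable_funM => //; apply: measurableT_comp => //.
apply: measurable_funM => //; apply: (measurableT_comp (@measurable_ln R)).
exact: measurable_funD.
Qed.

(** Transforms of [mfun] reduce to transforms of [mker], for each point [y] of the
    contour. *)
Lemma mfun_Fubini (g : R -> C) (G : R -> R) : cmeasurable g ->
  measurable_fun setT G -> (forall u, 0 < u -> normc (g u) <= G u) ->
  mu.-integrable D (EFin \o (fun u => expR (- (c * u)) * G u)) ->
  [/\ cintegrable D (fun u => (mfun u)%:C * g u),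
     cintegrable setT (fun y => cintegral D (fun u => mker u y * g u)) &
    (2 * pi)%:C * cintegral D (fun u => (mfun u)%:C * g u) =
    cintegral setT (fun y => cintegral D (fun u => mker u y * g u))].
Proof.
move=> mg mG gG iG.
have := @cFubini R D setT (fun u y => mker u y * g u)
  (fun z => (expR (- (c * z.1)) * G z.1) * (K * rho z.2))
  (fun y => (\int[mu]_(u in D) (expR (- (c * u)) * G u)) * (K * rho y)) mD (@measurableT _ _).
case.
- apply: cmeasurableM; first exact: cmeasurable_mker.
  exact: (cmeasurable_comp (@measurable_fst _ _ _ _) mg).
- apply: measurable_funM; last first.
    exact: (measurableT_comp mrho (@measurable_snd _ _ _ _)).
  have mh : measurable_fun setT (fun x => expR (- (c * x)) * G x).
    apply: measurable_funM => //; apply: measurableT_comp => //.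
    by apply: measurableT_comp => //; exact: measurable_funM.
  exact: (measurableT_comp mh (@measurable_fst _ _ _ _)).
- move=> u y; rewrite /= in_itv /= andbT => u0 _.
  rewrite ComplexField.Normc.normcM mulrAC.
  by apply: ler_pM; rewrite ?normc_ge0 ?normc_mker ?gG.
- move=> y _.
  have -> : (fun x => ((expR (- (c * (x, y).1)) * G (x, y).1 * (K * rho (x, y).2)))%:E) =
     EFin \o (fun x => (K * rho y) * (expR (- (c * x)) * G x)).
    by apply/funext => x /=; rewrite mulrC.
  exact: integrableRZ.
- by move=> y _ /=; rewrite RintegralZr.
- rewrite (_ : (EFin \o _) = EFin \o (fun y => (\int[mu]_(u in D) (expR (- (c * u)) * G u)) *
    (K * rho y)))//.
  exact: integrableRZ.
have p0 : (2 * pi : R) != 0 by rewrite mulf_neq0 ?pnatr_eq0// gt_eqF ?pi_gt0.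
have e u : D u -> cintegral setT (fun y => mker u y * g u) =
    (2 * pi)%:C * ((mfun u)%:C * g u).
  rewrite /= in_itv /= andbT => u0; rewrite mulrA -rmorphM /= -cintegral_mker//.
  rewrite mulrC -cintegralZ//; last exact: cintegrable_mker.
  by apply: eq_cintegral => y _; rewrite mulrC.
move=> i1 i2 E.
have i3 : cintegrable D (fun u => (2 * pi)%:C * ((mfun u)%:C * g u)).
  exact: eq_cintegrable mD e i1.
have q : ((2 * pi)^-1)%:C * (2 * pi)%:C = 1 :> C by rewrite -rmorphM mulVf.
have i4 : cintegrable D (fun u => (mfun u)%:C * g u).
  have i5 := cintegrableZ mD ((2 * pi)^-1)%:C i3.
  apply: (@eq_cintegrable D _ (fun u => (mfun u)%:C * g u) mD _ i5) => u _.
  rewrite mulrA q mul1r; reflexivity.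
split; [exact: i4|exact: i2|]; rewrite -E -(cintegralZ mD _ i4).
by apply: eq_cintegral => u Du; rewrite (e u Du).
Qed.

Lemma integrable_expN (k : R) : 0 < k ->
  mu.-integrable D (EFin \o (fun u => expR (- (k * u)))).
Proof.
move=> k0; have := integrable_gamma ltr01 k0.
rewrite (_ : (EFin \o _) = (EFin \o (fun u => expR (- (k * u)))))//.
by apply/funext => u /=; rewrite subrr mul0r add0r.
Qed.

Lemma measurable_mfun : measurable_fun setT mfun.
Proof.
have c0 : 0 < c by rewrite divr_gt0// kappa_gt0.
have ig : mu.-integrable D (EFin \o (fun u => expR (- (c * u)) * (1 : R))).
  rewrite (_ : (EFin \o _) = (EFin \o (fun u => expR (- (c * u)))))//.
    exact: integrable_expN.
  by apply/funext => u /=; rewrite mulr1.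
have h1 (u : R) : 0 < u -> normc (1 : C) <= 1 by rewrite ComplexField.Normc.normc1.
have [[/integrableP[m1 _] _] _ _] := @mfun_Fubini (fun=> 1) (fun=> 1) (@cmeasurable_cst _ _ (measurableTypeR R) 1)
  (measurable_cst (1 : R)) h1 ig.
have md : measurable_fun D (fun t => mfun t).
  apply/measurable_EFinP; move: m1.
  rewrite (_ : (EFin \o _) = (EFin \o (fun t => mfun t)))//.
  by apply/funext => t; rewrite compE mulr1.
have := (measurable_restrictT mfun mD).1 md.
rewrite (_ : _ \_ _ = mfun)//; apply/funext => t; rewrite patchE; case: ifPn => // tD.
rewrite /mfun; case: ifPn => // t0; case/negP: tD.
by rewrite inE /= in_itv /= andbT.
Qed.

Lemma continuous_mfun u : 0 < u -> {for u, continuous mfun}.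
Proof.
move=> u0.
pose f := fun t => (2 * pi)^-1 * \int[mu]_y Re (mker t y).
apply: (@near_eq_continuous _ _ f).
  by near=> t; rewrite /f /mfun; have -> : 0 < t by near: t; exact: lt_nbhsr.
have cd t y : exists d, cder (mker^~ y) t d.
  have h1 : is_derive t 1 (fun s : R => s) 1 by exact: is_derive_id.
  eexists; apply: cderM.
    apply: cder_cexp; apply: (cderD (cder_cst (1 +i* y) t)).
    have := cderZ (- cexp (alpha%:C * L y)) (cder_real h1).
    rewrite (_ : (fun _ => _) = (fun s : R => - (s%:C * cexp (alpha%:C * L y)))); last first.
      by apply/funext => s; rewrite mulNr mulrC.
    apply.
  apply: (cderD (cder_cst _ t)).
  have := cderZ (alpha%:C * cexp ((2 * alpha - 2)%:C * L y)) (cder_real h1).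
  rewrite (_ : (fun _ => _) = (fun s : R => (s * alpha)%:C * cexp ((2 * alpha - 2)%:C * L y))); last first.
    by apply/funext => s; rewrite rmorphM /=; ring.
  apply.
apply: cvgMl_tmp.
have u2 : u / 2 < u < u + 1 by apply/andP; split; lra.
apply: (@continuous_Rintegral _ _ _ mu setT (fun t y => Re (mker t y)) (fun y => K * rho y) u (u / 2) (u + 1)) => //.
- by move=> t _; have [] := cmeasurable_mker1 t.
- by move=> t y _ _; have [d hd] := cd t y; have [] := cder_continuous hd.
- move=> t y /andP[t0 _] _; apply: (le_trans (normr_Re_le _)).
  have t0' : 0 < t by lra.
  apply: (le_trans (normc_mker y t0')); rewrite ler_piMl//.
    rewrite /K /rho !mulr_ge0 ?expR_ge0// addr_ge0// divr_ge0// ltW//; exact: kappa_gt0.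
  rewrite -[leRHS]expR0 ler_expR oppr_le0 mulr_ge0 ?ltW// divr_gt0//; exact: kappa_gt0.
Unshelve. all: by end_near. Qed.

(** For fixed [y] the integral over [u] is a Gamma integral in the direction
    [lambda ^ alpha]. What remains is a power of [lambda] times [exp lambda], whose
    contour integral is [Hankel_vertical]. *)
Lemma Mellin_mfun (p : C) : Re p < 1 ->
  cintegrable D (fun u => (mfun u)%:C * cexp (- (p * (ln u)%:C))) /\
  cintegral D (fun u => (mfun u)%:C * cexp (- (p * (ln u)%:C))) =
  gam (1 - p) 1 / gam (1 - alpha%:C * p) 1.
Proof.
move=> p1.
pose g (u : R) : C := cexp (- (p * (ln u)%:C)).
pose G (u : R) : R := expR (- Re p * ln u).
have mln : measurable_fun setT (@ln R) by exact: measurable_ln.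
have mg : cmeasurable g.
  apply: cmeasurable_cexp.
  rewrite (_ : (fun _ => _) = (fun u : R => (- p) * (ln u)%:C)); last first.
    by apply/funext => u; rewrite mulNr.
  apply: cmeasurableM; last exact: cmeasurable_real.
  exact: (@cmeasurable_cst _ _ (measurableTypeR R)).
have mG : measurable_fun setT G.
  by apply: measurableT_comp => //; exact: measurable_funM.
have gG (u : R) : 0 < u -> normc (g u) <= G u.
  by move=> _; rewrite normc_cexp !csimp /= mulr0 subr0 /G mulNr.
have c0 : 0 < c by rewrite divr_gt0// kappa_gt0.
have iG : mu.-integrable D (EFin \o (fun u => expR (- (c * u)) * G u)).
  have p1' : 0 < 1 - Re p by rewrite subr_gt0.
  have := integrable_gamma p1' c0.
  rewrite (_ : (EFin \o _) = (EFin \o (fun u => expR (- (c * u)) * G u)))//.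
  by apply/funext => u /=; rewrite -expRD; congr (expR _)%:E; ring.
have [iM iN E] := @mfun_Fubini g G mg mG gG iG; split; first exact: iM.
have p0 : (2 * pi)%:C != 0 :> C.
  by rewrite eq_complex /= eqxx andbT mulf_neq0 ?pnatr_eq0// gt_eqF ?pi_gt0.
have rp : 0 < Re (1 - p) by rewrite !csimp /= subr_gt0.
have rw : 1 < Re (1 - alpha%:C * p + 1).
  rewrite !csimp /= mul0r subr0 ltrDr subr_gt0; have := a0; have := a1 => *; nra.
have inner y : cintegral D (fun u => mker u y * g u) =
    gam (1 - p) 1 * (1 - alpha%:C * p) *
    cexp ((1 +i* y) - (1 - alpha%:C * p + 1) * L y).
  set m := cexp (alpha%:C * L y).
  have m0 : 0 < Re m.
    rewrite /m LE /= !mul0r subr0 addr0 mulr_gt0 ?expR_gt0//.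
    exact: cos_gt0_pihalf (angle y).
  have lm : clog m = alpha%:C * L y.
    rewrite /m LE (_ : _ * _ = (alpha * lr y) +i* (alpha * atan y)); last first.
      by apply: complex_ext; rewrite !csimp /=; ring.
    by rewrite clog_cexp// angle.
  set A := cexp (1 +i* y) * ((1 - alpha)%:C * cexp ((alpha - 2)%:C * L y)).
  set B := cexp (1 +i* y) * (alpha%:C * cexp ((2 * alpha - 2)%:C * L y)).
  have i1 : cintegrable D (gint (1 - p) m) by exact: cintegrable_gint.
  have rp2 : 0 < Re (1 - p + 1) by rewrite ReD /= addr_gt0.
  have i2 : cintegrable D (gint (1 - p + 1) m) by exact: cintegrable_gint.
  transitivity (cintegral D (fun u => A * gint (1 - p) m u + B * gint (1 - p + 1) m u)).
    apply: eq_cintegral => u; rewrite /= in_itv /= andbT => u0.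
    have g1 : gint (1 - p) m u = cexp (- (u%:C * m)) * g u.
      by rewrite /gint /g -cexpD; congr cexp; ring.
    have g2 : gint (1 - p + 1) m u = u%:C * (cexp (- (u%:C * m)) * g u).
      rewrite -[X in X%:C * _](@lnK _ u) ?posrE// -cexp_real -!cexpD /gint.
      by congr cexp; ring.
    rewrite g1 g2 /mker cexpD -/m /A /B rmorphM /=; ring.
  rewrite cintegralD; [|exact: mD|exact: cintegrableZ|exact: cintegrableZ].
  rewrite !cintegralZ// -!/(gam _ _) !(gam_clog _ m0)// lm.
  (* the two terms of [mker] now combine, because [1 - alpha + alpha * (1 - p)]
     is [1 - alpha * p] *)
  have := gam_rec rp (m := 1) ltr01; rewrite mul1r => <-.
  rewrite /A /B.
  have e1 : cexp (1 +i* y) * ((1 - alpha)%:C * cexp ((alpha - 2)%:C * L y)) *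
    (cexp (- ((1 - p) * (alpha%:C * L y))) * gam (1 - p) 1) =
    (1 - alpha)%:C * gam (1 - p) 1 * cexp ((1 +i* y) - (1 - alpha%:C * p + 1) * L y).
    have -> : (1 +i* y) - (1 - alpha%:C * p + 1) * L y = (1 +i* y) +
      ((alpha - 2)%:C * L y + - ((1 - p) * (alpha%:C * L y))).
      by rewrite rmorphB /=; ring.
    by rewrite !cexpD; ring.
  have e2 : cexp (1 +i* y) * (alpha%:C * cexp ((2 * alpha - 2)%:C * L y)) *
    (cexp (- ((1 - p + 1) * (alpha%:C * L y))) * ((1 - p) * gam (1 - p) 1)) =
    alpha%:C * (1 - p) * gam (1 - p) 1 * cexp ((1 +i* y) - (1 - alpha%:C * p + 1) * L y).
    have -> : (1 +i* y) - (1 - alpha%:C * p + 1) * L y = (1 +i* y) +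
      ((2 * alpha - 2)%:C * L y + - ((1 - p + 1) * (alpha%:C * L y))).
      by rewrite rmorphB rmorphM /=; ring.
    by rewrite !cexpD; ring.
  rewrite e1 e2 rmorphB /=; ring.
have H := Hankel_vertical rw.
have rw0 : 0 < Re (1 - alpha%:C * p).
  by move: rw; rewrite ReD /= ltrDr.
apply: (mulfI p0); rewrite E.
rewrite (eq_cintegral (g := fun y => gam (1 - p) 1 * (1 - alpha%:C * p) *
    cexp ((1 +i* y) - (1 - alpha%:C * p + 1) * L y))); last by move=> y _; exact: inner.
have n1 : gam (1 - p) 1 * (1 - alpha%:C * p) != 0.
  rewrite mulf_neq0 ?gam_neq0//; apply: contraTneq rw0 => ->.
  by rewrite ltxx.
have iH : cintegrable setT (fun y => cexp ((1 +i* y) - (1 - alpha%:C * p + 1) * L y)).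
  have := cintegrableZ (@measurableT _ _) (gam (1 - p) 1 * (1 - alpha%:C * p))^-1 iN.
  rewrite (_ : (fun _ => _) = (fun y => cexp ((1 +i* y) - (1 - alpha%:C * p + 1) * L y)))//.
  by apply/funext => y; rewrite inner mulKf.
rewrite cintegralZ//.
have g0 := gam_neq0 rw0.
have := gam_rec rw0 (m := 1) ltr01; rewrite mul1r => r.
have n2 : 1 - alpha%:C * p != 0.
  by apply: contraTneq rw0 => ->; rewrite ltxx.
rewrite -H -r; field.
exact: g0.
Qed.

End mainardi.

(** * Euler's Beta integral *)
Section beta.
Context {R : realType}.
Local Notation Re := complex.Re.
Local Notation Im := complex.Im.
Local Notation C := R[i].
Local Notation normc := ComplexField.Normc.normc.
Notation mu := (@lebesgue_measure R).
Local Notation D := (`]0, +oo[%classic : set R).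

Let mD : measurable (D : set (measurableTypeR R)). Proof. exact: measurable_itv. Qed.

Lemma cintegral_scale (a : R) (f : R -> C) : 0 < a -> cmeasurable f ->
  cintegral D (fun u => f (a * u)) = (a^-1)%:C * cintegral D f.
Proof.
move=> a0 [m1 m2]; apply: complex_ext; rewrite csimp /= mul0r ?subr0 ?addr0.
  exact: (Rintegral_scale a0 m1).
exact: (Rintegral_scale a0 m2).
Qed.

Section shift.
Variables (u : R) (G : R -> R).
Hypotheses (u0 : 0 <= u) (mG : measurable_fun setT G).

Let F := G \_ D.
Let H (r : R) := if u < r then G (r - u) else 0.

Let mF : measurable_fun setT F.
Proof. by apply: (measurable_restrictT G mD).1; exact: measurable_funTS. Qed.

Let HE : H \_ D = fun r => F (1 * r + - u).
Proof.
apply/funext => r; rewrite mul1r /F /H !patchE.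
have -> : (r - u \in D) = (u < r).
  by apply/idP/idP; rewrite ?inE /= in_itv /= andbT subr_gt0.
case: ifPn; case: (ltP u r) => // ur; case/negP.
by rewrite inE /= in_itv /= andbT (le_lt_trans u0).
Qed.

Lemma Rintegral_shift :
  \int[mu]_(r in D) (if u < r then G (r - u) else 0) = \int[mu]_(v in D) G v.
Proof.
rewrite [LHS]Rintegral_mkcond [RHS]Rintegral_mkcond -/H HE -/F.
have o : (1 : R) != 0 by exact: oner_neq0.
by rewrite (Rintegral_affine (- u) o mF) normr1 invr1 mul1r.
Qed.

Lemma integrable_shift : mu.-integrable D (EFin \o G) ->
  mu.-integrable D (EFin \o (fun r => if u < r then G (r - u) else 0)).
Proof.
have o : (1 : R) != 0 by exact: oner_neq0.
move=> iG; have iF : mu.-integrable setT (EFin \o F).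
  have := (@integrable_mkcond _ _ _ mu D (EFin \o G) mD).1 iG.
  by rewrite /F restrict_EFin.
have := integrable_affine (- u) o iF; rewrite -HE => i1.
by apply: (integrable_mkcond _ mD).2; rewrite restrict_EFin.
Qed.

End shift.

(** Extended by zero beyond [s = 1], the Beta weight turns integrals over the
    unit interval into Mellin transforms on the half line. *)
Definition kb (b s : R) : R := if s < 1 then expR ((b - 1) * ln (1 - s)) else 0.

Definition cbeta (w : C) (b : R) : C :=
  cintegral D (fun s => cexp ((w - 1) * (ln s)%:C) * (kb b s)%:C).

Lemma measurable_kb b : measurable_fun setT (kb b).
Proof.
apply: measurable_fun_ifT => //; first exact: measurable_fun_ltr.
apply: measurableT_comp => //; apply: measurable_funM => //.
by apply: (measurableT_comp (@measurable_ln R)); exact: measurable_funB.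
Qed.

Lemma kb_ge0 b s : 0 <= kb b s.
Proof. by rewrite /kb; case: ifP => // _; exact: expR_ge0. Qed.

Lemma kb1 s : kb 1 s = (s < 1)%R%:R.
Proof. by rewrite /kb subrr mul0r expR0; case: (s < 1). Qed.

Lemma integrable_powr01 a : 0 < a ->
  mu.-integrable D (EFin \o (fun s => expR ((a - 1) * ln s) * kb 1 s)).
Proof.
move=> ha.
apply: (@integrable_dom _ _ _ mu D mD _ (fun s => expR 1 * expR ((a - 1) * ln s - 1 * s))).
- apply: measurable_funTS; apply: measurable_funM; last exact: measurable_kb.
  by apply: measurableT_comp => //; apply: measurable_funM => //; exact: measurable_ln.
- move=> s; rewrite /= in_itv /= andbT => s0.
  rewrite ger0_norm ?mulr_ge0 ?expR_ge0 ?kb_ge0// kb1 -expRD.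
  case: (ltP s 1) => s1 /=; last by rewrite mulr0 expR_ge0.
  by rewrite mulr1 ler_expR; lra.
- by apply: integrableRZ => //; exact: integrable_gamma.
Qed.

Lemma integrable_kb b : 0 < b -> mu.-integrable D (EFin \o kb b).
Proof.
move=> hb; have i1 := integrable_powr01 hb.
have := (integrable_mkcond _ mD).1 i1; rewrite restrict_EFin => i2.
have o : (-1 : R) != 0 by rewrite oppr_eq0 oner_eq0.
have i3 := integrableST mD (integrable_affine 1 o i2).
apply: (@integrable_dom _ _ _ mu D mD _ _ _ _ i3).
  by apply: measurable_funTS; exact: measurable_kb.
move=> s; rewrite /= in_itv /= andbT => s0.
rewrite ger0_norm ?kb_ge0// mulN1r patchE kb1 /kb.
have -> : (- s + 1 \in D) = (s < 1).
  by apply/idP/idP; rewrite ?inE /= in_itv /= andbT [- s + _]addrC subr_gt0.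
case: ifP => // s1; have -> : - s + 1 < 1 by lra.
by rewrite mulr1 [- s + 1]addrC.
Qed.

(** Split at [s = 2^-1]: near each endpoint one of the factors is bounded. *)
Lemma integrable_beta a b : 0 < a -> 0 < b ->
  mu.-integrable D (EFin \o (fun s => expR ((a - 1) * ln s) * kb b s)).
Proof.
move=> ha hb.
pose K (x : R) := expR (`|x - 1| * ln 2).
have half (x s : R) : 2^-1 <= s -> s < 1 -> expR ((x - 1) * ln s) <= K x.
  move=> s2 s1; rewrite ler_expR (le_trans (ler_norm _))// normrM ler_wpM2l//.
  have l2 : ln s <= 0 by rewrite ln_le0// ltW.
  rewrite ler0_norm// -lnV ?posrE ?invr_gt0//; last by lra.
  rewrite ler_ln ?posrE ?invr_gt0//; last by lra.
  by rewrite -[leRHS]invrK lef_pV2 ?posrE ?invr_gt0//; lra.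
apply: (@integrable_dom _ _ _ mu D mD _ (fun s =>
   K b * (expR ((a - 1) * ln s) * kb 1 s) + K a * kb b s)).
- apply: measurable_funTS; apply: measurable_funM; last exact: measurable_kb.
  by apply: measurableT_comp => //; apply: measurable_funM => //; exact: measurable_ln.
- move=> s; rewrite /= in_itv /= andbT => s0.
  rewrite ger0_norm ?mulr_ge0 ?expR_ge0 ?kb_ge0// kb1 /kb.
  case: (ltP s 1) => s1 /=; last by rewrite !mulr0 addr0.
  rewrite mulr1; case: (lerP s 2^-1) => h.
    rewrite mulrC ler_wpDr ?mulr_ge0 ?expR_ge0// ler_wpM2r ?expR_ge0//.
    apply: half; lra.
  by rewrite ler_wpDl ?mulr_ge0 ?expR_ge0// ler_wpM2r ?expR_ge0// half// ltW.
- apply: integrableRD => //; apply: integrableRZ => //.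
    exact: integrable_powr01.
  exact: integrable_kb.
Qed.

Lemma cmeasurable_cpow (w : C) : cmeasurable (fun s : R => cexp (w * (ln s)%:C)).
Proof.
apply: cmeasurable_cexp; apply: cmeasurableM.
  exact: (@cmeasurable_cst _ _ (measurableTypeR R)).
by apply: cmeasurable_real; exact: measurable_ln.
Qed.

Lemma normc_cpow (w : C) (s : R) : normc (cexp (w * (ln s)%:C)) = expR (Re w * ln s).
Proof. by rewrite normc_cexp !csimp /= mulr0 subr0. Qed.

Lemma cintegrable_beta (w : C) b : 0 < Re w -> 0 < b ->
  cintegrable D (fun s => cexp ((w - 1) * (ln s)%:C) * (kb b s)%:C).
Proof.
move=> w0 b0; apply: (cintegrable_dom mD _ _ (integrable_beta w0 b0)).
  apply: cmeasurableM; first exact: cmeasurable_cpow.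
  apply: cmeasurable_real; exact: measurable_kb.
move=> s _; rewrite ComplexField.Normc.normcM normc_cpow normc_real.
by rewrite ger0_norm ?kb_ge0// ReD ReN.
Qed.

Lemma complexV (r : R) : r != 0 -> r%:C * (r^-1)%:C = 1 :> C.
Proof. by move=> r0; rewrite -rmorphM /= divff. Qed.

Lemma gam_real (b : R) :
  gam b%:C 1 = (\int[mu]_(v in D) expR ((b - 1) * ln v - v))%:C.
Proof.
have <- : cintegral D (fun v => (expR ((b - 1) * ln v - v))%:C) =
    (\int[mu]_(v in D) expR ((b - 1) * ln v - v))%:C by exact: cintegral_real.
apply: (@eq_cintegral _ D (gint b%:C 1)) => v _.
rewrite -cexp_real /gint; congr cexp.
by rewrite !(rmorphB, rmorphM) /= mul1r.
Qed.

Let beta_integrand (w : C) (b r s : R) : 0 < r -> 0 < s ->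
  gint w 1 (r * s) *
    (if r * s < r then expR ((b - 1) * ln (r - r * s) - (r - r * s)) else 0)%:C =
  cexp ((w - 1) * (ln r)%:C + ((b - 1) * ln r - r)%:C) *
    (cexp ((w - 1) * (ln s)%:C) * (kb b s)%:C).
Proof.
move=> r0 s0; rewrite /kb gtr_pMr//.
case: (ltP s 1) => s1; last by rewrite !mulr0.
have -> : r - r * s = r * (1 - s) by ring.
rewrite /gint !lnM ?posrE ?subr_gt0// -!cexp_real -!cexpD; congr cexp.
by rewrite !(rmorphD, rmorphB, rmorphM) /=; ring.
Qed.

Let gintD (w : C) (b r : R) : 0 < r ->
  r%:C * cexp ((w - 1) * (ln r)%:C + ((b - 1) * ln r - r)%:C) =
  gint (w + b%:C) 1 r.
Proof.
move=> r0; rewrite -[X in X%:C * _](@lnK _ r) ?posrE// -cexp_real /gint -cexpD.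
by congr cexp; rewrite !(rmorphD, rmorphB, rmorphM) /=; ring.
Qed.

(** Integrate [u ^ (w - 1) exp (- u) * (r - u) ^ (b - 1) exp (- (r - u))] over
    [u < r], in both orders; in one of them the substitution [u = r * s] isolates
    the Beta integral. *)
Lemma beta_gam (w : C) b : 0 < Re w -> 0 < b ->
  cbeta w b * gam (w + b%:C) 1 = gam w 1 * gam b%:C 1.
Proof.
move=> w0 b0.
pose G (v : R) : R := expR ((b - 1) * ln v - v).
have mln : measurable_fun setT (@ln R) by exact: measurable_ln.
have mG : measurable_fun setT G.
  apply: measurableT_comp => //; apply: measurable_funB => //.
  exact: measurable_funM.
have iG : mu.-integrable D (EFin \o G).
  have := integrable_gamma b0 ltr01; rewrite (_ : (EFin \o _) = EFin \o G)//.
  by apply/funext => v /=; rewrite mul1r.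
pose Gb := \int[mu]_(v in D) G v.
pose S (r u : R) : R := if u < r then G (r - u) else 0.
have S0 r u : 0 <= S r u by rewrite /S; case: ifP => // _; exact: expR_ge0.
pose f (r u : R) : C := gint w 1 u * (S r u)%:C.
have mS : measurable_fun setT (fun z : R * R => S z.1 z.2).
  apply: measurable_fun_ifT => //; first exact: measurable_fun_ltr.
  by apply: (measurableT_comp mG); exact: measurable_funB.
pose k (z : R * R) : R := expR ((Re w - 1) * ln z.2 - 1 * z.2) * S z.1 z.2.
have mk : measurable_fun setT k.
  apply: measurable_funM => //; apply: measurableT_comp => //.
  apply: measurable_funB; apply: measurable_funM => //.
  by apply: (measurableT_comp mln); exact: measurable_snd.
have := @cFubini R D D f k (fun u => Gb * expR ((Re w - 1) * ln u - 1 * u)) mD mD _ mk.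
case.
- apply: cmeasurableM; last exact: cmeasurable_real.
  exact: (cmeasurable_comp (@measurable_snd _ _ _ _) (cmeasurable_gint w 1)).
- move=> r u _ _; rewrite ComplexField.Normc.normcM normc_gint normc_real.
  by rewrite ger0_norm//.
- move=> u; rewrite /= in_itv /= andbT => u0.
  have i1 := integrable_shift (ltW u0) iG.
  exact: (integrableRZ mD (expR ((Re w - 1) * ln u - 1 * u)) i1).
- move=> u; rewrite /= in_itv /= andbT => u0.
  have i1 := integrable_shift (ltW u0) iG.
  rewrite /k /= RintegralZl// /S (Rintegral_shift (ltW u0) mG) mulrC//.
- by apply: integrableRZ => //; exact: integrable_gamma.
move=> _ _ E.
have E1 : cintegral D (fun u => cintegral D (fun r => f r u)) = gam w 1 * gam b%:C 1.
  have igw : cintegrable D (gint w 1) by exact: cintegrable_gint.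
  rewrite mulrC gam_real -(cintegralZ mD _ igw).
  apply: eq_cintegral => u; rewrite /= in_itv /= andbT => u0.
  have i1 := integrable_shift (ltW u0) iG.
  have e1 : \int[mu]_(r in D) S r u = Gb := Rintegral_shift (ltW u0) mG.
  rewrite /f (@cintegralZ_real _ D mD (gint w 1 u) (S^~ u) i1) e1 mulrC.
  reflexivity.
rewrite -E1 -E; clear E E1.
have wb : 0 < Re (w + b%:C) by rewrite ReD /= addr_gt0.
have igwb : cintegrable D (gint (w + b%:C) 1) by exact: cintegrable_gint.
rewrite -(cintegralZ mD _ igwb).
apply: eq_cintegral => r; rewrite /= in_itv /= andbT => r0.
have mf : cmeasurable (f r).
  have mp : measurable_fun setT (fun u : R => (r, u)) by exact: measurable_pair1.
  apply: cmeasurableM; first exact: cmeasurable_gint.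
  by apply: cmeasurable_real; exact: (measurableT_comp mS mp).
have r1 := complexV (lt0r_neq0 r0).
pose A := cexp ((w - 1) * (ln r)%:C + ((b - 1) * ln r - r)%:C).
have e (s : R) : 0 < s -> f r (r * s) = A * (cexp ((w - 1) * (ln s)%:C) * (kb b s)%:C).
  exact: beta_integrand.
have ib := cintegrable_beta w0 b0.
have -> : cintegral D (f r) = r%:C * cintegral D (fun s => f r (r * s)).
  by rewrite (cintegral_scale r0 mf) mulrA r1 mul1r.
rewrite (_ : cintegral D (fun s => f r (r * s)) = A * cbeta w b); last first.
  rewrite /cbeta -(cintegralZ mD _ ib).
  by apply: eq_cintegral => s; rewrite /= in_itv /= andbT => /e.
by rewrite mulrA mulrC /A gintD.
Qed.

Lemma gam11 : gam 1 1 = 1 :> C.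
Proof.
have -> : gam 1 1 = gam (1 : R)%:C 1 :> C by [].
rewrite gam_real (@eq_Rintegral _ _ _ mu D (fun v : R => expR (- v))); last first.
  by move=> v _; rewrite subrr mul0r add0r.
have dN (v : R) : is_derive v 1 (fun v => - expR (- v)) (expR (- v)).
  by apply: is_derive_eq; rewrite /GRing.scale /=; ring.
have ce : continuous (fun v : R => expR (- v)).
  move=> v; apply: (@is_derive_continuous _ (fun v : R => expR (- v)) v (- expR (- v))).
  by apply: is_derive_eq; rewrite /GRing.scale /=; ring.
have c1 : - expR (- v) @[v --> (0 : R)^'+] --> (-1 : R).
  apply: cvg_at_right_filter; apply: cvgN; rewrite -[X in _ --> X]expR0 -[X in expR X]oppr0.
  exact: ce.
have c2 : - expR (- v) @[v --> +oo] --> (0 : R).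
  rewrite -[X in _ --> X]oppr0; apply: cvgN.
  exact: cvgr_expR.
rewrite (@FTC_0y _ (fun v => - expR (- v)) (fun v => expR (- v)) (-1) 0 _ _ _ c1 c2).
- by rewrite sub0r opprK.
- by move=> x _; exact: ce.
- have := @integrable_expN R 1 ltr01.
  rewrite (_ : (EFin \o _) = EFin \o (fun v => expR (- v)))//.
  by apply/funext => v /=; rewrite mul1r.
Qed.

Lemma cbeta1 (w : C) : 0 < Re w -> cbeta w 1 = w^-1.
Proof.
move=> w0; have := beta_gam w0 ltr01.
have w1 : 0 < Re (w + 1) by rewrite ReD /= addr_gt0.
have := @gam_rec _ w 1 w0 ltr01; rewrite mul1r.
have -> : gam (1 : R)%:C 1 = 1 :> C by exact: gam11.
have g0 := gam_neq0 w1.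
have -> : w + (1 : R)%:C = w + 1 by [].
move=> r; rewrite mulr1 => e.
have wn : w != 0 by apply: contraTneq w0 => ->; rewrite ltxx.
apply: (mulIf g0); rewrite e -r mulKf//.
Qed.

End beta.

(** * The Abel integral of the tail of the M-function *)
Section multiplicative_convolution.
Context {R : realType}.
Local Notation Re := complex.Re.
Local Notation Im := complex.Im.
Local Notation C := R[i].
Local Notation normc := ComplexField.Normc.normc.
Notation mu := (@lebesgue_measure R).
Local Notation D := (`]0, +oo[%classic : set R).

Let mD : measurable (D : set (measurableTypeR R)). Proof. exact: measurable_itv. Qed.
Let mln : measurable_fun setT (@ln R). Proof. exact: measurable_ln. Qed.

Let Dgt0 x : D x -> 0 < x. Proof. by rewrite /= in_itv /= andbT. Qed.

Lemma Rintegral_expN (k : R) : 0 < k -> \int[mu]_(u in D) expR (- (k * u)) = k^-1.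
Proof.
move=> k0; have mf : measurable_fun setT (fun u : R => expR (- u)).
  by apply: measurableT_comp => //; exact: measurableT_comp.
rewrite (Rintegral_scale k0 mf).
have := @gam_real R 1; have -> : gam (1 : R)%:C 1 = 1 :> C by exact: gam11.
move=> [e]; rewrite -[RHS]mulr1 [X in _ = _ * X]e; congr (_ * _).
by apply: eq_Rintegral => v _; rewrite subrr mul0r add0r.
Qed.

Variables (alpha : R) (ka f : R -> R) (B c : R).
Hypotheses (a0 : 0 < alpha) (c0 : 0 < c) (B0 : 0 <= B).
Hypotheses (mka : measurable_fun setT ka) (mf : measurable_fun setT f).
Hypothesis ka0 : forall s, 0 <= ka s.
Hypothesis ika : mu.-integrable D (EFin \o (fun s => ka s * expR (alpha * ln s))).
Hypothesis fb : forall u, 0 < u -> `|f u| <= B * expR (- (c * u)).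

Let la (s : R) : R := expR (- (alpha * ln s)).
Let la0 s : 0 < la s. Proof. exact: expR_gt0. Qed.
Let laV s : (la s)^-1 = expR (alpha * ln s). Proof. by rewrite /la expRN invrK. Qed.
Let mla : measurable_fun setT la.
Proof.
apply: measurableT_comp => //; apply: measurableT_comp => //.
exact: measurable_funM.
Qed.

(** A multiplicative convolution with the push-forward of [ka] under
    [s |-> s ^ alpha]. *)
Definition mconv (y : R) : R :=
  \int[mu]_(s in D) (ka s * f (y * expR (- (alpha * ln s)))).

Let mint2 : measurable_fun setT (fun z : R * R => ka z.2 * f (z.1 * la z.2)).
Proof.
have m2 := @measurable_snd _ _ (measurableTypeR R) (measurableTypeR R).
have m1 := @measurable_fst _ _ (measurableTypeR R) (measurableTypeR R).
apply: measurable_funM; first exact: (measurableT_comp mka m2).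
apply: (measurableT_comp mf); apply: measurable_funM => //.
exact: (measurableT_comp mla m2).
Qed.

Let mint1 y : measurable_fun setT (fun s => ka s * f (y * la s)).
Proof.
have mp : measurable_fun setT (fun s : R => (y, s)) by exact: measurable_pair1.
exact: (measurableT_comp mint2 mp).
Qed.

Let bnd (e y s : R) : 0 < e -> e < y ->
  `|ka s * f (y * la s)| <= B / (c * e) * (ka s * expR (alpha * ln s)).
Proof.
move=> e0 ey; have y0 := lt_trans e0 ey.
rewrite normrM ger0_norm// mulrCA ler_wpM2l//.
have yl : 0 < y * la s by rewrite mulr_gt0.
apply: (le_trans (fb yl)); rewrite -mulrA ler_wpM2l// expRN -laV -invfM.
rewrite lef_pV2 ?posrE ?expR_gt0 ?mulr_gt0//.
have := expR_ge1Dx (c * (y * la s)); apply: le_trans.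
rewrite -mulrA ler_wpDl// ler_pM2l// ler_pM2r// ltW//.
Qed.

Let ismall y : 0 < y ->
  mu.-integrable D (EFin \o (fun s => ka s * f (y * la s))).
Proof.
move=> y0; have y2 : 0 < y / 2 by rewrite divr_gt0.
have yy : y / 2 < y by lra.
apply: (@integrable_dom _ _ _ mu D mD _ (fun s => B / (c * (y / 2)) * (ka s * expR (alpha * ln s)))).
- exact: measurable_funTS (mint1 y).
- by move=> s _; exact: bnd.
- exact: integrableRZ.
Qed.

Lemma continuous_mconv y : 0 < y -> (forall u, 0 < u -> {for u, continuous f}) ->
  {for y, continuous mconv}.
Proof.
move=> y0 cf; have y2 : 0 < y / 2 by rewrite divr_gt0.
have yy : y / 2 < y < y + 1 by apply/andP; split; lra.
apply: (@continuous_Rintegral _ _ _ mu D (fun y s => ka s * f (y * la s))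
  (fun s => B / (c * (y / 2)) * (ka s * expR (alpha * ln s))) y (y / 2) (y + 1) mD yy).
- by move=> x _; exact: measurable_funTS (mint1 x).
- move=> x s /andP[x0 _] _; apply: cvgMl_tmp.
  have xl : 0 < x * la s by rewrite mulr_gt0// (lt_trans y2).
  have c1 : {for x, continuous (fun x : R => x * la s)} by apply: cvgMr_tmp; exact: cvg_id.
  exact: (continuous_comp c1 (cf _ xl)).
- exact: integrableRZ.
- by move=> x s /andP[x0 _] _; exact: bnd.
Qed.

(** Fubini's theorem and the substitution [u = y * s ^ (- alpha)]. *)
Lemma Mellin_mconv (tau : R) :
  cintegrable D (fun y => (mconv y)%:C * cexp (0 +i* (- (tau * ln y)))) /\
  cintegral D (fun y => (mconv y)%:C * cexp (0 +i* (- (tau * ln y)))) =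
  cintegral D (fun s => (ka s)%:C * cexp ((alpha +i* (- (alpha * tau))) * (ln s)%:C)) *
  cintegral D (fun u => (f u)%:C * cexp (0 +i* (- (tau * ln u)))).
Proof.
pose e (y : R) : C := cexp (0 +i* (- (tau * ln y))).
have e1 y : normc (e y) = 1 by rewrite normc_cexp expR0.
have me : cmeasurable e.
  apply: cmeasurable_cexp; split => /=; first exact: measurable_cst.
  by apply: measurableT_comp => //; exact: measurable_funM.
have ik : cintegrable D (fun s => (ka s)%:C * cexp ((alpha +i* (- (alpha * tau))) * (ln s)%:C)).
  apply: (cintegrable_dom mD _ _ ika).
    by apply: cmeasurableM; [exact: cmeasurable_real|exact: cmeasurable_cpow].
  move=> s _; rewrite ComplexField.Normc.normcM normc_real ger0_norm//.
  by rewrite normc_cpow.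
pose F (y s : R) : C := e y * (ka s * f (y * la s))%:C.
pose k (z : R * R) : R := ka z.2 * (B * expR (- (c * la z.2 * z.1))).
have m2 := @measurable_snd _ _ (measurableTypeR R) (measurableTypeR R).
have m1 := @measurable_fst _ _ (measurableTypeR R) (measurableTypeR R).
have mk : measurable_fun setT k.
  apply: measurable_funM; first exact: (measurableT_comp mka m2).
  apply: measurable_funM => //; apply: measurableT_comp => //.
  apply: measurableT_comp => //; apply: measurable_funM => //.
  apply: measurable_funM => //; exact: (measurableT_comp mla m2).
have cl s : 0 < c * la s by rewrite mulr_gt0.
have [] := @cFubini R D D F k (fun s => B / c * (ka s * expR (alpha * ln s))) mD mD _ mk.
- apply: cmeasurableM; last exact: cmeasurable_real.
  exact: (cmeasurable_comp m1 me).
- move=> y s /Dgt0 y0 /Dgt0 s0.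
  rewrite ComplexField.Normc.normcM e1 mul1r normc_real normrM ger0_norm//.
  rewrite ler_wpM2l//; apply: (le_trans (fb _)); first by rewrite mulr_gt0.
  by rewrite /= [y * _]mulrC mulrA.
- move=> s _.
  exact: (integrableRZ mD (ka s) (integrableRZ mD B (integrable_expN (cl s)))).
- move=> s _; rewrite /k /=.
  have i1 := integrable_expN (cl s).
  have i2 := integrableRZ mD B i1.
  rewrite RintegralZl// RintegralZl// Rintegral_expN// invfM laV.
  by rewrite le_eqVlt; apply/orP; left; apply/eqP; ring.
- exact: integrableRZ.
have E1 y : D y -> cintegral D (F y) = (mconv y)%:C * e y.
  rewrite /= in_itv /= andbT => y0.
  by rewrite /F (cintegralZ_real mD _ (ismall y0)) mulrC.
have if_ : mu.-integrable D (EFin \o f).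
  apply: (@integrable_dom _ _ _ mu D mD _ (fun u => B * expR (- (c * u)))).
  - exact: measurable_funTS.
  - by move=> u; rewrite /= in_itv /= andbT; exact: fb.
  - by apply: integrableRZ => //; exact: integrable_expN.
have ife : cintegrable D (fun u => (f u)%:C * e u).
  apply: (cintegrable_dom mD _ _ (integrable_normr if_)).
    by apply: cmeasurableM => //; exact: cmeasurable_real.
  by move=> u _; rewrite ComplexField.Normc.normcM e1 mulr1 normc_real.
set I := cintegral D (fun u => (f u)%:C * e u).
have E2 s : D s -> cintegral D (F^~ s) =
    I * ((ka s)%:C * cexp ((alpha +i* (- (alpha * tau))) * (ln s)%:C)).
  rewrite /= in_itv /= andbT => s0.
  pose A : C := (ka s)%:C * cexp (0 +i* (- (alpha * tau * ln s))).
  have e2 y : 0 < y -> e y = cexp (0 +i* (- (alpha * tau * ln s))) * e (la s * y).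
    move=> y0; rewrite /e -cexpD lnM ?posrE// /la expRK; congr cexp.
    by apply: complex_ext; rewrite !csimp /=; ring.
  have -> : cintegral D (F^~ s) =
      cintegral D (fun y => A * ((f (la s * y))%:C * e (la s * y))).
    apply: eq_cintegral => y; rewrite /= in_itv /= andbT => y0.
    by rewrite /F {1}e2// /A rmorphM /= [y * la s]mulrC; ring.
  have mfe : cmeasurable (fun u => (f u)%:C * e u).
    by apply: cmeasurableM => //; exact: cmeasurable_real.
  have sc := cintegral_scale (la0 s) (cmeasurableM (@cmeasurable_cst _ _ (measurableTypeR R) A) mfe).
  rewrite {}sc (cintegralZ mD _ ife) -/I laV.
  have -> : cexp ((alpha +i* (- (alpha * tau))) * (ln s)%:C) =
      (expR (alpha * ln s))%:C * cexp (0 +i* (- (alpha * tau * ln s))).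
    by rewrite -cexp_real -cexpD; congr cexp; apply: complex_ext; rewrite !csimp /=; ring.
  by rewrite /A; ring.
move=> j1 j2 E; split.
  exact: (eq_cintegrable mD E1 j1).
transitivity (cintegral D (fun x => cintegral D (F x))).
  by apply: eq_cintegral => y Dy; rewrite E1.
rewrite E mulrC -(cintegralZ mD _ ik).
by apply: eq_cintegral => s Ds; rewrite E2.
Qed.

End multiplicative_convolution.

Section tail.
Context {R : realType}.
Local Notation Re := complex.Re.
Local Notation Im := complex.Im.
Local Notation C := R[i].
Local Notation normc := ComplexField.Normc.normc.
Notation mu := (@lebesgue_measure R).
Local Notation D := (`]0, +oo[%classic : set R).

Let mD : measurable (D : set (measurableTypeR R)). Proof. exact: measurable_itv. Qed.
Let mln : measurable_fun setT (@ln R). Proof. exact: measurable_ln. Qed.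
Let Dgt0 x : D x -> 0 < x. Proof. by rewrite /= in_itv /= andbT. Qed.
Let gt0D x : 0 < x -> D x. Proof. by rewrite /= in_itv /= andbT. Qed.

Variable alpha : R.
Hypothesis a01 : 0 < alpha < 1.
Let a0 : 0 < alpha. Proof. by case/andP: a01. Qed.
Let a1 : alpha < 1. Proof. by case/andP: a01. Qed.

Local Notation M := (mfun alpha).
Local Notation B := (mbound alpha).
Let c : R := kappa alpha / 2.
Let c0 : 0 < c. Proof. by rewrite divr_gt0// kappa_gt0. Qed.

Let Mb u : `|M u| <= B * expR (- (c * u)). Proof. exact: mfun_bound. Qed.
Let mM : measurable_fun setT M. Proof. exact: measurable_mfun. Qed.

Lemma mbound_ge0 : 0 <= B.
Proof. by have := le_trans (normr_ge0 _) (Mb 0); rewrite pmulr_lge0// expR_gt0. Qed.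

Let iBe : mu.-integrable D (EFin \o (fun v => B * expR (- (c * v)))).
Proof. by apply: integrableRZ => //; exact: integrable_expN. Qed.

Lemma integrable_mfun : mu.-integrable D (EFin \o M).
Proof.
apply: (@integrable_dom _ _ _ mu D mD M (fun v => B * expR (- (c * v)))) => //.
exact: measurable_funTS.
Qed.

(** Written as an integral over a fixed domain, for continuity under the integral
    sign; see [mtailE]. *)
Definition mtail (u : R) : R :=
  if 0 < u then \int[mu]_(v in D) M (v + u) else 0.

Let mMu (u : R) : measurable_fun setT (fun v : R => M (v + u)).
Proof. by apply: (measurableT_comp mM); exact: measurable_funD. Qed.

Let Mub u v : 0 <= u -> `|M (v + u)| <= B * expR (- (c * v)).
Proof.
move=> u0; apply: (le_trans (Mb _)); rewrite ler_wpM2l ?mbound_ge0// ler_expR lerN2.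
by rewrite ler_wpM2l ?(ltW c0)// lerDl.
Qed.

Lemma mtailE u : 0 < u ->
  mtail u = \int[mu]_(v in D) (if u < v then M v else 0).
Proof.
move=> u0; rewrite /mtail u0 -(Rintegral_shift (ltW u0) (mMu u)).
by apply: eq_Rintegral => v _; rewrite subrK.
Qed.

Lemma continuous_mtail u : 0 < u -> {for u, continuous mtail}.
Proof.
move=> u0; apply: (@near_eq_continuous _ _ (fun t => \int[mu]_(v in D) M (v + t))).
  by near=> t; rewrite /mtail; have -> : 0 < t by near: t; exact: lt_nbhsr.
have uu : u / 2 < u < u + 1 by apply/andP; split; lra.
apply: (@continuous_Rintegral _ _ _ mu D (fun t v => M (v + t)) (fun v => B * expR (- (c * v))) u (u / 2) (u + 1) mD uu).
- by move=> t _; exact: measurable_funTS (mMu t).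
- move=> t v /andP[t0 _] /Dgt0 v0.
  have vt : 0 < v + t by lra.
  have c1 : {for t, continuous (fun t : R => v + t)}.
    by apply: cvgD; [exact: cvg_cst|exact: cvg_id].
  exact: (continuous_comp c1 (continuous_mfun a01 vt)).
- exact: iBe.
- by move=> t v /andP[t0 _] _; apply: Mub; lra.
Unshelve. all: by end_near. Qed.

Lemma measurable_mtail : measurable_fun setT mtail.
Proof.
have oD : open D by exact: rray_open.
have mt : measurable_fun D mtail.
  apply: open_continuous_measurable_fun => //.
  by move=> u /set_mem /Dgt0 u0; exact: continuous_mtail.
have := (measurable_restrictT mtail mD).1 mt.
rewrite (_ : _ \_ _ = mtail)//; apply/funext => t; rewrite patchE; case: ifPn => // tD.
rewrite /mtail; case: ifPn => // t0; case/negP: tD.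
by rewrite inE; exact: gt0D.
Qed.

Lemma mtail_bound u : 0 < u -> `|mtail u| <= B / c * expR (- (c * u)).
Proof.
move=> u0; rewrite /mtail u0.
have i1 : mu.-integrable D (EFin \o (fun v => M (v + u))).
  apply: (@integrable_dom _ _ _ mu D mD _ (fun v => B * expR (- (c * v)))) => //.
    exact: measurable_funTS (mMu u).
  by move=> v _; apply: Mub; exact: ltW.
have ie := @integrable_expN R c c0.
have i2 : mu.-integrable D (EFin \o (fun v => B * expR (- (c * u)) * expR (- (c * v)))).
  exact: integrableRZ.
have := @normr_Rintegral_le _ _ _ mu D mD _ _ i1 i2.
rewrite RintegralZl// Rintegral_expN// [B / c * _]mulrAC; apply => v _.
by apply: (le_trans (Mb _)); rewrite mulrDr opprD expRD -mulrA [expR (- (c * u)) * _]mulrC.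
Qed.

(** Integration by parts in the form of Fubini's theorem: [u < v] is integrated
    first in [u]. *)
Lemma Mellin_mtail (p : C) : Re p < 1 -> 0 <= Re p ->
  cintegral D (fun u => (mtail u)%:C * cexp (- (p * (ln u)%:C))) =
  (1 - p)^-1 * cintegral D (fun v => (M v)%:C * cexp (- ((p - 1) * (ln v)%:C))).
Proof.
move=> p1 p0.
pose e (u : R) : C := cexp (- (p * (ln u)%:C)).
have eE u : e u = cexp ((- p) * (ln u)%:C) by rewrite /e mulNr.
have me : cmeasurable e.
  by rewrite (_ : e = (fun u : R => cexp ((- p) * (ln u)%:C))); [exact: cmeasurable_cpow|apply/funext => u; exact: eE].
have ne u : normc (e u) = expR ((1 - Re p - 1) * ln u).
  by rewrite eE normc_cpow ReN; congr expR; ring.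
pose S (u v : R) : R := if u < v then M v else 0.
pose F (u v : R) : C := e u * (S u v)%:C.
pose k (z : R * R) : R := B * expR (- (c / 2 * z.2)) * expR ((1 - Re p - 1) * ln z.1 - c / 2 * z.1).
have m2 := @measurable_snd _ _ (measurableTypeR R) (measurableTypeR R).
have m1 := @measurable_fst _ _ (measurableTypeR R) (measurableTypeR R).
have mS : measurable_fun setT (fun z : R * R => S z.1 z.2).
  apply: measurable_fun_ifT => //; first exact: measurable_fun_ltr.
  exact: (measurableT_comp mM m2).
have mk : measurable_fun setT k.
  apply: measurable_funM.
    apply: measurable_funM => //; apply: measurableT_comp => //.
    by apply: measurableT_comp => //; exact: measurable_funM.
  apply: measurableT_comp => //; apply: measurable_funB; apply: measurable_funM => //.
  exact: (measurableT_comp mln m1).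
have c2 : 0 < c / 2 by rewrite divr_gt0.
have p1' : 0 < 1 - Re p by rewrite subr_gt0.
have ig := integrable_gamma p1' c2.
set J := \int[mu]_(u in D) expR ((1 - Re p - 1) * ln u - c / 2 * u).
have Sb u v : 0 < u -> 0 < v -> `|S u v| <= B * expR (- (c / 2 * v)) * expR (- (c / 2 * u)).
  move=> u0 v0; rewrite /S; case: ltP => uv; last first.
    by rewrite normr0 mulr_ge0 ?expR_ge0// mulr_ge0 ?expR_ge0// mbound_ge0.
  apply: (le_trans (Mb _)); rewrite -mulrA ler_wpM2l ?mbound_ge0// -expRD ler_expR.
  by rewrite -opprD lerN2 -mulrDr {2}(_ : c = c / 2 * 2); [rewrite -mulrA ler_pM2l//; lra|field].
have E1 u : D u -> cintegral D (F u) = (mtail u)%:C * e u.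
  move=> /Dgt0 u0; rewrite (mtailE u0) mulrC /F.
  have iS : mu.-integrable D (EFin \o S u).
    apply: (@integrable_dom _ _ _ mu D mD _ (fun v => B * expR (- (c * v)))) => //.
      apply: measurable_funTS.
      have mp : measurable_fun setT (fun s : R => (u, s)) by exact: measurable_pair1.
      exact: (measurableT_comp mS mp).
    move=> v _; rewrite /S; case: ifP => // _.
    by rewrite normr0 mulr_ge0 ?expR_ge0// mbound_ge0.
  exact: (cintegralZ_real mD (e u) iS).
have rp : 0 < Re (1 - p) by rewrite !csimp /= subr_gt0.
have E2 v : D v -> cintegral D (F^~ v) =
    (1 - p)^-1 * ((M v)%:C * cexp (- ((p - 1) * (ln v)%:C))).
  move=> /Dgt0 v0.
  have ib := cintegrable_beta rp ltr01.
  pose A : C := (M v)%:C * e v.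
  have mF : cmeasurable (F^~ v).
    apply: cmeasurableM => //; apply: cmeasurable_real.
    have mp : measurable_fun setT (fun u : R => (u, v)) by exact: measurable_pair2.
    exact: (measurableT_comp mS mp).
  have sc := cintegral_scale v0 mF.
  have e2 : cintegral D (fun s => F (v * s) v) = A * cbeta (1 - p) 1.
    rewrite /cbeta -(cintegralZ mD A ib); apply: eq_cintegral => s /Dgt0 s0.
    rewrite /F /S gtr_pMr// kb1 /A eE eE lnM ?posrE// rmorphD /= mulrDr cexpD.
    have -> : 1 - p - 1 = - p by ring.
    by case: (s < 1); rewrite /= ?mulr0// mulr1; ring.
  have vV := complexV (lt0r_neq0 v0).
  have -> : cintegral D (F^~ v) = v%:C * (A * cbeta (1 - p) 1).
    by rewrite -e2 sc mulrA vV mul1r.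
  rewrite cbeta1// /A.
  have -> : cexp (- ((p - 1) * (ln v)%:C)) = v%:C * e v.
    rewrite -[X in X%:C * _](@lnK _ v) ?posrE// -cexp_real /e -cexpD.
    by congr cexp; ring.
  by ring.
have [] := @cFubini R D D F k (fun v => J * B * expR (- (c / 2 * v))) mD mD _ mk.
- apply: cmeasurableM; last exact: cmeasurable_real.
  exact: (cmeasurable_comp m1 me).
- move=> u v /Dgt0 u0 /Dgt0 v0.
  rewrite ComplexField.Normc.normcM ne normc_real /k /= expRD mulrCA.
  by rewrite ler_pM2l ?expR_gt0//; exact: Sb.
- by move=> v _; exact: (integrableRZ mD (B * expR (- (c / 2 * v))) ig).
- move=> v _; rewrite /k /= RintegralZl// -/J.
  by rewrite le_eqVlt; apply/orP; left; apply/eqP; ring.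
- by apply: integrableRZ => //; exact: integrable_expN.
move=> j1 j2 E.
have Q : Re (p - 1) < 1 by rewrite !csimp /=; lra.
have [iQ _] := Mellin_mfun a01 Q.
transitivity (cintegral D (fun u => cintegral D (F u))).
  by apply: eq_cintegral => u Du; rewrite (E1 u Du).
rewrite E -(cintegralZ mD _ iQ); apply: eq_cintegral => v Dv; exact: E2.
Qed.

Definition gamma1 : R := Re (gam (1 - alpha)%:C 1).

Lemma gamma1E : gam (1 - alpha)%:C 1 = gamma1%:C.
Proof. by rewrite /gamma1 gam_real. Qed.

Let Abel_algebra (cb gw g1 gp gq q p1 : C) :
  gw != 0 -> gq != 0 -> q != 0 -> p1 != 0 -> cb * (q * gq) = gw * g1 ->
  cb * (p1^-1 * (p1 * gp / gw)) + - g1 * (q^-1 * (gp / gq)) = 0.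
Proof.
move=> n1 n2 n3 n4 e.
have -> : g1 = cb * (q * gq) / gw by rewrite e mulrC mulKf.
by field; rewrite n1 n2 n3 n4.
Qed.

(** The identity behind the fractional equation. Both sides are multiplicative
    convolutions in [y]; their Mellin transforms are products of the transforms of
    the factors, and agree by [Mellin_mfun], [beta_gam] and the functional
    equation. *)
Lemma Abel_mtail y : 0 < y ->
  \int[mu]_(s in D) (kb (1 - alpha) s * mtail (y * expR (- (alpha * ln s)))) =
  gamma1 * \int[mu]_(s in D) (kb 1 s * expR (- (alpha * ln s)) *
     M (y * expR (- (alpha * ln s)))).
Proof.
move=> y0; have b0 : 0 < 1 - alpha by rewrite subr_gt0.
have al1 : 0 < 1 + alpha by rewrite addr_gt0.
pose k1 := kb (1 - alpha); pose k2 s := kb 1 s * expR (- (alpha * ln s)).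
have mk1 : measurable_fun setT k1 by exact: measurable_kb.
have mk2 : measurable_fun setT k2.
  apply: measurable_funM; first exact: measurable_kb.
  apply: measurableT_comp => //; apply: measurableT_comp => //.
  exact: measurable_funM.
have k10 s : 0 <= k1 s by exact: kb_ge0.
have k20 s : 0 <= k2 s by rewrite mulr_ge0 ?kb_ge0 ?expR_ge0.
have ik1 : mu.-integrable D (EFin \o (fun s => k1 s * expR (alpha * ln s))).
  have := integrable_beta al1 b0; rewrite (_ : (EFin \o _) = EFin \o (fun s => k1 s * expR (alpha * ln s)))//.
  by apply/funext => s /=; rewrite addrAC subrr add0r mulrC.
have ik2 : mu.-integrable D (EFin \o (fun s => k2 s * expR (alpha * ln s))).
  have := integrable_kb (@ltr01 R); rewrite (_ : (EFin \o _) = EFin \o (fun s => k2 s * expR (alpha * ln s)))//.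
  by apply/funext => s /=; rewrite /k2 -mulrA -expRD addNr expR0 mulr1.
have Bc : 0 <= B / c by rewrite divr_ge0 ?mbound_ge0// ltW.
have Mb' u : 0 < u -> `|M u| <= B * expR (- (c * u)) by [].
have T1 tau := Mellin_mconv c0 Bc mk1 measurable_mtail k10 ik1 mtail_bound tau.
have T2 tau := Mellin_mconv c0 mbound_ge0 mk2 mM k20 ik2 Mb' tau.
have C1 x (x0 : 0 < x) := @continuous_mconv R alpha k1 mtail _ _ c0 Bc mk1 measurable_mtail k10 ik1 mtail_bound x x0 continuous_mtail.
have C2 x (x0 : 0 < x) := @continuous_mconv R alpha k2 M _ _ c0 mbound_ge0 mk2 mM k20 ik2 Mb' x x0 (continuous_mfun a01).
pose X1 := mconv alpha k1 mtail; pose X2 := mconv alpha k2 M.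
suff : X1 y - gamma1 * X2 y = 0 by move/eqP; rewrite subr_eq0 => /eqP.
have tau0 (X : R -> R) : cintegrable D (fun u => (X u)%:C * cexp (0 +i* (- (0 * ln u)))) ->
    mu.-integrable D (EFin \o X).
  move=> [i1 _]; move: i1; rewrite (_ : (EFin \o _) = EFin \o X)//.
  apply/funext => u; rewrite compE.
  have -> : cexp (0 +i* (- (0 * ln u))) = 1 :> C.
    by rewrite mul0r oppr0; exact: cexp0.
  by rewrite mulr1.
have iX1 := tau0 _ (T1 0).1; have iX2 := tau0 _ (T2 0).1.
pose g u := X1 u - gamma1 * X2 u.
have ig : mu.-integrable D (EFin \o g).
  by apply: integrableRB => //; exact: integrableRZ.
have mg : measurable_fun setT (g \_ D).
  by apply: (measurable_restrictT g mD).1; case/integrableP: ig => /measurable_EFinP.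
have gE u : 0 < u -> (g \_ D) u = g u.
  by move=> u0; rewrite patchE mem_set//; exact: gt0D.
change (g y = 0); rewrite -gE//.
apply: (Mellin_unique y0 mg).
- by apply: (@eq_integrable _ _ _ mu D mD (EFin \o g) _ _ ig) => u; rewrite inE => /Dgt0 u0; rewrite /= gE.
- apply: (@near_eq_continuous _ _ g).
    by near=> t; rewrite gE//; near: t; exact: lt_nbhsr.
  by apply: cvgB; [exact: C1|apply: cvgMl_tmp; exact: C2].
move=> tau.
have [i1 e1] := T1 tau; have [i2 e2] := T2 tau.
transitivity (cintegral D (fun u => (X1 u)%:C * cexp (0 +i* (- (tau * ln u))) +
   (- gamma1%:C) * ((X2 u)%:C * cexp (0 +i* (- (tau * ln u)))))).
  apply: eq_cintegral => u /Dgt0 u0; rewrite gE// /g rmorphB rmorphM /=; ring.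
rewrite (cintegralD mD i1 (cintegrableZ mD _ i2)) (cintegralZ mD _ i2) e1 e2.
clear i1 i2 e1 e2 T1 T2 iX1 iX2 ig mg gE C1 C2 tau0 g X1 X2.
pose p : C := 0 +i* tau.
have pE u : cexp (0 +i* (- (tau * ln u))) = cexp (- (p * (ln u)%:C)).
  by congr cexp; apply: complex_ext; rewrite !csimp /=; ring.
have Rp : Re p = 0 by [].
have p1 : Re p < 1 by rewrite Rp.
have pm1 : Re (p - 1) < 1 by rewrite !csimp /=; lra.
have -> : cintegral D (fun u => (mtail u)%:C * cexp (0 +i* (- (tau * ln u)))) =
    (1 - p)^-1 * (gam (1 - (p - 1)) 1 / gam (1 - alpha%:C * (p - 1)) 1).
  have [_ eM] := Mellin_mfun a01 pm1.
  have p0 : 0 <= Re p by rewrite Rp.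
  rewrite -eM -(Mellin_mtail p1 p0).
  apply: (@eq_cintegral _ D) => u _; congr (_ * _); exact: pE.
have -> : cintegral D (fun u => (M u)%:C * cexp (0 +i* (- (tau * ln u)))) =
    gam (1 - p) 1 / gam (1 - alpha%:C * p) 1.
  have [_ eM] := Mellin_mfun a01 p1; rewrite -eM.
  apply: (@eq_cintegral _ D) => u _; congr (_ * _); exact: pE.
pose w : C := 1 - alpha%:C * (p - 1).
have w0 : 0 < Re w by rewrite !csimp /= mul0r; have := a0 => *; lra.
have w1 : 0 < Re (1 - alpha%:C * p) by rewrite !csimp /= mul0r; lra.
have ex1 : alpha +i* (- (alpha * tau)) = w - 1.
  by apply: complex_ext; rewrite !csimp /=; ring.
have ex2 : alpha +i* (- (alpha * tau)) = 1 - alpha%:C * p - 1 + alpha%:C.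
  by apply: complex_ext; rewrite !csimp /=; ring.
have i1E : cintegral D (fun s => (k1 s)%:C * cexp ((alpha +i* (- (alpha * tau))) * (ln s)%:C)) =
    cbeta w (1 - alpha).
  rewrite /cbeta; apply: (@eq_cintegral _ D) => s _.
  by rewrite ex1 mulrC /k1.
have i2E : cintegral D (fun s => (k2 s)%:C * cexp ((alpha +i* (- (alpha * tau))) * (ln s)%:C)) =
    cbeta (1 - alpha%:C * p) 1.
  rewrite /cbeta; apply: (@eq_cintegral _ D) => s _.
  rewrite ex2 /k2 rmorphM /= -mulrA mulrC; congr (_ * _).
  rewrite -cexp_real -cexpD; congr cexp.
  by rewrite rmorphN rmorphM /=; ring.
rewrite i1E i2E (cbeta1 w1).
have bg := beta_gam w0 b0.
have wb : w + (1 - alpha)%:C = 1 - alpha%:C * p + 1.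
  by rewrite /w rmorphB /=; ring.
rewrite wb gamma1E in bg.
have r1 : (1 - alpha%:C * p) * gam (1 - alpha%:C * p) 1 = gam (1 - alpha%:C * p + 1) 1.
  by have := gam_rec w1 (m := 1) ltr01; rewrite mul1r.
have rp : 0 < Re (1 - p) by rewrite !csimp /=; lra.
have r2 : (1 - p) * gam (1 - p) 1 = gam (1 - (p - 1)) 1.
  have -> : 1 - (p - 1) = 1 - p + 1 by ring.
  have := gam_rec rp (m := 1) ltr01; rewrite mul1r; apply.
have n1 : gam w 1 != 0 by exact: gam_neq0.
have n2 : gam (1 - alpha%:C * p) 1 != 0 by exact: gam_neq0.
have n3 : 1 - p != 0 by apply: contraTneq rp => ->; rewrite ltxx.
have n4 : 1 - alpha%:C * p != 0 by apply: contraTneq w1 => ->; rewrite ltxx.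
rewrite -r1 in bg; rewrite -r2 -/w.
exact: Abel_algebra n1 n2 n4 n3 bg.
Unshelve. all: by end_near. Qed.

End tail.

(** * Subordination: from the heat flow to the fractional equation *)
Section abel_in_unit_interval.
Context {R : realType}.
Notation mu := (@lebesgue_measure R).
Local Notation D := (`]0, +oo[%classic : set R).
Let mD : measurable (D : set (measurableTypeR R)). Proof. exact: measurable_itv. Qed.

Lemma Fubini_prod d1 d2 (T1 : measurableType d1) (T2 : measurableType d2)
    (m1 : {sigma_finite_measure set T1 -> \bar R})
    (m2 : {sigma_finite_measure set T2 -> \bar R}) (D1 : set T1) (D2 : set T2)
    (f : T1 * T2 -> R) (g : T1 -> R) (h : T2 -> R) :
  measurable D1 -> measurable D2 -> measurable_fun setT f ->
  (forall x, D1 x -> 0 <= g x) ->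
  m1.-integrable D1 (EFin \o g) -> m2.-integrable D2 (EFin \o h) ->
  (forall x y, D1 x -> D2 y -> `|f (x, y)| <= g x * h y) ->
  [/\ m1.-integrable D1 (EFin \o (fun x => \int[m2]_(y in D2) f (x, y))),
      m2.-integrable D2 (EFin \o (fun y => \int[m1]_(x in D1) f (x, y))) &
      \int[m1]_(x in D1) \int[m2]_(y in D2) f (x, y) =
      \int[m2]_(y in D2) \int[m1]_(x in D1) f (x, y)].
Proof.
move=> mD1 mD2 mf g0 ig ih fgh.
have ih' : m2.-integrable D2 (EFin \o (fun y => (\int[m1]_(x in D1) g x) * h y)).
  exact: integrableRZ.
apply: (Fubini_dominated mD1 mD2 mf ih') => y Dy.
have mfy : measurable_fun setT (fun x => f (x, y)).
  have mp : measurable_fun setT (fun x : T1 => (x, y)) by exact: measurable_pair2.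
  exact: (measurableT_comp mf mp).
have igh : m1.-integrable D1 (EFin \o (fun x => h y * g x)) by exact: integrableRZ.
apply: (@le_trans _ _ (\int[m1]_(x in D1) (h y * g x)%:E)%E).
  apply: ge0_le_integral => //.
  - by apply/measurable_EFinP/measurable_funTS; exact: measurableT_comp.
  - by case/integrableP: igh.
  - by move=> x Dx; rewrite lee_fin mulrC fgh.
have := integrable_fin_num mD1 igh => fin.
rewrite -(fineK fin) lee_fin -/(Rintegral m1 D1 (fun x => h y * g x)).
by rewrite RintegralZl// mulrC.
Qed.

(** The substitution [r = t * s], under which the kernel is the Beta weight. *)
Lemma abel_integral_unit (alpha t : R) (g : R -> R) : 0 < alpha < 1 -> 0 < t ->
  measurable_fun setT g ->
  mu.-integrable D (EFin \o (fun s => kb (1 - alpha) s * g (t * s))) ->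
  abel_integral alpha g t =
  t `^ (1 - alpha) * \int[mu]_(s in D) (kb (1 - alpha) s * g (t * s)).
Proof.
move=> /andP[a0 a1] t0 mg ig.
pose f (s : R) : R := if s < t then g s / (t - s) `^ alpha else 0.
have mp : measurable_fun setT (fun s : R => g s / (t - s) `^ alpha).
  apply: measurable_funM => //; apply: (measurableT_comp measurable_invr).
  by apply: (measurableT_comp (measurable_powR alpha)); exact: measurable_funB.
have mf : measurable_fun setT f.
  by apply: measurable_fun_ifT => //; exact: measurable_fun_ltr.
have fE s : 0 < s -> f (t * s) = t `^ (- alpha) * (kb (1 - alpha) s * g (t * s)).
  move=> s0; rewrite /f /kb gtr_pMr//; case: (ltP s 1) => s1; last by rewrite mul0r mulr0.
  have -> : t - t * s = t * (1 - s) by ring.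
  rewrite powRM ?subr_ge0 1?ltW// invfM -powRN.
  have -> : ((1 - s) `^ alpha)^-1 = expR ((1 - alpha - 1) * ln (1 - s)).
    by rewrite -powRN /powR gt_eqF ?subr_gt0//; congr expR; ring.
  by ring.
have ift : mu.-integrable D (EFin \o (fun s => f (t * s))).
  have i2 := integrableRZ mD (t `^ (- alpha)) ig.
  apply: (@eq_integrable _ _ _ mu D mD (EFin \o (fun s => t `^ (- alpha) * (kb (1 - alpha) s * g (t * s)))) _ _ i2).
  by move=> s; rewrite inE /= in_itv /= andbT => s0; rewrite fE.
have fD : \int[mu]_(s in D) f s = abel_integral alpha g t.
  have md : measurable_fun `]0, t[ (fun s => g s / (t - s) `^ alpha).
    exact: measurable_funTS.
  rewrite /abel_integral /Rintegral [X in _ = fine X](integral_itv_bndoo true false); last first.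
    by apply/measurable_EFinP; exact: md.
  congr fine; rewrite [LHS]integral_mkcond [RHS]integral_mkcond.
  apply: eq_integral => s _; rewrite !patchE /f.
  have -> : (s \in D) = (0 < s) by apply/idP/idP; rewrite inE /= in_itv /= andbT.
  have -> : (s \in `]0, t[%classic) = (0 < s) && (s < t).
    by apply/idP/idP; rewrite inE /= in_itv.
  by case: (0 < s); case: (s < t).
have := Rintegral_scale t0 mf; rewrite fD => e.
have -> : abel_integral alpha g t = t * (t^-1 * abel_integral alpha g t).
  by rewrite mulrA divff ?mul1r// gt_eqF.
rewrite -e (_ : \int[mu]_(u in D) f (t * u) = t `^ (- alpha) *
   \int[mu]_(s in D) (kb (1 - alpha) s * g (t * s))).
  rewrite mulrA; congr (_ * _); rewrite -{1}(powRr1 (ltW t0)) -powRD//.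
  by rewrite (gt_eqF t0) implybT.
rewrite -RintegralZl//; apply: eq_Rintegral => s; rewrite inE /= in_itv /= andbT.
by move=> s0; rewrite fE.
Qed.

Lemma continuous_normr_powR (alpha : R) : 0 < alpha ->
  continuous (fun t : R => `|t| `^ alpha).
Proof.
move=> a0 t; have [->|t0] := eqVneq t 0.
  apply/cvgrPdist_lt => e e0; rewrite normr0 powR0 ?gt_eqF//.
  have d0 : 0 < e `^ alpha^-1 by rewrite powR_gt0.
  have eE : (e `^ alpha^-1) `^ alpha = e.
    by rewrite -powRrM mulVf ?gt_eqF// powRr1// ltW.
  have h : \forall s \near (0 : R), `|s| < e `^ alpha^-1 by exact: nbhs0_lt.
  near=> s; rewrite sub0r normrN ger0_norm ?powR_ge0// -[ltRHS]eE.
  by rewrite gt0_ltr_powR ?nnegrE ?powR_ge0//; near: s; exact: h.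
have n0 : 0 < `|t| by rewrite normr_gt0.
have c1 : {for t, continuous (fun t : R => `|t|)} by exact: norm_continuous.
have c2 : {for `|t|, continuous (fun v => v `^ alpha)}.
  exact: is_derive_continuous (is_derive1_powR alpha n0).
exact: (continuous_comp c1 c2).
Unshelve. all: by end_near. Qed.

Lemma kb_total (b : R) : 0 < b -> \int[mu]_(s in D) kb b s = b^-1.
Proof.
move=> b0.
have r1 : 0 < complex.Re (1 : R[i]) by rewrite /= ltr01.
have := beta_gam r1 b0; rewrite gam11 mul1r.
have rb : 0 < complex.Re b%:C by [].
have := gam_rec rb (m := 1) ltr01; rewrite mul1r addrC => <-.
have g0 := gam_neq0 rb => e.
have b1 := complexV (lt0r_neq0 b0).
have e2 : cbeta 1 b * b%:C = 1 by apply: (mulIf g0); rewrite mul1r -mulrA; exact: e.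
have e3 : cbeta 1 b = (b^-1)%:C.
  transitivity (cbeta 1 b * (b%:C * (b^-1)%:C)); first by rewrite b1 mulr1.
  by rewrite mulrA e2 mul1r.
clear e2; clear e b1; move: e3 => /(congr1 (@complex.Re R)) /= <-.
by apply: eq_Rintegral => s _; rewrite subrr !(mul0r, mulr0, addr0, subr0) expR0 cos0; ring.
Qed.

End abel_in_unit_interval.

Section subordination.
Context {R : realType}.
Notation mu := (@lebesgue_measure R).
Local Notation D := (`]0, +oo[%classic : set R).

Let mD : measurable (D : set (measurableTypeR R)). Proof. exact: measurable_itv. Qed.
Let Dgt0 x : D x -> 0 < x. Proof. by rewrite /= in_itv /= andbT. Qed.
Let gt0D x : 0 < x -> D x. Proof. by rewrite /= in_itv /= andbT. Qed.

Variables (alpha cd : R).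
Hypotheses (a01 : 0 < alpha < 1) (cd0 : 0 < cd).
Let a0 : 0 < alpha. Proof. by case/andP: a01. Qed.
Let a1 : alpha < 1. Proof. by case/andP: a01. Qed.

Local Notation M := (mfun alpha).
Local Notation B := (mbound alpha).
Let c : R := kappa alpha / 2.
Let c0 : 0 < c. Proof. by rewrite divr_gt0// kappa_gt0. Qed.
Let Mb u : `|M u| <= B * expR (- (c * u)). Proof. exact: mfun_bound. Qed.
Let mM : measurable_fun setT M. Proof. exact: measurable_mfun. Qed.
Let B0 : 0 <= B. Proof. exact: mbound_ge0. Qed.
Let iBe : mu.-integrable D (EFin \o (fun v => B * expR (- (c * v)))).
Proof. by apply: integrableRZ => //; exact: integrable_expN. Qed.

(** [Mellin_mfun] at exponent [0]. *)
Lemma mfun_total : \int[mu]_(u in D) M u = 1.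
Proof.
have z1 : complex.Re (0 : R[i]) < 1 by exact: ltr01.
have [_] := Mellin_mfun a01 z1; rewrite mulr0 subr0 gam11 divr1.
move=> /(congr1 (@complex.Re R)) /= <-.
by apply: eq_Rintegral => u _; rewrite !(mul0r, mulr0, addr0, subr0, oppr0) expR0 cos0; ring.
Qed.

(** The flow [P] run with the random clock [cd * u * t ^ alpha], where [u] is
    weighted by [mfun alpha]. The absolute value makes the function continuous on the
    whole line. *)
Definition subord (P : R -> R) (t : R) : R :=
  \int[mu]_(u in D) (M u * P (cd * u * `|t| `^ alpha)).

Section bounded_flow.
Variables (P : R -> R) (K : R).
Hypotheses (cP : continuous P) (PK : forall v, `|P v| <= K).

Let K0 : 0 <= K. Proof. exact: le_trans (normr_ge0 _) (PK 0). Qed.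
Let mP : measurable_fun setT P. Proof. exact: continuous_measurable_fun. Qed.

Let mint (r : R) : measurable_fun setT (fun u => M u * P (cd * u * r)).
Proof.
apply: measurable_funM => //; apply: (measurableT_comp mP).
by apply: measurable_funM => //; exact: measurable_funM.
Qed.

Let bint (u r : R) : `|M u * P (cd * u * r)| <= K * (B * expR (- (c * u))).
Proof. by rewrite normrM mulrC; apply: ler_pM. Qed.

Let iint (r : R) : mu.-integrable D (EFin \o (fun u => M u * P (cd * u * r))).
Proof.
apply: (@integrable_dom _ _ _ mu D mD _ (fun u => K * (B * expR (- (c * u))))).
- exact: measurable_funTS (mint r).
- by move=> u _; exact: bint.
- exact: integrableRZ.
Qed.

Lemma integrable_subord (t : R) : mu.-integrable D (EFin \o (fun u => M u * P (cd * u * `|t| `^ alpha))).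
Proof. exact: iint. Qed.

Lemma subord0 : subord P 0 = P 0.
Proof.
rewrite /subord normr0 powR0 ?gt_eqF// -[RHS]mulr1 -mfun_total.
rewrite -RintegralZl//; last exact: integrable_mfun.
by apply: eq_Rintegral => u _; rewrite mulr0 mulrC.
Qed.

Lemma subord_bound t : `|subord P t| <= K * (B / c).
Proof.
have ib := integrableRZ mD K iBe.
apply: (le_trans (normr_Rintegral_le mD (iint _) ib _)); first by move=> u _; exact: bint.
have ie := @integrable_expN R c c0.
by rewrite !RintegralZl// Rintegral_expN.
Qed.

Lemma continuous_subord : continuous (subord P).
Proof.
move=> t; have tt : t - 1 < t < t + 1 by apply/andP; split; lra.
apply: (@continuous_Rintegral _ _ _ mu D (fun t u => M u * P (cd * u * `|t| `^ alpha))
  (fun u => K * (B * expR (- (c * u)))) t (t - 1) (t + 1) mD tt).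
- by move=> x _; exact: measurable_funTS (mint _).
- move=> x u _ _; apply: cvgMl_tmp.
  have c1 : {for x, continuous (fun x : R => cd * u * `|x| `^ alpha)}.
    by apply: cvgMl_tmp; exact: continuous_normr_powR.
  have c2 : {for cd * u * `|x| `^ alpha, continuous P} by exact: cP.
  exact: (continuous_comp c1 c2).
- exact: integrableRZ.
- by move=> x u _ _; exact: bint.
Qed.

Let msub : measurable_fun setT (subord P).
Proof. by apply: continuous_measurable_fun; exact: continuous_subord. Qed.

Lemma integrable_kb_subord b t : 0 < b ->
  mu.-integrable D (EFin \o (fun s => kb b s * subord P (t * s))).
Proof.
move=> b0; apply: (@integrable_dom _ _ _ mu D mD _ (fun s => K * (B / c) * kb b s)).
- apply: measurable_funTS; apply: measurable_funM; first exact: measurable_kb.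
  by apply: (measurableT_comp msub); exact: measurable_funM.
- move=> s _; rewrite normrM ger0_norm ?kb_ge0// mulrC ler_wpM2r ?kb_ge0//.
  exact: subord_bound.
- by apply: integrableRZ => //; exact: integrable_kb.
Qed.

End bounded_flow.

Variables (P P2 : R -> R) (K K2 : R).
Hypotheses (cP : continuous P) (PK : forall v, `|P v| <= K).
Hypotheses (cP2 : continuous P2) (P2K : forall v, `|P2 v| <= K2).
Hypothesis dP : forall v : R, 0 < v -> is_derive v 1 P (P2 v).

Let K20 : 0 <= K2. Proof. exact: le_trans (normr_ge0 _) (P2K 0). Qed.
Let mP2 : measurable_fun setT P2. Proof. exact: continuous_measurable_fun. Qed.

Lemma flow_integral (x : R) : 0 < x ->
  P x = P 0 + \int[mu]_(v in D) (if v < x then P2 v else 0).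
Proof.
move=> x0.
have E : (\int[mu]_(v in `[0%R, x]) (P2 v)%:E = (P x)%:E - (P 0%R)%:E)%E.
  apply: continuous_FTC2 => //.
  - by apply: continuous_subspaceT => v; exact: cP2.
  - split.
    + by move=> v; rewrite in_itv /= => /andP[v0 _]; have [] := dP v0.
    + by apply: cvg_at_right_filter; exact: cP.
    + by apply: cvg_at_left_filter; exact: cP.
  - move=> v; rewrite in_itv /= => /andP[v0 _]; rewrite derive1E.
    by apply: derive_val; exact: dP.
have md : measurable_fun `]0, x[ (EFin \o P2).
  by apply/measurable_EFinP; exact: measurable_funTS.
rewrite (integral_itv_bndoo true false md) in E.
suff -> : \int[mu]_(v in D) (if v < x then P2 v else 0) = P x - P 0 by ring.
transitivity (\int[mu]_(v in `]0, x[) P2 v); last by rewrite /Rintegral E.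
rewrite [LHS]Rintegral_mkcond [RHS]Rintegral_mkcond; apply: eq_Rintegral => v _.
rewrite !patchE.
have -> : (v \in D) = (0 < v) by apply/idP/idP; rewrite inE /= in_itv /= andbT.
have -> : (v \in `]0, x[%classic) = (0 < v) && (v < x).
  by apply/idP/idP; rewrite inE /= in_itv.
by case: (0 < v); case: (v < x).
Qed.

(** By parts: the derivative of the flow falls on the tail of the clock. *)
Lemma subord_tail (s : R) : 0 < s ->
  subord P s = P 0 + \int[mu]_(v in D) (P2 v * mtail alpha (v / (cd * s `^ alpha))).
Proof.
move=> s0; set k := cd * s `^ alpha.
have k0 : 0 < k by rewrite mulr_gt0// powR_gt0.
pose F (z : R * R) : R := M z.1 * (if z.2 < k * z.1 then P2 z.2 else 0).
have m2 := @measurable_snd _ _ (measurableTypeR R) (measurableTypeR R).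
have m1 := @measurable_fst _ _ (measurableTypeR R) (measurableTypeR R).
have mF : measurable_fun setT F.
  apply: measurable_funM; first exact: (measurableT_comp mM m1).
  apply: measurable_fun_ifT => //; last exact: (measurableT_comp mP2 m2).
  by apply: measurable_fun_ltr => //; exact: measurable_funM.
have c2 : 0 < c / 2 by rewrite divr_gt0.
have ck : 0 < c / (2 * k) by rewrite divr_gt0// mulr_gt0.
have ig : mu.-integrable D (EFin \o (fun u => B * expR (- (c / 2 * u)))).
  by apply: integrableRZ => //; exact: integrable_expN.
have ih : mu.-integrable D (EFin \o (fun v => K2 * expR (- (c / (2 * k) * v)))).
  by apply: integrableRZ => //; exact: integrable_expN.
have g0 u : D u -> 0 <= B * expR (- (c / 2 * u)).
  by move=> _; rewrite mulr_ge0// expR_ge0.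
have Fb u v : D u -> D v -> `|F (u, v)| <= B * expR (- (c / 2 * u)) * (K2 * expR (- (c / (2 * k) * v))).
  move=> /Dgt0 u0 /Dgt0 v0; rewrite /F /=; case: ltP => vu; last first.
    by rewrite mulr0 normr0; do !apply: mulr_ge0 => //; exact: expR_ge0.
  rewrite normrM.
  have -> : B * expR (- (c / 2 * u)) * (K2 * expR (- (c / (2 * k) * v))) =
     (B * (expR (- (c / 2 * u)) * expR (- (c / (2 * k) * v)))) * K2 by ring.
  apply: ler_pM => //; apply: (le_trans (Mb _)); rewrite ler_wpM2l// -expRD ler_expR.
  have : c / (2 * k) * v <= c / (2 * k) * (k * u) by rewrite ler_pM2l// ltW.
  have -> : c / (2 * k) * (k * u) = c / 2 * u by field; rewrite gt_eqF.
  have e : c / 2 * u + c / 2 * u = c * u by field.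
  by move=> h; lra.
have iS x : mu.-integrable D (EFin \o (fun v => if v < x then P2 v else 0)).
  have ie := @integrable_expN R 1 ltr01.
  apply: (@integrable_dom _ _ _ mu D mD _ (fun v => K2 * expR x * expR (- (1 * v)))).
  - apply: measurable_funTS; apply: measurable_fun_ifT => //.
    exact: measurable_fun_ltr.
  - move=> v _; case: ltP => vx; last by rewrite normr0 !mulr_ge0 ?expR_ge0.
    apply: (le_trans (P2K _)); rewrite -mulrA ler_peMr// -expRD -[leLHS]expR0 ler_expR.
    by rewrite mul1r subr_ge0 ltW.
  - exact: integrableRZ.
rewrite /subord gtr0_norm//.
transitivity (\int[mu]_(u in D) (P 0 * M u + \int[mu]_(v in D) F (u, v))).
  apply: eq_Rintegral => u; rewrite inE => /Dgt0 u0.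
  have -> : \int[mu]_(v in D) F (u, v) =
      M u * \int[mu]_(v in D) (if v < k * u then P2 v else 0).
    by rewrite /F /= RintegralZl//; exact: iS.
  have -> : cd * u * s `^ alpha = k * u by rewrite /k; ring.
  by rewrite (flow_integral (mulr_gt0 k0 u0)); ring.
have iM := @integrable_mfun R alpha a01.
have [iF _ E] := Fubini_prod mD mD mF g0 ig ih Fb.
rewrite (RintegralD mD (integrableRZ mD (P 0) iM) iF) (RintegralZl _ mD iM).
rewrite mfun_total mulr1 E; clear E iF; congr (_ + _).
apply: eq_Rintegral => v; rewrite inE => /Dgt0 v0.
have vk : 0 < v / k by rewrite divr_gt0.
have it : mu.-integrable D (EFin \o (fun u => if v / k < u then M u else 0)).
  apply: (@integrable_dom _ _ _ mu D mD _ (fun v => B * expR (- (c * v))) _ _ iBe).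
    apply: measurable_funTS; apply: measurable_fun_ifT => //.
    exact: measurable_fun_ltr.
  by move=> u _; case: ifP => // _; rewrite normr0 mulr_ge0// expR_ge0.
rewrite (mtailE a01 vk) -(RintegralZl _ mD it).
apply: eq_Rintegral => u _; rewrite /F /= ltr_pdivrMr// [u * k]mulrC.
by case: ifP => _; rewrite ?mulr0// mulrC.
Qed.

Lemma Rintegral_kb1 (q : R -> R) (t : R) : 0 < t -> measurable_fun setT q ->
  t * \int[mu]_(s in D) (kb 1 s * q (t * s)) = \int[mu]_(s in `]0, t]) q s.
Proof.
move=> t0 mq; pose f (s : R) : R := if s < t then q s else 0.
have mf : measurable_fun setT f.
  by apply: measurable_fun_ifT => //; exact: measurable_fun_ltr.
have -> : \int[mu]_(s in D) (kb 1 s * q (t * s)) = \int[mu]_(s in D) f (t * s).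
  apply: eq_Rintegral => s _; rewrite kb1 /f gtr_pMr//.
  by case: (s < 1); rewrite ?mul1r ?mul0r.
rewrite (Rintegral_scale t0 mf) mulrA divff ?gt_eqF// mul1r.
have md : measurable_fun `]0, t[ (EFin \o q).
  by apply/measurable_EFinP; exact: measurable_funTS.
rewrite [RHS]/Rintegral (integral_itv_bndoo false false md) -/(Rintegral mu `]0, t[ q).
rewrite [LHS]Rintegral_mkcond [RHS]Rintegral_mkcond; apply: eq_Rintegral => s _.
rewrite !patchE.
have -> : (s \in D) = (0 < s) by apply/idP/idP; rewrite inE /= in_itv /= andbT.
have -> : (s \in `]0, t[%classic) = (0 < s) && (s < t).
  by apply/idP/idP; rewrite inE /= in_itv.
by rewrite /f; case: (0 < s); case: (s < t).
Qed.

(** Insert [subord_tail] into the Abel integral, and exchange the integrals; for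
    each value [v] of the flow time the inner integral is [Abel_mtail]. *)
Lemma abel_subord (t : R) : 0 < t ->
  abel_integral alpha (subord P) t =
  P 0 / (1 - alpha) * t `^ (1 - alpha) +
  cd * gamma1 alpha * \int[mu]_(s in `]0, t]) subord P2 s.
Proof.
move=> t0; set k := cd * t `^ alpha.
have k0 : 0 < k by rewrite mulr_gt0// powR_gt0.
have b0 : 0 < 1 - alpha by rewrite subr_gt0.
pose la (s : R) : R := expR (- (alpha * ln s)).
have la0 s : 0 < la s by exact: expR_gt0.
have laV (s : R) : 0 < s -> s `^ alpha = (la s)^-1.
  by move=> s0; rewrite /powR gt_eqF// /la expRN invrK.
have mla : measurable_fun setT la.
  apply: measurableT_comp => //; apply: measurableT_comp => //.
  by apply: measurable_funM => //; exact: measurable_ln.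
have la1 (s : R) : 0 < s -> s < 1 -> 1 <= la s.
  move=> s0 s1; rewrite /la -[leLHS]expR0 ler_expR -mulrN mulr_ge0 ?(ltW a0)//.
  by rewrite oppr_ge0 ln_le0// ltW.
have ikl : mu.-integrable D (EFin \o (fun s => kb 1 s * la s)).
  have := integrable_powr01 b0.
  rewrite (_ : (EFin \o _) = EFin \o (fun s => kb 1 s * la s))//.
  by apply/funext => s /=; rewrite mulrC /la addrAC subrr add0r mulNr.
have m2 := @measurable_snd _ _ (measurableTypeR R) (measurableTypeR R).
have m1 := @measurable_fst _ _ (measurableTypeR R) (measurableTypeR R).
have marg : measurable_fun setT (fun z : R * R => z.2 / k * la z.1).
  by apply: measurable_funM; [exact: measurable_funM|exact: (measurableT_comp mla m1)].
have cP' := continuous_subord cP PK; have cP2' := continuous_subord cP2 P2K.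
have mq : measurable_fun setT (subord P2) by exact: continuous_measurable_fun.
have ck : 0 < c / k by rewrite divr_gt0.
have arg (s v : R) : 0 < s -> v / (cd * (t * s) `^ alpha) = v / k * la s.
  move=> s0; rewrite powRM ?(ltW t0) ?(ltW s0)// (laV s s0) /k; field.
  by rewrite (gt_eqF (la0 s)) (gt_eqF cd0) gt_eqF// powR_gt0.
have expb (x v s : R) : 0 <= x -> 0 < s -> s < 1 -> 0 < v ->
    x * expR (- (c * (v / k * la s))) <= x * expR (- (c / k * v)).
  move=> x0 s0 s1 v0; rewrite ler_wpM2l// ler_expR lerN2.
  have -> : c * (v / k * la s) = c / k * v * la s by ring.
  by rewrite ler_peMr ?la1// mulr_ge0 ?ltW.
(* the tail form of the Abel integral, with the order of integration swapped *)
pose F1 (z : R * R) : R := kb (1 - alpha) z.1 * (P2 z.2 * mtail alpha (z.2 / k * la z.1)).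
have mF1 : measurable_fun setT F1.
  apply: measurable_funM; first exact: (measurableT_comp (measurable_kb (1 - alpha)) m1).
  apply: measurable_funM; first exact: (measurableT_comp mP2 m2).
  exact: (measurableT_comp (measurable_mtail a01) marg).
have ih (x : R) : mu.-integrable D (EFin \o (fun v => x * expR (- (c / k * v)))).
  by apply: integrableRZ => //; exact: integrable_expN.
have F1b s v : D s -> D v -> `|F1 (s, v)| <= kb (1 - alpha) s * (K2 * (B / c) * expR (- (c / k * v))).
  move=> /Dgt0 s0 /Dgt0 v0; rewrite /F1 /= normrM ger0_norm ?kb_ge0//.
  rewrite [kb _ _]/kb; case: (ltP s 1) => s1; last by rewrite !mul0r.
  rewrite ler_wpM2l ?expR_ge0// normrM -[leRHS]mulrA; apply: ler_pM => //.
  have vk : 0 < v / k * la s by rewrite mulr_gt0// divr_gt0.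
  by apply: (le_trans (mtail_bound a01 vk)); apply: expb => //; rewrite divr_ge0// ltW.
have kbg s : D s -> 0 <= kb (1 - alpha) s by rewrite kb_ge0.
pose F2 (z : R * R) : R := kb 1 z.1 * la z.1 * (P2 z.2 * M (z.2 / k * la z.1)).
have mF2 : measurable_fun setT F2.
  apply: measurable_funM.
    apply: measurable_funM; first exact: (measurableT_comp (measurable_kb 1) m1).
    exact: (measurableT_comp mla m1).
  apply: measurable_funM; first exact: (measurableT_comp mP2 m2).
  exact: (measurableT_comp mM marg).
have F2b s v : D s -> D v -> `|F2 (s, v)| <= kb 1 s * la s * (K2 * B * expR (- (c / k * v))).
  move=> /Dgt0 s0 /Dgt0 v0; rewrite /F2 /= normrM ger0_norm ?mulr_ge0 ?kb_ge0 ?expR_ge0//.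
  rewrite kb1; case: (ltP s 1) => s1; last by rewrite !mul0r.
  rewrite mul1r ler_wpM2l ?expR_ge0// normrM -[leRHS]mulrA; apply: ler_pM => //.
  by apply: (le_trans (Mb _)); exact: expb.
have klg s : D s -> 0 <= kb 1 s * la s by rewrite mulr_ge0 ?kb_ge0 ?expR_ge0.
have e2 : \int[mu]_(v in D) \int[mu]_(s in D) F2 (s, v) =
    k * \int[mu]_(s in D) (kb 1 s * subord P2 (t * s)).
  have [_ _ <-] := Fubini_prod mD mD mF2 klg ikl (ih _) F2b.
  rewrite -(RintegralZl _ mD (integrable_kb_subord cP2 P2K t ltr01)).
  apply: eq_Rintegral => s; rewrite inE => /Dgt0 s0.
  pose phi (v : R) : R := P2 v * M (v / k * la s).
  have mphi : measurable_fun setT phi.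
    have mp : measurable_fun setT (fun v : R => (s, v)) by exact: measurable_pair1.
    apply: measurable_funM; first exact: mP2.
    exact: (measurableT_comp mM (measurableT_comp marg mp)).
  have iphi : mu.-integrable D (EFin \o phi).
    have r0 : 0 < c / k * la s by rewrite mulr_gt0.
    apply: (@integrable_dom _ _ _ mu D mD _ (fun v => K2 * B * expR (- (c / k * la s * v)))).
    - exact: measurable_funTS.
    - move=> v _; rewrite normrM -[leRHS]mulrA; apply: ler_pM => //.
      apply: (le_trans (Mb _)); rewrite le_eqVlt; apply/orP; left; apply/eqP.
      by congr (_ * expR _); ring.
    - by apply: integrableRZ => //; exact: integrable_expN.
  have -> : \int[mu]_(v in D) F2 (s, v) = kb 1 s * la s * \int[mu]_(v in D) phi v.
    by rewrite -RintegralZl.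
  have ka0 : 0 < k / la s by rewrite divr_gt0.
  have sc := Rintegral_scale ka0 mphi.
  have -> : \int[mu]_(v in D) phi v = k / la s * subord P2 (t * s).
    have -> : \int[mu]_(v in D) phi v = k / la s * ((k / la s)^-1 * \int[mu]_(v in D) phi v).
      by rewrite mulrA divff ?mul1r// gt_eqF.
    rewrite -sc; congr (_ * _); apply: eq_Rintegral => u _.
    have u1 : k / la s * u / k * la s = u by field; rewrite (gt_eqF k0) gt_eqF.
    have u2 : cd * u * `|t * s| `^ alpha = k / la s * u.
      rewrite gtr0_norm ?mulr_gt0// powRM ?(ltW t0) ?(ltW s0)// (laV s s0) /k.
      by field; rewrite gt_eqF.
    by rewrite /phi u1 u2 mulrC.
  by field; rewrite gt_eqF.
have [iF1 _ _] := Fubini_prod mD mD mF1 kbg (integrable_kb b0) (ih _) F1b.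
rewrite (abel_integral_unit a01 t0); last 2 first.
- exact: continuous_measurable_fun.
- exact: (integrable_kb_subord cP PK).
have -> : \int[mu]_(s in D) (kb (1 - alpha) s * subord P (t * s)) =
    P 0 / (1 - alpha) + \int[mu]_(s in D) \int[mu]_(v in D) F1 (s, v).
  rewrite -(kb_total b0) -(RintegralZl _ mD (integrable_kb b0)).
  rewrite -(RintegralD mD (integrableRZ mD (P 0) (integrable_kb b0)) iF1).
  apply: eq_Rintegral => s; rewrite inE => Ds; have s0 := Dgt0 Ds.
  rewrite (subord_tail (mulr_gt0 t0 s0)) mulrDr mulrC; congr (_ + _).
  have -> : \int[mu]_(v in D) (P2 v * mtail alpha (v / (cd * (t * s) `^ alpha))) =
      \int[mu]_(v in D) (P2 v * mtail alpha (v / k * la s)).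
    by apply: eq_Rintegral => v _; rewrite arg.
  rewrite /F1 /=; case: (ltP s 1) => s1; last first.
    rewrite /kb ltNge s1 /= mul0r -[LHS](_ : \int[mu]_(v in D) 0 = 0).
      by apply: eq_Rintegral => v _; rewrite mul0r.
    by rewrite Rintegral_cst// mul0r.
  have ims : mu.-integrable D (EFin \o (fun v => P2 v * mtail alpha (v / k * la s))).
    apply: (@integrable_dom _ _ _ mu D mD _ _ _ _ (ih (K2 * (B / c)))).
      have mp : measurable_fun setT (fun v : R => (s, v)) by exact: measurable_pair1.
      apply: measurable_funTS; apply: measurable_funM; first exact: mP2.
      exact: (measurableT_comp (measurable_mtail a01) (measurableT_comp marg mp)).
    move=> v /Dgt0 v0; rewrite normrM -[leRHS]mulrA; apply: ler_pM => //.
    have vk : 0 < v / k * la s by rewrite mulr_gt0// divr_gt0.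
    by apply: (le_trans (mtail_bound a01 vk)); apply: expb => //; rewrite divr_ge0// ltW.
  exact: (esym (RintegralZl (kb (1 - alpha) s) mD ims)).
have [_ _ ->] := Fubini_prod mD mD mF1 kbg (integrable_kb b0) (ih _) F1b.
have -> : \int[mu]_(v in D) \int[mu]_(s in D) F1 (s, v) =
    gamma1 alpha * \int[mu]_(v in D) \int[mu]_(s in D) F2 (s, v).
  have [_ iF2 _] := Fubini_prod mD mD mF2 klg ikl (ih _) F2b.
  rewrite -(RintegralZl _ mD iF2); clear iF2.
  apply: eq_Rintegral => v; rewrite inE => /Dgt0 v0.
  have vk : 0 < v / k by rewrite divr_gt0.
  have mp : measurable_fun setT (fun s : R => (s, v)) by exact: measurable_pair2.
  have margv := measurableT_comp marg mp.
  have i1 : mu.-integrable D (EFin \o (fun s => kb (1 - alpha) s * mtail alpha (v / k * la s))).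
    apply: (@integrable_dom _ _ _ mu D mD _ (fun s => B / c * kb (1 - alpha) s)).
    - apply: measurable_funTS; apply: measurable_funM; first exact: measurable_kb.
      exact: (measurableT_comp (measurable_mtail a01) margv).
    - move=> s _; rewrite normrM ger0_norm ?kb_ge0// mulrC ler_wpM2r ?kb_ge0//.
      have vks : 0 < v / k * la s by rewrite mulr_gt0.
      apply: (le_trans (mtail_bound a01 vks)); rewrite ler_piMr//.
        by rewrite divr_ge0// ltW.
      by rewrite -[leRHS]expR0 ler_expR oppr_le0 mulr_ge0 ?ltW.
    - by apply: integrableRZ => //; exact: integrable_kb.
  have i2 : mu.-integrable D (EFin \o (fun s => kb 1 s * la s * M (v / k * la s))).
    apply: (@integrable_dom _ _ _ mu D mD _ (fun s => B * (kb 1 s * la s))).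
    - apply: measurable_funTS; apply: measurable_funM.
        by apply: measurable_funM => //; exact: measurable_kb.
      exact: (measurableT_comp mM margv).
    - move=> s _; rewrite normrM ger0_norm ?mulr_ge0 ?kb_ge0 ?expR_ge0//.
      rewrite mulrC ler_wpM2r ?mulr_ge0 ?kb_ge0 ?expR_ge0//.
      have vks : 0 < v / k * la s by rewrite mulr_gt0.
      apply: (le_trans (Mb _)); rewrite ler_piMr//.
      by rewrite -[leRHS]expR0 ler_expR oppr_le0 mulr_ge0 ?ltW.
    - exact: integrableRZ.
  have -> : \int[mu]_(s in D) F1 (s, v) =
      P2 v * \int[mu]_(s in D) (kb (1 - alpha) s * mtail alpha (v / k * la s)).
    rewrite -(RintegralZl _ mD i1).
    by apply: eq_Rintegral => s _; rewrite /F1 /= mulrCA.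
  have -> : \int[mu]_(s in D) F2 (s, v) =
      P2 v * \int[mu]_(s in D) (kb 1 s * la s * M (v / k * la s)).
    rewrite -(RintegralZl _ mD i2).
    by apply: eq_Rintegral => s _; rewrite /F2 /= mulrCA.
  by rewrite (Abel_mtail a01 vk) mulrCA.
rewrite e2.
rewrite mulrDr [_ * (P 0 / _)]mulrC; congr (_ + _).
rewrite -(Rintegral_kb1 t0 mq).
have tt : t `^ (1 - alpha) * t `^ alpha = t.
  by rewrite -powRD ?subrK ?powRr1 ?(ltW t0)// (gt_eqF t0) implybT.
by rewrite -[X in _ = _ * (X * _)]tt /k; ring.
Qed.

(** Differentiating [abel_subord]: the power of [t] is what the Caputo derivative
    subtracts, and [gamma1 alpha] is the Gamma factor in front of it. *)
Lemma caputo_subord (T t : R) (p : R -> R) :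
  (forall s, 0 <= s <= T -> p s = subord P s) -> 0 < t <= T ->
  is_caputo T alpha p t (cd * subord P2 t).
Proof.
move=> pE /andP[t0 tT]; have b0 : 0 < 1 - alpha by rewrite subr_gt0.
have G0 : Gamma (1 - alpha) = gamma1 alpha.
  rewrite /Gamma /cGamma /= b0 addr0 big_ord0 divr1 /gamma1 /gam /euler_integral.
  congr complex.Re; apply: eq_cintegral => u _; rewrite /gint /cpowR -cexp_real -cexpD.
  by congr cexp; rewrite rmorphN /= mul1r.
have g1 : gamma1 alpha != 0.
  have r : 0 < complex.Re (1 - alpha)%:C by [].
  have := gam_neq0 r; rewrite gamma1E; apply: contraNneq => ->.
  by apply/eqP.
pose H (s : R) : R := P 0 / (1 - alpha) * s `^ (1 - alpha) +
  cd * gamma1 alpha * \int[mu]_(s in `]0, s]) subord P2 s.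
have AE s : 0 < s <= T -> abel_integral alpha p s = H s.
  move=> /andP[s0 sT]; rewrite /H -abel_subord//; apply: eq_Rintegral => r.
  rewrite inE /= in_itv /= => /andP[r0 rs]; rewrite pE// r0 /=.
  exact: le_trans rs sT.
pose d := P 0 * t `^ (- alpha) + cd * gamma1 alpha * subord P2 t.
have cP2' := continuous_subord cP2 P2K.
have dI : is_derive t 1 (fun x => \int[mu]_(s in `]0, x]) subord P2 s) (subord P2 t).
  have tu : t < t + 1 by rewrite ltrDl.
  have ii : mu.-integrable [set` Interval (BRight 0) (BRight (t + 1))] (EFin \o subord P2).
    apply: (@integrableS _ _ _ mu `[0, t + 1]) => //.
      by move=> x; rewrite /= !in_itv /= => /andP[/ltW -> ->].
    apply: continuous_compact_integrable; first exact: segment_compact.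
    by apply: continuous_subspaceT => x; exact: cP2'.
  have ax : (BRight (0 : R) < BRight t)%O by rewrite bnd_simp.
  have [] := continuous_FTC1 tu ii ax (cP2' t).
  by rewrite derive1E => h1 h2; apply: DeriveDef.
have dH : is_derive t 1 H d.
  have dp := is_derive1_powR (1 - alpha) t0.
  apply: (is_derive_eq (is_deriveD (is_deriveZ (P 0 / (1 - alpha)) dp)
     (is_deriveZ (cd * gamma1 alpha) dI))).
  rewrite /GRing.scale /= /d mulrA divfK ?gt_eqF//; congr (_ * t `^ _ + _).
  by ring.
exists d; last first.
  rewrite G0 pE ?lexx ?(le_trans (ltW t0))// subord0//.
  rewrite /d powRN; field; rewrite g1.
  by rewrite gt_eqF ?powR_gt0.
have := @ex_derive _ _ _ _ _ _ _ dH; rewrite /derivable => cv.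
have dE : 'D_1 H t = d by exact: derive_val.
have lim : (h^-1 *: (H (h *: (1 : R) + t) - H t)) @[h --> (0 : R)^'] --> d.
  by rewrite -dE; exact: cv.
apply/cvgrPdist_lt => e e0; move/cvgrPdist_lt: lim => /(_ e e0).
rewrite /dnbhs !near_withinE => h.
have c1 : s - t @[s --> t] --> (0 : R).
  by rewrite -(subrr t); apply: cvgB; [exact: cvg_id|exact: cvg_cst].
have h2 : \forall s \near t, s - t != 0 ->
    `|d - (s - t)^-1 *: (H ((s - t) *: 1 + t) - H t)| < e := c1 _ h.
near=> s; have hs : s - t != 0 -> `|d - (s - t)^-1 *: (H ((s - t) *: 1 + t) - H t)| < e.
  by near: s; exact: h2.
move=> /= st sT; rewrite !AE ?t0//.
by move: hs; rewrite /GRing.scale /= mulr1 subrK mulrC subr_eq0; apply.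
Unshelve. all: by end_near. Qed.

End subordination.

(** * The Mellin-Barnes integral as a mixture of Gaussians *)
Section foxH.
Context {R : realType}.
Local Notation Re := complex.Re.
Local Notation Im := complex.Im.
Local Notation C := R[i].
Local Notation normc := ComplexField.Normc.normc.
Notation mu := (@lebesgue_measure R).
Local Notation D := (`]0, +oo[%classic : set R).

Let mD : measurable (D : set (measurableTypeR R)). Proof. exact: measurable_itv. Qed.
Let mln : measurable_fun setT (@ln R). Proof. exact: measurable_ln. Qed.
Let Dgt0 x : D x -> 0 < x. Proof. by rewrite /= in_itv /= andbT. Qed.

Lemma cGamma_gam (w : C) : 0 < Re w -> cGamma w = gam w 1.
Proof.
move=> w0; rewrite /cGamma w0 addr0 big_ord0 divr1 /euler_integral /gam.
apply: (@eq_cintegral _ D) => u _; rewrite /cpowR -cexp_real -cexpD /gint.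
by congr cexp; rewrite rmorphN /= mul1r.
Qed.

Variables (alpha beta sigma z : R).
Hypotheses (a01 : 0 < alpha < 1) (sb : sigma < beta) (s1 : sigma < 1) (z0 : 0 < z).
Let a0 : 0 < alpha. Proof. by case/andP: a01. Qed.
Let a1 : alpha < 1. Proof. by case/andP: a01. Qed.
Local Notation M := (mfun alpha).
Local Notation B := (mbound alpha).
Let c : R := kappa alpha / 2.
Let c0 : 0 < c. Proof. by rewrite divr_gt0// kappa_gt0. Qed.

Let b : R := beta - sigma.
Let b0 : 0 < b. Proof. by rewrite subr_gt0. Qed.

Let g (tau : R) : C := gam (b +i* (- tau)) 1.

Let gint_cont (u t : R) :
  {for t, continuous (fun t => Re (gint (b +i* (- t)) 1 u))} /\
  {for t, continuous (fun t => Im (gint (b +i* (- t)) 1 u))}.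
Proof.
have h1 : cder (fun t => b +i* (- t)) t (0 +i* (- 1)).
  split => /=; first exact: is_derive_cst.
  by apply: is_derive_eq.
have h2 := cderM (cderD h1 (cder_cst (- 1) t)) (cder_cst ((ln u)%:C) t).
exact: (cder_continuous (cder_cexp (cderD h2 (cder_cst (- (1 * u%:C)) t)))).
Qed.

Let mg : cmeasurable g.
Proof.
have gb (x u : R) : normc (gint (b +i* (- x)) 1 u) <= expR ((b - 1) * ln u - 1 * u).
  by rewrite normc_gint.
have ig := integrable_gamma b0 ltr01.
have tt (t : R) : t - 1 < t < t + 1 by apply/andP; split; lra.
split; apply: continuous_measurable_fun => t.
  apply: (@continuous_Rintegral _ _ _ mu D (fun t u => Re (gint (b +i* (- t)) 1 u)) _ t (t - 1) (t + 1) mD (tt t) _ _ ig).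
  - by move=> x _; apply: measurable_funTS; have [] := cmeasurable_gint (b +i* (- x)) 1.
  - by move=> x u _ _; have [] := gint_cont u x.
  - by move=> x u _ _; exact: le_trans (normr_Re_le _) (gb x u).
apply: (@continuous_Rintegral _ _ _ mu D (fun t u => Im (gint (b +i* (- t)) 1 u)) _ t (t - 1) (t + 1) mD (tt t) _ _ ig).
- by move=> x _; apply: measurable_funTS; have [] := cmeasurable_gint (b +i* (- x)) 1.
- by move=> x u _ _; have [] := gint_cont u x.
- by move=> x u _ _; exact: le_trans (normr_Im_le _) (gb x u).
Qed.

Let e (u tau : R) : C := cexp (0 +i* (tau * (ln z - ln u))).
Let pw (u : R) : R := expR (sigma * (ln z - ln u)).
Let F (u tau : R) : C := (M u * pw u)%:C * (g tau * e u tau).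

Let ne u tau : normc (e u tau) = 1.
Proof. by rewrite normc_cexp expR0. Qed.

Let mpw : measurable_fun setT pw.
Proof.
apply: measurableT_comp => //; apply: measurable_funM => //.
by apply: measurable_funB.
Qed.

Let me : cmeasurable (fun w : R * R => e w.1 w.2).
Proof.
have m2 := @measurable_snd _ _ (measurableTypeR R) (measurableTypeR R).
have m1 := @measurable_fst _ _ (measurableTypeR R) (measurableTypeR R).
apply: cmeasurable_cexp; split => /=; first exact: measurable_cst.
apply: measurable_funM => //; apply: measurable_funB => //.
exact: (measurableT_comp mln m1).
Qed.

Let mF : cmeasurable (fun w : R * R => F w.1 w.2).
Proof.
have m2 := @measurable_snd _ _ (measurableTypeR R) (measurableTypeR R).
have m1 := @measurable_fst _ _ (measurableTypeR R) (measurableTypeR R).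
apply: cmeasurableM.
  apply: cmeasurable_real; apply: measurable_funM.
    exact: (measurableT_comp (measurable_mfun a01) m1).
  exact: (measurableT_comp mpw m1).
apply: cmeasurableM; last exact: me.
exact: (cmeasurable_comp m2 mg).
Qed.

Let w_ (tau : R) : C := sigma +i* tau.

Let Fmellin (u tau : R) : F u tau =
  g tau * cexp (w_ tau * (ln z)%:C) * ((M u)%:C * cexp (- (w_ tau * (ln u)%:C))).
Proof.
rewrite /F rmorphM /= -cexp_real.
have -> : cexp (w_ tau * (ln z)%:C) = cexp ((sigma * (ln z - ln u))%:C) * e u tau * cexp (w_ tau * (ln u)%:C).
  rewrite -!cexpD; congr cexp; apply: complex_ext; rewrite !csimp /=; ring.
have n0 := cexp_neq0 (w_ tau * (ln u)%:C).
by rewrite cexpN; field.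
Qed.

(** Over the contour, only Gamma of the first parameter and the power of [z / u]
    are left, a Cahen-Mellin integral. *)
Let Fgauss (u : R) : 0 < u -> cintegral setT (F u) =
  (2 * pi)%:C * (M u * expR (beta * ln (z / u) - z / u))%:C.
Proof.
move=> u0; have [K HK] := gam_decay b0.
have ige : cintegrable setT (fun tau => g tau * e u tau).
  apply: (cintegrable_dom (@measurableT _ _) (g := fun tau => K * (1 + tau ^+ 2)^-1)).
  - apply: cmeasurableM => //.
    have mp : measurable_fun setT (fun t : R => (u, t)) by exact: measurable_pair1.
    exact: (cmeasurable_comp mp me).
  - move=> tau _; rewrite ComplexField.Normc.normcM ne mulr1 -[tau ^+ 2]sqrrN.
    exact: HK.
  - by apply: integrableRZ => //; exact: integrable_invDx2.
rewrite /F (cintegralZ (@measurableT _ _) _ ige).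
have zu : 0 < z / u by rewrite divr_gt0.
have lzu : ln (z / u) = ln z - ln u by rewrite ln_div ?posrE.
have := Cahen_Mellin b0 zu; rewrite lzu => CM.
rewrite [X in _ * X]CM.
have -> : gint b%:C 1 (z / u) = (expR ((b - 1) * ln (z / u) - z / u))%:C.
  by rewrite -cexp_real /gint; congr cexp; rewrite !(rmorphB, rmorphM) /= mul1r.
rewrite -!rmorphM; congr (_%:C); rewrite /pw -lzu.
have zE : z / u = expR (ln (z / u)) by rewrite lnK.
set l := ln (z / u) in zE *; rewrite zE.
have -> : expR (beta * l - expR l) = expR (sigma * l) * (expR l * expR ((b - 1) * l - expR l)).
  by rewrite -!expRD; congr expR; rewrite /b; ring.
by ring.
Qed.

(** Under the Mellin-Barnes integral, the quotient of the two other Gamma factors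
    is the Mellin transform of the M-function ([Mellin_mfun]); exchanging the
    integrals leaves [Fgauss]. For [sigma < Num.min beta 1] all arguments of Gamma
    have positive real part. *)
Lemma foxH_mixture : foxH2012 sigma 1 alpha beta 1 1 1 z =
  (\int[mu]_(u in D) (M u * expR (beta * ln (z / u) - z / u)))%:C.
Proof.
have [K HK] := gam_decay b0.
have B0 : 0 <= B by exact: mbound_ge0.
have s1' : 0 < 1 - sigma by rewrite subr_gt0.
have ig := integrable_gamma s1' c0.
set J := \int[mu]_(u in D) expR ((1 - sigma - 1) * ln u - c * u) in ig *.
pose k (w : R * R) : R := (B * expR (sigma * ln z) * expR ((1 - sigma - 1) * ln w.1 - c * w.1)) *
   (K * (1 + w.2 ^+ 2)^-1).
have m2 := @measurable_snd _ _ (measurableTypeR R) (measurableTypeR R).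
have m1 := @measurable_fst _ _ (measurableTypeR R) (measurableTypeR R).
have mk : measurable_fun setT k.
  apply: measurable_funM; apply: measurable_funM => //.
    apply: measurableT_comp => //; apply: measurable_funB; apply: measurable_funM => //.
    exact: (measurableT_comp mln m1).
  apply: (measurableT_comp measurable_invr); apply: measurable_funD => //.
  exact: measurable_funX.
have Fk u tau : D u -> setT tau -> normc (F u tau) <= k (u, tau).
  move=> /Dgt0 u0 _; have -> : k (u, tau) = (B * expR (sigma * ln z) * expR ((1 - sigma - 1) * ln u - c * u)) *
     (K * (1 + tau ^+ 2)^-1) by [].
  rewrite !ComplexField.Normc.normcM ne mulr1 normc_real.
  apply: ler_pM; [exact: normr_ge0|exact: normc_ge0| |]; last first.
    by rewrite -[tau ^+ 2]sqrrN; exact: HK.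
  rewrite normrM [`|pw u|]gtr0_norm ?expR_gt0//.
  have -> : B * expR (sigma * ln z) * expR ((1 - sigma - 1) * ln u - c * u) =
      B * expR (- (c * u)) * pw u.
    have e1 : expR (sigma * ln z) * expR ((1 - sigma - 1) * ln u - c * u) = expR (- (c * u)) * pw u.
      by rewrite /pw -!expRD; congr expR; ring.
    by rewrite -[LHS]mulrA e1 mulrA.
  by rewrite ler_wpM2r ?expR_ge0//; exact: mfun_bound.
have ih : mu.-integrable setT (EFin \o (fun tau : R => B * expR (sigma * ln z) * J * K * (1 + tau ^+ 2)^-1)).
  by apply: integrableRZ => //; exact: integrable_invDx2.
have kh (tau : R) : setT tau -> \int[mu]_(u in D) k (u, tau) <=
    B * expR (sigma * ln z) * J * K * (1 + tau ^+ 2)^-1.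
  move=> _.
  have := RintegralZl (B * expR (sigma * ln z) * (K * (1 + tau ^+ 2)^-1)) mD ig.
  rewrite -/J => e1.
  rewrite le_eqVlt; apply/orP; left; apply/eqP.
  transitivity (\int[mu]_(u in D) (B * expR (sigma * ln z) * (K * (1 + tau ^+ 2)^-1) *
     expR ((1 - sigma - 1) * ln u - c * u))).
    by apply: eq_Rintegral => u _; rewrite /k /=; ring.
  by rewrite e1; ring.
have ik (tau : R) : setT tau -> mu.-integrable D (fun u => (k (u, tau))%:E).
  move=> _.
  have i1 := integrableRZ mD (B * expR (sigma * ln z) * (K * (1 + tau ^+ 2)^-1)) ig.
  apply: (@eq_integrable _ _ _ mu D mD (EFin \o (fun u => B * expR (sigma * ln z) * (K * (1 + tau ^+ 2)^-1) *
     expR ((1 - sigma - 1) * ln u - c * u))) _ _ i1).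
  by move=> u _; rewrite /k /=; congr EFin; ring.
have Gs (tau : R) : 0 < Re (1 - w_ tau) by rewrite !csimp.
have Ga (tau : R) : 0 < Re (1 - alpha%:C * w_ tau).
  by rewrite !csimp /= mul0r; have := a0; have := a1; have := s1 => *; nra.
have w1 (tau : R) : Re (w_ tau) < 1 by exact: s1.
have inner (tau : R) : setT tau -> cintegral D (F^~ tau) =
    cGamma (beta%:C - (1 : R)%:C * w_ tau) * cGamma ((1 : R)%:C - (1 : R)%:C * w_ tau)
    / cGamma ((1 : R)%:C - alpha%:C * w_ tau) * cpowR z (w_ tau).
  move=> _; have [iM eM] := Mellin_mfun a01 (w1 tau).
  transitivity (cintegral D (fun u => g tau * cexp (w_ tau * (ln z)%:C) *
     ((M u)%:C * cexp (- (w_ tau * (ln u)%:C))))).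
    by apply: (@eq_cintegral _ D) => u _; exact: Fmellin.
  rewrite (cintegralZ mD _ iM) eM.
  have bw : beta%:C - (1 : R)%:C * w_ tau = b +i* (- tau).
    by apply: complex_ext; rewrite !csimp /=; rewrite /b; ring.
  have g1 : cGamma (beta%:C - (1 : R)%:C * w_ tau) = g tau.
    by rewrite bw cGamma_gam.
  have g2 : cGamma ((1 : R)%:C - (1 : R)%:C * w_ tau) = gam (1 - w_ tau) 1.
    by rewrite mul1r cGamma_gam.
  have g3 : cGamma ((1 : R)%:C - alpha%:C * w_ tau) = gam (1 - alpha%:C * w_ tau) 1.
    by rewrite cGamma_gam.
  by rewrite g1 g2 g3 /cpowR; ring.
have [j1 j2 _] := cFubini mD (@measurableT _ (measurableTypeR R)) mF mk Fk ik kh ih.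
have p0 : (2 * pi : R) != 0 by rewrite mulf_neq0 ?pnatr_eq0// gt_eqF ?pi_gt0.
have pV := complexV p0.
have ii : 'i%C * 'i%C = -1 :> C by rewrite -expr2 sqr_i.
have i0 : 'i%C != 0 :> C.
  by apply/eqP => h; move/eqP: ii; rewrite h mul0r eq_sym oppr_eq0 oner_eq0.
have e2pi : 2 * pi%:C = (2 * pi)%:C :> C by rewrite rmorphM /= rmorph_nat.
have p1 : (2 * pi)%:C != 0 :> C.
  by apply/eqP => h; move: pV; rewrite h mul0r => /eqP; rewrite eq_sym oner_eq0.
clear pV ii.
have eD : cintegral D (fun u => cintegral setT (F u)) = (2 * pi)%:C *
    (\int[mu]_(u in D) (M u * expR (beta * ln (z / u) - z / u)))%:C.
  have ed u : D u -> cintegral setT (F u) = ((2 * pi) * (M u * expR (beta * ln (z / u) - z / u)))%:C.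
    by move=> /Dgt0 u0; rewrite Fgauss// -rmorphM.
  have iR : mu.-integrable D (EFin \o (fun u => (2 * pi) * (M u * expR (beta * ln (z / u) - z / u)))).
    have [i1 _] := j1.
    apply: (@eq_integrable _ _ _ mu D mD _ _ _ i1) => u; rewrite inE => Du.
    by rewrite compE ed.
  transitivity (cintegral D (fun u => ((2 * pi) * (M u * expR (beta * ln (z / u) - z / u)))%:C)).
    by apply: (@eq_cintegral _ D) => u Du; exact: ed.
  rewrite cintegral_real// -rmorphM; congr (_%:C).
  have iR2 : mu.-integrable D (EFin \o (fun u => M u * expR (beta * ln (z / u) - z / u))).
    have i3 := integrableRZ mD (2 * pi)^-1 iR.
    apply: (@eq_integrable _ _ _ mu D mD _ _ _ i3) => u _.
    by rewrite /= mulKf.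
  exact: (RintegralZl (2 * pi) mD iR2).
rewrite /foxH2012 e2pi.
have -> : cintegral setT (fun tau => let s := sigma +i* tau in
    cGamma (beta%:C - (1 : R)%:C * s) * cGamma ((1 : R)%:C - (1 : R)%:C * s)
    / cGamma ((1 : R)%:C - alpha%:C * s) * cpowR z s * 'i%C) =
    'i%C * cintegral setT (fun tau => cintegral D (F^~ tau)).
  rewrite -(cintegralZ (@measurableT _ (measurableTypeR R)) _ j2).
  by apply: (@eq_cintegral _ setT) => tau _; rewrite (inner tau I) mulrC.
have [_ _ <-] := cFubini mD (@measurableT _ (measurableTypeR R)) mF mk Fk ik kh ih.
rewrite eD; clear eD j1 j2.
have alg (p i X : C) : p != 0 -> i != 0 -> (p * i)^-1 * (i * (p * X)) = X.
  by move=> p0' i0'; field; rewrite i0' p0'.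
exact: alg p1 i0.
Qed.

End foxH.

(** * Lebesgue measure in dimension n *)
(** A change of variables established for nonnegative extended-real functions
    extends to real ones through their positive and negative parts. *)
Section change_of_variables.
Context {R : realType} d (T : measurableType d) (m : {measure set T -> \bar R}).
Variables (phi : T -> T) (k : R).
Hypotheses (k0 : 0 < k) (mphi : measurable_fun setT phi).
Hypothesis phiE : forall F : T -> \bar R, measurable_fun setT F ->
  (forall u, 0 <= F u)%E -> (\int[m]_u F (phi u) = k%:E * \int[m]_u F u)%E.

Lemma Rintegral_change (f : T -> R) : measurable_fun setT f ->
  \int[m]_u f (phi u) = k * \int[m]_u f u.
Proof.
move=> mf; rewrite /Rintegral.
have mEf : measurable_fun setT (EFin \o f) by exact/measurable_EFinP.
have -> : (\int[m]_u (f (phi u))%:E = k%:E * \int[m]_u ((EFin \o f)^\+) u -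
    k%:E * \int[m]_u ((EFin \o f)^\-) u)%E.
  rewrite (@integralE _ _ R m setT (fun x => (f (phi x))%:E)).
  rewrite -(phiE (measurable_funepos mEf))// -(phiE (measurable_funeneg mEf))//.
  apply: (congr2 (fun u v => u - v)%E).
    by apply: eq_integral => x _; rewrite ?funeposE ?funenegE.
  by apply: eq_integral => x _; rewrite ?funeposE ?funenegE.
rewrite [in RHS]integralE.
set p := (\int[m]_u ((EFin \o f)^\+) u)%E; set q := (\int[m]_u ((EFin \o f)^\-) u)%E.
have p0 : (0 <= p)%E by exact: integral_ge0.
have q0 : (0 <= q)%E by exact: integral_ge0.
have k1 : (0 < k%:E)%E by rewrite lte_fin.
move: (p) (q) p0 q0 => [{}p| |] [{}q| |] // _ _;
  rewrite ?gt0_muley//= ?mulr0//.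
by rewrite mulrBr.
Qed.

Lemma integrable_change (f : T -> R) : m.-integrable setT (EFin \o f) ->
  m.-integrable setT (EFin \o (fun u => f (phi u))).
Proof.
move=> /integrableP[mf fi]; apply/integrableP; split.
  by apply/measurable_EFinP; apply: (measurableT_comp _ mphi); exact/measurable_EFinP.
have -> : (\int[m]_x `|(EFin \o (fun u => f (phi u))) x| = k%:E * \int[m]_x `|(EFin \o f) x|)%E.
  rewrite -phiE//; exact: measurableT_comp.
by rewrite lte_mul_pinfty// lee_fin ltW.
Qed.

End change_of_variables.

Section lebn.
Context {R : realType}.
Notation mu := (@lebesgue_measure R).
Local Notation tup n := (n.-tuple (measurableTypeR R)).

Lemma measurable_rowcoord n (i : 'I_n) :
  measurable_fun setT (fun u : tup n => row_of_tuple u 0 i).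
Proof.
rewrite (_ : (fun _ => _) = (fun u : tup n => tnth u i)).
  exact: measurable_tnth.
by apply/funext => u; rewrite /row_of_tuple mxE.
Qed.

(** A continuous function is the limit of its values on finer and finer grids,
    and those have countable range. *)
Lemma measurable_continuous_row n (f : 'rV[R]_n -> R) : continuous f ->
  measurable_fun setT (fun u : tup n => f (row_of_tuple u)).
Proof.
move=> cf.
pose h (k : nat) (z : {ffun 'I_n -> int}) : 'rV[R]_n :=
  \row_(i < n) ((z i)%:~R / k.+1%:R).
pose q (k : nat) (u : tup n) : {ffun 'I_n -> int} :=
  [ffun i => Num.floor (k.+1%:R * tnth u i)].
have mq k z : measurable [set u : tup n | q k u = z].
  rewrite (_ : [set _ | _] = \bigcap_(i in [set: 'I_n])
      ((fun u : tup n => tnth u i) @^-1` [set x : R | Num.floor (k.+1%:R * x) = z i])); last first.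
    apply/seteqP; split => u /=.
      by move=> <- i _ /=; rewrite ffunE.
    by move=> h1; apply/ffunP => i; rewrite ffunE; exact: h1.
  apply: fin_bigcap_measurable => // i _.
  rewrite -[X in measurable X]setTI; apply: (@measurable_tnth _ (measurableTypeR R) n i) => //.
  rewrite (_ : [set _ | _] = [set` `[(z i)%:~R / k.+1%:R, (z i + 1)%:~R / k.+1%:R[ ]); last first.
    apply/seteqP; split => x /=; rewrite in_itv /= ler_pdivrMr// ltr_pdivlMr//.
      by move=> <-; rewrite [x * _]mulrC floor_le_tmp floorD1_gt.
    move=> /andP[h1 h2]; apply: floor_def; rewrite ![_ * x]mulrC.
    by rewrite h1 h2.
  exact: measurable_itv.
apply: (@measurable_fun_cvg _ _ R setT (fun k u => f (h k (q k u)))).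
- move=> k; move=> _ B mB; rewrite setTI.
  rewrite (_ : _ @^-1` _ = \bigcup_z (if f (h k z) \in B then [set u : tup n | q k u = z] else set0)).
    apply: countable_bigcupT_measurable; first exact: countableP.
    by move=> z; case: ifP.
  apply/seteqP; split => u /=.
    by move=> Bu; exists (q k u) => //=; rewrite mem_set.
  by move=> [z _ /=]; case: ifPn => // /set_mem Bz zE; move: Bz; rewrite -zE.
- move=> u _.
  apply: (cvg_comp (fun k => h k (q k u)) f); last exact: cf.
  apply/cvg_ballP => e e0.
  have he : \forall k \near \oo, (k.+1%:R : R)^-1 < e by exact: (near_infty_natSinv_lt (PosNum e0)).
  near=> k; split => // i j; rewrite /ball /= !mxE ffunE.
  have k0 : (0 : R) < k.+1%:R by rewrite ltr0n.
  have /andP[h1 h2] := floor_itv (k.+1%:R * tnth u j).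
  have hk : (k.+1%:R : R)^-1 < e by near: k; exact: he.
  have d0 : 0 <= tnth u j - (Num.floor (k.+1%:R * tnth u j))%:~R / k.+1%:R.
    by rewrite subr_ge0 ler_pdivrMr// mulrC; move: h1; rewrite mulrC.
  apply: le_lt_trans hk; rewrite (ger0_norm d0) [_ / _]mulrC.
  rewrite -(ler_pM2l k0) mulrBr mulVKf ?gt_eqF// divff ?gt_eqF//.
  by rewrite lerBlDr addrC ltW//; move: h2; rewrite rmorphD.
Unshelve. all: by end_near. Qed.

(** One coordinate split off; the inductions on the dimension run through it. *)
Lemma lebn_Tonelli n (F : tup n.+1 -> \bar R) : measurable_fun setT F ->
  (forall u, 0 <= F u)%E ->
  (\int[@lebn R n.+1]_u F u = \int[mu]_x \int[@lebn R n]_u F (tcons (x, u)))%E.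
Proof.
move=> mF F0.
pose m2 := [the {sigma_finite_measure set (tup n) -> \bar R} of @lebn R n].
pose p := [the {measure set _ -> \bar R} of (mu \x m2)%E].
pose q : {measure set _ -> \bar R} :=
  @measure_function_pushforward__canonical__measure_function_Measure
    _ _ _ _ R p (@tcons R n) (@measurable_tcons R n).
rewrite (eq_measure_integral q)//.
rewrite (@ge0_integral_pushforward _ _ _ _ R (@tcons R n) (@measurable_tcons R n) p setT F)//.
rewrite preimage_setT (fubini_tonelli1 (m1 := mu) (m2 := m2))//.
  by apply: measurableT_comp => //; exact: measurable_tcons.
by move=> z; exact: F0.
Qed.

(** The translation vector is a sequence, so that its tail still makes sense one
    dimension lower. *)
Definition aff n (r : R) (a : nat -> R) (u : tup n) : tup n :=
  [tuple (r * tnth u i + a i) | i < n].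

Lemma measurable_aff n r a : measurable_fun setT (@aff n r a).
Proof.
apply/measurable_fun_tnthP => i.
rewrite (_ : _ \o _ = (fun u : tup n => r * tnth u i + a i)).
  apply: measurable_funD => //; apply: measurable_funM => //.
  exact: measurable_tnth.
by apply/funext => u; rewrite /= tnth_mktuple.
Qed.

Lemma aff_tcons n r a x (u : tup n) :
  aff r a (tcons (x, u)) = tcons (r * x + a 0%N, aff r (fun i => a i.+1) u).
Proof.
apply: eq_from_tnth => i; rewrite tnth_mktuple; case: (unliftP ord0 i) => [j ->|->].
  by rewrite !tnthS tnth_mktuple.
by rewrite !tnth0.
Qed.

Lemma ge0_integral_aff n (r : R) (a : nat -> R) (F : tup n -> \bar R) : 0 < r ->
  measurable_fun setT F -> (forall u, 0 <= F u)%E ->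
  (\int[@lebn R n]_u F (aff r a u) = (r ^- n)%:E * \int[@lebn R n]_u F u)%E.
Proof.
move=> r0; elim: n a F => [|n IH] a F mF F0.
  rewrite expr0 invr1 mul1e; apply: eq_integral => u _; congr F.
  by apply: eq_from_tnth; case.
have mFa : measurable_fun setT (fun u => F (aff r a u)).
  by apply: measurableT_comp => //; exact: measurable_aff.
rewrite !lebn_Tonelli//.
pose G (x : R) : \bar R := (\int[@lebn R n]_u F (tcons (x, u)))%E.
pose m2 := [the {sigma_finite_measure set (tup n) -> \bar R} of @lebn R n].
have mFt : measurable_fun setT (F \o @tcons R n).
  by apply: measurableT_comp => //; exact: measurable_tcons.
have mG : measurable_fun setT G.
  apply: (measurable_fun_fubini_tonelli_F (m2 := m2) (F \o @tcons R n)) => //.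
  by move=> z; exact: F0.
have G0 x : (0 <= G x)%E by exact: integral_ge0.
have e x : (\int[@lebn R n]_u F (aff r a (tcons (x, u))) = (r ^- n)%:E * G (r * x + a 0%N)%R)%E.
  have mFx : measurable_fun setT (fun u : tup n => F (tcons (r * x + a 0%N, u))).
    have mp : measurable_fun setT (fun u : tup n => (r * x + a 0%N, u)) by exact: measurable_pair1.
    exact: (measurableT_comp mFt mp).
  rewrite /G -(IH (fun i => a i.+1) _ mFx)//.
  by apply: eq_integral => u _; rewrite aff_tcons.
under eq_integral do rewrite e.
have rn0 : 0 <= r ^- n by rewrite invr_ge0 exprn_ge0// ltW.
have rn : r != 0 by rewrite gt_eqF.
have mGa : measurable_fun setT (fun x : R => G (r * x + a 0%N)).
  by apply: (measurableT_comp mG); apply: measurable_funD => //; exact: measurable_funM.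
have Ga0 (x : R) : setT x -> (0 <= G (r * x + a 0%N)%R)%E by move=> _; exact: G0.
rewrite (ge0_integralZl mu measurableT mGa Ga0 _); last by rewrite lee_fin.
have := @ge0_integral_affine R r (a 0%N) rn G mG G0.
rewrite (gtr0_norm r0) => eG.
rewrite -[X in _ = (_ * X)%E]/(\int[mu]_x G x)%E eG muleA -EFinM.
have -> : r ^- n.+1 * r = r ^- n by rewrite exprS; field; rewrite rn expf_neq0.
reflexivity.
Qed.

Lemma ge0_integral_prod n (f : 'I_n -> R -> R) (I : 'I_n -> R) :
  (forall i, measurable_fun setT (f i)) -> (forall i x, 0 <= f i x) ->
  (forall i, \int[mu]_x (f i x)%:E = (I i)%:E)%E ->
  (\int[@lebn R n]_u (\prod_(i < n) f i (tnth u i))%:E = (\prod_(i < n) I i)%:E)%E.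
Proof.
elim: n f I => [|n IH] f I mf f0 fI.
  rewrite big_ord0 (eq_integral (fun=> 1%E)); last by move=> u _; rewrite big_ord0.
  by rewrite integral_cst// /lebn /= diracT mule1.
have mp k (g : 'I_k -> R -> R) : (forall i, measurable_fun setT (g i)) ->
    measurable_fun setT (fun u : tup k => \prod_(i < k) g i (tnth u i)).
  move=> mg; apply: measurable_prod => i _.
  exact: (measurableT_comp (mg i) (@measurable_tnth _ (measurableTypeR R) k i)).
rewrite lebn_Tonelli//; last 2 first.
- by apply/measurable_EFinP; exact: mp.
- by move=> u; rewrite lee_fin prodr_ge0.
have I0 i : 0 <= I i.
  by rewrite -lee_fin -fI; apply: integral_ge0 => x _; rewrite lee_fin.
have P0 : (0 <= (\prod_(i < n) I (lift ord0 i))%:E)%E by rewrite lee_fin prodr_ge0.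
have J0 (x : R) : setT x -> (0 <= (f ord0 x)%:E)%E by rewrite lee_fin.
have mE : measurable_fun setT (fun x => (f ord0 x)%:E) by exact/measurable_EFinP.
rewrite [in RHS]big_ord_recl EFinM -fI muleC -(ge0_integralZl mu measurableT mE J0 P0).
apply: eq_integral => x _; rewrite -(IH (fun i => f (lift ord0 i)) (fun i => I (lift ord0 i)))//.
pose g (u : tup n) : R := \prod_(i < n) f (lift ord0 i) (tnth u i).
have mg : measurable_fun setT (fun u => (g u)%:E) 
  by apply/measurable_EFinP; exact: (mp n (fun i => f (lift ord0 i)) (fun i => mf _)).
have g0 (u : tup n) : setT u -> (0 <= (g u)%:E)%E by move=> _; rewrite lee_fin prodr_ge0.
rewrite muleC -(ge0_integralZl (@lebn R n) measurableT mg g0 (J0 x Logic.I)).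
apply: eq_integral => u _; rewrite big_ord_recl tnth0 -EFinM; congr (_ * _)%:E.
by apply: eq_bigr => i _; rewrite tnthS.
Qed.

(** Presents a row vector as a translation for [aff]. *)
Definition rowfun n (a : 'rV[R]_n) (i : nat) : R :=
  if insub i is Some j then a 0 j else 0.

Lemma row_aff n (r : R) (a : 'rV[R]_n) (u : tup n) :
  row_of_tuple (aff r (rowfun a) u) = r *: row_of_tuple u + a.
Proof.
by apply/rowP => i; rewrite !mxE tnth_mktuple /rowfun valK.
Qed.

Lemma intRn_affine n (r : R) (a : 'rV[R]_n) (f : 'rV[R]_n -> R) : 0 < r ->
  measurable_fun setT (fun u : tup n => f (row_of_tuple u)) ->
  intRn (fun x => f (r *: x + a)) = r ^- n * intRn f.
Proof.
move=> r0 mf; rewrite /intRn.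
have rn : 0 < r ^- n by rewrite invr_gt0 exprn_gt0.
rewrite -(@Rintegral_change R _ _ (@lebn R n) (aff r (rowfun a)) (r ^- n) rn _ _ mf).
- by apply: eq_Rintegral => u _; rewrite row_aff.
- by move=> F mF F0; exact: ge0_integral_aff.
Qed.

Lemma integrableRn_affine n (r : R) (a : 'rV[R]_n) (f : 'rV[R]_n -> R) : 0 < r ->
  integrableRn f -> integrableRn (fun x => f (r *: x + a)).
Proof.
move=> r0 fi; rewrite /integrableRn.
have rn : 0 < r ^- n by rewrite invr_gt0 exprn_gt0.
have := @integrable_change R _ _ (@lebn R n) (aff r (rowfun a)) (r ^- n) rn
  (@measurable_aff n r _) _ (fun u => f (row_of_tuple u)).
rewrite (_ : (EFin \o (fun u => f (row_of_tuple (aff r (rowfun a) u)))) =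
  (fun u => (f (r *: row_of_tuple u + a))%:E)); last first.
  by apply/funext => u; rewrite /= row_aff.
apply => //; by move=> F mF F0; exact: ge0_integral_aff.
Qed.

Lemma integrableRn_prod n (f : 'I_n -> R -> R) :
  (forall i, measurable_fun setT (f i)) -> (forall i x, 0 <= f i x) ->
  (forall i, mu.-integrable setT (EFin \o f i)) ->
  integrableRn (fun x => \prod_(i < n) f i (x 0 i)) /\
  intRn (fun x => \prod_(i < n) f i (x 0 i)) = \prod_(i < n) \int[mu]_x f i x.
Proof.
move=> mf f0 fi.
have e : (\int[@lebn R n]_u (\prod_(i < n) f i (tnth u i))%:E =
    (\prod_(i < n) \int[mu]_x f i x)%:E)%E.
  apply: ge0_integral_prod => // i; rewrite /Rintegral fineK//.
  exact: integrable_fin_num (fi i).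
have rE (u : tup n) : \prod_(i < n) f i (row_of_tuple u 0 i) = \prod_(i < n) f i (tnth u i).
  by apply: eq_bigr => i _; rewrite mxE.
split.
  apply/integrableP; split.
    apply/measurable_EFinP; apply: measurable_prod => i _.
    exact: (measurableT_comp (mf i) (measurable_rowcoord i)).
  have -> : (\int[@lebn R n]_u `|(\prod_(i < n) f i (row_of_tuple u 0 i))%:E| =
      \int[@lebn R n]_u (\prod_(i < n) f i (tnth u i))%:E)%E.
    by apply: eq_integral => u _; rewrite rE gee0_abs// lee_fin prodr_ge0.
  by rewrite e ltry.
rewrite /intRn /Rintegral.
have -> : (\int[@lebn R n]_u (\prod_(i < n) f i (row_of_tuple u 0 i))%:E =
    \int[@lebn R n]_u (\prod_(i < n) f i (tnth u i))%:E)%E.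
  by apply: eq_integral => u _; rewrite rE.
by rewrite e.
Qed.

Lemma integrableRn_dom n (f g : 'rV[R]_n -> R) :
  measurable_fun setT (fun u : tup n => f (row_of_tuple u)) ->
  (forall x, `|f x| <= g x) -> integrableRn g -> integrableRn f.
Proof.
by move=> mf fg gi; apply: (integrable_dom measurableT mf _ gi) => u _; exact: fg.
Qed.

Lemma measurable_integrableRn n (f : 'rV[R]_n -> R) : integrableRn f ->
  measurable_fun setT (fun u : tup n => f (row_of_tuple u)).
Proof. by move=> /integrableP[/measurable_EFinP]. Qed.

Lemma integrableRn_mul n (f g : 'rV[R]_n -> R) (K : R) : integrableRn f ->
  measurable_fun setT (fun u : tup n => g (row_of_tuple u)) ->
  (forall x, `|g x| <= K) -> integrableRn (fun x => f x * g x).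
Proof.
move=> fi mg gK; have mf := measurable_integrableRn fi.
have nfi : integrableRn (fun x => K * `|f x|).
  apply: (integrableRZ measurableT K); exact: (integrable_normr fi).
apply: (integrableRn_dom (measurable_funM mf mg) _ nfi) => x.
by rewrite normrM mulrC ler_wpM2r.
Qed.

Lemma normr_intRn_le n (f g : 'rV[R]_n -> R) : integrableRn f -> integrableRn g ->
  (forall x, `|f x| <= g x) -> `|intRn f| <= intRn g.
Proof. by move=> fi gi fg; apply: (normr_Rintegral_le measurableT fi gi) => u _. Qed.

Lemma enorm_coord n (x : 'rV[R]_n) i : `|x 0 i| <= enorm x.
Proof.
rewrite -sqrtr_sqr /enorm ler_wsqrtr//.
by rewrite (bigD1 i)//= lerDl sumr_ge0// => j _; rewrite sqr_ge0.
Qed.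

(** Multiples of indicators of cubes serve as integrable majorants of continuous
    functions with bounded support, because their integrals are products. *)
Definition cube n (r : R) (x : 'rV[R]_n) : R :=
  \prod_(i < n) \1_(`[- r, r]%classic) (x 0 i).

Lemma integrableRn_cube n (r : R) : integrableRn (@cube n r).
Proof.
pose I (x : R) : R := \1_(`[- r, r]%classic) x.
have mI : measurable_fun setT I by exact: measurable_indic.
have I0 x : 0 <= I x by rewrite /I indicE.
have iI : mu.-integrable setT (EFin \o I) by exact: integrable_indic_itv.
by have [] := @integrableRn_prod n (fun=> I) (fun=> mI) (fun _ => I0) (fun=> iI).
Qed.

Lemma cube_ge0 n (r : R) (x : 'rV[R]_n) : 0 <= cube r x.
Proof. by rewrite /cube prodr_ge0// => i _; rewrite indicE. Qed.

Lemma cube1 n (r : R) (x : 'rV[R]_n) : (forall i, `|x 0 i| <= r) -> cube r x = 1.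
Proof.
move=> h; rewrite /cube big1// => i _.
by rewrite indicE mem_set//= in_itv/= -ler_norml.
Qed.

Lemma normr_le_cube n (f : 'rV[R]_n -> R) (K r : R) x : `|f x| <= K ->
  (r < enorm x -> f x = 0) -> `|f x| <= K * cube r x.
Proof.
move=> fK f0; have [h|h] := ltP r (enorm x).
  by rewrite f0// normr0 mulr_ge0 ?cube_ge0//; exact: le_trans fK.
by rewrite cube1 ?mulr1// => i; apply: le_trans h; exact: enorm_coord.
Qed.

Lemma bounded_support n (f : 'rV[R]_n -> R) (r : R) : continuous f ->
  (forall x, r < enorm x -> f x = 0) -> exists K, forall x, `|f x| <= K.
Proof.
move=> cf f0.
pose A := [set x : 'rV[R]_n | `|x| <= r].
have cA : compact A.
  apply: bounded_closed_compact.
    exists r; split; first exact: num_real.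
    by move=> M rM x /= h; apply: le_trans h _; exact: ltW.
  rewrite (_ : A = (fun x : 'rV[R]_n => `|x|) @^-1` [set y | y <= r])//.
  by apply: closed_comp; [move=> x _; exact: norm_continuous|exact: closed_le].
have cfA : {within A, continuous (fun x => `|f x|)}.
  apply: continuous_subspaceT => x; apply: continuous_comp; first exact: cf.
  exact: norm_continuous.
have : compact ((fun x => `|f x|) @` A) by exact: continuous_compact.
move=> /compact_bounded[M [_ hM]].
exists (Num.max 0 (M + 1)) => x; have [h|h] := ltP r (enorm x).
  by rewrite f0// normr0 le_max lexx.
rewrite le_max; apply/orP; right.
have Ax : A x.
  have nE : `|x| = mx_norm x by [].
  rewrite /A /= nE; have [->|] := eqVneq (mx_norm x) 0.
    by apply: le_trans h; rewrite sqrtr_ge0.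
  move=> /mx_norm_neq0[[i j] ->] /=; rewrite (ord1 i); apply: le_trans h.
  exact: enorm_coord.
have M1 : M < M + 1 by rewrite ltrDl.
have := hM (M + 1) M1 `|f x| (ex_intro2 _ _ x Ax erefl).
by move=> /= h'; rewrite -normr_id.
Qed.

Lemma integrableRn_support n (f : 'rV[R]_n -> R) (r : R) : continuous f ->
  (forall x, r < enorm x -> f x = 0) -> integrableRn f.
Proof.
move=> cf f0; have [K fK] := bounded_support cf f0.
have Kc : integrableRn (fun x : 'rV[R]_n => K * cube r x).
  exact: (integrableRZ measurableT K (@integrableRn_cube n r)).
apply: (integrableRn_dom (measurable_continuous_row cf) _ Kc) => x.
by apply: normr_le_cube => //; exact: f0.
Qed.

(** Reduces directional derivatives to one-variable calculus. *)
Lemma is_derive_line n (f : 'rV[R]_n -> R) (x v : 'rV[R]_n) (s : R) :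
  derivable f (x + s *: v) v ->
  is_derive s 1 (fun t : R => f (x + t *: v)) ('D_v f (x + s *: v)).
Proof.
move=> df.
have e : (fun h : R => h^-1 *: ((((fun t : R => f (x + t *: v)) \o shift s) (h *: (1 : R))) -
    f (x + s *: v))) = (fun h : R => h^-1 *: ((f \o shift (x + s *: v)) (h *: v) - f (x + s *: v))).
  apply/funext => h /=; congr (_ *: (f _ - _)).
  by rewrite [h *: 1]mulr1 scalerDl [RHS]addrC addrA addrAC -addrA.
apply: DeriveDef; first by rewrite /derivable e.
by rewrite /derive e.
Qed.

Lemma derive_of_line n (f : 'rV[R]_n -> R) (x v : 'rV[R]_n) (d : R) :
  is_derive (0 : R) 1 (fun t : R => f (x + t *: v)) d ->
  derivable f x v /\ 'D_v f x = d.
Proof.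
move=> [df de].
have e : (fun h : R => h^-1 *: ((((fun t : R => f (x + t *: v)) \o shift 0) (h *: (1 : R))) -
    f (x + 0 *: v))) = (fun h : R => h^-1 *: ((f \o shift x) (h *: v) - f x)).
  apply/funext => h /=; rewrite scale0r !addr0; congr (_ *: (f _ - _)).
  by rewrite ?addr0 [h%:A]mulr1 // [LHS]addrC.
by split; [move: df; rewrite /derivable e|rewrite -de /derive e].
Qed.

(** Room for moving the argument of a function with bounded support in a
    coordinate direction; the factor [n%:R] comes from comparing the Euclidean
    norm with the maximum norm. *)
Lemma enorm_shift n (x : 'rV[R]_n) (i : 'I_n) (s r : R) : `|s| <= 1 -> 0 <= r ->
  n%:R * (r + 1) < enorm x -> r < enorm (x + s *: delta_mx 0 i).
Proof.
move=> s1 r0; apply: contraTT; rewrite -!leNgt => h.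
have hj j : `|x 0 j| <= r + 1.
  have := le_trans (enorm_coord _ j) h; rewrite !mxE /= => hj.
  rewrite -[x 0 j](addrK (s * (j == i)%:R)); apply: le_trans (ler_normB _ _) _.
  apply: lerD; first exact: hj.
  by rewrite normrM; case: eqP => _; rewrite ?normr1 ?mulr1// normr0 mulr0.
have rn0 : 0 <= n%:R * (r + 1) by rewrite mulr_ge0// addr_ge0.
rewrite /enorm -(ger0_norm rn0) -sqrtr_sqr ler_wsqrtr//.
apply: (@le_trans _ _ (\sum_(j < n) (r + 1) ^+ 2)).
  apply: ler_sum => j _; rewrite -real_normK ?num_real//.
  by rewrite ler_pXn2r ?nnegrE ?addr_ge0.
rewrite sumr_const card_ord -[leLHS]mulr_natl exprMn; apply: ler_wpM2r; first exact: sqr_ge0.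
by rewrite -natrX ler_nat; case: (n) => // m; rewrite expnS expn1 leq_pmulr.
Qed.

Lemma pderiv_support n (i : 'I_n) (f : 'rV[R]_n -> R) (r : R) : 0 <= r ->
  (forall x, r < enorm x -> f x = 0) ->
  forall x, n%:R * (r + 1) < enorm x -> pderiv i f x = 0.
Proof.
move=> r0 f0 x hx.
have d0 : is_derive (0 : R) 1 (fun t : R => f (x + t *: delta_mx 0 i)) 0.
  apply: (@near_eq_is_derive _ _ _ (cst (0 : R))).
  have h : \forall s \near (0 : R), `|s| < 1.
    by exists 1 => //= s /=; rewrite sub0r normrN.
  near=> s; apply/esym/f0; have s1 : `|s| < 1 by near: s; exact: h.
  exact: (enorm_shift i (ltW s1) r0 hx).
by have [_] := derive_of_line d0.
Unshelve. all: by end_near. Qed.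

(** The integral of a translate does not depend on the translation; differentiate
    under the integral sign. *)
Lemma intRn_pderiv n (i : 'I_n) (f : 'rV[R]_n -> R) (r : R) :
  continuous f -> (forall x, r < enorm x -> f x = 0) ->
  (forall x, pderivable i f x) -> continuous (pderiv i f) ->
  intRn (pderiv i f) = 0.
Proof.
move=> cf f0r df cdf.
pose r0 := Num.max r 0.
have r00 : 0 <= r0 by rewrite le_max lexx orbT.
have f0 x : r0 < enorm x -> f x = 0 by rewrite gt_max => /andP[/f0r].
have df0 := pderiv_support i r00 f0.
have [K dK] := bounded_support cdf df0.
set r1 := n%:R * (r0 + 1) in df0.
have r10 : 0 <= r1 by rewrite mulr_ge0// addr_ge0.
pose r2 := n%:R * (r1 + 1).
have Kc : (@lebn R n).-integrable setT (EFin \o (fun u : tup n => K * cube r2 (row_of_tuple u))).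
  exact: (integrableRZ measurableT K (@integrableRn_cube n r2)).
pose e : 'rV[R]_n := delta_mx 0 i.
have fi : integrableRn f by exact: integrableRn_support f0.
have fE (s : R) : (fun x => f (1 *: x + s *: e)) = (fun x => f (x + s *: e)).
  by apply/funext => x; rewrite scale1r.
have : is_derive (0 : R) 1 (fun s : R => intRn (fun x => f (x + s *: e)))
    (intRn (fun x => pderiv i f (x + 0 *: e))).
  apply: (@is_derive_under_integral R _ _ (@lebn R n) setT
    (fun s u => f (row_of_tuple u + s *: e))
    (fun s u => pderiv i f (row_of_tuple u + s *: e))
    (fun u => K * cube r2 (row_of_tuple u)) 0 (-1) 1) => //.
  - by rewrite ltrN10 ltr01.
  - by move=> s _; have := @integrableRn_affine n 1 (s *: e) f ltr01 fi; rewrite fE.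
  - move=> s u _ _; exact: (is_derive_line (df (row_of_tuple u + s *: e))).
  - move=> s u s1 _; apply: (@normr_le_cube n (fun x => pderiv i f (x + s *: e))) => //.
    move=> h; apply: df0; apply: enorm_shift => //.
    by move: s1; rewrite -ltr_norml => /ltW.
have -> : (fun x => pderiv i f (x + 0 *: e)) = pderiv i f.
  by apply/funext => x; rewrite scale0r addr0.
have -> : (fun s : R => intRn (fun x => f (x + s *: e))) = cst (intRn f).
  apply/funext => s; rewrite -fE intRn_affine ?expr1n ?invr1 ?mul1r//.
  exact: measurable_continuous_row.
by move=> h; have := is_derive_cst (intRn f) (0 : R) (1 : R) => h'; rewrite -(@derive_val _ _ _ _ _ _ _ h) (@derive_val _ _ _ _ _ _ _ h').
Qed.

End lebn.

(** * The heat kernel *)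
Section heat_kernel.
Context {R : realType}.
Notation mu := (@lebesgue_measure R).

(** [pi `^ (- b) * hk b (|x| ^ 2) v] with [b = n / 2] is the heat kernel of R^n
    at time [v]; lowering or raising [b] accounts for its derivatives. *)
Definition hk (b rho v : R) : R :=
  if 0 < v then expR (- (b * ln (4 * v)) - rho / (4 * v)) else 0.

Lemma hk_ge0 (b rho v : R) : 0 <= hk b rho v.
Proof. by rewrite /hk; case: ifP => // _; exact: expR_ge0. Qed.

Lemma hk_bound_time (b rho v : R) : 0 <= rho -> 0 < v ->
  `|hk b rho v| <= expR (- (b * ln (4 * v))).
Proof.
move=> r0 v0; rewrite ger0_norm ?hk_ge0// /hk v0 ler_expR gerBl.
by rewrite divr_ge0// mulr_ge0// ltW.
Qed.

(** Uniform in time, for [rho] away from [0]: [y ^ b * exp (- y)] is bounded, at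
    [y = rho / (4 * v)]. *)
Lemma hk_bound (b : R) : 0 < b -> exists K, 0 < K /\ forall rho v : R, 0 < rho ->
  `|hk b rho v| <= K * expR (- (b * ln rho)).
Proof.
move=> b0; have [K HK] := ln_le_affine b0 ltr01.
exists (expR K); split; first exact: expR_gt0.
move=> rho v r0; rewrite ger0_norm ?hk_ge0// /hk -expRD; case: ifPn => [v0|_]; last exact: expR_ge0.
have v4 : 0 < 4 * v by rewrite mulr_gt0.
have := HK _ (divr_gt0 r0 v4); rewrite ln_div ?posrE// ler_expR => h.
by rewrite -subr_ge0; move: h; rewrite -subr_ge0; congr (0 <= _); ring.
Qed.

Lemma hk_shift (b rho v : R) : 0 < v -> hk b rho v = 4 * v * hk (b + 1) rho v.
Proof.
move=> v0; have v4 : 0 < 4 * v by rewrite mulr_gt0.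
by rewrite /hk v0 -[X in X * expR _]lnK ?posrE// -expRD; congr expR; ring.
Qed.

Lemma is_derive_hk_space (b rho v : R) :
  is_derive rho 1 (hk b ^~ v) (- hk (b + 1) rho v).
Proof.
rewrite /hk; case: ifPn => v0; last by rewrite oppr0; exact: is_derive_cst.
have v4 : 0 < 4 * v by rewrite mulr_gt0.
have h : is_derive rho 1 (fun r : R => - (b * ln (4 * v)) - r / (4 * v)) (0 - (4 * v)^-1).
  apply: is_deriveB; exact: is_derive_mulr_cst.
have h' := is_derive_comp (is_derive_expR _) h; apply: (is_derive_eq h').
rewrite -[X in _ * (0 - X^-1)]lnK ?posrE// -expRN sub0r mulrN -expRD.
by congr (- expR _); ring.
Qed.

Lemma is_derive_hk_time (b rho v : R) : 0 < v ->
  is_derive v 1 (hk b rho) (- (4 * b) * hk (b + 1) rho v + 4 * rho * hk (b + 2) rho v).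
Proof.
move=> v0; have v4 : 0 < 4 * v by rewrite mulr_gt0.
have d4 : is_derive v 1 (fun w : R => 4 * w) 4.
  have h := is_deriveZ (4 : R) (is_derive_id v (1 : R)).
  by apply: (is_derive_eq h); rewrite [_ *: _]mulr1.
have h : is_derive v 1 (fun w : R => - (b * ln (4 * w)) - rho / (4 * w))
    (- (b * (4 / (4 * v))) - rho * (- 4 * (4 * v)^-1 ^+ 2)).
  apply: is_deriveB.
    apply: is_deriveN; apply: (is_deriveZ b); exact: is_derive_lnf.
  by apply: (is_deriveZ rho); apply: is_derive_invf => //; rewrite gt_eqF.
have := is_derive_comp (is_derive_expR _) h => {}h.
apply: (@near_eq_is_derive _ _ _ (fun w : R => expR (- (b * ln (4 * w)) - rho / (4 * w)))).
  have hv : \forall w \near v, 0 < w by exact: lt_nbhsr.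
  near=> w; rewrite /hk ifT//; near: w; exact: hv.
apply: (is_derive_eq h).
have e k : hk (b + k) rho v = (4 * v)^-1 `^ k * hk b rho v.
  rewrite /hk v0 /powR gt_eqF ?invr_gt0// lnV ?posrE// -expRD.
  by congr expR; ring.
rewrite e powRr1 ?invr_ge0 1?ltW// e -[2]/(2%:R) powR_mulrn ?invr_ge0 1?ltW// /hk v0.
set E := expR _; set w := (4 * v)^-1; rewrite -[4 / (4 * v)]/(4 * w); ring.
Unshelve. all: by end_near. Qed.

(** At [v = 0], [hk_shift] gains a factor [v] against the bound of
    [hk (b + 1)]. *)
Lemma continuous_hk (b rho : R) : 0 < b -> 0 < rho -> continuous (hk b rho).
Proof.
move=> b0 r0 v; have [v0|v0|->] := ltgtP v 0.
- apply: (@near_eq_continuous _ _ (cst 0)); last exact: cst_continuous.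
  have hv : \forall w \near v, w < 0 by exact: lt_nbhsl.
  near=> w; rewrite /hk ifF//; apply/negbTE; rewrite -leNgt ltW//; near: w; exact: hv.
- exact: is_derive_continuous (is_derive_hk_time b rho v0).
have b1 : 0 < b + 1 by rewrite addr_gt0.
have [K [K0 HK]] := hk_bound b1.
apply/cvgrPdist_lt => /= e e0.
pose C := 4 * (K * expR (- ((b + 1) * ln rho))).
have C0 : 0 < C by rewrite !mulr_gt0// expR_gt0.
have h : \forall w \near (0 : R), `|w| < e / C.
  by exists (e / C) => /=; [rewrite divr_gt0|move=> w /=; rewrite sub0r normrN].
near=> w; rewrite [hk b rho 0]/hk ltxx sub0r normrN.
have [w0|w0] := ltP 0 w; last first.
  by rewrite /hk ifF ?normr0//; apply/negbTE; rewrite -leNgt.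
rewrite hk_shift// normrM (gtr0_norm (mulr_gt0 _ w0))//.
apply: (@le_lt_trans _ _ (w * C)).
  by rewrite /C [4 * w]mulrC -!mulrA ler_pM2l// ler_pM2l// HK.
by rewrite -ltr_pdivlMr//; apply: le_lt_trans (ler_norm w) _; near: w; exact: h.
Unshelve. all: by end_near. Qed.

Lemma measurable_hk (b : R) : measurable_fun setT (fun z : R * R => hk b z.1 z.2).
Proof.
have m4 : measurable_fun setT (fun z : R * R => 4 * z.2) by exact: measurable_funM.
apply: measurable_fun_ifT => //.
  by apply: measurable_fun_ltr.
apply: measurableT_comp => //; apply: measurable_funB.
  apply: measurableT_comp => //; apply: measurable_funM => //.
  by apply: measurableT_comp.
by apply: measurable_funM => //; apply: (measurableT_comp measurable_invr).
Qed.

Definition sqn n (x : 'rV[R]_n) : R := \sum_(i < n) x 0 i ^+ 2.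

Lemma sqn_ge0 n (x : 'rV[R]_n) : 0 <= sqn x.
Proof. by apply: sumr_ge0 => i _; exact: sqr_ge0. Qed.

Lemma sqn_gt0 n (x : 'rV[R]_n) : (0 < sqn x) = (x != 0).
Proof.
rewrite lt_neqAle sqn_ge0 andbT eq_sym; congr (~~ _).
apply/eqP/eqP => [h|->]; last by rewrite /sqn big1// => i _; rewrite mxE expr0n.
apply/rowP => i; rewrite mxE; apply/eqP; rewrite -sqrf_eq0; apply/eqP.
by move/psumr_eq0P : h => -> // j _; exact: sqr_ge0.
Qed.

Lemma enorm_sqr n (x : 'rV[R]_n) : enorm x ^+ 2 = sqn x.
Proof. by rewrite /enorm sqr_sqrtr// sqn_ge0. Qed.

Lemma sqnZ n (r : R) (x : 'rV[R]_n) : sqn (r *: x) = r ^+ 2 * sqn x.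
Proof. by rewrite /sqn mulr_sumr; apply: eq_bigr => i _; rewrite mxE exprMn. Qed.

Lemma is_derive_sqn n (x : 'rV[R]_n) (i : 'I_n) (s : R) :
  is_derive s 1 (fun t : R => sqn (x + t *: delta_mx 0 i)) (2 * (x + s *: delta_mx 0 i) 0 i).
Proof.
have -> : (fun t : R => sqn (x + t *: delta_mx 0 i)) =
    \sum_(j < n) (fun t : R => (x 0 j + t * (j == i)%:R) ^+ 2).
  apply/funext => t; rewrite fct_sumE; apply: eq_bigr => j _.
  by rewrite !mxE eqxx.
have h : is_derive s 1 (\sum_(j < n) (fun t : R => (x 0 j + t * (j == i)%:R) ^+ 2))
    (\sum_(j < n) ((j == i)%:R * (x 0 j + s * (j == i)%:R) + (x 0 j + s * (j == i)%:R) * (j == i)%:R)).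
  apply: is_derive_sum => j; apply: is_derive_mul; rewrite -[X in is_derive _ _ _ X]add0r;
  by apply: is_deriveD; exact: is_derive_mulr_cst.
apply: (is_derive_eq h).
rewrite (bigD1 i)//= big1 ?addr0; last by move=> j /negbTE ->; rewrite mul0r mulr0 addr0.
have -> : (i == i) = true by exact: eqxx.
by rewrite !mxE !eqxx /=; ring.
Qed.

Lemma continuous_coord n (i : 'I_n) : continuous (fun x : 'rV[R]_n => x 0 i).
Proof. exact: coord_continuous. Qed.

Lemma continuous_sqn n : continuous (@sqn n).
Proof.
rewrite /sqn; apply: continuous_big; first exact: add_continuous.
by move=> i _ x; exact: (cvgM (@continuous_coord n i x) (@continuous_coord n i x)).
Qed.

(** The profile is a function of the square [sqn y], a polynomial, rather than of
    the norm. *)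
Lemma pderiv_radial n (i : 'I_n) (F F' : R -> R) (x : 'rV[R]_n) :
  is_derive (sqn x) 1 F (F' (sqn x)) ->
  pderivable i (fun y => F (sqn y)) x /\
  pderiv i (fun y => F (sqn y)) x = 2 * x 0 i * F' (sqn x).
Proof.
move=> dF; apply: derive_of_line.
have h := is_derive_sqn x i 0.
have e : sqn (x + 0 *: delta_mx 0 i) = sqn x by rewrite scale0r addr0.
have dF' : is_derive (sqn (x + 0 *: delta_mx 0 i)) 1 F (F' (sqn x)) by rewrite e.
apply: (is_derive_eq (is_derive_comp dF' h)).
by rewrite scale0r addr0 mulrC.
Qed.

Lemma pderiv_radial2 n (i : 'I_n) (F F' F'' : R -> R) (x : 'rV[R]_n) :
  (\forall r \near (sqn x : R), is_derive (r : R) 1 F (F' r)) ->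
  is_derive (sqn x) 1 F' (F'' (sqn x)) ->
  pderivable i (pderiv i (fun y => F (sqn y))) x /\
  pderiv i (pderiv i (fun y => F (sqn y))) x =
    2 * F' (sqn x) + 4 * x 0 i ^+ 2 * F'' (sqn x).
Proof.
move=> dF dF'; apply: derive_of_line.
have e : sqn (x + 0 *: delta_mx 0 i) = sqn x by rewrite scale0r addr0.
have cs : {for (0 : R), continuous (fun t : R => sqn (x + t *: delta_mx 0 i))}.
  exact: is_derive_continuous (is_derive_sqn x i 0).
have dn : \forall t \near (0 : R),
    is_derive (sqn (x + t *: delta_mx 0 i)) 1 F (F' (sqn (x + t *: delta_mx 0 i))).
  have dFe : nbhs (sqn (x + 0 *: delta_mx 0 i)) (fun r : R => is_derive (r : R) 1 F (F' r)).
    by rewrite e.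
  exact: (cs _ dFe).
apply: (@near_eq_is_derive _ _ _
    (fun t : R => 2 * (x 0 i + t * 1) * F' (sqn (x + t *: delta_mx 0 i)))).
  near=> t.
  have ht : is_derive (sqn (x + t *: delta_mx 0 i)) 1 F (F' (sqn (x + t *: delta_mx 0 i))).
    by near: t; exact: dn.
  by have [_ ->] := pderiv_radial i ht; rewrite !mxE !eqxx.
have d2 : is_derive (sqn (x + 0 *: delta_mx 0 i)) 1 F' (F'' (sqn x)) by rewrite e.
have d3 := is_derive_comp d2 (is_derive_sqn x i 0).
have d1 : is_derive (0 : R) 1 (fun t : R => 2 * (x 0 i + t * 1)) 2.
  have h := is_deriveZ (2 : R) (is_deriveD (is_derive_cst (x 0 i) (0 : R) (1 : R)) (is_derive_mulr_cst (1 : R) (0 : R))).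
  by apply: (is_derive_eq h); rewrite add0r [_ *: _]mulr1.
apply: (is_derive_eq (is_derive_mul d1 d3)).
by rewrite scale0r !addr0 mul0r addr0; ring.
Unshelve. all: by end_near. Qed.

End heat_kernel.

Section heat_average.
Context {R : realType}.
Notation mu := (@lebesgue_measure R).
Local Notation tup n := (n.-tuple (measurableTypeR R)).

Definition gaussn n (z : 'rV[R]_n) : R := expR (- sqn z).

Lemma continuous_gaussn n : continuous (@gaussn n).
Proof.
move=> z; apply: (continuous_comp (f := fun z => - sqn z)); last exact: continuous_expR.
by apply: continuousN; exact: continuous_sqn.
Qed.

Lemma gaussn_ge0 n (z : 'rV[R]_n) : 0 <= gaussn z. Proof. exact: expR_ge0. Qed.

Lemma intRn_gaussn n : integrableRn (@gaussn n) /\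
  intRn (@gaussn n) = Num.sqrt pi ^+ n.
Proof.
have e : (@gaussn n) = (fun x => \prod_(i < n) gauss_fun (x 0 i)).
  by apply/funext => x; rewrite /gaussn /sqn -sumrN expR_sum.
have mg : measurable_fun setT (@gauss_fun R) by exact: measurable_gauss_fun.
have ig : mu.-integrable setT (EFin \o (@gauss_fun R)) by exact: integrableT_gauss.
have [h1 h2] := @integrableRn_prod R n (fun=> @gauss_fun R) (fun=> mg)
  (fun _ => @gauss_fun_ge0 R) (fun=> ig).
rewrite e; split=> //; rewrite h2 /Rintegral integralT_gauss /=.
by rewrite prodr_const card_ord.
Qed.

(** The normalising constant of the Gaussian [gaussn] of dimension [n]. *)
Definition pnorm (n : nat) : R := pi `^ (- (n%:R / 2)).

Lemma pnorm_gt0 n : 0 < pnorm n. Proof. by rewrite powR_gt0// pi_gt0. Qed.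

Lemma pnormE n : pnorm n * Num.sqrt pi ^+ n = 1.
Proof.
have p0 : 0 <= (pi : R) by rewrite pi_ge0.
rewrite /pnorm -powR12_sqrt// -powR_mulrn ?powR_ge0// -powRrM powRN.
by rewrite [_^-1 * _]mulrC [2^-1 * _]mulrC mulfV// gt_eqF// powR_gt0// pi_gt0.
Qed.

Lemma hk_gaussn n (v : R) (z : 'rV[R]_n) : 0 < v ->
  hk (n%:R / 2) (sqn (Num.sqrt (4 * v) *: z)) v = Num.sqrt (4 * v) ^- n * gaussn z.
Proof.
move=> v0; have v4 : 0 < 4 * v by rewrite mulr_gt0.
rewrite sqnZ sqr_sqrtr ?ltW// /hk v0.
have -> : 4 * v * sqn z / (4 * v) = sqn z by rewrite mulrAC divff ?gt_eqF// mul1r.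
rewrite expRD /gaussn.
congr (_ * _); rewrite expRN -powR12_sqrt ?ltW// -powR_mulrn ?powR_ge0// -powRrM.
by rewrite /powR gt_eqF//; congr (expR _)^-1; ring.
Qed.

Lemma measurable_hk_sqn n b (v : R) :
  measurable_fun setT (fun u : tup n => hk b (sqn (row_of_tuple u)) v).
Proof.
have ms : measurable_fun setT (fun u : tup n => sqn (row_of_tuple u)).
  exact: (measurable_continuous_row (@continuous_sqn R n)).
have mp : measurable_fun setT (fun u : tup n => (sqn (row_of_tuple u), v)).
  by apply: measurable_fun_pair.
exact: (measurableT_comp (measurable_hk b) mp).
Qed.

Lemma measurable_scale_row n (r : R) (f : 'rV[R]_n -> R) :
  measurable_fun setT (fun u : tup n => f (row_of_tuple u)) ->
  measurable_fun setT (fun u : tup n => f (r *: row_of_tuple u)).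
Proof.
move=> mf.
have -> : (fun u : tup n => f (r *: row_of_tuple u)) =
    (fun u => f (row_of_tuple (aff r (rowfun (0 : 'rV[R]_n)) u))).
  by apply/funext => u; rewrite row_aff addr0.
exact: (measurableT_comp mf (@measurable_aff R n r _)).
Qed.

Section bounded_datum.
Variables (n : nat) (f : 'rV[R]_n -> R) (K : R).
Hypotheses (mf : measurable_fun setT (fun u : tup n => f (row_of_tuple u)))
  (fK : forall x, `|f x| <= K).

Lemma integrable_gaussn_mul (r : R) : integrableRn (fun z => gaussn z * f (r *: z)).
Proof.
have [gi _] := intRn_gaussn n.
apply: (@integrableRn_mul R n _ (fun z => f (r *: z)) K gi) => [|z]; last exact: fK.
exact: measurable_scale_row.
Qed.

(** The substitution [x = Num.sqrt (4 * v) *: z]. *)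
Lemma intRn_hk (v : R) : 0 < v ->
  integrableRn (fun x => hk (n%:R / 2) (sqn x) v * f x) /\
  intRn (fun x => hk (n%:R / 2) (sqn x) v * f x) =
  intRn (fun z => gaussn z * f (Num.sqrt (4 * v) *: z)).
Proof.
move=> v0; set r := Num.sqrt _.
have r0 : 0 < r by rewrite sqrtr_gt0 mulr_gt0.
have r1 : r != 0 by rewrite gt_eqF.
have rn : r ^- n != 0 by rewrite invr_neq0// expf_neq0.
have mh : measurable_fun setT (fun u : tup n =>
    hk (n%:R / 2) (sqn (row_of_tuple u)) v * f (row_of_tuple u)).
  by apply: measurable_funM => //; exact: measurable_hk_sqn.
have e : (fun x : 'rV[R]_n => hk (n%:R / 2) (sqn (r *: x + 0)) v * f (r *: x + 0)) =
    (fun x => r ^- n * (gaussn x * f (r *: x))).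
  by apply/funext => x; rewrite addr0 hk_gaussn// mulrA.
have gi := integrable_gaussn_mul r.
have rgi : integrableRn (fun x : 'rV[R]_n => r ^- n * (gaussn x * f (r *: x))).
  exact: (integrableRZ measurableT (r ^- n) gi).
split.
  rewrite -e in rgi.
  have ri0 : 0 < r^-1 by rewrite invr_gt0.
  have := integrableRn_affine 0 ri0 rgi.
  by congr integrableRn; apply/funext => x; rewrite !addr0 scalerA mulfV// scale1r.
apply: (mulfI rn); rewrite -(intRn_affine 0 r0 mh) e.
exact: (RintegralZl (r ^- n) measurableT gi).
Qed.

(** The heat flow of [f] seen at the origin; the Gaussian is fixed and the
    datum is scaled, which makes sense down to time [0]. *)
Definition havg (v : R) : R :=
  pnorm n * intRn (fun z => gaussn z * f (Num.sqrt (4 * `|v|) *: z)).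

Lemma havgE (v : R) : 0 < v ->
  havg v = pnorm n * intRn (fun x => hk (n%:R / 2) (sqn x) v * f x).
Proof. by move=> v0; rewrite /havg gtr0_norm// (intRn_hk v0).2. Qed.

Lemma havg_bound v : `|havg v| <= K.
Proof.
have [gi ge] := intRn_gaussn n.
have Kgi : integrableRn (fun z : 'rV[R]_n => K * gaussn z).
  exact: (integrableRZ measurableT K gi).
have h := normr_intRn_le (integrable_gaussn_mul (Num.sqrt (4 * `|v|))) Kgi.
rewrite /havg normrM gtr0_norm ?pnorm_gt0//.
have -> : K = pnorm n * intRn (fun z : 'rV[R]_n => K * gaussn z).
  have -> : intRn (fun z : 'rV[R]_n => K * gaussn z) = K * intRn (@gaussn n).
    exact: (RintegralZl K measurableT gi).
  by rewrite ge mulrCA pnormE mulr1.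
rewrite ler_pM2l ?pnorm_gt0//; apply: h => z.
by rewrite normrM ger0_norm ?gaussn_ge0// mulrC ler_wpM2r ?gaussn_ge0.
Qed.

Lemma havg0 : havg 0 = f 0.
Proof.
have [gi ge] := intRn_gaussn n.
rewrite /havg normr0 mulr0 sqrtr0.
have -> : (fun z : 'rV[R]_n => gaussn z * f (0 *: z)) = (fun z => f 0 * gaussn z).
  by apply/funext => z; rewrite scale0r mulrC.
have -> : intRn (fun z : 'rV[R]_n => f 0 * gaussn z) = f 0 * intRn (@gaussn n).
  exact: (RintegralZl (f 0) measurableT gi).
by rewrite ge mulrCA pnormE mulr1.
Qed.

Lemma continuous_havg : continuous f -> continuous havg.
Proof.
move=> cf v; have vv : v - 1 < v < v + 1 by apply/andP; split; lra.
have [gi _] := intRn_gaussn n.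
have Kgi : integrableRn (fun z : 'rV[R]_n => K * gaussn z).
  exact: (integrableRZ measurableT K gi).
apply: cvgMl_tmp.
apply: (@continuous_Rintegral R _ _ (@lebn R n) setT
  (fun v u => gaussn (row_of_tuple u) * f (Num.sqrt (4 * `|v|) *: row_of_tuple u))
  (fun u => K * gaussn (row_of_tuple u)) v (v - 1) (v + 1) measurableT vv).
- move=> w _; apply: measurable_funM; last exact: measurable_scale_row.
  exact: (measurable_continuous_row (@continuous_gaussn n)).
- move=> w u _ _; apply: cvgMl_tmp.
  have c1 : {for w, continuous (fun w : R => Num.sqrt (4 * `|w|) *: row_of_tuple u)}.
    apply: cvgZr_tmp.
    have c3 : {for w, continuous (fun w : R => 4 * `|w|)}.
      by apply: cvgMl_tmp; exact: norm_continuous.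
    have c4 : {for 4 * `|w|, continuous (@Num.sqrt R)} by exact: sqrt_continuous.
    exact: (continuous_comp c3 c4).
  have c2 : {for Num.sqrt (4 * `|w|) *: row_of_tuple u, continuous f} by exact: cf.
  exact: (continuous_comp c1 c2).
- exact: Kgi.
- move=> w u _ _; rewrite normrM ger0_norm ?gaussn_ge0// mulrC.
  by rewrite ler_wpM2r ?gaussn_ge0.
Qed.

End bounded_datum.

End heat_average.

(** * Smooth functions *)
Section smooth_functions.
Context {R : realType} {n : nat}.
Implicit Types f g : 'rV[R]_n -> R.

Lemma continuous_add f g : continuous f -> continuous g ->
  continuous (fun x => f x + g x).
Proof. by move=> cf cg x; exact: (cvgD (cf x) (cg x)). Qed.

Lemma continuous_mul f g : continuous f -> continuous g ->
  continuous (fun x => f x * g x).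
Proof. by move=> cf cg x; exact: (cvgM (cf x) (cg x)). Qed.

Lemma continuous_scale (c : R) f : continuous f -> continuous (fun x => c * f x).
Proof. by move=> cf; apply: continuous_mul => // x; exact: cst_continuous. Qed.

Lemma continuous_opp f : continuous f -> continuous (fun x => - f x).
Proof. by move=> cf x; exact: (cvgN (cf x)). Qed.

(** Smoothness is coinductive: it holds on every class of continuous functions
    that is stable under partial derivatives. *)
Lemma smooth_class (S : ('rV[R]_n -> R) -> Prop) :
  (forall f, S f -> continuous f /\
     forall i, (forall x, pderivable i f x) /\ S (pderiv i f)) ->
  forall f, S f -> smooth f.
Proof.
move=> HS f Sf s; have : S (foldr (@pderiv R n) f s).
  by elim: s => //= i s /HS[_ /(_ i)[]].
by move=> /HS[cg dg]; split=> // i x; have [h _] := dg i; exact: h.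
Qed.

Lemma smooth_continuous f : smooth f -> continuous f.
Proof. by move=> /(_ [::])[]. Qed.

Lemma smooth_pderivable f : smooth f -> forall i x, pderivable i f x.
Proof. by move=> sf i x; have [_] := sf [::]; exact. Qed.

Lemma smooth_pderiv f i : smooth f -> smooth (pderiv i f).
Proof. by move=> sf s; have := sf (rcons s i); rewrite foldr_rcons. Qed.

Lemma pderivD i f g : (forall x, pderivable i f x) -> (forall x, pderivable i g x) ->
  (forall x, pderivable i (fun y => f y + g y) x) /\
  pderiv i (fun y => f y + g y) = (fun x => pderiv i f x + pderiv i g x).
Proof.
move=> df dg; split=> [x|]; first exact: (derivableD (df x) (dg x)).
by apply/funext => x; exact: (deriveD (df x) (dg x)).
Qed.

Lemma pderivM i f g : (forall x, pderivable i f x) -> (forall x, pderivable i g x) ->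
  (forall x, pderivable i (fun y => f y * g y) x) /\
  pderiv i (fun y => f y * g y) = (fun x => pderiv i f x * g x + f x * pderiv i g x).
Proof.
move=> df dg; split=> [x|]; first exact: (derivableM (df x) (dg x)).
apply/funext => x; rewrite addrC [X in _ = _ + X]mulrC.
exact: (deriveM (df x) (dg x)).
Qed.

Lemma pderiv_cst i (c : R) (x : 'rV[R]_n) :
  pderivable i (fun=> c) x /\ pderiv i (fun=> c) x = 0.
Proof. by split; [exact: derivable_cst|exact: derive_cst]. Qed.

Lemma smooth_cst (c : R) : smooth (fun _ : 'rV[R]_n => c).
Proof.
apply: (@smooth_class (fun f => exists c, f = (fun=> c))); last by exists c.
move=> _ [{}c ->]; split; first by move=> x; exact: cst_continuous.
move=> i; split=> [x|]; first by have [] := pderiv_cst i c x.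
by exists 0; apply/funext => x; have [] := pderiv_cst i c x.
Qed.

Lemma smoothD f g : smooth f -> smooth g -> smooth (fun x => f x + g x).
Proof.
move=> sf sg.
apply: (@smooth_class (fun h => exists f g, [/\ smooth f, smooth g & h = (fun x => f x + g x)])).
  move=> _ [{sf}f [{sg}g [sf sg ->]]]; split.
    exact: (continuous_add (smooth_continuous sf) (smooth_continuous sg)).
  move=> i; have [d1 ->] := pderivD (@smooth_pderivable _ sf i) (@smooth_pderivable _ sg i).
  split; first exact: d1.
  exists (pderiv i f), (pderiv i g).
  by split; [exact: (smooth_pderiv i sf)|exact: (smooth_pderiv i sg)|reflexivity].
by exists f, g.
Qed.

(** Leibniz' rule turns a product of smooth functions into a sum of two such
    products; finite sums of products are therefore stable under partial
    derivatives, as [smooth_class] requires. *)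
Inductive sum_of_products : ('rV[R]_n -> R) -> Prop :=
| SumOne f g : smooth f -> smooth g -> sum_of_products (fun x => f x * g x)
| SumAdd f g : sum_of_products f -> sum_of_products g ->
    sum_of_products (fun x => f x + g x).

Lemma smoothM f g : smooth f -> smooth g -> smooth (fun x => f x * g x).
Proof.
move=> sf sg; apply: (@smooth_class sum_of_products); last exact: SumOne.
move=> h; elim=> {h sf sg f g} [f g sf sg|f g _ [cf df] _ [cg dg]].
  split=> [|i].
    exact: (continuous_mul (smooth_continuous sf) (smooth_continuous sg)).
  have [d1 ->] := pderivM (@smooth_pderivable _ sf i) (@smooth_pderivable _ sg i).
  split; first exact: d1.
  exact: (SumAdd (SumOne (smooth_pderiv i sf) sg) (SumOne sf (smooth_pderiv i sg))).
split=> [|i]; first exact: continuous_add.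
have [f1 f2] := df i; have [g1 g2] := dg i.
by have [d1 ->] := pderivD f1 g1; split=> //; exact: SumAdd.
Qed.

Lemma smooth_sum (I : Type) (s : seq I) (f : I -> 'rV[R]_n -> R) :
  (forall i, smooth (f i)) -> smooth (fun x => \sum_(i <- s) f i x).
Proof.
move=> sf; elim: s => [|i s IH].
  rewrite (_ : (fun _ => _) = (fun=> 0)); first exact: smooth_cst.
  by apply/funext => x; rewrite big_nil.
have -> : (fun x => \sum_(j <- i :: s) f j x) = (fun x => f i x + \sum_(j <- s) f j x).
  by apply/funext => x; rewrite big_cons.
exact: (smoothD (sf i) IH).
Qed.

Lemma test_laplacian (phi : 'rV[R]_n -> R) : test_function phi ->
  test_function (laplacian phi).
Proof.
move=> [sp [r pr]]; split; first by apply: smooth_sum => i; do 2 apply: smooth_pderiv.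
have pr0 x : Num.max r 0 < enorm x -> phi x = 0 by rewrite gt_max => /andP[/pr].
have r0 : 0 <= Num.max r 0 by rewrite le_max lexx orbT.
pose r1 := n%:R * (Num.max r 0 + 1).
have r10 : 0 <= r1 by rewrite mulr_ge0// addr_ge0.
exists (n%:R * (r1 + 1)) => x hx; rewrite /laplacian big1// => i _.
apply: (pderiv_support i r10 _ hx) => y; exact: (pderiv_support i r0 pr0).
Qed.

Lemma test_bounded (phi : 'rV[R]_n -> R) : test_function phi ->
  exists K, forall x, `|phi x| <= K.
Proof. by move=> [sp [r pr]]; exact: (bounded_support (smooth_continuous sp) pr). Qed.

Lemma test_integrable (phi : 'rV[R]_n -> R) : test_function phi -> integrableRn phi.
Proof. by move=> [sp [r pr]]; exact: (integrableRn_support (smooth_continuous sp) pr). Qed.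

Lemma intRn_sum (I : Type) (s : seq I) (f : I -> 'rV[R]_n -> R) :
  (forall i, integrableRn (f i)) ->
  integrableRn (fun x => \sum_(i <- s) f i x) /\
  intRn (fun x => \sum_(i <- s) f i x) = \sum_(i <- s) intRn (f i).
Proof.
move=> fi; elim: s => [|i s [IH1 IH2]].
  rewrite big_nil (_ : (fun _ => _) = (fun=> 0)); last by apply/funext => x; rewrite big_nil.
  split; first exact: integrable0.
  by rewrite /intRn /Rintegral integral0.
rewrite big_cons (_ : (fun _ => _) = (fun x => f i x + \sum_(j <- s) f j x)); last first.
  by apply/funext => x; rewrite big_cons.
split; first exact: (integrableRD measurableT (fi i) IH1).
by rewrite -IH2; exact: (RintegralD measurableT (fi i) IH1).
Qed.

End smooth_functions.

Section heat_flow.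
Context {R : realType} {n : nat}.
Let b : R := n%:R / 2.
Local Notation tup n := (n.-tuple (measurableTypeR R)).

Lemma continuous_hk_sqn (k v : R) : continuous (fun x : 'rV[R]_n => hk k (sqn x) v).
Proof.
move=> x; have c1 := @continuous_sqn R n x.
have c2 : {for sqn x, continuous (hk k ^~ v)}.
  exact: is_derive_continuous (is_derive_hk_space k (sqn x) v).
exact: (continuous_comp c1 c2).
Qed.

Lemma pderiv_hk (k v : R) i (x : 'rV[R]_n) :
  pderivable i (fun y => hk k (sqn y) v) x /\
  pderiv i (fun y => hk k (sqn y) v) x = - (2 * x 0 i) * hk (k + 1) (sqn x) v.
Proof.
have [h1 h2] := @pderiv_radial R n i (hk k ^~ v) (fun r => - hk (k + 1) r v) x
  (is_derive_hk_space k (sqn x) v).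
by split=> //; rewrite h2 mulrN mulNr.
Qed.

Lemma pderiv2_hk (k v : R) i (x : 'rV[R]_n) :
  pderivable i (pderiv i (fun y => hk k (sqn y) v)) x /\
  pderiv i (pderiv i (fun y => hk k (sqn y) v)) x =
    - 2 * hk (k + 1) (sqn x) v + 4 * x 0 i ^+ 2 * hk (k + 2) (sqn x) v.
Proof.
have d2 : is_derive (sqn x) 1 (fun r => - hk (k + 1) r v) (hk (k + 2) (sqn x) v).
  have := is_deriveN (is_derive_hk_space (k + 1) (sqn x) v); rewrite opprK -addrA.
  exact.
have d1 : \forall r \near (sqn x : R), is_derive (r : R) 1 (hk k ^~ v) (- hk (k + 1) r v).
  by exists 1 => //= r _; exact: is_derive_hk_space.
have [h1 h2] := @pderiv_radial2 R n i (hk k ^~ v) (fun r => - hk (k + 1) r v)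
  (fun r => hk (k + 2) r v) x d1 d2.
by split=> //; rewrite h2 mulrN mulNr.
Qed.

(** The time derivative of [hk k rho], see [is_derive_hk_time]. *)
Definition dhk (k rho v : R) : R :=
  - (4 * k) * hk (k + 1) rho v + 4 * rho * hk (k + 2) rho v.

(** The Laplacian of a radial function, from its second partial derivatives; here
    the dimension enters, as [4 * b = 2 * n]. *)
Lemma sum_radial (x : 'rV[R]_n) (s1 s2 : R) :
  \sum_(i < n) (- 2 * s1 + 4 * x 0 i ^+ 2 * s2) = - (4 * b) * s1 + 4 * sqn x * s2.
Proof.
rewrite big_split/= sumr_const card_ord -mulr_suml -mulr_sumr -/(sqn x).
by congr (_ + _); rewrite -[LHS]mulr_natl /b; field.
Qed.

(** Green's identity, since [dhk b (sqn x) v] is the Laplacian of the heat kernel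
    at [x]. The field [dh i * phi - h * pderiv i phi] has bounded support, so
    its [i]-th partial derivative has integral [0] by [intRn_pderiv]. *)
Lemma intRn_green (v : R) (phi : 'rV[R]_n -> R) : test_function phi ->
  intRn (fun x => dhk b (sqn x) v * phi x) =
  intRn (fun x => hk b (sqn x) v * laplacian phi x).
Proof.
move=> [sp [r pr]].
have pr0 x : Num.max r 0 < enorm x -> phi x = 0 by rewrite gt_max => /andP[/pr].
have r0 : 0 <= Num.max r 0 by rewrite le_max lexx orbT.
have dpr i := pderiv_support i r0 pr0.
set r1 := n%:R * (Num.max r 0 + 1) in dpr.
have r10 : 0 <= r1 by rewrite mulr_ge0// addr_ge0.
have ddpr i := pderiv_support i r10 (dpr i).
set r2 := n%:R * (r1 + 1) in ddpr.
pose h (x : 'rV[R]_n) := hk b (sqn x) v.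
pose dh i (x : 'rV[R]_n) := - (2 * x 0 i) * hk (b + 1) (sqn x) v.
have dhE i : pderiv i h = dh i by apply/funext => x; have [] := pderiv_hk b v i x.
pose ddh i (x : 'rV[R]_n) :=
  - 2 * hk (b + 1) (sqn x) v + 4 * x 0 i ^+ 2 * hk (b + 2) (sqn x) v.
have ddhE i : pderiv i (dh i) = ddh i.
  by rewrite -dhE; apply/funext => x; have [] := pderiv2_hk b v i x.
have dh1 i x : pderivable i h x by have [] := pderiv_hk b v i x.
have dh2 i x : pderivable i (dh i) x by rewrite -dhE; have [] := pderiv2_hk b v i x.
have ch : continuous h by exact: continuous_hk_sqn.
have cdh i : continuous (dh i).
  apply: continuous_mul; last exact: continuous_hk_sqn.
  by apply: continuous_opp; apply: continuous_scale; exact: continuous_coord.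
have cddh i : continuous (ddh i).
  apply: continuous_add; first by apply: continuous_scale; exact: continuous_hk_sqn.
  apply: continuous_mul; last exact: continuous_hk_sqn.
  apply: continuous_scale; apply: continuous_mul; exact: continuous_coord.
pose F i (x : 'rV[R]_n) := dh i x * phi x + - h x * pderiv i phi x.
pose dF i (x : 'rV[R]_n) := ddh i x * phi x - h x * pderiv i (pderiv i phi) x.
have dp := @smooth_pderivable R n _ sp.
have ddp i := @smooth_pderivable R n _ (smooth_pderiv i sp) i.
have cp := smooth_continuous sp.
have cdp i := smooth_continuous (smooth_pderiv i sp).
have cddp i := smooth_continuous (smooth_pderiv i (smooth_pderiv i sp)).
have FE i : (forall x, pderivable i (F i) x) /\ pderiv i (F i) = dF i.
  have [a1 a2] := pderivM (dh2 i) (dp i).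
  have nh x : pderivable i (fun y => - h y) x by exact: derivableN (dh1 i x).
  have nhE x : pderiv i (fun y => - h y) x = - dh i x.
    by rewrite -dhE; exact: (deriveN (dh1 i x)).
  have [b1 b2] := pderivM nh (ddp i).
  have [c1 c2] := pderivD a1 b1.
  split=> //; rewrite c2 a2 b2; apply/funext => x; rewrite nhE ddhE /dF.
  by rewrite mulNr [X in _ + X = _]addrC; ring.
have cF i : continuous (F i).
  apply: continuous_add; first exact: continuous_mul.
  by apply: continuous_mul; first exact: continuous_opp.
have cdF i : continuous (dF i).
  apply: continuous_add; first exact: continuous_mul.
  by apply: continuous_opp; exact: continuous_mul.
pose m := Num.max (Num.max r 0) (Num.max r1 r2).
have F0 i x : m < enorm x -> F i x = 0.
  by rewrite !gt_max -andbA => /and4P[h0 h1 h2 _]; rewrite /F pr// (dpr i)// !mulr0 addr0.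
have dF0 i x : m < enorm x -> dF i x = 0.
  by rewrite !gt_max -andbA => /and4P[h0 h1 _ h2]; rewrite /dF pr// (ddpr i)// !mulr0 subr0.
have IF i : intRn (dF i) = 0.
  have [e1 e2] := FE i; rewrite -e2; apply: (intRn_pderiv (cF i) (F0 i) e1).
  by rewrite e2.
have idF i : integrableRn (dF i) by exact: (integrableRn_support (cdF i) (dF0 i)).
have [_] := intRn_sum (index_enum 'I_n) idF.
rewrite [RHS]big1 => [|i _]; last exact: IF.
have idh : integrableRn (fun x => dhk b (sqn x) v * phi x).
  apply: (@integrableRn_support R n _ r); last by move=> x /pr ->; rewrite mulr0.
  apply: continuous_mul => //.
  apply: continuous_add; first by apply: continuous_scale; exact: continuous_hk_sqn.
  apply: continuous_mul; last exact: continuous_hk_sqn.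
  by apply: continuous_scale; exact: continuous_sqn.
have ilh : integrableRn (fun x => hk b (sqn x) v * laplacian phi x).
  have [sl [q ql]] := test_laplacian (conj sp (ex_intro _ r pr)).
  apply: (@integrableRn_support R n _ q); last by move=> x /ql ->; rewrite mulr0.
  by apply: continuous_mul; [exact: continuous_hk_sqn|exact: smooth_continuous].
have -> : (fun x => \sum_(i < n) dF i x) =
    (fun x => dhk b (sqn x) v * phi x - hk b (sqn x) v * laplacian phi x).
  apply/funext => x; rewrite /dF sumrB -mulr_suml -mulr_sumr; congr (_ * _ - _).
  exact: sum_radial.
move=> e; apply/eqP; rewrite -subr_eq0 -{}e; apply/eqP/esym.
exact: (RintegralB measurableT idh ilh).
Qed.

(** The heat equation, moved to the datum by [intRn_green]. *)
Lemma is_derive_havg (phi : 'rV[R]_n -> R) (v : R) : test_function phi -> 0 < v ->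
  is_derive v 1 (havg phi) (havg (laplacian phi) v).
Proof.
move=> tp v0; have [sp [r pr]] := tp.
have cp := smooth_continuous sp.
have mp := measurable_continuous_row cp.
have [K pK] := test_bounded tp.
have [L pL] := test_bounded (test_laplacian tp).
have ml := measurable_continuous_row (smooth_continuous (test_laplacian tp).1).
rewrite (havgE ml pL v0) -intRn_green//.
apply: (@near_eq_is_derive _ _ _
    (fun w : R => pnorm n * intRn (fun x => hk b (sqn x) w * phi x))).
  have hv : \forall w \near v, 0 < w by exact: lt_nbhsr.
  near=> w; have w0 : 0 < w by near: w; exact: hv.
  by rewrite (havgE mp pK w0).
have vv : v / 2 < v < 2 * v by apply/andP; split; lra.
have b0 : 0 <= b by rewrite divr_ge0.
pose e k := expR (- (k * ln (2 * v))).
pose C := 4 * b * e (b + 1) + 4 * r ^+ 2 * e (b + 2).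
have iC : integrableRn (fun x => C * `|phi x|).
  by apply: (integrableRZ measurableT C); exact: integrable_normr (test_integrable tp).
apply: (is_deriveZ (pnorm n)).
apply: (@is_derive_under_integral R _ _ (@lebn R n) setT
    (fun w u => hk b (sqn (row_of_tuple u)) w * phi (row_of_tuple u))
    (fun w u => dhk b (sqn (row_of_tuple u)) w * phi (row_of_tuple u))
    (fun u => C * `|phi (row_of_tuple u)|) v (v / 2) (2 * v) measurableT vv).
- move=> w /andP[w0 _]; have {}w0 : 0 < w by apply: lt_trans w0; rewrite divr_gt0.
  by have [] := intRn_hk mp pK w0.
- move=> w u /andP[w0 _] _; have {}w0 : 0 < w by apply: lt_trans w0; rewrite divr_gt0.
  have h := is_derive_mul (is_derive_hk_time b (sqn (row_of_tuple u)) w0)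
    (is_derive_cst (phi (row_of_tuple u)) w (1 : R)).
  by apply: (is_derive_eq h); rewrite mulr0 addr0.
- exact: iC.
- move=> w u /andP[vw _] _; set x := row_of_tuple u.
  have w0 : 0 < w by apply: lt_trans vw; rewrite divr_gt0.
  have [h|h] := ltP r (enorm x); first by rewrite pr// normr0 !mulr0 normr0.
  have er : sqn x <= r ^+ 2.
    have h0 : 0 <= enorm x by exact: sqrtr_ge0.
    by rewrite -enorm_sqr ler_pXn2r// nnegrE// (le_trans h0 h).
  rewrite normrM ler_wpM2r// /dhk; apply: le_trans (ler_normD _ _) _.
  have hb k : 0 <= k -> `|hk (b + k) (sqn x) w| <= e (b + k).
    move=> k0; apply: le_trans (hk_bound_time _ (sqn_ge0 x) w0) _.
    rewrite /e ler_expR lerN2 ler_wpM2l ?addr_ge0//.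
    by rewrite ler_ln ?posrE ?mulr_gt0//; lra.
  apply: lerD.
    have b40 : 0 <= 4 * b by rewrite mulr_ge0.
    rewrite normrM normrN (ger0_norm b40).
    by apply: (ler_wpM2l b40); exact: hb.
  rewrite normrM ger0_norm ?mulr_ge0 ?sqn_ge0//; apply: ler_pM; rewrite ?mulr_ge0 ?sqn_ge0//.
    by rewrite ler_pM2l.
  exact: hb.
Unshelve. all: by end_near. Qed.

End heat_flow.

(** * The fundamental solution *)
Section solution.
Context {R : realType} {n : nat}.
Notation mu := (@lebesgue_measure R).
Local Notation D := (`]0, +oo[%classic : set R).
Let mD : measurable (D : set (measurableTypeR R)). Proof. exact: measurable_itv. Qed.
Local Notation tup := (n.-tuple (measurableTypeR R)).
Variables (alpha cnu : R).
Hypotheses (n1 : (1 <= n)%N) (a01 : 0 < alpha < 1) (cnu0 : 0 < cnu).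
Let b : R := n%:R / 2.
Let b0 : 0 < b. Proof. by rewrite divr_gt0// ltr0n. Qed.
Let a0 : 0 < alpha. Proof. by case/andP: a01. Qed.
Local Notation M := (mfun alpha).
Local Notation B := (mbound alpha).
Let c : R := kappa alpha / 2.
Let c0 : 0 < c. Proof. by rewrite divr_gt0// kappa_gt0. Qed.

Let pn0 : 0 < pnorm n :> R. Proof. exact: pnorm_gt0. Qed.

(** [fine] sends infinite values to [0]. Hence the next two lemmas hold without
    integrability, which at [x = 0] may fail. *)
Lemma Rintegral_nonintegrable d (Y : measurableType d) (m : {measure set Y -> \bar R})
    (A : set Y) (f : Y -> R) : measurable A -> measurable_fun A f ->
  ~ m.-integrable A (EFin \o f) -> \int[m]_(y in A) f y = 0.
Proof.
move=> mA mf ni.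
have mEf : measurable_fun A (EFin \o f) by exact/measurable_EFinP.
have p0 : (0 <= \int[m]_(y in A) ((EFin \o f)^\+) y)%E by exact: integral_ge0.
have q0 : (0 <= \int[m]_(y in A) ((EFin \o f)^\-) y)%E by exact: integral_ge0.
have pq : ~ (\int[m]_(y in A) ((EFin \o f)^\+) y < +oo /\
    \int[m]_(y in A) ((EFin \o f)^\-) y < +oo)%E.
  move=> [p1 q1]; apply: ni; apply/integrableP; split=> //.
  rewrite -[X in integral _ _ X]/(abse \o (EFin \o f)) fune_abse.
  rewrite ge0_integralD//; first exact: lte_add_pinfty.
    exact: measurable_funepos.
  exact: measurable_funeneg.
rewrite /Rintegral integralE.
move: p0 q0 pq; case: (integral _ _ _) => [p| |] //; case: (integral _ _ _) => [q| |] //= _ _.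
by move=> []; rewrite !ltry.
Qed.

Lemma normr_Rintegral_gen d (Y : measurableType d) (m : {measure set Y -> \bar R})
    (A : set Y) (f : Y -> R) : measurable A -> measurable_fun A f ->
  `|\int[m]_(y in A) f y| <= \int[m]_(y in A) `|f y|.
Proof.
move=> mA mf; have [fi|ni] := pselect (m.-integrable A (EFin \o f)).
  by apply: normr_Rintegral_le => //; exact: integrable_normr.
by rewrite Rintegral_nonintegrable// normr0; apply: Rintegral_ge0.
Qed.

Lemma Rintegral_mulr d (Y : measurableType d) (m : {measure set Y -> \bar R})
    (A : set Y) (f : Y -> R) (k : R) : measurable A -> measurable_fun A f ->
  \int[m]_(y in A) (f y * k) = (\int[m]_(y in A) f y) * k.
Proof.
move=> mA mf; have e (g : Y -> R) (h : R) : (fun y => g y * h) = (fun y => h * g y).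
  by apply/funext => y; rewrite mulrC.
have [fi|ni] := pselect (m.-integrable A (EFin \o f)).
  by rewrite e mulrC (RintegralZl k mA fi).
rewrite (Rintegral_nonintegrable mA mf ni) mul0r.
have [->|k0] := eqVneq k 0.
  rewrite (_ : (fun y => f y * 0) = (fun=> 0)); first by rewrite /Rintegral integral0.
  by apply/funext => y; rewrite mulr0.
apply: Rintegral_nonintegrable => //; first exact: measurable_funM.
move=> /(integrableRZ mA k^-1) h; apply: ni.
by apply: eq_integrable h => // y _; rewrite /= [X in X%:E]mulrC mulfK.
Qed.

(** With [k = n%:R / 2] and [rho = sqn x], the Gaussian of R^n at [x] as a function
    of time. *)
Definition gk (k : R) (rho v : R) : R := pnorm n * hk k rho v.

Lemma gk_bound (k : R) : 0 < k -> exists K, 0 < K /\ forall rho v : R, 0 < rho ->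
  `|gk k rho v| <= K * expR (- (k * ln rho)).
Proof.
move=> k0; have [K [K0 HK]] := hk_bound k0.
exists (pnorm n * K); split; first exact: mulr_gt0.
by move=> rho v r0; rewrite /gk normrM gtr0_norm// -mulrA ler_pM2l// HK.
Qed.

Lemma continuous_gk (k rho : R) : 0 < k -> 0 < rho -> continuous (gk k rho).
Proof. by move=> k0 r0 v; apply: cvgMl_tmp; exact: continuous_hk. Qed.

Definition sol (x : 'rV[R]_n) (t : R) : R := subord alpha cnu (gk b (sqn x)) t.

Local Notation S k rho t := (subord alpha cnu (gk k rho) t).

Lemma subordD (P Q : R -> R) (p q K L t : R) :
  continuous P -> (forall v, `|P v| <= K) -> continuous Q -> (forall v, `|Q v| <= L) ->
  subord alpha cnu (fun v => p * P v + q * Q v) t =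
  p * subord alpha cnu P t + q * subord alpha cnu Q t.
Proof.
move=> cP PK cQ QL.
have iP := @integrable_subord R alpha cnu a01 P K cP PK t.
have iQ := @integrable_subord R alpha cnu a01 Q L cQ QL t.
rewrite /subord -(RintegralZl p mD iP) -(RintegralZl q mD iQ).
rewrite -(RintegralD mD (integrableRZ mD p iP) (integrableRZ mD q iQ)).
by apply: eq_Rintegral => u _; ring.
Qed.

(** Away from the origin the heat kernels and their derivatives are bounded
    uniformly in time ([gk_bound]), which justifies differentiating in space under
    the integral over the clock. *)
Lemma is_derive_S (k rho t : R) : 0 < k -> 0 < rho ->
  is_derive rho 1 (fun r => S k r t) (- S (k + 1) rho t).
Proof.
move=> k0 r0; have k1 : 0 < k + 1 by rewrite addr_gt0.
have [K [K0 HK]] := gk_bound k1; have [K' [_ HK']] := gk_bound k0.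
have rr : rho / 2 < rho < 2 * rho by apply/andP; split; lra.
have dint r : 0 < r ->
    mu.-integrable D (EFin \o (fun u => M u * gk (k + 1) r (cnu * u * `|t| `^ alpha))).
  move=> r1; exact: (@integrable_subord R alpha cnu a01 _ _ (continuous_gk k1 r1) (fun v => HK r v r1)).
have -> : - S (k + 1) rho t =
    \int[mu]_(u in D) (M u * - gk (k + 1) rho (cnu * u * `|t| `^ alpha)).
  rewrite /subord -mulN1r -(RintegralZl (-1) mD (dint _ r0)).
  by apply: eq_Rintegral => u _; ring.
pose C := K * expR (- ((k + 1) * ln (rho / 2))).
apply: (@is_derive_under_integral R _ _ mu D
  (fun r u => M u * gk k r (cnu * u * `|t| `^ alpha))
  (fun r u => M u * - gk (k + 1) r (cnu * u * `|t| `^ alpha))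
  (fun u => C * `|M u|) rho (rho / 2) (2 * rho) mD rr).
- move=> r /andP[r1 _]; have {}r1 : 0 < r by apply: lt_trans r1; rewrite divr_gt0.
  exact: (@integrable_subord R alpha cnu a01 _ _ (continuous_gk k0 r1) (fun v => HK' r v r1)).
- move=> r u _ _; apply: (is_deriveZ (M u)).
  have h := is_deriveZ (pnorm n) (is_derive_hk_space k r (cnu * u * `|t| `^ alpha)).
  by apply: (is_derive_eq h); rewrite /gk -[_ *: _]/(_ * _) mulrN.
- apply: (integrableRZ mD C); apply: integrable_normr; exact: integrable_mfun.
- move=> r u /andP[r1 _] _; rewrite normrM normrN mulrC ler_wpM2r//.
  have r2 : 0 < rho / 2 by rewrite divr_gt0.
  have r3 : 0 < r by apply: lt_trans r1.
  apply: le_trans (HK r _ r3) _; rewrite /C ler_pM2l// ler_expR lerN2 ler_pM2l//.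
  by rewrite ler_ln ?posrE// ltW.
Qed.

Lemma sol_derive x i t : x != 0 ->
  [/\ pderivable i (sol ^~ t) x, pderivable i (pderiv i (sol ^~ t)) x &
   pderiv i (pderiv i (sol ^~ t)) x =
     - 2 * S (b + 1) (sqn x) t + 4 * x 0 i ^+ 2 * S (b + 2) (sqn x) t].
Proof.
move=> x0; have r0 : 0 < sqn x by rewrite sqn_gt0.
have b1 : 0 < b + 1 by rewrite addr_gt0.
have [h1 _] := @pderiv_radial R n i (fun r => S b r t) (fun r => - S (b + 1) r t) x
  (is_derive_S t b0 r0).
have d2 : is_derive (sqn x) 1 (fun r => - S (b + 1) r t) (S (b + 2) (sqn x) t).
  have := is_deriveN (is_derive_S t b1 r0); rewrite opprK -addrA.
  exact.
have d1 : \forall r \near (sqn x : R), is_derive (r : R) 1 (fun r => S b r t) (- S (b + 1) r t).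
  have h : \forall r \near (sqn x : R), 0 < r by exact: lt_nbhsr.
  near=> r; apply: is_derive_S => //; near: r; exact: h.
have [h2 h3] := @pderiv_radial2 R n i (fun r => S b r t) (fun r => - S (b + 1) r t)
  (fun r => S (b + 2) r t) x d1 d2.
by split; [exact: h1|exact: h2|rewrite h3 mulrN mulNr].
Unshelve. all: by end_near. Qed.

Lemma continuous_sol x t : x != 0 -> {for x, continuous (sol ^~ t)}.
Proof.
move=> x0; have r0 : 0 < sqn x by rewrite sqn_gt0.
have c1 := @continuous_sqn R n x.
have c2 : {for sqn x, continuous (fun r => S b r t)}.
  exact: is_derive_continuous (is_derive_S t b0 r0).
exact: (continuous_comp c1 c2).
Qed.

(** [caputo_subord] for the heat kernel at a fixed point off the origin. Its time
    derivative, averaged over the clock, is the Laplacian of the solution. *)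
Lemma sol_caputo (T t : R) x : x != 0 -> 0 < t <= T ->
  is_caputo T alpha (sol x) t (cnu * laplacian (sol ^~ t) x).
Proof.
move=> x0 tT; have r0 : 0 < sqn x by rewrite sqn_gt0.
have b1 : 0 < b + 1 by rewrite addr_gt0.
have b2 : 0 < b + 2 by rewrite addr_gt0.
have [K [_ HK]] := gk_bound b0; have [K1 [_ HK1]] := gk_bound b1; have [K2 [_ HK2]] := gk_bound b2.
pose P2 v := - (4 * b) * gk (b + 1) (sqn x) v + 4 * sqn x * gk (b + 2) (sqn x) v.
have c1 := continuous_gk b1 r0; have c2 := continuous_gk b2 r0.
have P2b v : `|P2 v| <= `|- (4 * b)| * (K1 * expR (- ((b + 1) * ln (sqn x)))) +
    `|4 * sqn x| * (K2 * expR (- ((b + 2) * ln (sqn x)))).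
  apply: le_trans (ler_normD _ _) _; apply: lerD; rewrite normrM ler_wpM2l//.
    exact: HK1.
  exact: HK2.
have cP2 : continuous P2.
  move=> v; apply: cvgD; apply: cvgMl_tmp; [exact: c1|exact: c2].
have -> : laplacian (sol ^~ t) x = subord alpha cnu P2 t.
  rewrite (@subordD _ _ _ _ _ _ t c1 (fun v => HK1 _ v r0) c2 (fun v => HK2 _ v r0)).
  have e i : pderiv i (pderiv i (sol ^~ t)) x =
     - 2 * S (b + 1) (sqn x) t + 4 * x 0 i ^+ 2 * S (b + 2) (sqn x) t.
    by have [] := sol_derive i t x0.
  by rewrite -sum_radial; apply: eq_bigr => i _; exact: e.
apply: (@caputo_subord R alpha cnu a01 cnu0 (gk b (sqn x)) P2 _ _ (continuous_gk b0 r0)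
  (fun v => HK _ v r0) cP2 P2b) => //.
move=> v v0; have h := is_deriveZ (pnorm n) (is_derive_hk_time b (sqn x) v0).
by apply: (is_derive_eq h); rewrite /P2 /gk -[_ *: _]/(_ * _); ring.
Qed.

Lemma sol_init (T : R) x : x != 0 ->
  sol x 0 = 0 /\ {within `[0, T], continuous (sol x)}.
Proof.
move=> x0; have r0 : 0 < sqn x by rewrite sqn_gt0.
have [K [_ HK]] := gk_bound b0.
have cg := continuous_gk b0 r0.
split.
  rewrite /sol (@subord0 R alpha cnu a01).
  by rewrite /gk /hk ltxx mulr0.
apply: continuous_subspaceT.
exact: (@continuous_subord R alpha cnu a01 _ _ cg (fun v => HK _ v r0)).
Qed.

Lemma sol_decay (t e : R) : 0 < e -> exists r : R, forall x, r < enorm x -> `|sol x t| < e.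
Proof.
move=> e0; have [K [K0 HK]] := gk_bound b0.
have B0 : 0 <= B by exact: mbound_ge0.
pose L := K * (B / c) + 1.
have L0 : 0 < L.
  by rewrite ltr_wpDl// (mulr_ge0 (ltW K0))//; exact: (divr_ge0 B0 (ltW c0)).
exists (expR ((ln L - ln e) / b / 2)) => x hx.
have r0 : 0 < sqn x.
  by rewrite -enorm_sqr exprn_gt0//; apply: lt_trans hx; exact: expR_gt0.
have := @subord_bound R alpha cnu a01 _ _ (continuous_gk b0 r0) (fun v => HK _ v r0) t.
rewrite -/(sol x t) => h; apply: (le_lt_trans h).
apply: (@lt_trans _ _ (L * expR (- (b * ln (sqn x))))).
  rewrite mulrAC ltr_pM2r ?expR_gt0// /L ltrDl.
  exact: ltr01.
rewrite -[X in X * _]lnK ?posrE// -expRD -[ltRHS]lnK ?posrE// ltr_expR ltrBlDr -ltrBlDl.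
rewrite mulrC -ltr_pdivrMr// -enorm_sqr lnXn; last by apply: lt_trans hx; exact: expR_gt0.
rewrite -[X in _ < X]mulr_natr -ltr_pdivrMr// -[ltLHS]expRK ltr_ln ?posrE ?expR_gt0//.
by apply: lt_trans hx; exact: expR_gt0.
Qed.

(** Fubini: averaging the solution is averaging the heat flow over the clock. *)
Section pairing.
Variables (psi : 'rV[R]_n -> R) (K : R).
Hypotheses (mpsi : measurable_fun setT (fun u : tup => psi (row_of_tuple u)))
  (psiK : forall x, `|psi x| <= K).

Let f (t : R) (z : tup * R) : R :=
  M z.2 * gk b (sqn (row_of_tuple z.1)) (cnu * z.2 * `|t| `^ alpha) * psi (row_of_tuple z.1).

Let mf t : measurable_fun setT (f t).
Proof.
have ms : measurable_fun setT (fun u : tup => sqn (row_of_tuple u)).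
  exact: (measurable_continuous_row (@continuous_sqn R n)).
apply: measurable_funM; last exact: (measurableT_comp mpsi measurable_fst).
apply: measurable_funM.
  exact: (measurableT_comp (measurable_mfun a01) measurable_snd).
apply: measurable_funM => //.
have mp : measurable_fun setT (fun z : tup * R =>
    (sqn (row_of_tuple z.1), cnu * z.2 * `|t| `^ alpha)).
  apply: measurable_fun_pair; first exact: (measurableT_comp ms measurable_fst).
  by apply: measurable_funM => //; exact: measurable_funM.
exact: (measurableT_comp (measurable_hk b) mp).
Qed.

Let clock_gt0 t u : 0 < t -> D u -> 0 < cnu * u * `|t| `^ alpha.
Proof.
by move=> t0; rewrite /= in_itv /= andbT => u0; rewrite !mulr_gt0// powR_gt0// normr_gt0 gt_eqF.
Qed.

Let fint t u : 0 < t -> D u ->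
  (@lebn R n).-integrable setT (EFin \o (fun x => f t (x, u))) /\
  \int[@lebn R n]_x f t (x, u) = M u * havg psi (cnu * u * `|t| `^ alpha).
Proof.
move=> t0 Du; have v0 := clock_gt0 t0 Du; set v := cnu * u * _ in v0 *.
have [i1 _] := intRn_hk mpsi psiK v0.
have e : (fun x => f t (x, u)) =
    (fun x => (M u * pnorm n) * (hk b (sqn (row_of_tuple x)) v * psi (row_of_tuple x))).
  by apply/funext => x; rewrite /f /gk /=; ring.
rewrite e; split; first exact: (integrableRZ measurableT _ i1).
by rewrite (havgE mpsi psiK v0) mulrA; exact: (RintegralZl _ measurableT i1).
Qed.

Let fint_abs t u : 0 < t -> D u ->
  (\int[@lebn R n]_x `|f t (x, u)|%:E <= (K * `|M u|)%:E)%E.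
Proof.
move=> t0 Du; have v0 := clock_gt0 t0 Du; set v := cnu * u * _ in v0 *.
have mpa : measurable_fun setT (fun u : tup => `|psi (row_of_tuple u)|).
  exact: measurableT_comp.
have pa x : `| `|psi x| | <= K by rewrite normr_id.
have [i1 _] := @intRn_hk R n (fun x => `|psi x|) K mpa pa v v0.
have e : (fun x => `|f t (x, u)|) =
    (fun x => (`|M u| * pnorm n) * (hk b (sqn (row_of_tuple x)) v * `|psi (row_of_tuple x)|)).
  apply/funext => x; rewrite /f /gk /= !normrM (gtr0_norm pn0) (ger0_norm (hk_ge0 _ _ _)).
  by rewrite /v; ring.
have i2 : (@lebn R n).-integrable setT (EFin \o (fun x => `|f t (x, u)|)).
  rewrite e; exact: (integrableRZ measurableT _ i1).
have -> : (\int[@lebn R n]_x `|f t (x, u)|%:E = (\int[@lebn R n]_x `|f t (x, u)|)%:E)%E.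
  by rewrite /Rintegral fineK//; exact: (integrable_fin_num measurableT i2).
rewrite lee_fin.
have -> : \int[@lebn R n]_x `|f t (x, u)| = `|M u| * havg (fun x => `|psi x|) v.
  rewrite (havgE mpa pa v0) mulrA -(RintegralZl _ measurableT i1).
  by apply: eq_Rintegral => x _; have /(congr1 (fun g => g x)) := e.
rewrite mulrC ler_wpM2r//; apply: le_trans (ler_norm _) _; exact: (havg_bound mpa pa).
Qed.

Let mfx t (x : tup) : measurable_fun setT (fun u : R => f t (x, u)).
Proof.
have mp : measurable_fun setT (fun u : R => (x, u)) by exact: measurable_pair1.
exact: (measurableT_comp (mf t) mp).
Qed.

Let iM : mu.-integrable D (EFin \o (fun u => K * `|M u|)).
Proof.
apply: (integrableRZ mD K); apply: integrable_normr; exact: integrable_mfun.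
Qed.

Let mM (x : tup) (t : R) : measurable_fun D (fun u : R =>
  M u * gk b (sqn (row_of_tuple x)) (cnu * u * `|t| `^ alpha)).
Proof.
apply: measurable_funTS; apply: measurable_funM; first exact: measurable_mfun.
apply: measurable_funM => //.
have mp : measurable_fun setT (fun u : R =>
    (sqn (row_of_tuple x), cnu * u * `|t| `^ alpha)).
  by apply: measurable_fun_pair => //; apply: measurable_funM => //; exact: measurable_funM.
exact: (measurableT_comp (measurable_hk b) mp).
Qed.

Lemma sol_pairing t : 0 < t ->
  integrableRn (fun x => sol x t * psi x) /\
  intRn (fun x => sol x t * psi x) = subord alpha cnu (havg psi) t.
Proof.
move=> t0.
have e : (fun x : tup => \int[mu]_(u in D) f t (x, u)) =
    (fun x => sol (row_of_tuple x) t * psi (row_of_tuple x)).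
  apply/funext => x; rewrite /sol /subord -(Rintegral_mulr _ _ mD (mM x t)).
  by [].
have [i1 _ E] := @Fubini_dominated R _ _ _ _ (@lebn R n) mu setT D (f t)
  (fun u => K * `|M u|) measurableT mD (mf t) iM (fun u Du => fint_abs t0 Du).
rewrite e in i1 E; split; first exact: i1.
rewrite /intRn E; apply: eq_Rintegral => u Du.
by apply: (fint t0 _).2; rewrite inE in Du.
Qed.

(** For [psi] constant, the bound of the mass that is uniform in time. *)
Lemma sol_pairing_abs t : 0 < t -> (forall x, 0 <= psi x) ->
  integrableRn (fun x => `|sol x t| * psi x) ->
  intRn (fun x => `|sol x t| * psi x) <= \int[mu]_(u in D) (K * `|M u|).
Proof.
move=> t0 p0 i0.
have mfa : measurable_fun setT (fun z => `|f t z|) by exact: measurableT_comp.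
have fa u : D u -> (\int[@lebn R n]_x `| `|f t (x, u)| |%:E <= (K * `|M u|)%:E)%E.
  move=> Du; have -> : (\int[@lebn R n]_x `| `|f t (x, u)| |%:E = \int[@lebn R n]_x `|f t (x, u)|%:E)%E.
    by apply: eq_integral => x _; rewrite normr_id.
  exact: fint_abs.
have [i1 i2 E] := @Fubini_dominated R _ _ _ _ (@lebn R n) mu setT D (fun z => `|f t z|)
  (fun u => K * `|M u|) measurableT mD mfa iM fa.
apply: (@le_trans _ _ (\int[@lebn R n]_x \int[mu]_(u in D) `|f t (x, u)|)).
  apply: le_trans (ler_norm _) _.
  apply: (normr_Rintegral_le measurableT i0 i1) => x _.
  rewrite normrM normr_id -normrM /sol /subord -(Rintegral_mulr _ _ mD (mM x t)).
  apply: (normr_Rintegral_gen mu mD); exact: measurable_funTS (mfx t x).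
rewrite E; apply: le_trans (ler_norm _) _.
apply: (normr_Rintegral_le mD i2 iM) => u Du.
have h := fint_abs t0 Du.
have [i3 _] := fint t0 Du.
have i4 := integrable_normr i3.
rewrite ger0_norm; last by apply: Rintegral_ge0.
rewrite -lee_fin /Rintegral fineK//; exact: (integrable_fin_num measurableT i4).
Qed.

End pairing.

(** Off the origin everything is [sol_caputo] and its companions. The weak
    equation is [caputo_subord] for the heat flow [havg phi] of the test function,
    whose derivative is [havg (laplacian phi)]. *)
Lemma sol_fundamental (T : R) : fundamental_solution alpha cnu T sol.
Proof.
have cst1 : measurable_fun setT (fun u : tup => (fun _ : 'rV[R]_n => 1 : R) (row_of_tuple u)) by [].
have b1 : forall x : 'rV[R]_n, `|(fun _ : 'rV[R]_n => 1 : R) x| <= 1 by move=> x; rewrite normr1.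
have weak phi t : test_function phi -> 0 <= t ->
    pairing sol phi t = subord alpha cnu (havg phi) t.
  move=> tp t0; have [K pK] := test_bounded tp.
  have cp := smooth_continuous tp.1; have mp := measurable_continuous_row cp.
  rewrite /pairing; have [->|t1] := eqVneq t 0.
    by rewrite (@subord0 R alpha cnu a01) havg0.
  have t2 : 0 < t by rewrite lt_neqAle eq_sym t1.
  by have [_] := sol_pairing mp pK t2.
split.
- exists (\int[mu]_(u in D) (1 * `|M u|)) => t /andP[t0 _].
  have [i1 _] := sol_pairing cst1 b1 t0.
  have e : (fun x => sol x t * 1) = sol ^~ t by apply/funext => x; rewrite mulr1.
  rewrite e in i1; split; first exact: i1.
  have e' : (fun x => `|sol x t| * 1) = (fun x => `|sol x t|) by apply/funext => x; rewrite mulr1.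
  have h := @sol_pairing_abs _ _ cst1 b1 t t0 (fun=> ler01); rewrite e' in h.
  by apply: h; exact: (integrable_normr i1).
- move=> phi tp; have [K pK] := test_bounded tp.
  have cp := smooth_continuous tp.1; have mp := measurable_continuous_row cp.
  have cs := @continuous_subord R alpha cnu a01 _ _ (continuous_havg mp pK cp) (havg_bound mp pK).
  have : {within `[0, T], continuous (subord alpha cnu (havg phi))} by exact: continuous_subspaceT.
  apply: subspace_eq_continuous => t; rewrite inE /= in_itv /= => /andP[t0 _].
  by rewrite /from_subspace weak.
- move=> phi t tp /andP[t0 tT]; have tl := test_laplacian tp.
  have [K pK] := test_bounded tp; have [L lL] := test_bounded tl.
  have cp := smooth_continuous tp.1; have mp := measurable_continuous_row cp.
  have cl := smooth_continuous tl.1; have ml := measurable_continuous_row cl.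
  have [_ ->] := sol_pairing ml lL t0.
  apply: (@caputo_subord R alpha cnu a01 cnu0 (havg phi) (havg (laplacian phi)) _ _
    (continuous_havg mp pK cp) (havg_bound mp pK) (continuous_havg ml lL cl) (havg_bound ml lL)).
  + by move=> v v0; exact: is_derive_havg.
  + by move=> s /andP[s0 _]; exact: weak.
  + by rewrite t0.
- by move=> x x0; exact: sol_init.
- move=> x t x0 _; split; first exact: continuous_sol.
  by move=> i; have [] := sol_derive i t x0.
- by move=> x t x0 tT; exact: sol_caputo.
- by move=> t _ e e0; exact: sol_decay.
Qed.

(** With [z] the argument of the H-function, the heat kernel at time
    [cnu * u * t ^ alpha] is a constant times [(z / u) ^ b * exp (- z / u)], so
    [foxH_mixture] applies. *)
Lemma sol_foxH (sigma : R) x t : sigma < b -> sigma < 1 -> x != 0 -> 0 < t ->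
  (sol x t)%:C = ((enorm x ^- n) * pi `^ (- (n%:R / 2)))%:C *
    foxH2012 sigma 1 alpha b 1 1 1 (enorm x ^+ 2 * t `^ (- alpha) / (4 * cnu)).
Proof.
move=> sb s1 x0 t0; have r0 : 0 < sqn x by rewrite sqn_gt0.
set z := _ / (4 * cnu).
have ta : 0 < t `^ alpha by exact: powR_gt0.
have zE : z = sqn x / (4 * (cnu * t `^ alpha)).
  by rewrite /z enorm_sqr powRN; field; rewrite !gt_eqF.
have z0 : 0 < z by rewrite zE divr_gt0// !mulr_gt0.
rewrite (foxH_mixture a01 sb s1 z0) -rmorphM /=; congr (_ %:C).
have en : 0 < enorm x by rewrite sqrtr_gt0.
have e u : D u -> M u * gk b (sqn x) (cnu * u * `|t| `^ alpha) =
    (M u * expR (b * ln (z / u) - z / u)) * (enorm x ^- n * pnorm n).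
  rewrite /= in_itv /= andbT => u0.
  have v0 : 0 < cnu * u * t `^ alpha by rewrite !mulr_gt0.
  rewrite gtr0_norm// /gk /hk v0.
  have -> : z / u = sqn x / (4 * (cnu * u * t `^ alpha)).
    by rewrite zE; field; rewrite !gt_eqF.
  set v := cnu * u * _ in v0 *; have v4 : 0 < 4 * v by rewrite mulr_gt0.
  have -> : enorm x ^- n = expR (- (b * ln (sqn x))).
    by rewrite expRN -enorm_sqr lnXn// -{1}[enorm x]lnK ?posrE// -expRM_natl /b; congr (expR _)^-1; field.
  have -> : M u * expR (b * ln (sqn x / (4 * v)) - sqn x / (4 * v)) *
     (expR (- (b * ln (sqn x))) * pnorm n) = M u * (pnorm n * (expR (b * ln (sqn x / (4 * v)) - sqn x / (4 * v)) *
     expR (- (b * ln (sqn x))))) by ring.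
  by rewrite -expRD ln_div ?posrE//; congr (_ * (_ * expR _)); ring.
rewrite /sol /subord.
have -> : \int[mu]_(u in D) (M u * gk b (sqn x) (cnu * u * `|t| `^ alpha)) =
    \int[mu]_(u in D) ((M u * expR (b * ln (z / u) - z / u)) * (enorm x ^- n * pnorm n)).
  by apply: eq_Rintegral => u Du; apply: e; rewrite inE in Du.
rewrite -/(pnorm n) [RHS]mulrC; apply: Rintegral_mulr => //.
apply: measurable_funTS; apply: measurable_funM; first exact: measurable_mfun.
have mz : measurable_fun setT (fun u : R => z / u).
  by apply: measurable_funM => //; exact: measurable_invr.
apply: measurableT_comp => //; apply: measurable_funB => //.
by apply: measurable_funM => //; exact: measurableT_comp.
Qed.

End solution.

(** * Abel's integral equation *)
Section power_kernels.
Context {R : realType}.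
Notation mu := (@lebesgue_measure R).
Local Notation D := (`]0, +oo[%classic : set R).
Let mD : measurable (D : set (measurableTypeR R)). Proof. exact: measurable_itv. Qed.

(** Powers extended by zero, so that integrals over [[0, t]] become convolutions on
    the whole line. *)
Definition pw (p u : R) : R := if 0 < u then expR (p * ln u) else 0.

(** The exponential weight of rate [k] makes the total mass small, of the order
    [k ^ (- a)]; this drives the contraction in [abel_unique]. *)
Definition egam (a k u : R) : R := pw (a - 1) u * expR (- (k * u)).

Lemma pw_ge0 (p u : R) : 0 <= pw p u.
Proof. by rewrite /pw; case: ifP => // _; exact: expR_ge0. Qed.

Lemma egam_ge0 (a k u : R) : 0 <= egam a k u.
Proof. by rewrite mulr_ge0 ?pw_ge0 ?expR_ge0. Qed.

Lemma pw_scale (p k u : R) : 0 < k -> pw p (k * u) = expR (p * ln k) * pw p u.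
Proof.
move=> k0; rewrite /pw pmulr_rgt0//; case: ifP => u0; last by rewrite mulr0.
by rewrite lnM ?posrE// mulrDr expRD.
Qed.

Lemma measurable_pw (p : R) : measurable_fun setT (pw p).
Proof.
apply: measurable_fun_ifT => //; first exact: measurable_fun_ltr.
by apply: measurableT_comp => //; apply: measurable_funM.
Qed.

Lemma measurable_egam (a k : R) : measurable_fun setT (egam a k).
Proof.
apply: measurable_funM; first exact: measurable_pw.
by apply: measurableT_comp => //; apply: measurableT_comp => //; exact: measurable_funM.
Qed.

Lemma integrable_egam (a k : R) : 0 < a -> 0 < k ->
  mu.-integrable setT (EFin \o egam a k).
Proof.
move=> a0 k0; have := integrable_gamma a0 k0.
rewrite (integrable_mkcond _ mD); apply: eq_integrable => // u _.
rewrite patchE /egam /pw /=.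
have -> : (u \in D) = (0 < u) by apply/idP/idP; rewrite inE /= in_itv /= andbT.
by case: ifP => _; rewrite ?mul0r// -expRD.
Qed.

Lemma integrable_egam_reflect (a k t : R) : 0 < a -> 0 < k ->
  mu.-integrable setT (EFin \o (fun s => egam a k (t - s))).
Proof.
move=> a0 k0; have n1 : (-1 : R) != 0 by rewrite oppr_eq0 oner_eq0.
have := integrable_affine t n1 (integrable_egam a0 k0).
by apply: eq_integrable => // s _; rewrite /= mulN1r addrC.
Qed.

Lemma Rintegral_egam_reflect (a k t : R) : 
  \int[mu]_s egam a k (t - s) = \int[mu]_s egam a k s.
Proof.
have n1 : (-1 : R) != 0 by rewrite oppr_eq0 oner_eq0.
have := Rintegral_affine t n1 (measurable_egam a k).
rewrite normrN1 invr1 mul1r => <-.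
by apply: eq_Rintegral => s _; rewrite mulN1r addrC.
Qed.

Lemma Rintegral_egam (a k : R) : 0 < k ->
  \int[mu]_s egam a k s = expR (- (a * ln k)) * \int[mu]_s egam a 1 s.
Proof.
move=> k0; have k1 : k != 0 by rewrite gt_eqF.
have e s : egam a k s = expR ((1 - a) * ln k) * egam a 1 (k * s + 0).
  rewrite addr0 /egam pw_scale// mul1r !mulrA -expRD -mulrDl.
  by rewrite subrKA subrr mul0r expR0 mul1r.
have := Rintegral_affine 0 k1 (measurable_egam a 1); rewrite (gtr0_norm k0) => h.
have i1 : \int[mu]_s egam a k s =
    \int[mu]_s (egam a 1 (k * s + 0) * expR ((1 - a) * ln k)).
  by apply: eq_Rintegral => s _; rewrite e mulrC.
have mk : measurable_fun setT (fun s : R => egam a 1 (k * s + 0)).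
  by apply: (measurableT_comp (measurable_egam a 1)); apply: measurable_funD.
apply: (etrans i1).
apply: (etrans (Rintegral_mulr mu (expR ((1 - a) * ln k)) measurableT mk)).
rewrite h mulrC mulrA; congr (_ * _).
by rewrite -[k^-1]lnK ?posrE ?invr_gt0// lnV ?posrE// -expRD; congr expR; ring.
Qed.

Lemma integrable_bounded_oo (f : R -> R) (a b K : R) : measurable_fun setT f ->
  (forall x, `|f x| <= K) ->
  mu.-integrable `]a, b[ (EFin \o (fun _ : R => K)) /\ mu.-integrable `]a, b[ (EFin \o f).
Proof.
move=> mf fK.
have mI : measurable (`]a, b[%classic : set (measurableTypeR R)) by exact: measurable_itv.
have iK : mu.-integrable `]a, b[ (EFin \o (fun _ : R => K)).
  have i1 : mu.-integrable setT (EFin \o (\1_(`]a, b[%classic : set R) : R -> R)).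
    exact: integrable_indic_itv.
  have := integrableST mI (integrableRZ measurableT K i1).
  by apply: eq_integrable => // x xI; rewrite /= indicE xI mulr1.
split=> //; apply: (@integrable_dom R _ _ mu _ mI f _ _ _ iK) => [|x _]; last exact: fK.
exact: measurable_funTS.
Qed.

Lemma Rintegral_cst_oo (s K : R) : 0 < s -> \int[mu]_(x in `]0, s[) K = K * s.
Proof.
move=> s0; rewrite Rintegral_cst//; congr (_ * _).
have e : lebesgue_measure (`]0, s[%classic : set R) = s%:E.
  by rewrite lebesgue_measure_itv/= lte_fin s0 oppr0 adde0.
exact: (congr1 fine e).
Qed.

(** Only values up to [1] of the argument matter below, where an exponential
    factor is harmless and makes the power integrable on the line. *)
Lemma pw_le_egam (a u : R) : u <= 1 -> pw (a - 1) u <= expR 1 * egam a 1 u.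
Proof.
move=> u1; rewrite mulrCA mul1r -{1}[pw _ _]mulr1 ler_wpM2l ?pw_ge0//.
by rewrite -expRD -{1}(@expR0 R) ler_expR subr_ge0.
Qed.

End power_kernels.

Section abel_equation.
Context {R : realType}.
Notation mu := (@lebesgue_measure R).
Variables (alpha : R).
Hypothesis a01 : 0 < alpha < 1.
Let a0 : 0 < alpha. Proof. by case/andP: a01. Qed.
Let a1 : 0 < 1 - alpha. Proof. by rewrite subr_gt0; case/andP: a01. Qed.

(** The integrand of the Beta integral of [alpha] and [1 - alpha]. *)
Let kap (x : R) : R := pw (alpha - 1) (1 - x) * pw (- alpha) x.

Let kap_ge0 x : 0 <= kap x. Proof. by rewrite mulr_ge0 ?pw_ge0. Qed.

Let mkap : measurable_fun setT kap.
Proof.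
apply: measurable_funM; last exact: measurable_pw.
by apply: (measurableT_comp (measurable_pw _)); exact: measurable_funB.
Qed.

(** Near each endpoint one factor is at most [2]. *)
Let kap_le x : kap x <= 2 * expR 1 * (egam alpha 1 (1 - x) + egam (1 - alpha) 1 x).
Proof.
have eA : - alpha = 1 - alpha - 1 by ring.
have [x0|x0] := leP x 0.
  rewrite /kap {2}/pw ltNge x0/= mulr0 mulr_ge0 ?mulr_ge0 ?expR_ge0 ?addr_ge0 ?egam_ge0//.
have [x1|x1] := leP 1 x.
  rewrite /kap {1}/pw subr_gt0 ltNge x1/= mul0r mulr_ge0 ?mulr_ge0 ?expR_ge0 ?addr_ge0 ?egam_ge0//.
have x1' : 0 < 1 - x by rewrite subr_gt0.
have half (p y : R) : -1 < p < 0 -> 2^-1 <= y -> pw p y <= 2.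
  move=> /andP[p1 p0] hy; have y0 : 0 < y by apply: lt_le_trans hy; rewrite invr_gt0.
  rewrite /pw y0 -[leRHS]lnK ?posrE// ler_expR.
  have hl : - ln 2 <= ln y :> R by rewrite -lnV ?posrE// ler_ln ?posrE// invr_gt0.
  have l2 : 0 <= ln 2 :> R by rewrite ln_ge0// ler1n.
  have : - p * - ln y <= - p * ln 2.
    have nl : - ln y <= ln 2 by rewrite lerNl.
    by apply: ler_wpM2l nl; rewrite oppr_ge0 ltW.
  rewrite mulrNN => h; apply: le_trans h _; rewrite -[leRHS]mul1r ler_wpM2r//.
  by rewrite lerNl ltW.
have p1 : -1 < alpha - 1 < 0 by apply/andP; split; move: a0 a1; lra.
have p2 : -1 < - alpha < 0 by apply/andP; split; move: a0 a1; lra.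
have l1 : pw (alpha - 1) (1 - x) <= expR 1 * egam alpha 1 (1 - x).
  by apply: pw_le_egam; rewrite gerBl ltW.
have l2 : pw (- alpha) x <= expR 1 * egam (1 - alpha) 1 x.
  by rewrite {1}eA; apply: pw_le_egam; exact: ltW.
rewrite mulrDr -!mulrA /kap.
have g1 := egam_ge0 alpha 1 (1 - x); have g2 := egam_ge0 (1 - alpha) 1 x.
have e0 : 0 <= expR 1 :> R by exact: expR_ge0.
have [hx|hx] := leP 2^-1 x.
  apply: (@le_trans _ _ (2 * (expR 1 * egam alpha 1 (1 - x)))).
    by rewrite [leLHS]mulrC; apply: ler_pM => //; rewrite ?pw_ge0//; exact: half.
  by rewrite lerDl; exact: (mulr_ge0 (ler0n _ 2) (mulr_ge0 e0 g2)).
apply: (@le_trans _ _ (2 * (expR 1 * egam (1 - alpha) 1 x))).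
  by apply: ler_pM => //; rewrite ?pw_ge0//; apply: half => //; move: hx; lra.
by rewrite lerDr; exact: (mulr_ge0 (ler0n _ 2) (mulr_ge0 e0 g1)).
Qed.

Let ikap : mu.-integrable setT (EFin \o kap).
Proof.
have i1 := integrable_egam_reflect 1 a0 (@ltr01 R).
have i2 := integrable_egam a1 (@ltr01 R).
have i3 := integrableRZ measurableT (2 * expR 1) (integrableRD measurableT i1 i2).
apply: (@integrable_dom R _ _ mu setT measurableT kap _ _ _ i3).
  exact: mkap.
move=> x _; by rewrite ger0_norm ?kap_ge0// kap_le.
Qed.

Let bet : R := \int[mu]_x kap x.

(** On the unit interval both factors are at least [1]. *)
Let bet_ge1 : 1 <= bet.
Proof.
have i01 : mu.-integrable setT (EFin \o (\1_(`]0, 1[%classic : set R) : R -> R)).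
  exact: integrable_indic_itv.
have e : \int[mu]_x \1_(`]0, 1[%classic : set R) x = 1 :> R.
  rewrite /Rintegral integral_indic//= setIT lebesgue_measure_itv/= lte_fin ltr01 oppr0.
  by rewrite adde0.
rewrite -[leLHS]e; apply: le_trans (ler_norm _) _.
apply: (normr_Rintegral_le measurableT i01 ikap) => x _.
rewrite indicE; case: (boolP (x \in _)) => [|_]; last by rewrite normr0.
rewrite inE /= in_itv /= => /andP[x0 x1]; rewrite normr1.
have x1' : 0 < 1 - x by rewrite subr_gt0.
rewrite /kap /pw x0 x1' -expRD -[leLHS]expR0 ler_expR.
have l1 : ln (1 - x) <= 0 by apply: ln_le0; rewrite gerBl ltW.
have l2 : ln x <= 0 by apply: ln_le0; exact: ltW.
have a1' : alpha - 1 <= 0 by rewrite subr_le0 -subr_ge0 ltW.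
have a0' : - alpha <= 0 by rewrite oppr_le0 ltW.
exact: (addr_ge0 (mulr_le0 a1' l1) (mulr_le0 a0' l2)).
Qed.

(** The composition of the kernels of two fractional integrals whose orders add up
    to one; its integral over the middle variable [s] does not depend on the
    endpoints, by scaling. *)
Let kern (t s r : R) : R := pw (alpha - 1) (t - s) * pw (- alpha) (s - r).

Let kernE t r s : r < t -> kern t s r = (t - r)^-1 * kap ((t - r)^-1 * s + - (t - r)^-1 * r).
Proof.
move=> rt; have d0 : 0 < t - r by rewrite subr_gt0.
have d1 : t - r != 0 by rewrite gt_eqF.
rewrite /kern /kap; set x := _ * s + _.
have -> : t - s = (t - r) * (1 - x) by rewrite /x; field.
have -> : s - r = (t - r) * x by rewrite /x; field.
rewrite !pw_scale//.
have -> : (t - r)^-1 = expR ((alpha - 1) * ln (t - r)) * expR (- alpha * ln (t - r)).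
  by rewrite -expRD -{1}[t - r]lnK ?posrE// -expRN; congr expR; ring.
by ring.
Qed.

Let kern0 t r s : t <= r -> kern t s r = 0.
Proof.
move=> tr; rewrite /kern /pw !subr_gt0; case: (ltP s t) => st; last by rewrite mul0r.
by rewrite ltNge (le_trans (ltW st) tr) mulr0.
Qed.

Let kern_ge0 t s r : 0 <= kern t s r. Proof. by rewrite mulr_ge0 ?pw_ge0. Qed.

Let kern_int t r : mu.-integrable setT (EFin \o (fun s => kern t s r)) /\
  \int[mu]_s kern t s r = if r < t then bet else 0.
Proof.
case: ifPn => [rt|]; last first.
  rewrite -leNgt => tr; have -> : (fun s => kern t s r) = (fun=> 0).
    by apply/funext => s; exact: kern0.
  by split; [exact: integrable0|rewrite /Rintegral integral0].
have d0 : 0 < (t - r)^-1 by rewrite invr_gt0 subr_gt0.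
have d1 : (t - r)^-1 != 0 by rewrite gt_eqF.
have -> : (fun s => kern t s r) =
    (fun s => (t - r)^-1 * kap ((t - r)^-1 * s + - (t - r)^-1 * r)).
  by apply/funext => s; exact: kernE.
have i1 := integrable_affine (- (t - r)^-1 * r) d1 ikap.
split; first exact: (integrableRZ measurableT _ i1).
rewrite (RintegralZl _ measurableT i1) (Rintegral_affine _ d1 mkap).
by rewrite (gtr0_norm d0) mulrA mulfV// mul1r.
Qed.

Section unknown.
Variables (w : R -> R) (K T lam : R).
Hypotheses (mw : measurable_fun setT w) (wK : forall s, `|w s| <= K)
  (w0 : forall s, s <= 0 -> w s = 0).

Lemma abel_kernel_bound t s :
  `|w s * pw (- alpha) (t - s)| <= K * expR t * egam (1 - alpha) 1 (t - s).
Proof.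
have K0 : 0 <= K by exact: le_trans (normr_ge0 _) (wK 0).
have [s0|s0] := leP s 0.
  by rewrite w0// mul0r normr0; exact: (mulr_ge0 (mulr_ge0 K0 (expR_ge0 t)) (egam_ge0 _ _ _)).
rewrite normrM (ger0_norm (pw_ge0 _ _)) -mulrA; apply: ler_pM => //; first exact: pw_ge0.
have -> : pw (- alpha) (t - s) = pw (1 - alpha - 1) (t - s) by congr pw; ring.
rewrite /egam mulrCA -{1}[pw _ _]mulr1 ler_wpM2l ?pw_ge0//.
by rewrite -expRD -{1}(@expR0 R) ler_expR mul1r opprB subrKC ltW.
Qed.

Lemma integrable_abel_bound t :
  mu.-integrable setT (EFin \o (fun s => K * expR t * egam (1 - alpha) 1 (t - s))).
Proof.
exact: (integrableRZ measurableT (K * expR t) (integrable_egam_reflect t a1 (@ltr01 R))).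
Qed.

(** On data vanishing on the negative half line the Abel integral is a
    convolution on the whole line. *)
Lemma abel_integralE t :
  mu.-integrable setT (EFin \o (fun s => w s * pw (- alpha) (t - s))) /\
  abel_integral alpha w t = \int[mu]_s (w s * pw (- alpha) (t - s)).
Proof.
have m1 : measurable_fun setT (fun s => w s * pw (- alpha) (t - s)).
  apply: measurable_funM => //; apply: (measurableT_comp (measurable_pw _)).
  exact: measurable_funB.
split.
  apply: (@integrable_dom R _ _ mu setT measurableT _ _ m1 _ (integrable_abel_bound t)) => s _.
  exact: abel_kernel_bound.
rewrite /abel_integral Rintegral_mkcond; apply: eq_Rintegral => s _.
rewrite patchE mem_setE in_itv /=; case: ifPn.
  move=> /andP[s0 st]; rewrite /pw subr_gt0; congr (_ * _).
  have [ts|ts] := ltP s t; last first.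
    have -> : s = t by apply/eqP; rewrite eq_le st ts.
    by rewrite subrr powR0 ?invr0// gt_eqF.
  by rewrite -powRN /powR gt_eqF ?subr_gt0.
move=> /negP h; have [s0|s0] := leP s 0; first by rewrite w0// mul0r.
have st : t < s by rewrite ltNge; apply/negP => st; apply: h; rewrite (ltW s0).
by rewrite /pw subr_gt0 ltNge (ltW st)/= mulr0.
Qed.

Let J t := \int[mu]_(s in `]0, t[) w s.

Let F t (z : R * R) : R := w z.2 * kern t z.1 z.2.

Let K0 : 0 <= K. Proof. exact: le_trans (normr_ge0 _) (wK 0). Qed.

Let mF t : measurable_fun setT (F t).
Proof.
apply: measurable_funM; first exact: (measurableT_comp mw measurable_snd).
apply: measurable_funM; apply: (measurableT_comp (measurable_pw _)).
  by apply: measurable_funB => //; exact: measurable_fst.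
by apply: measurable_funB; [exact: measurable_fst|exact: measurable_snd].
Qed.

(** Convolving with the conjugate power turns the Abel integral into a multiple of
    the primitive: Fubini's theorem and [kern_int]. *)
Let abel_conjugate t :
  mu.-integrable setT (EFin \o (fun s => pw (alpha - 1) (t - s) * abel_integral alpha w s)) /\
  \int[mu]_s (pw (alpha - 1) (t - s) * abel_integral alpha w s) = bet * J t.
Proof.
pose I (r : R) : R := \1_(`]0, t[%classic : set R) r.
have iI : mu.-integrable setT (EFin \o (fun r => K * bet * I r)).
  apply: (integrableRZ measurableT); exact: integrable_indic_itv.
have b0 : 0 <= bet by apply: le_trans bet_ge1.
have Fb r : setT r -> (\int[mu]_s `|F t (s, r)|%:E <= (K * bet * I r)%:E)%E.
  move=> _; have [i1 e1] := kern_int t r.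
  have i2 : mu.-integrable setT (EFin \o (fun s => `|w r| * kern t s r)).
    exact: (integrableRZ measurableT _ i1).
  have -> : (\int[mu]_s `|F t (s, r)|%:E = (`|w r| * \int[mu]_s kern t s r)%:E)%E.
    rewrite -(RintegralZl _ measurableT i1) /Rintegral fineK; last first.
      exact: (integrable_fin_num measurableT i2).
    by apply: eq_integral => s _; rewrite /F normrM (ger0_norm (kern_ge0 _ _ _)).
  rewrite lee_fin e1 /I indicE mem_setE in_itv /=.
  have [r0|r0] := leP r 0; first by rewrite w0// normr0 mul0r mulr_ge0// mulr_ge0.
  by case: ifP => _; rewrite ?mulr0// mulr1 ler_wpM2r.
have e1 s : \int[mu]_r F t (s, r) = pw (alpha - 1) (t - s) * abel_integral alpha w s.
  have [i1 ->] := abel_integralE s.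
  rewrite -(RintegralZl _ measurableT i1).
  by apply: eq_Rintegral => r _; rewrite /F /kern /=; ring.
have e2 r : \int[mu]_s F t (s, r) = bet * (w \_ (`]0, t[%classic : set R)) r.
  have [i1 e] := kern_int t r.
  rewrite (RintegralZl (w r) measurableT i1) e patchE mem_setE in_itv /=.
  have [r0|r0] := leP r 0; first by rewrite w0// mul0r mulr0.
  by case: ifP => _; rewrite ?mulr0// mulrC.
have [i1 _ E] := @Fubini_dominated R _ _ _ _ mu mu setT setT (F t)
  (fun r => K * bet * I r) measurableT measurableT (mF t) iI Fb.
have e1' : (fun s => \int[mu]_r F t (s, r)) =
    (fun s => pw (alpha - 1) (t - s) * abel_integral alpha w s) by apply/funext => s; exact: e1.
rewrite -e1'; split; first exact: i1.
have e2' : (fun r => \int[mu]_s F t (s, r)) = (fun r => bet * (w \_ (`]0, t[%classic : set R)) r).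
  by apply/funext => r; exact: e2.
rewrite {}E e2'.
have mI : measurable (`]0, t[%classic : set (measurableTypeR R)) by exact: measurable_itv.
have iw : mu.-integrable setT (EFin \o (w \_ (`]0, t[%classic : set R))).
  have iI' : mu.-integrable setT (EFin \o (fun r => K * I r)).
    apply: (integrableRZ measurableT); exact: integrable_indic_itv.
  apply: (@integrable_dom R _ _ mu setT measurableT _ _ _ _ iI') => [|r _].
    by apply: (measurable_restrictT w mI).1; exact: measurable_funTS.
  rewrite patchE /I indicE; case: ifP => _; rewrite ?mulr1 ?mulr0 ?normr0//.
rewrite (RintegralZl bet measurableT iw) /J; congr (_ * _).
by rewrite [RHS]Rintegral_mkcond.
Qed.

Hypothesis eqw : forall t, 0 < t < T -> abel_integral alpha w t = - lam * J t.

(** Gronwall: by [abel_conjugate] the primitive [J] is controlled by its own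
    fractional integral. For the rate [k] chosen below each pass halves the constant
    [C] in [`|J s| <= C * expR (k * s)]. *)
Lemma abel_unique t : 0 < t < T -> \int[mu]_(s in `]0, t[) w s = 0.
Proof.
move=> tT; have /andP[t0 t1] := tT; have T0 : 0 < T by exact: lt_trans t1.
pose G := \int[mu]_s egam alpha 1 s.
have G0 : 0 <= G by apply: Rintegral_ge0 => // s _; exact: egam_ge0.
(* [q] and [k] are chosen to make [small] true *)
pose q := 2 * `|lam| * G + 1.
have q1 : 1 <= q by rewrite lerDr !mulr_ge0.
have q0 : 0 < q by exact: lt_le_trans q1.
pose k := expR (ln q / alpha).
have k0 : 0 < k by exact: expR_gt0.
have kE : expR (- (alpha * ln k)) = q^-1.
  by rewrite /k expRK mulrC divfK ?gt_eqF// expRN lnK.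
have small : `|lam| * \int[mu]_s egam alpha k s <= 2^-1.
  rewrite (Rintegral_egam _ k0) kE -/G mulrCA mulrC ler_pdivrMr// /q.
  by rewrite mulrDr !mulrA mulVf// mul1r lerDl mulr1 invr_ge0.
have step C : (forall s, 0 < s < T -> `|J s| <= C * expR (k * s)) ->
    forall s, 0 < s < T -> `|J s| <= C / 2 * expR (k * s).
  move=> HC s sT; have /andP[s0 s1] := sT.
  have C0 : 0 <= C.
    have := le_trans (normr_ge0 _) (HC s sT).
    by rewrite pmulr_lge0// expR_gt0.
  have [i1 e1] := abel_conjugate s.
  have i2 := integrable_egam_reflect s a0 k0.
  have i3 := integrableRZ measurableT (`|lam| * C * expR (k * s)) i2.
  have h : `|bet * J s| <= `|lam| * C * expR (k * s) * \int[mu]_r egam alpha k (s - r).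
    rewrite -e1 -(RintegralZl _ measurableT i2).
    apply: (normr_Rintegral_le measurableT i1 i3) => r _.
    rewrite normrM (ger0_norm (pw_ge0 _ _)).
    have [sr|rs] := leP s r.
      by rewrite {1}/pw subr_gt0 ltNge sr/= mul0r mulr_ge0 ?egam_ge0// !mulr_ge0 ?expR_ge0.
    have [r0|r0] := leP r 0.
      have -> : abel_integral alpha w r = 0.
        have [_ ->] := abel_integralE r; rewrite /Rintegral integral0_eq// => v _.
        have [v0|v0] := leP v 0; first by rewrite w0// mul0r.
        by rewrite /pw subr_gt0 ltNge (le_trans r0 (ltW v0))/= mulr0.
      by rewrite normr0 mulr0 mulr_ge0 ?egam_ge0// !mulr_ge0 ?expR_ge0.
    have rT : 0 < r < T by rewrite r0 (lt_trans rs s1).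
    rewrite (eqw rT) normrM normrN /egam.
    have -> : `|lam| * C * expR (k * s) * (pw (alpha - 1) (s - r) * expR (- (k * (s - r)))) =
        pw (alpha - 1) (s - r) * (`|lam| * (C * (expR (k * s) * expR (- (k * (s - r)))))) by ring.
    rewrite -expRD; have -> : k * s + - (k * (s - r)) = k * r by ring.
    by rewrite ler_wpM2l ?pw_ge0// ler_wpM2l// HC.
  rewrite Rintegral_egam_reflect in h.
  apply: (@le_trans _ _ `|bet * J s|).
    rewrite normrM ler_peMl// ger0_norm//; exact: le_trans bet_ge1.
  apply: le_trans h _.
  have -> : `|lam| * C * expR (k * s) * \int[mu]_r egam alpha k r =
      (`|lam| * \int[mu]_r egam alpha k r) * (C * expR (k * s)) by ring.
  have -> : C / 2 * expR (k * s) = 2^-1 * (C * expR (k * s)) by ring.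
  by rewrite ler_wpM2r// mulr_ge0// expR_ge0.
have base s : 0 < s < T -> `|J s| <= K * T * expR (k * s).
  move=> /andP[s0 s1].
  have mI : measurable (`]0, s[%classic : set (measurableTypeR R)) by exact: measurable_itv.
  have [iK iw] := integrable_bounded_oo 0 s mw wK.
  have h := normr_Rintegral_le mI iw iK (fun r _ => wK r).
  apply: (le_trans h); rewrite Rintegral_cst_oo// -mulrA ler_wpM2l//.
  apply: (le_trans (ltW s1)); rewrite ler_peMr ?(ltW T0)//.
  by rewrite -(@expR0 R) ler_expR mulr_ge0// ltW.
have all m s : 0 < s < T -> `|J s| <= K * T / 2 ^+ m * expR (k * s).
  elim: m s => [|m IH] s sT; first by rewrite expr0 divr1 base.
  have -> : K * T / 2 ^+ m.+1 = K * T / 2 ^+ m / 2.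
    by rewrite exprSr; field; rewrite expf_neq0.
  exact: (step _ IH).
rewrite -/(J t); apply/eqP/negPn/negP => Jt.
have J0 : 0 < `|J t| by rewrite normr_gt0.
pose C := K * T * expR (k * t) / `|J t|.
have C0 : 0 <= C by rewrite !mulr_ge0 ?expR_ge0 ?invr_ge0// ltW.
pose m := (Num.truncn C).+1.
have hm : C < m%:R by exact: truncnS_gt.
have h2 : (m%:R : R) < 2 ^+ m by rewrite -natrX ltr_nat ltn_expl.
have := all m t tT; apply/negP; rewrite -ltNge.
rewrite mulrAC ltr_pdivrMr ?exprn_gt0//.
rewrite [ltRHS]mulrC -ltr_pdivrMr//; exact: (lt_trans hm h2).
Qed.

End unknown.

End abel_equation.

Section caputo_to_abel.
Context {R : realType}.
Notation mu := (@lebesgue_measure R).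
Local Notation D := (`]0, +oo[%classic : set R).
Let mD : measurable (D : set (measurableTypeR R)). Proof. exact: measurable_itv. Qed.
Variables (alpha T : R).
Hypotheses (a01 : 0 < alpha < 1) (T0 : 0 < T).
Let a1 : 0 < 1 - alpha. Proof. by rewrite subr_gt0; case/andP: a01. Qed.

Definition clamp (s : R) : R := Num.max 0 (Num.min s T).

Lemma clampP s : 0 <= clamp s <= T.
Proof. by rewrite /clamp le_max lexx/= ge_max (ltW T0)/= ge_min lexx orbT. Qed.

Lemma clamp_id s : 0 <= s <= T -> clamp s = s.
Proof. by move=> /andP[s0 sT]; rewrite /clamp min_l// max_r. Qed.

Lemma clamp_le0 s : s <= 0 -> clamp s = 0.
Proof. by move=> s0; rewrite /clamp min_l ?(le_trans s0 (ltW T0))// max_l. Qed.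

Lemma continuous_clamp : continuous clamp.
Proof.
move=> s; apply: (@continuous_max R R (cst 0) (fun s => Num.min s T)).
  exact: cst_continuous.
by apply: (@continuous_min R R id (cst T)); [exact: id|exact: cst_continuous].
Qed.

(** Continuing by constants keeps a function on [[0, T]] continuous, hence bounded
    and measurable, on the line. *)
Definition extend (p : R -> R) (s : R) : R := p (clamp s).

Lemma continuous_extend p : {within `[0, T], continuous p} -> continuous (extend p).
Proof.
move=> /subspace_continuousP cp s.
have cA : (`[0, T]%classic : set R) (clamp s) by rewrite /= in_itv /= clampP.
move=> A hA; have h := cp _ cA A hA.
have h2 : nbhs s (clamp @^-1` (fun y => (`[0, T]%classic : set R) y -> A (p y))).
  exact: (@continuous_clamp s _ h).
by apply: filterS h2 => y /=; apply; rewrite in_itv /= clampP.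
Qed.

Lemma bounded_extend p : {within `[0, T], continuous p} ->
  exists K, forall s, `|extend p s| <= K.
Proof.
move=> /continuous_extend cp.
have ca : {within `[0, T], continuous (fun s => `|extend p s|)}.
  apply: continuous_subspaceT => s.
  exact: (continuous_comp (@cp s) (@norm_continuous _ _ (extend p s))).
have [c _ h] := EVT_max (ltW T0) ca.
exists `|extend p c| => s; have sT := clampP s.
have : clamp s \in `[0, T]%R by rewrite in_itv.
by move=> /h; rewrite /extend (clamp_id sT).
Qed.

Lemma Gamma_neq0 : Gamma (1 - alpha) != 0 :> R.
Proof.
have cg : (0 : R) < complex.Re (1 - alpha)%:C by exact: a1.
have g0 := gam_neq0 cg.
rewrite /Gamma (cGamma_gam cg) (gamma1E alpha) /=.
by apply: contra_neq g0; rewrite (gamma1E alpha) => ->.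
Qed.

Section volterra.
Variables (p l : R -> R).
Hypotheses (cp : {within `[0, T], continuous p}) (p0 : p 0 = 0)
  (cl : {within `[0, T], continuous l}).
Hypothesis pl : forall t, 0 < t <= T -> is_caputo T alpha p t (l t).

Let A := abel_integral alpha (extend p).
Let mw : measurable_fun setT (extend p).
Proof. by apply: continuous_measurable_fun; exact: continuous_extend. Qed.

Let abelE s : s <= T -> abel_integral alpha p s = A s.
Proof.
move=> sT; apply: eq_Rintegral => r; rewrite mem_setE in_itv /= => /andP[r0 rs].
by rewrite /extend clamp_id// r0 (le_trans rs sT).
Qed.

(** Since [p 0 = 0], the Caputo derivative at an inner point is an ordinary
    derivative of the Abel integral. *)
Let dA t : 0 < t < T -> is_derive t 1 A (Gamma (1 - alpha) * l t).
Proof.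
move=> /andP[t0 tT]; have tT' : 0 < t <= T by rewrite t0 ltW.
have [d hd ->] := pl tT'.
rewrite p0 mul0r subr0 mulVKf ?Gamma_neq0//.
have c0 : {for (0 : R), continuous (fun h : R => h + t)}.
  by apply: cvgD; [exact: cvg_id|exact: cvg_cst].
have ht : \forall h \near (0 : R), (0 < h + t) && (h + t < T).
  have h1 : \forall y \near (0 + t : R), (0 < y) && (y < T).
    rewrite add0r.
    have h2 : \forall y \near t, 0 < y by exact: lt_nbhsr.
    have h3 : \forall y \near t, y < T by exact: lt_nbhsl.
    by apply: filterS2 h2 h3 => y -> ->.
  exact: (c0 _ h1).
suff hA : (fun h : R => h^-1 *: ((A \o shift t) (h *: (1 : R)) - A t)) @ 0^' --> d.
  by apply: DeriveDef; [apply/cvg_ex; exists d|exact: cvg_lim hA].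
move=> B Bd; have hB := hd B Bd.
have hB' : nbhs (0 + t) (fun s : R => s != t -> 0 < s <= T ->
    B ((abel_integral alpha p s - abel_integral alpha p t) / (s - t))).
  rewrite add0r; exact: hB.
have hc : \forall h \near (0 : R), (h + t != t -> 0 < h + t <= T ->
    B ((abel_integral alpha p (h + t) - abel_integral alpha p t) / (h + t - t))).
  exact: (c0 _ hB').
apply: filterS2 ht hc => h /andP[h1 h2] hb h0.
have := hb _ _; rewrite addrK (abelE (ltW h2)) (abelE (ltW tT)) h1 (ltW h2).
have ht' : h + t != t by rewrite -subr_eq0 addrK.
move=> /(_ ht' isT).
by rewrite /preimage /= [h%:A]mulr1 [_ / h]mulrC.
Qed.

(** The Abel integral of a bounded function is [O(t ^ (1 - alpha))]. *)
Let A_bound : exists C, forall t, 0 < t -> `|A t| <= C * `|t| `^ (1 - alpha).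
Proof.
have [K wK] := bounded_extend cp.
have K0 : 0 <= K by exact: le_trans (normr_ge0 _) (wK 0).
have ik := integrable_kb a1.
have iKk := integrableRZ mD K ik.
exists (\int[mu]_(s in D) (K * kb (1 - alpha) s)) => t t0.
have m1 : measurable_fun setT (fun s => kb (1 - alpha) s * extend p (t * s)).
  apply: measurable_funM; first exact: measurable_kb.
  by apply: (measurableT_comp mw); exact: measurable_funM.
have b1 s : `|kb (1 - alpha) s * extend p (t * s)| <= K * kb (1 - alpha) s.
  by rewrite normrM ger0_norm ?kb_ge0// mulrC ler_wpM2r ?kb_ge0.
have i1 : mu.-integrable D (EFin \o (fun s => kb (1 - alpha) s * extend p (t * s))).
  apply: (@integrable_dom R _ _ mu D mD _ _ _ _ iKk) => [|s _]; last exact: b1.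
  exact: measurable_funTS.
rewrite /A (abel_integral_unit a01 t0 mw i1) normrM (gtr0_norm t0) mulrC.
rewrite (ger0_norm (powR_ge0 _ _)); apply: ler_wpM2r; first exact: powR_ge0.
by apply: (normr_Rintegral_le mD i1 iKk) => s _; exact: b1.
Qed.

Let extend_le0 s : s <= 0 -> extend p s = 0.
Proof. by move=> s0; rewrite /extend clamp_le0. Qed.

(** Integrate [dA] from [0], where the Abel integral vanishes by [A_bound]. *)
Lemma caputo_volterra t : 0 < t < T ->
  abel_integral alpha (extend p) t =
  Gamma (1 - alpha) * \int[mu]_(s in `]0, t[) extend l s.
Proof.
move=> /andP[t0 tT].
have [K wK] := bounded_extend cp; have [L lL] := bounded_extend cl.
have ml : measurable_fun setT (extend l).
  by apply: continuous_measurable_fun; exact: continuous_extend.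
have A0 : A 0 = 0.
  rewrite /A (@abel_integralE R alpha a01 (extend p) K mw wK extend_le0 0).2.
  rewrite /Rintegral integral0_eq// => v _.
  have [v0|v0] := leP v 0; first by rewrite extend_le0// mul0r.
  by rewrite /pw sub0r oppr_gt0 ltNge (ltW v0)/= mulr0.
have AR : A s @[s --> 0^'+] --> A 0.
  have [C HC] := A_bound.
  rewrite A0; apply: norm_cvg0; rewrite -/(0 : R).
  have c1 : C * `|s| `^ (1 - alpha) @[s --> 0^'+] --> (0 : R).
    apply: cvg_at_right_filter.
    have c2 : C * `|s| `^ (1 - alpha) @[s --> (0 : R)] --> C * `|0 : R| `^ (1 - alpha).
      by apply: cvgMl_tmp; exact: (continuous_normr_powR a1).
    by rewrite normr0 powR0 ?mulr0 ?gt_eqF// in c2.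
  apply: (squeeze_cvgr _ (cvg_cst 0) c1).
  near=> s; rewrite normr_ge0/=; apply: HC.
  by near: s; exact: nbhs_right_gt.
have tT' : 0 < t < T by rewrite t0.
have E : (\int[mu]_(s in `[0%R, t]) (Gamma (1 - alpha) * extend l s)%:E = (A t)%:E - (A 0%R)%:E)%E.
  apply: (@continuous_FTC2 R (fun s => Gamma (1 - alpha) * extend l s) A 0 t t0).
  - apply: continuous_subspaceT => s; apply: cvgMl_tmp.
    exact: (continuous_extend cl).
  - split; [|exact: AR|].
    + move=> s; rewrite in_itv /= => /andP[s0 st].
      have sT : 0 < s < T by rewrite s0 (lt_trans st tT).
      by have [] := dA sT.
    + apply: cvg_at_left_filter; exact: is_derive_continuous (dA tT').
  - move=> s; rewrite in_itv /= => /andP[s0 st]; rewrite derive1E.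
    have sT : 0 < s < T by rewrite s0 (lt_trans st tT).
    have -> : extend l s = l s by rewrite /extend clamp_id// (ltW s0) ltW// (lt_trans st tT).
    apply: derive_val; exact: dA.
have md : measurable_fun `]0, t[ (fun s => (Gamma (1 - alpha) * extend l s)%:E).
  by apply/measurable_EFinP; apply: measurable_funTS; exact: measurable_funM.
rewrite (integral_itv_bndoo true false md) in E.
have [_ il] := integrable_bounded_oo 0 t ml lL.
have mI : measurable (`]0, t[%classic : set (measurableTypeR R)) by exact: measurable_itv.
rewrite -(RintegralZl _ mI il) /Rintegral E A0 /= subr0.
reflexivity.
Unshelve. all: by end_near. Qed.

End volterra.

End caputo_to_abel.

(** * Plane waves and cut-offs *)
Section waves.
Context {R : realType} {n : nat}.

(** The phase [c] makes the class closed under derivatives, see [pderiv_wave]. *)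
Definition wave (k : 'rV[R]_n) (c : R) (x : 'rV[R]_n) : R :=
  cos (\sum_(i < n) k 0 i * x 0 i + c).

Lemma pderiv_wave k (c : R) i (x : 'rV[R]_n) :
  pderivable i (wave k c) x /\
  pderiv i (wave k c) x = k 0 i * wave k (c + pi / 2) x.
Proof.
apply: derive_of_line.
have e : (fun t : R => wave k c (x + t *: delta_mx 0 i)) =
    (fun t => cos ((\sum_(j < n) k 0 j * x 0 j + c) + t * k 0 i)).
  apply/funext => t; rewrite /wave; congr cos; rewrite addrAC; congr (_ + _).
  rewrite [in LHS](eq_bigr (fun j => k 0 j * x 0 j + k 0 j * (t * (j == i)%:R))).
    rewrite big_split/=; congr (_ + _); rewrite (bigD1 i)//= eqxx mulr1 mulrC big1 ?addr0//.
    by move=> j /negbTE ->; rewrite !mulr0.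
  by move=> j _; rewrite !mxE /= mulrDr.
rewrite e.
have d1 : is_derive (0 : R) 1 (fun t : R => (\sum_(j < n) k 0 j * x 0 j + c) + t * k 0 i) (0 + k 0 i).
  exact: (is_deriveD (is_derive_cst _ _ _) (is_derive_mulr_cst _ _)).
have := is_derive_comp (is_derive_cos _) d1 => h; apply: (is_derive_eq h).
by rewrite mul0r addr0 add0r /wave addrA cosDpihalf mulrC.
Qed.

Lemma smooth_wave k c : smooth (wave k c).
Proof.
have aux (a c' : R) (x : 'rV[R]_n) i :
    pderivable i (fun y => a * wave k c' y) x /\
    pderiv i (fun y => a * wave k c' y) x = a * k 0 i * wave k (c' + pi / 2) x.
  have [h1 h2] := pderiv_wave k c' i x.
  split; first exact: (@derivableZ _ _ _ _ a _ _ h1).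
  by rewrite -mulrA -h2; exact: (@deriveZ _ _ _ _ a _ _ h1).
apply: (@smooth_class R n (fun f => exists a c', f = (fun x => a * wave k c' x))).
  move=> _ [a [c' ->]]; split.
    apply: continuous_scale => x.
    have cc : continuous (fun x : 'rV[R]_n => \sum_(i < n) k 0 i * x 0 i + c').
      apply: continuous_add; last by move=> y; exact: cst_continuous.
      apply: continuous_big; first exact: add_continuous.
      by move=> i _; apply: continuous_scale; exact: continuous_coord.
    exact: (continuous_comp (cc x) (@continuous_cos R _)).
  move=> i; split=> [x|]; first by have [] := aux a c' x i.
  exists (a * k 0 i), (c' + pi / 2); apply/funext => x.
  by have [_ ->] := aux a c' x i.
by exists 1, c; apply/funext => x; rewrite mul1r.
Qed.

Lemma wave_le1 k c x : `|wave k c x| <= 1.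
Proof. by rewrite ler_norml cos_geN1 cos_le1. Qed.

Lemma wave_mul k1 c1 k2 c2 x : wave k1 c1 x * wave k2 c2 x =
  2^-1 * wave (k1 + k2) (c1 + c2) x + 2^-1 * wave (k1 - k2) (c1 - c2) x.
Proof.
rewrite /wave; set a := \sum_(i < n) k1 0 i * x 0 i; set b := \sum_(i < n) k2 0 i * x 0 i.
have -> : \sum_(i < n) (k1 + k2) 0 i * x 0 i = a + b.
  by rewrite -big_split/=; apply: eq_bigr => i _; rewrite !mxE mulrDl.
have -> : \sum_(i < n) (k1 - k2) 0 i * x 0 i = a - b.
  by rewrite -sumrB/=; apply: eq_bigr => i _; rewrite !mxE mulrBl.
have -> : a + b + (c1 + c2) = (a + c1) + (b + c2) by ring.
have -> : a - b + (c1 - c2) = (a + c1) - (b + c2) by ring.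
by set A := a + c1; set B := b + c2; rewrite (cosD A B) (cosB A B); field.
Qed.

Lemma laplacian_wave k c x : laplacian (wave k c) x = - sqn k * wave k c x.
Proof.
rewrite /laplacian /sqn -sumrN mulr_suml; apply: eq_bigr => i _.
have -> : pderiv i (wave k c) = (fun y => k 0 i * wave k (c + pi / 2) y).
  by apply/funext => y; have [] := pderiv_wave k c i y.
have [h1 h2] := pderiv_wave k (c + pi / 2) i x.
have -> : pderiv i (fun y => k 0 i * wave k (c + pi / 2) y) x = k 0 i * pderiv i (wave k (c + pi / 2)) x.
  exact: (@deriveZ _ _ _ _ (k 0 i) _ _ h1).
rewrite h2 /wave; set a := \sum_(j < n) _.
have -> : a + (c + pi / 2 + pi / 2) = a + c + pi by field.
by rewrite cosDpi; ring.
Qed.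

(** Finite sums of waves form an algebra, by [wave_mul]; it contains all
    trigonometric polynomials. *)
Inductive trig : ('rV[R]_n -> R) -> Prop :=
| TrigWave a k c : trig (fun x => a * wave k c x)
| TrigAdd f g : trig f -> trig g -> trig (fun x => f x + g x).

Lemma trig_mul f g : trig f -> trig g -> trig (fun x => f x * g x).
Proof.
move=> tf tg; elim: tf => {f} [a k c|f1 f2 _ IH1 _ IH2].
  elim: tg => {g} [b k' c'|g1 g2 _ IH1 _ IH2].
    have -> : (fun x => a * wave k c x * (b * wave k' c' x)) =
        (fun x => (a * b / 2) * wave (k + k') (c + c') x + (a * b / 2) * wave (k - k') (c - c') x).
      by apply/funext => x; rewrite mulrACA wave_mul; field.
    by apply: TrigAdd; exact: TrigWave.
  have -> : (fun x => a * wave k c x * (g1 x + g2 x)) =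
      (fun x => a * wave k c x * g1 x + a * wave k c x * g2 x).
    by apply/funext => x; rewrite mulrDr.
  exact: TrigAdd.
have -> : (fun x => (f1 x + f2 x) * g x) = (fun x => f1 x * g x + f2 x * g x).
  by apply/funext => x; rewrite mulrDl.
exact: TrigAdd.
Qed.

Lemma trig1 : trig (fun=> 1).
Proof.
have -> : (fun _ : 'rV[R]_n => 1 : R) = (fun x => 1 * wave 0 0 x).
  apply/funext => x; rewrite mul1r /wave big1 ?addr0 ?cos0// => i _.
  by rewrite mxE mul0r.
exact: TrigWave.
Qed.

Lemma trig_exp f m : trig f -> trig (fun x => f x ^+ m).
Proof.
move=> tf; elim: m => [|m IH]; first exact: trig1.
have -> : (fun x => f x ^+ m.+1) = (fun x => f x * f x ^+ m).
  by apply/funext => x; rewrite exprS.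
exact: trig_mul.
Qed.

Lemma trig_prod (I : Type) (s : seq I) (f : I -> 'rV[R]_n -> R) :
  (forall i, trig (f i)) -> trig (fun x => \prod_(i <- s) f i x).
Proof.
move=> tf; elim: s => [|i s IH].
  have -> : (fun x => \prod_(i <- [::]) f i x) = (fun=> 1) by apply/funext => x; rewrite big_nil.
  exact: trig1.
have -> : (fun x => \prod_(j <- i :: s) f j x) = (fun x => f i x * \prod_(j <- s) f j x).
  by apply/funext => x; rewrite big_cons.
exact: trig_mul.
Qed.

Lemma trig_cos_coord i (q c : R) : trig (fun x => cos (q * x 0 i + c)).
Proof.
have -> : (fun x : 'rV[R]_n => cos (q * x 0 i + c)) = (fun x => 1 * wave (q *: delta_mx 0 i) c x).
  apply/funext => x; rewrite mul1r /wave; congr (cos (_ + _)).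
  rewrite (bigD1 i)//= !mxE !eqxx mulr1 big1 ?addr0// => j /negbTE ji.
  by rewrite !mxE ji andbF mulr0 mul0r.
exact: TrigWave.
Qed.

End waves.

Section gaussian_limit.
Context {R : realType}.

Lemma cvg_invS : (m.+1%:R^-1 : R) @[m --> \oo] --> (0 : R).
Proof.
apply/cvgrPdist_lt => e e0.
have he : \forall k \near \oo, (k.+1%:R : R)^-1 < e by exact: (near_infty_natSinv_lt (PosNum e0)).
by apply: filterS he => k hk; rewrite sub0r normrN gtr0_norm ?invr_gt0.
Qed.

Lemma expR_le_1B (a : R) : a < 1 -> expR (- (a / (1 - a))) <= 1 - a.
Proof.
move=> a1; have b0 : 0 < 1 - a by rewrite subr_gt0.
rewrite expRN invf_ple ?posrE ?expR_gt0//.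
apply: le_trans (expR_ge1Dx _); rewrite le_eqVlt; apply/orP; left; apply/eqP.
by field; rewrite gt_eqF.
Qed.

(** [(cos h) ^ 2 = 1 - (sin h) ^ 2] is [exp (- h ^ 2)] to second order, which is
    enough for a power of size [h ^ (- 2)]. *)
Lemma cvg_cos_gauss (th : R) :
  (cos (th * Num.sqrt m.+1%:R^-1) ^+ 2) ^+ m.+1 @[m --> \oo] --> expR (- th ^+ 2).
Proof.
pose h (m : nat) : R := th * Num.sqrt m.+1%:R^-1.
have s0 m : 0 < Num.sqrt m.+1%:R^-1 :> R by rewrite sqrtr_gt0 invr_gt0 ltr0n.
have inv0 := cvg_invS.
have h0 : h m @[m --> \oo] --> (0 : R).
  have c1 := cvg_comp _ _ inv0 (@sqrt_continuous R 0).
  rewrite sqrtr0 in c1.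
  have c2 : h m @[m --> \oo] --> th * 0 by apply: cvgMl_tmp; exact: c1.
  by rewrite mulr0 in c2.
have [th0|th0] := eqVneq th 0.
  have -> : (fun m => (cos (th * Num.sqrt m.+1%:R^-1) ^+ 2) ^+ m.+1) = (fun=> 1).
    by apply/funext => m; rewrite th0 mul0r cos0 !expr1n.
  by rewrite th0 expr0n oppr0 expR0; exact: cvg_cst.
have hn0 m : h m != 0 by rewrite mulf_neq0// gt_eqF.
have hd : h m @[m --> \oo] --> (0 : R)^'.
  move=> A; rewrite /nbhs /= => hA.
  have hA' : \forall m \near \oo, (h m != 0 -> A (h m)) by exact: (h0 _ hA).
  by apply: filterS hA' => m; apply; exact: hn0.
have sinc : (h m)^-1 * sin (h m) @[m --> \oo] --> (1 : R).
  have [ds sE] := is_derive_sin (0 : R).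
  have := ds; rewrite /derivable => /cvg_ex[l hl].
  have l1 : l = 1 := etrans (esym (cvg_lim (@Rhausdorff R) hl)) (etrans sE (@cos0 R)).
  rewrite l1 in hl.
  have := cvg_comp _ _ hd hl; apply: cvg_trans; apply: near_eq_cvg.
  by near=> m; rewrite /= addr0 sin0 subr0 [(h m)%:A]mulr1.
pose a m := sin (h m) ^+ 2.
have sin0' : sin (h m) @[m --> \oo] --> (0 : R).
  have c := cvg_comp _ _ h0 (@continuous_sin R 0).
  by rewrite sin0 in c.
have a0 : a m @[m --> \oo] --> (0 : R).
  have c : a m @[m --> \oo] --> (0 * 0 : R) by exact: (cvgM sin0' sin0').
  by rewrite mulr0 in c.
pose S (m : nat) := th ^+ 2 * ((h m)^-1 * sin (h m)) ^+ 2.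
have SE m : S m = m.+1%:R * a m.
  rewrite /S /a exprMn exprVn {1}/h exprMn sqr_sqrtr ?invr_ge0//.
  have : (m.+1%:R : R) != 0 by rewrite pnatr_eq0.
  by move: (m.+1%:R : R) => p p0; field; rewrite th0 p0.
have cS : S m @[m --> \oo] --> th ^+ 2.
  have c : S m @[m --> \oo] --> th ^+ 2 * (1 * 1).
    by apply: cvgMl_tmp; exact: cvgM.
  by rewrite !mulr1 in c.
have cU : expR (- S m) @[m --> \oo] --> expR (- th ^+ 2).
  apply: (cvg_comp (fun m => - S m) (@expR R)); last exact: continuous_expR.
  exact: cvgN.
have cL : expR (- (S m * (1 - a m)^-1)) @[m --> \oo] --> expR (- th ^+ 2).
  apply: (cvg_comp (fun m => - (S m * (1 - a m)^-1)) (@expR R)); last exact: continuous_expR.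
  apply: cvgN; rewrite -[X in _ --> X]mulr1; apply: cvgM => //.
  rewrite -[X in _ --> X]invr1; apply: cvgV; first exact: oner_neq0.
  by rewrite -[X in _ --> X]subr0; apply: cvgB => //; exact: cvg_cst.
apply: (squeeze_cvgr _ cL cU).
have ha : \forall m \near \oo, a m < 1.
  by apply: (cvgr_lt (0 : R)) => //; exact: a0.
apply: filterS ha => m am1.
have -> : cos (th * Num.sqrt m.+1%:R^-1) ^+ 2 = 1 - a m.
  by rewrite -/(h m) /a -(cos2Dsin2 (h m)) addrK.
rewrite !SE.
have b0 : 0 <= 1 - a m by rewrite subr_ge0 ltW.
have -> : - (m.+1%:R * a m * (1 - a m)^-1) = m.+1%:R * - (a m / (1 - a m)) by ring.
have -> : - (m.+1%:R * a m) = m.+1%:R * - a m by ring.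
rewrite !expRM_natl; apply/andP; split.
  by rewrite lerXn2r ?nnegrE ?expR_ge0// expR_le_1B.
by rewrite lerXn2r ?nnegrE ?expR_ge0// -[1 - a m]/(1 + - a m) expR_ge1Dx.
Unshelve. all: by end_near. Qed.

End gaussian_limit.

Section cutoff.
Context {R : realType} {n : nat}.

(** In its time variable [hk m 1] is the classical flat function: a power of [v]
    times [exp (- 1 / (4 * v))], continued by zero. *)
Lemma is_derive_flat (m v : R) : 0 < m -> is_derive v 1 (hk m 1) (dhk m 1 v).
Proof.
move=> m0; have [v0|v0|->] := ltgtP v 0; last 1 first.
- have m1 : 0 < m + 1 by rewrite addr_gt0.
  have z k : hk k 1 (0 : R) = 0 by rewrite /hk ltxx.
  have d0 : dhk m 1 0 = 0 :> R by rewrite /dhk !z !mulr0 addr0.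
  suff h : (fun h : R => h^-1 *: ((hk m 1 \o shift 0) (h *: (1 : R)) - hk m 1 0)) @ 0^' --> (0 : R).
    by rewrite d0; apply: DeriveDef; [apply/cvg_ex; exists 0|exact: cvg_lim h].
  have c1 : 4 * hk (m + 1) 1 h @[h --> (0 : R)^'] --> (0 : R).
    have c2 : 4 * hk (m + 1) 1 h @[h --> (0 : R)] --> (4 * hk (m + 1) 1 0 : R).
      by apply: cvgMl_tmp; exact: (continuous_hk m1 ltr01).
    by rewrite z mulr0 in c2; exact: cvg_within_filter c2.
  apply: cvg_trans c1; apply: near_eq_cvg.
  have h0 : \forall h \near (0 : R)^', h != 0 by exact: nbhs_dnbhs_neq.
  apply: filterS h0 => h hn /=.
  rewrite addr0 z subr0 [h%:A]mulr1; have [hp|hp] := ltP 0 h.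
    by rewrite [hk m 1 h]hk_shift// -[_ *: _]/(_ * _); field.
  by rewrite /hk ltNge hp/= mulr0 [_ *: _]mulr0.
- apply: (@near_eq_is_derive _ _ _ (cst (0 : R))).
    have hv : \forall w \near v, w < 0 by exact: lt_nbhsl.
    by apply: filterS hv => w w0; rewrite /hk ltNge (ltW w0).
  by rewrite /dhk /hk ltNge (ltW v0)/= !mulr0 addr0; exact: is_derive_cst.
- exact: is_derive_hk_time.
Qed.

Lemma pderiv_comp i (F : R -> R) (d : R) (u : 'rV[R]_n -> R) (x : 'rV[R]_n) :
  is_derive (u x) 1 F d -> pderivable i u x ->
  pderivable i (fun y => F (u y)) x /\ pderiv i (fun y => F (u y)) x = d * pderiv i u x.
Proof.
move=> dF du; apply: derive_of_line.
have e : x + 0 *: delta_mx 0 i = x by rewrite scale0r addr0.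
have h : is_derive (0 : R) 1 (fun t : R => u (x + t *: delta_mx 0 i)) (pderiv i u x).
  have du' : derivable u (x + 0 *: delta_mx 0 i) (delta_mx 0 i) by rewrite e.
  by apply: (is_derive_eq (is_derive_line du')); rewrite e.
have dF' : is_derive (u (x + 0 *: delta_mx 0 i)) 1 F d by rewrite e.
exact: (is_derive_comp dF' h).
Qed.

(** Compositions with the flat functions [hk m 1], with smooth coefficients: a class
    stable under partial derivatives, since differentiating [hk m 1] only changes
    [m]. *)
Inductive flat_sum (u : 'rV[R]_n -> R) : ('rV[R]_n -> R) -> Prop :=
| FlatOne q (m : R) : smooth q -> 0 < m -> flat_sum u (fun x => q x * hk m 1 (u x))
| FlatAdd f g : flat_sum u f -> flat_sum u g -> flat_sum u (fun x => f x + g x).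

Lemma smooth_flat (u : 'rV[R]_n -> R) (m : R) : smooth u -> 0 < m ->
  smooth (fun x => hk m 1 (u x)).
Proof.
move=> su m0.
have -> : (fun x => hk m 1 (u x)) = (fun x => (fun=> 1) x * hk m 1 (u x)).
  by apply/funext => x; rewrite mul1r.
apply: (@smooth_class R n (flat_sum u)); last exact: (FlatOne u (smooth_cst 1) m0).
move=> f; elim=> {m m0 f} [q m sq m0|f g _ [cf df] _ [cg dg]]; last first.
  split=> [|i]; first exact: continuous_add.
  have [f1 f2] := df i; have [g1 g2] := dg i.
  have [d1 ->] := pderivD f1 g1.
  by split; [exact: d1|exact: FlatAdd].
split=> [|i].
  apply: continuous_mul; first exact: smooth_continuous.
  move=> x; have c1 := smooth_continuous su (x := x).
  exact: (continuous_comp c1 (continuous_hk m0 ltr01 (x := u x))).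
have dH x := pderiv_comp (is_derive_flat (u x) m0) (@smooth_pderivable R n u su i x).
have [d1 ->] := pderivM (@smooth_pderivable R n q sq i) (fun x => (dH x).1).
split; first exact: d1.
have m1 : 0 < m + 1 by rewrite addr_gt0.
have m2 : 0 < m + 2 by rewrite addr_gt0.
have sdu := smooth_pderiv i su.
have -> : (fun x => pderiv i q x * hk m 1 (u x) + q x * pderiv i (fun y => hk m 1 (u y)) x) =
  (fun x => pderiv i q x * hk m 1 (u x) +
    (((fun=> - (4 * m)) x * (q x * pderiv i u x)) * hk (m + 1) 1 (u x) +
     ((fun=> 4) x * (q x * pderiv i u x)) * hk (m + 2) 1 (u x))).
  by apply/funext => x; rewrite (dH x).2 /dhk; ring.
have sc (a : R) := smoothM (smooth_cst a) (smoothM sq sdu).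
exact: (FlatAdd (FlatOne u (smooth_pderiv i sq) m0)
  (FlatAdd (FlatOne u (sc (- (4 * m))) m1) (FlatOne u (sc 4) m2))).
Qed.

Lemma smooth_coord (i : 'I_n) : smooth (fun x : 'rV[R]_n => x 0 i).
Proof.
have line x j : is_derive (0 : R) 1 (fun t : R => (x + t *: delta_mx 0 j : 'rV[R]_n) 0 i) (i == j)%:R.
  have -> : (fun t : R => (x + t *: delta_mx 0 j : 'rV[R]_n) 0 i) = (fun t => x 0 i + t * (i == j)%:R).
    by apply/funext => t; rewrite !mxE.
  have h := is_deriveD (is_derive_cst (x 0 i) (0 : R) (1 : R)) (is_derive_mulr_cst ((i == j)%:R : R) (0 : R)).
  by apply: (is_derive_eq h); rewrite add0r.
have lineP x j := @derive_of_line R n (fun x => x 0 i) x (delta_mx 0 j) _ (line x j).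
pose S (f : 'rV[R]_n -> R) := f = (fun x => x 0 i) \/ exists c, f = (fun=> c).
apply: (@smooth_class R n S); last by left.
move=> f [->|[c ->]].
  split; first exact: continuous_coord.
  move=> j; split=> [x|]; first exact: (lineP x j).1.
  right; exists (i == j)%:R; apply/funext => x.
  exact: (lineP x j).2.
split; first by move=> x; exact: cst_continuous.
move=> j; split=> [x|]; first by have [] := pderiv_cst j c x.
by right; exists 0; apply/funext => x; have [] := pderiv_cst j c x.
Qed.

Lemma smooth_sqn : smooth (@sqn R n).
Proof. by apply: smooth_sum => i; apply: smoothM; exact: smooth_coord. Qed.

Lemma laplacianM (f g : 'rV[R]_n -> R) x : smooth f -> smooth g ->
  laplacian (fun y => f y * g y) x = laplacian f x * g x +
    \sum_(i < n) (2 * pderiv i f x * pderiv i g x + f x * pderiv i (pderiv i g) x).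
Proof.
move=> sf sg; rewrite /laplacian mulr_suml -big_split/=; apply: eq_bigr => i _.
have df := @smooth_pderivable R n _ sf i; have dg := @smooth_pderivable R n _ sg i.
have ddf := @smooth_pderivable R n _ (smooth_pderiv i sf) i.
have ddg := @smooth_pderivable R n _ (smooth_pderiv i sg) i.
have [_ ->] := pderivM df dg.
have [a1 a2] := pderivM ddf dg; have [b1 b2] := pderivM df ddg.
have [_ ->] := pderivD a1 b1; rewrite a2 b2.
have alg (p q r s t u : R) : p * q + r * s + (r * s + t * u) = p * q + (2 * r * s + t * u) by ring.
exact: alg.
Qed.

(** A bump of radius [e^-1] with value [1] at the origin. *)
Definition cutoff (e : R) (x : 'rV[R]_n) : R := hk 1 1 (1 - e ^+ 2 * sqn x) / hk 1 1 1.

Lemma hk111_gt0 : 0 < hk 1 1 1 :> R.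
Proof. by rewrite /hk ltr01 expR_gt0. Qed.

Lemma test_cutoff_wave k c (e : R) : 0 < e ->
  test_function (fun x => wave k c x * cutoff e x).
Proof.
move=> e0; split.
  apply: smoothM; first exact: smooth_wave.
  have -> : cutoff e = (fun x => hk 1 1 (1 + - e ^+ 2 * sqn x) * (hk 1 1 1)^-1).
    by apply/funext => x; rewrite /cutoff mulNr.
  apply: smoothM; last exact: smooth_cst.
  apply: smooth_flat => //; apply: smoothD; first exact: smooth_cst.
  by apply: smoothM; [exact: smooth_cst|exact: smooth_sqn].
exists e^-1 => x hx; rewrite /cutoff /hk ltNge.
suff -> : 1 - e ^+ 2 * sqn x <= 0 by rewrite mul0r mulr0.
rewrite subr_le0 -enorm_sqr -exprMn.
have h : 1 <= e * enorm x by rewrite mulrC -ler_pdivrMr// div1r ltW.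
by rewrite -(expr1n _ 2) lerXn2r// nnegrE// (le_trans ler01 h).
Qed.

Lemma cutoff_bound : exists K, forall (e : R) x, `|cutoff e x| <= K.
Proof.
have [K [K0 HK]] := hk_bound (@ltr01 R).
exists (K / hk 1 1 1) => e x; rewrite /cutoff normrM normfV (gtr0_norm hk111_gt0).
rewrite ler_pM2r ?invr_gt0 ?hk111_gt0//; apply: le_trans (HK 1 _ ltr01) _.
by rewrite ln1 mulr0 oppr0 expR0 mulr1.
Qed.

Lemma cvg_cutoff x : cutoff m.+1%:R^-1 x @[m --> \oo] --> (1 : R).
Proof.
have inv0 := @cvg_invS R.
have c1 : {for (0 : R), continuous (fun e : R => 1 - e ^+ 2 * sqn x)}.
  apply: cvgB; first exact: cvg_cst.
  by apply: cvgM; [exact: exprn_continuous|exact: cvg_cst].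
have c2 : {for 1 - 0 ^+ 2 * sqn x, continuous (hk 1 (1 : R))}.
  exact: continuous_hk.
have c3 := cvg_comp _ _ inv0 (continuous_comp c1 c2).
have c4 : cutoff m.+1%:R^-1 x @[m --> \oo] --> (hk 1 1 (1 - 0 ^+ 2 * sqn x) / hk 1 1 1 : R).
  by apply: cvgM; [exact: c3|exact: cvg_cst].
by rewrite expr0n mul0r subr0 divff ?gt_eqF ?hk111_gt0// in c4.
Qed.

(** Each derivative of the cut-off carries a factor [e], and [`|e * x 0 i| <= 1] on
    its support. *)
Lemma laplacian_cutoff_wave k c : exists C, forall (e : R) x, 0 < e <= 1 ->
  `|laplacian (fun x => wave k c x * cutoff e x) x + sqn k * (wave k c x * cutoff e x)| <= C * e.
Proof.
have b2 : 0 < 2 :> R by []; have b3 : 0 < 3 :> R by [].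
have b4 : 0 < 4 :> R by []; have b5 : 0 < 5 :> R by [].
have [K2 [K20 H2]] := hk_bound b2; have [K3 [K30 H3]] := hk_bound b3.
have [K4 [K40 H4]] := hk_bound b4; have [K5 [K50 H5]] := hk_bound b5.
have one (K b v : R) : (forall rho v : R, 0 < rho -> `|hk b rho v| <= K * expR (- (b * ln rho))) ->
    `|hk b 1 v| <= K.
  by move=> /(_ 1 v ltr01); rewrite ln1 mulr0 oppr0 expR0 mulr1.
pose h0 : R := hk 1 1 1; have h00 : 0 < h0 by exact: hk111_gt0.
pose F1 (v : R) := dhk 1 1 v.
pose F2 (v : R) := - 4 * dhk 2 1 v + 4 * dhk 3 1 v.
pose C1 := 4 * K2 + 4 * K3.
pose C2 := 4 * (8 * K3 + 4 * K4) + 4 * (12 * K4 + 4 * K5).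
have e11 : 1 + 1 = 2 :> R by ring.
have e12 : 1 + 2 = 3 :> R by ring.
have e21 : 2 + 1 = 3 :> R by ring.
have e22 : 2 + 2 = 4 :> R by ring.
have e31 : 3 + 1 = 4 :> R by ring.
have e32 : 3 + 2 = 5 :> R by ring.
have tri (a b p q A B : R) : 0 <= a -> 0 <= b -> `|p| <= A -> `|q| <= B ->
    `|- a * p + b * q| <= a * A + b * B.
  move=> a0 b0 pA qB; apply: le_trans (ler_normD _ _) _.
  rewrite !normrM normrN (ger0_norm a0) (ger0_norm b0).
  by apply: lerD; apply: ler_wpM2l.
have F1b v : `|F1 v| <= C1.
  rewrite /F1 /dhk mulr1 e11 e12.
  by apply: (tri) => //; exact: one.
have F2b v : `|F2 v| <= C2.
  apply: (tri) => //; rewrite /dhk mulr1.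
    rewrite e21 e22 (_ : 4 * 2 = 8 :> R); last by ring.
    by apply: (tri) => //; exact: one.
  rewrite e31 e32 (_ : 4 * 3 = 12 :> R); last by ring.
  by apply: (tri) => //; exact: one.
have Fneg v : v <= 0 -> F1 v = 0 /\ F2 v = 0.
  move=> v0; have z b r : hk b r v = 0 by rewrite /hk ltNge v0.
  by rewrite /F1 /F2 /dhk !z !(mulr0, addr0).
have d2 (v : R) : is_derive v 1 F1 (F2 v).
  have h1 := is_deriveZ (- 4 : R) (is_derive_flat v b2).
  have h2 := is_deriveZ (4 : R) (is_derive_flat v b3).
  have -> : F1 = (fun v => - 4 * hk 2 1 v + 4 * hk 3 1 v).
    by apply/funext => w; rewrite /F1 /dhk !mulr1 e11 e12.
  exact: (is_deriveD h1 h2).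
pose C := \sum_(i < n) (2 * `|k 0 i| * (2 * (C1 / h0)) + (2 * (C1 / h0) + 4 * (C2 / h0))).
exists C => e x /andP[e0 e1].
have du (r : R) : is_derive r 1 (fun r : R => 1 - e ^+ 2 * r) (0 - e ^+ 2).
  have h1 := is_deriveZ (e ^+ 2) (is_derive_id r (1 : R)).
  apply: (is_derive_eq (is_deriveB (is_derive_cst (1 : R) r (1 : R)) h1)).
  by rewrite [_ *: _]mulr1.
pose P (r : R) := hk 1 1 (1 - e ^+ 2 * r) / h0.
pose P1 (r : R) := - e ^+ 2 * F1 (1 - e ^+ 2 * r) / h0.
pose P2 (r : R) := e ^+ 4 * F2 (1 - e ^+ 2 * r) / h0.
have dP (r : R) : is_derive r 1 P (P1 r).
  have h := is_derive_mul (is_derive_comp (is_derive_flat _ (@ltr01 R)) (du r)) (is_derive_cst (h0^-1) r (1 : R)).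
  by apply: (is_derive_eq h); rewrite mulr0 addr0 sub0r /P1 /F1 [_ * - _]mulrC.
have dP1 (r : R) : is_derive r 1 P1 (P2 r).
  have h := is_derive_mul (is_derive_mul (is_derive_cst (- e ^+ 2) r (1 : R)) (is_derive_comp (d2 _) (du r)))
    (is_derive_cst (h0^-1) r (1 : R)).
  by apply: (is_derive_eq h); rewrite /P2 /cst; ring.
have near1 : \forall r \near (sqn x : R), is_derive (r : R) 1 P (P1 r).
  by exists 1 => //= r _; exact: dP.
have cE : cutoff e = (fun y => P (sqn y)) by [].
have sc : smooth (cutoff e).
  have -> : cutoff e = (fun x => hk 1 1 (1 + - e ^+ 2 * sqn x) * h0^-1).
    by apply/funext => y; rewrite /cutoff mulNr.
  apply: smoothM; last exact: smooth_cst.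
  apply: smooth_flat => //; apply: smoothD; first exact: smooth_cst.
  by apply: smoothM; [exact: smooth_cst|exact: smooth_sqn].
rewrite (laplacianM x (smooth_wave k c) sc) laplacian_wave.
have -> (s : R) : - sqn k * wave k c x * cutoff e x + s + sqn k * (wave k c x * cutoff e x) = s by ring.
rewrite /C mulr_suml; apply: le_trans (ler_norm_sum _ _ _) _; apply: ler_sum => i _.
have [_ w1] := pderiv_wave k c i x.
have [_ q1] := pderiv_radial i (dP (sqn x)).
have [_ q2] := pderiv_radial2 i near1 (dP1 (sqn x)).
rewrite w1 cE q1 q2 /P1 /P2.
set v := 1 - e ^+ 2 * sqn x; set w := wave k c x; set w' := wave k _ x.
have e0' : 0 <= e by exact: ltW.
have [v0|v0] := leP v 0.
  have [-> ->] := Fneg v v0; rewrite !(mulr0, mul0r, addr0) normr0.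
  have C10 : 0 <= C1 / h0 by rewrite divr_ge0 ?ltW// addr_gt0// mulr_gt0.
  have C20 : 0 <= C2 / h0.
    by rewrite divr_ge0 ?ltW// !(addr_gt0, mulr_gt0).
  have t1 : 0 <= 2 * `|k 0 i| * (2 * (C1 / h0)).
    exact: (mulr_ge0 (mulr_ge0 (ler0n _ 2) (normr_ge0 _)) (mulr_ge0 (ler0n _ 2) C10)).
  have t2 : 0 <= 2 * (C1 / h0) + 4 * (C2 / h0) by rewrite addr_ge0// mulr_ge0.
  exact: (mulr_ge0 (addr_ge0 t1 t2) e0').
have ex : `|e * x 0 i| <= 1.
  rewrite -(@expr_le1 _ 2)// real_normK ?num_real// exprMn.
  have h1 : e ^+ 2 * sqn x <= 1 by move: v0; rewrite /v subr_gt0 => /ltW.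
  apply: le_trans h1; rewrite ler_wpM2l ?sqr_ge0//.
  by rewrite /sqn (bigD1 i)//= lerDl sumr_ge0// => j _; rewrite sqr_ge0.
have F1h : `|F1 v / h0| <= C1 / h0.
  by rewrite normrM normfV (gtr0_norm h00) ler_pM2r ?invr_gt0.
have F2h : `|F2 v / h0| <= C2 / h0.
  by rewrite normrM normfV (gtr0_norm h00) ler_pM2r ?invr_gt0.
have mul_le (p q B : R) : `|p| <= 1 -> `|q| <= B -> `|p * q| <= B.
  by move=> p1 qB; rewrite normrM -[B]mul1r; exact: ler_pM.
have ee : `|e| <= 1 by rewrite ger0_norm.
have scale (q B : R) : `|q| <= B -> `|e * q| <= e * B.
  by move=> qB; rewrite normrM (ger0_norm e0') ler_wpM2l.
have b1 : `|x 0 i * (- e ^+ 2 * F1 v / h0)| <= e * (C1 / h0).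
  have -> : x 0 i * (- e ^+ 2 * F1 v / h0) = - (e * ((e * x 0 i) * (F1 v / h0))) by ring.
  by rewrite normrN; apply: (scale); exact: mul_le.
have b2' : `|- e ^+ 2 * F1 v / h0| <= e * (C1 / h0).
  have -> : - e ^+ 2 * F1 v / h0 = - (e * (e * (F1 v / h0))) by ring.
  by rewrite normrN; apply: (scale); exact: mul_le.
have b3' : `|x 0 i ^+ 2 * (e ^+ 4 * F2 v / h0)| <= e * (C2 / h0).
  have -> : x 0 i ^+ 2 * (e ^+ 4 * F2 v / h0) =
      e * (e * ((e * x 0 i) * ((e * x 0 i) * (F2 v / h0)))) by ring.
  by apply: (scale); do 3 (apply: (mul_le) => //).
have -> : 2 * (k 0 i * w') * (2 * x 0 i * (- e ^+ 2 * F1 v / h0)) +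
    w * (2 * (- e ^+ 2 * F1 v / h0) + 4 * x 0 i ^+ 2 * (e ^+ 4 * F2 v / h0)) =
  2 * (k 0 i * (w' * (2 * (x 0 i * (- e ^+ 2 * F1 v / h0))))) +
    w * (2 * (- e ^+ 2 * F1 v / h0) + 4 * (x 0 i ^+ 2 * (e ^+ 4 * F2 v / h0))) by ring.
move: b1 b2' b3'; set p := x 0 i * _; set q := - e ^+ 2 * F1 v / h0; set s := x 0 i ^+ 2 * _ => b1 b2' b3'.
have w1' : `|w| <= 1 by exact: wave_le1.
have w2' : `|w'| <= 1 by exact: wave_le1.
have dbl (a : R) : `|2 * a| = 2 * `|a| by rewrite normrM ger0_norm.
have quad (a : R) : `|4 * a| = 4 * `|a| by rewrite normrM ger0_norm.
have -> : (2 * `|k 0 i| * (2 * (C1 / h0)) + (2 * (C1 / h0) + 4 * (C2 / h0))) * e =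
  2 * (`|k 0 i| * (2 * (e * (C1 / h0)))) + (2 * (e * (C1 / h0)) + 4 * (e * (C2 / h0))) by ring.
move: b1 b2' b3'; move: (e * (C1 / h0)) (e * (C2 / h0)) => A B b1 b2' b3'.
apply: le_trans (ler_normD _ _) _; apply: lerD.
  rewrite dbl ler_pM2l// normrM ler_wpM2l//; apply: (mul_le) => //.
  by rewrite dbl ler_pM2l.
apply: (mul_le) => //; apply: le_trans (ler_normD _ _) _.
by rewrite dbl quad; apply: lerD; rewrite ler_pM2l.
Qed.

End cutoff.

(** * Uniqueness *)
Section caputo_difference.
Context {R : realType}.
Notation mu := (@lebesgue_measure R).
Variables (alpha T : R).
Hypotheses (a01 : 0 < alpha < 1) (T0 : 0 < T).
Let a1 : 0 < 1 - alpha. Proof. by rewrite subr_gt0; case/andP: a01. Qed.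
Let a0 : 0 < alpha. Proof. by case/andP: a01. Qed.

Lemma integrable_abel_itv (w : R -> R) (K t : R) : measurable_fun setT w ->
  (forall s, `|w s| <= K) ->
  mu.-integrable `[0, t] (EFin \o (fun s => w s / (t - s) `^ alpha)).
Proof.
move=> mw wK; have K0 : 0 <= K by exact: le_trans (normr_ge0 _) (wK 0).
have mI : measurable (`[0, t]%classic : set (measurableTypeR R)) by exact: measurable_itv.
have ib := integrableST mI (@integrable_abel_bound R alpha a01 K t).
have m1 : measurable_fun `[0, t] (fun s => w s / (t - s) `^ alpha).
  apply: measurable_funTS; apply: measurable_funM => //.
  apply: (measurableT_comp measurable_invr).
  by apply: (measurableT_comp (measurable_powR alpha)); exact: measurable_funB.
apply: (@integrable_dom R _ _ mu _ mI _ _ m1 _ ib) => s /=; rewrite in_itv /= => /andP[s0 st].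
rewrite normrM -mulrA; apply: ler_pM => //.
have [ts|ts] := ltP s t; last first.
  have -> : s = t by apply/eqP; rewrite eq_le st ts.
  rewrite subrr powR0 ?gt_eqF// invr0 normr0.
  by apply: mulr_ge0; [exact: expR_ge0|exact: egam_ge0].
rewrite normfV ger0_norm ?powR_ge0// -powRN.
have -> : (t - s) `^ (- alpha) = pw (1 - alpha - 1) (t - s).
  by rewrite /pw /powR subr_gt0 ts gt_eqF ?subr_gt0//; congr expR; ring.
rewrite /egam mulrCA -{1}[pw _ _]mulr1 ler_wpM2l ?pw_ge0//.
by rewrite -expRD -{1}(@expR0 R) ler_expR mul1r opprB subrKC.
Qed.

Variables (f g : R -> R).
Hypotheses (cf : {within `[0, T], continuous f}) (cg : {within `[0, T], continuous g}).

Let abel_extend (h : R -> R) s : s <= T ->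
  abel_integral alpha h s = abel_integral alpha (extend T h) s.
Proof.
move=> sT; apply: eq_Rintegral => r; rewrite mem_setE in_itv /= => /andP[r0 rs].
by rewrite /extend clamp_id// r0 (le_trans rs sT).
Qed.

Let abelB s : s <= T -> abel_integral alpha (fun r => f r - g r) s =
  abel_integral alpha f s - abel_integral alpha g s.
Proof.
move=> sT; rewrite (abel_extend f sT) (abel_extend g sT) (abel_extend (fun r => f r - g r) sT).
have [K fK] := bounded_extend T0 cf; have [L gL] := bounded_extend T0 cg.
have mI : measurable (`[0, s]%classic : set (measurableTypeR R)) by exact: measurable_itv.
have mf : measurable_fun setT (extend T f).
  by apply: continuous_measurable_fun; exact: continuous_extend.
have mg : measurable_fun setT (extend T g).
  by apply: continuous_measurable_fun; exact: continuous_extend.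
have i1 := integrable_abel_itv s mf fK; have i2 := integrable_abel_itv s mg gL.
rewrite /abel_integral -(RintegralB mI i1 i2).
by apply: eq_Rintegral => r _; rewrite /extend mulrBl.
Qed.

Lemma is_caputoB t l1 l2 : 0 < t <= T -> is_caputo T alpha f t l1 ->
  is_caputo T alpha g t l2 -> is_caputo T alpha (fun r => f r - g r) t (l1 - l2).
Proof.
move=> /andP[t0 tT] [d1 h1 ->] [d2 h2 ->]; exists (d1 - d2); last by ring.
apply: cvg_trans (cvgB h1 h2); apply: near_eq_cvg.
have hw : within [set s | 0 < s <= T] t^' [set s | 0 < s <= T] by exact: withinT.
apply: (@filterS _ (within [set s | 0 < s <= T] t^') _ _ _ _ hw) => s /= /andP[s0 sT].
rewrite (abelB sT) (abelB tT).
transitivity ((abel_integral alpha f s - abel_integral alpha f t) / (s - t) -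
  (abel_integral alpha g s - abel_integral alpha g t) / (s - t)); first reflexivity.
have alg (a b c d q : R) : (a - b) / q - (c - d) / q = (a - c - (b - d)) / q by ring.
exact: alg.
Qed.

End caputo_difference.

Section gaussian_concentration.
Context {R : realType} {n : nat}.
Notation mu := (@lebesgue_measure R).

Definition gauss_at (y : 'rV[R]_n) (m : nat) (x : 'rV[R]_n) : R :=
  expR (- (m%:R * sqn (x - y))).

Lemma gauss_at_le1 y m x : `|gauss_at y m x| <= 1.
Proof.
rewrite /gauss_at ger0_norm ?expR_ge0// -(@expR0 R) ler_expR.
by rewrite oppr_le0 mulr_ge0// sqn_ge0.
Qed.

Lemma continuous_gauss_at y m : continuous (gauss_at y m).
Proof.
move=> x.
have cs : continuous (fun x : 'rV[R]_n => - (m%:R * sqn (x - y))).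
  apply: continuous_opp; apply: continuous_scale.
  have -> : (fun x : 'rV[R]_n => sqn (x - y)) =
      (fun x => \sum_(i < n) (x 0 i + - y 0 i) * (x 0 i + - y 0 i)).
    by apply/funext => z; apply: eq_bigr => i _; rewrite !mxE.
  apply: continuous_big; first exact: add_continuous.
  move=> i _; apply: continuous_mul; apply: continuous_add;
    by [exact: continuous_coord|move=> z; exact: cst_continuous].
exact: (continuous_comp (cs x) (@continuous_expR R _)).
Qed.

Lemma cubeE (r : R) (x : 'rV[R]_n) : cube r x = ([forall i, `|x 0 i| <= r])%:R.
Proof.
case: forallP => [h|/existsNP[i hi]]; first by rewrite cube1.
rewrite /cube (bigD1 i)//= indicE memNset ?mul0r//= in_itv/= -ler_norml.
exact: hi.
Qed.

Lemma intRn_cube_gt0 (r : R) : 0 < r -> 0 < intRn (@cube R n r).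
Proof.
move=> r0; pose I (x : R) : R := \1_(`[- r, r]%classic) x.
have mI : measurable_fun setT I by exact: measurable_indic.
have I0 x : 0 <= I x by rewrite /I indicE.
have iI : mu.-integrable setT (EFin \o I) by exact: integrable_indic_itv.
have [_ e] := @integrableRn_prod R n (fun=> I) (fun=> mI) (fun _ => I0) (fun=> iI).
have {}e : intRn (@cube R n r) = \prod_(i < n) \int[mu]_x I x by exact: e.
rewrite e; apply: prodr_gt0 => i _.
have nr : - r < r by rewrite -subr_gt0 opprK addr_gt0.
rewrite /Rintegral integral_indic//= setIT lebesgue_measure_itv/= lte_fin nr.
by rewrite -EFinB opprK addr_gt0.
Qed.

(** Were [V y] positive, a small cube around [y] would contribute at least a
    multiple of [expR (- m * d ^ 2 / 2)] to the integral, while the negative part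
    of [V] lives at distance at least [d] and weighs at most a multiple of
    [expR (- m * d ^ 2)]. *)
Lemma gauss_concentration (V : 'rV[R]_n -> R) (y : 'rV[R]_n) : integrableRn V ->
  {for y, continuous V} -> (forall m, intRn (fun x => V x * gauss_at y m x) = 0) -> V y <= 0.
Proof.
move=> iV cV V0; rewrite leNgt; apply/negP => Vy.
pose c := V y / 2.
have c0 : 0 < c by rewrite divr_gt0.
have cy : c < V y by rewrite /c ltr_pdivrMr// ltr_pMr// ltr1n.
have hn : \forall x \near y, c < V x by exact: (cvgr_gt (V y) cV c cy).
have [d /= d0 hd] : exists2 d : R, 0 < d &
    forall x : 'rV[R]_n, (forall i, `|x 0 i - y 0 i| < d) -> c < V x.
  have /nbhs_ballP[d d0 hd] := hn.
  exists d => // x hx; apply: hd; split => // i j; rewrite (ord1 i) /ball /=.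
  by rewrite distrC.
(* small enough for [sqn (x - y) <= d ^ 2 / 2] on the cube of half-side [h] *)
pose h := d / (2 * n.+1%:R).
pose q (x : 'rV[R]_n) := cube h (x - y).
have n0 : 0 < n.+1%:R :> R by rewrite ltr0n.
have h0 : 0 < h by rewrite divr_gt0// mulr_gt0.
have [iq vq] : integrableRn q /\ 0 < intRn q.
  have qE : q = (fun x => cube h (1 *: x + - y)).
    by apply/funext => x; rewrite /q scale1r.
  have ic := @integrableRn_cube R n h.
  rewrite qE; split; first exact: (integrableRn_affine (- y) ltr01 ic).
  rewrite (intRn_affine (- y) ltr01 (measurable_integrableRn ic)) expr1n invr1 mul1r.
  exact: intRn_cube_gt0.
have inV : integrableRn (fun x => `|V x|) by exact: (integrable_normr iV).
pose G := intRn (fun x => `|V x|).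
have hnd : n%:R * h ^+ 2 <= d ^+ 2 / 2.
  have nn : n%:R * 2 <= (2 * n.+1%:R) ^+ 2 :> R.
    by rewrite -natr1; have := ler0n R n; nra.
  rewrite /h expr_div_n mulrCA ler_wpM2l ?sqr_ge0//.
  by rewrite ler_pdivrMr ?exprn_gt0 ?mulr_gt0// mulrC ler_pdivlMr.
have hd' : h < d.
  by rewrite /h ltr_pdivrMr ?mulr_gt0// ltr_pMr// -natr1; have := ler0n R n; lra.
have key m : c * intRn q <= G * expR (- (m%:R * (d ^+ 2 / 2))).
  pose e1 := expR (- (m%:R * (d ^+ 2 / 2))).
  have e1p : 0 < e1 by exact: expR_gt0.
  have e2 : e1 * e1 = expR (- (m%:R * d ^+ 2)) by rewrite -expRD; congr expR; field.
  have i1 : integrableRn (fun x => c * e1 * q x) by exact: (integrableRZ measurableT _ iq).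
  have mg := measurable_continuous_row (@continuous_gauss_at y m).
  have i2 := integrableRn_mul iV mg (gauss_at_le1 y m).
  have i3 : integrableRn (fun x => e1 * e1 * `|V x|) by exact: (integrableRZ measurableT _ inV).
  have i4 : integrableRn (fun x => V x * gauss_at y m x + e1 * e1 * `|V x|).
    exact: (integrableRD measurableT i2 i3).
  have pt x : `|c * e1 * q x| <= V x * gauss_at y m x + e1 * e1 * `|V x|.
    have q0 : 0 <= q x by exact: cube_ge0.
    have g0 : 0 <= gauss_at y m x by exact: expR_ge0.
    rewrite ger0_norm; last by apply: mulr_ge0 => //; rewrite mulr_ge0// ltW.
    have [/forallP hx|/forallPn[i hi]] := boolP [forall i, `|x 0 i - y 0 i| < d].
      have Vc := hd x hx; have V1 : 0 < V x by exact: lt_trans Vc.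
      rewrite -[leLHS]addr0; apply: lerD; last by rewrite mulr_ge0// mulr_ge0 ?ltW.
      rewrite /q cubeE; case: forallP => [hq|_]; last by rewrite mulr0 mulr_ge0// ltW.
      rewrite mulr1; apply: ler_pM; [exact: ltW|exact: ltW|exact: ltW|].
      rewrite ler_expR lerN2 ler_wpM2l//; apply: le_trans hnd.
      rewrite -[n in n%:R]card_ord -sum1_card natr_sum mulr_suml; apply: ler_sum => i _.
      rewrite mul1r -real_normK ?num_real// lerXn2r ?nnegrE// ?ltW//.
    rewrite -leNgt in hi.
    have -> : q x = 0.
      rewrite /q cubeE; case: forallP => // /(_ i); rewrite !mxE => hq.
      by have := le_trans hi hq; rewrite leNgt hd'.
    rewrite mulr0 -lerBlDr sub0r.
    have ge : gauss_at y m x <= e1 * e1.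
      rewrite e2 ler_expR lerN2 ler_wpM2l//.
      apply: (@le_trans _ _ ((x 0 i - y 0 i) ^+ 2)).
        by rewrite -[leRHS]real_normK ?num_real// lerXn2r ?nnegrE// ltW.
      rewrite /sqn (bigD1 i)//= !mxE lerDl sumr_ge0// => j _; exact: sqr_ge0.
    rewrite lerNl -mulNr; apply: (@le_trans _ _ (`|V x| * gauss_at y m x)).
      by rewrite ler_wpM2r// -normrN ler_norm.
    by rewrite mulrC ler_wpM2r.
  have := normr_intRn_le i1 i4 pt.
  have -> : intRn (fun x => V x * gauss_at y m x + e1 * e1 * `|V x|) =
      intRn (fun x => V x * gauss_at y m x) + e1 * e1 * G.
    rewrite -[e1 * e1 * G](RintegralZl _ measurableT inV).
    exact: (RintegralD measurableT i2 i3).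
  have -> : intRn (fun x => c * e1 * q x) = c * e1 * intRn q.
    exact: (RintegralZl _ measurableT iq).
  rewrite V0 add0r ger0_norm; last by rewrite mulr_ge0 ?mulr_ge0// ltW.
  have -> : c * e1 * intRn q = e1 * (c * intRn q) by ring.
  by rewrite -[e1 * e1 * G]mulrA (ler_pM2l e1p) [e1 * G]mulrC.
pose a := d ^+ 2 / 2.
have a0 : 0 < a by rewrite divr_gt0// exprn_gt0.
have cv : 0 < c * intRn q by rewrite mulr_gt0.
pose m := (Num.truncn (G / (c * intRn q * a))).+1.
have hm : G / (c * intRn q * a) < m%:R by exact: truncnS_gt.
have := key m; apply/negP; rewrite -ltNge expRN ltr_pdivrMr ?expR_gt0//.
rewrite ltr_pdivrMr ?mulr_gt0// in hm.
apply: (lt_le_trans hm); rewrite mulrCA (ler_pM2l cv).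
by apply: le_trans (expR_ge1Dx _); rewrite -/a ler_wpDl.
Qed.

End gaussian_concentration.

Section two_solutions.
Context {R : realType} {n : nat}.
Notation mu := (@lebesgue_measure R).
Local Notation tup := (n.-tuple (measurableTypeR R)).
Variables (alpha cnu T : R) (N1 N2 : 'rV[R]_n -> R -> R).
Hypotheses (a01 : 0 < alpha < 1) (T0 : 0 < T).
Hypotheses (sN1 : fundamental_solution alpha cnu T N1)
  (sN2 : fundamental_solution alpha cnu T N2).

Let W (x : 'rV[R]_n) (t : R) := N1 x t - N2 x t.

(** Constant in time after [T], and zero up to time [0], where the two solutions
    have the same datum. *)
Let wt (phi : 'rV[R]_n -> R) (t : R) : R :=
  if 0 < t then intRn (fun x => W x (Num.min t T) * phi x) else 0.

Let tminP t : 0 < t -> 0 < Num.min t T <= T.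
Proof. by move=> t0; rewrite lt_min t0 T0 ge_min lexx orbT. Qed.

Let W_mass : exists2 m : R, 0 <= m & forall t, 0 < t <= T ->
  integrableRn (W ^~ t) /\ intRn (fun x => `|W x t|) <= m.
Proof.
have [M1 H1] := fs_mass sN1; have [M2 H2] := fs_mass sN2.
have TT : 0 < T <= T by rewrite T0 lexx.
have aux t : 0 < t <= T -> integrableRn (W ^~ t) /\ intRn (fun x => `|W x t|) <= M1 + M2.
  move=> tT; have [i1 m1] := H1 t tT; have [i2 m2] := H2 t tT.
  have i3 : integrableRn (W ^~ t) by exact: (integrableRB measurableT i1 i2).
  split => //; have j1 : integrableRn (fun x => `|N1 x t|) by exact: (integrable_normr i1).
  have j2 : integrableRn (fun x => `|N2 x t|) by exact: (integrable_normr i2).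
  have j3 : integrableRn (fun x => `|W x t|) by exact: (integrable_normr i3).
  have j4 : integrableRn (fun x => `|N1 x t| + `|N2 x t|) by exact: (integrableRD measurableT j1 j2).
  apply: (@le_trans _ _ (intRn (fun x => `|N1 x t| + `|N2 x t|))).
    apply: le_trans (ler_norm _) _; apply: (normr_intRn_le j3 j4) => x.
    by rewrite normr_id; exact: ler_normB.
  have -> : intRn (fun x => `|N1 x t| + `|N2 x t|) =
      intRn (fun x => `|N1 x t|) + intRn (fun x => `|N2 x t|).
    exact: (RintegralD measurableT j1 j2).
  exact: lerD.
exists (M1 + M2) => //; have [_ h] := aux T TT.
by apply: le_trans h; apply: Rintegral_ge0.
Qed.

Let bm (phi : 'rV[R]_n -> R) (K : R) :=
  measurable_fun setT (fun u : tup => phi (row_of_tuple u)) /\ forall x, `|phi x| <= K.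

Let Wphi_int phi K t : bm phi K -> 0 < t <= T -> integrableRn (fun x => W x t * phi x).
Proof.
move=> [mp pK] tT; have [m m0 H] := W_mass; have [i1 _] := H t tT.
exact: (integrableRn_mul i1 mp pK).
Qed.

Let wt_bound : exists2 m : R, 0 <= m & forall phi K t, bm phi K -> `|wt phi t| <= m * K.
Proof.
have [m m0 H] := W_mass; exists m => // phi K t pb; have [mp pK] := pb.
have K0 : 0 <= K by exact: le_trans (normr_ge0 _) (pK 0).
rewrite /wt; case: ifP => t0; last by rewrite normr0 mulr_ge0.
have tT := tminP t0; have [i1 h1] := H _ tT.
have i2 : integrableRn (fun x => `|W x (Num.min t T)|) by exact: (integrable_normr i1).
have i3 : integrableRn (fun x => K * `|W x (Num.min t T)|) by exact: (integrableRZ measurableT K i2).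
apply: (@le_trans _ _ (intRn (fun x => K * `|W x (Num.min t T)|))).
  apply: (normr_intRn_le (Wphi_int pb tT) i3) => x.
  by rewrite normrM mulrC ler_wpM2r.
have -> : intRn (fun x => K * `|W x (Num.min t T)|) = K * intRn (fun x => `|W x (Num.min t T)|).
  exact: (RintegralZl K measurableT i2).
by rewrite mulrC ler_wpM2r.
Qed.

Let wt_le0 phi t : t <= 0 -> wt phi t = 0.
Proof. by move=> t0; rewrite /wt ltNge t0. Qed.

Let wtD phi psi K L t : bm phi K -> bm psi L ->
  wt (fun x => phi x + psi x) t = wt phi t + wt psi t.
Proof.
move=> pb qb; rewrite /wt; case: ifP => t0; last by rewrite addr0.
have tT := tminP t0; have i1 := Wphi_int pb tT; have i2 := Wphi_int qb tT.
have <- : intRn (fun x => W x (Num.min t T) * phi x + W x (Num.min t T) * psi x) =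
    intRn (fun x => W x (Num.min t T) * phi x) + intRn (fun x => W x (Num.min t T) * psi x).
  exact: (RintegralD measurableT i1 i2).
by apply: eq_Rintegral => u _; rewrite mulrDr.
Qed.

Let wtZ (a : R) phi K t : bm phi K -> wt (fun x => a * phi x) t = a * wt phi t.
Proof.
move=> pb; rewrite /wt; case: ifP => t0; last by rewrite mulr0.
have tT := tminP t0; have i1 := Wphi_int pb tT.
have <- : intRn (fun x => a * (W x (Num.min t T) * phi x)) = a * intRn (fun x => W x (Num.min t T) * phi x).
  exact: (RintegralZl a measurableT i1).
by apply: eq_Rintegral => u _; rewrite mulrCA.
Qed.

(** By dominated convergence in space, for each time. *)
Let wt_cvg (f : nat -> 'rV[R]_n -> R) phi K t : (forall m, bm (f m) K) -> bm phi K ->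
  (forall x, f m x @[m --> \oo] --> phi x) -> wt (f m) t @[m --> \oo] --> wt phi t.
Proof.
move=> fb pb fp; rewrite /wt; case: ifP => t0; last exact: cvg_cst.
have tT := tminP t0; have [m m0 H] := W_mass; have [i1 _] := H _ tT.
have i2 : integrableRn (fun x => `|W x (Num.min t T)|) by exact: (integrable_normr i1).
have i3 : integrableRn (fun x => K * `|W x (Num.min t T)|) by exact: (integrableRZ measurableT K i2).
apply: (@Rintegral_dct R _ _ (@lebn R n) setT measurableT
  (fun m u => W (row_of_tuple u) (Num.min t T) * f m (row_of_tuple u))
  (fun u => W (row_of_tuple u) (Num.min t T) * phi (row_of_tuple u))
  (fun u => K * `|W (row_of_tuple u) (Num.min t T)|) _ _ i3 _).2.
- move=> k; apply: measurable_funM; first exact: (measurable_integrableRn i1).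
  exact: (fb k).1.
- by move=> u _; apply: cvgMl_tmp; exact: fp.
- by move=> k u _; rewrite normrM mulrC ler_wpM2r//; exact: (fb k).2.
Qed.

Let test_bm phi : test_function phi -> exists K, bm phi K.
Proof.
move=> tp; have [K pK] := test_bounded tp; exists K; split => //.
exact: (measurable_continuous_row (smooth_continuous tp.1)).
Qed.

Let p phi t := pairing N1 phi t - pairing N2 phi t.

Let p_continuous phi : test_function phi -> {within `[0, T], continuous (p phi)}.
Proof.
move=> tp; have c1 := fs_weak_init sN1 tp; have c2 := fs_weak_init sN2 tp.
by move=> s; exact: (cvgB (c1 s) (c2 s)).
Qed.

Let p0 phi : p phi 0 = 0.
Proof. by rewrite /p /pairing eqxx subrr. Qed.

Let pE phi : test_function phi -> extend T (p phi) = wt phi.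
Proof.
move=> tp; apply/funext => t; rewrite /extend /wt; case: ifPn => t0; last first.
  by rewrite clamp_le0 ?p0// leNgt.
have tT := tminP t0; have /andP[t1 _] := tT.
have -> : clamp T t = Num.min t T by rewrite /clamp max_r// ltW.
rewrite /p /pairing gt_eqF//; have [K [mp pK]] := test_bm tp.
have [M1 H1] := fs_mass sN1; have [M2 H2] := fs_mass sN2.
have i1 := integrableRn_mul (H1 _ tT).1 mp pK; have i2 := integrableRn_mul (H2 _ tT).1 mp pK.
have <- : intRn (fun x => N1 x (Num.min t T) * phi x - N2 x (Num.min t T) * phi x) =
    intRn (fun x => N1 x (Num.min t T) * phi x) - intRn (fun x => N2 x (Num.min t T) * phi x).
  exact: (RintegralB measurableT i1 i2).
by apply: eq_Rintegral => u _; rewrite /W mulrBl.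
Qed.

Let wt_measurable_test phi : test_function phi -> measurable_fun setT (wt phi).
Proof.
move=> tp; rewrite -(pE tp); apply: continuous_measurable_fun.
apply: (continuous_extend T0); exact: p_continuous.
Qed.

(** The delta functions at time [0] cancel in the difference, so [caputo_volterra]
    applies to it. *)
Let wt_volterra phi t : test_function phi -> 0 < t < T ->
  abel_integral alpha (wt phi) t =
  Gamma (1 - alpha) * \int[mu]_(s in `]0, t[) (cnu * wt (laplacian phi) s).
Proof.
move=> tp tT; have tl := test_laplacian tp.
have cl : {within `[0, T], continuous (fun s => cnu * p (laplacian phi) s)}.
  by move=> s; apply: cvgMl_tmp; exact: (p_continuous tl).
have h s : 0 < s <= T -> is_caputo T alpha (p phi) s (cnu * p (laplacian phi) s).
  move=> sT; have /andP[s0 _] := sT.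
  have -> : cnu * p (laplacian phi) s = cnu * intRn (fun x => N1 x s * laplacian phi x) -
      cnu * intRn (fun x => N2 x s * laplacian phi x).
    by rewrite /p /pairing gt_eqF// mulrBr.
  apply: (is_caputoB a01 T0 (fs_weak_init sN1 tp) (fs_weak_init sN2 tp) sT).
    exact: (fs_weak_eq sN1 tp sT).
  exact: (fs_weak_eq sN2 tp sT).
have := caputo_volterra a01 T0 (p_continuous tp) (p0 phi) cl h tT.
rewrite (pE tp) => ->; congr (_ * _); apply: eq_Rintegral => s _.
by rewrite -(pE tl).
Qed.

(** The primitive of [wt phi], unlike [wt phi] itself, can be shown to vanish for
    waves directly from Abel's equation, and it passes to bounded limits. *)
Let null phi : Prop := [/\ exists K, bm phi K, measurable_fun setT (wt phi) &
  forall t, 0 < t < T -> \int[mu]_(s in `]0, t[) wt phi s = 0].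

Let wt_measurable_cvg (f : nat -> 'rV[R]_n -> R) phi K : (forall m, bm (f m) K) -> bm phi K ->
  (forall x, f m x @[m --> \oo] --> phi x) ->
  (forall m, measurable_fun setT (wt (f m))) -> measurable_fun setT (wt phi).
Proof.
move=> fb pb fp mf; apply: (@measurable_fun_cvg _ _ R setT (fun k t => wt (f k) t)).
  by move=> k; exact: mf.
by move=> t _; exact: (wt_cvg fb pb fp).
Qed.

Let mI t : measurable (`]0, t[%classic : set (measurableTypeR R)).
Proof. exact: measurable_itv. Qed.

Let prim_cvg (f : nat -> 'rV[R]_n -> R) phi K t : (forall m, bm (f m) K) -> bm phi K ->
  (forall x, f m x @[m --> \oo] --> phi x) ->
  (forall m, measurable_fun setT (wt (f m))) ->
  \int[mu]_(s in `]0, t[) wt (f m) s @[m --> \oo] --> \int[mu]_(s in `]0, t[) wt phi s.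
Proof.
move=> fb pb fp mf; have [m m0 wb] := wt_bound.
have [iK _] := integrable_bounded_oo 0 t (mf 0%N) (fun s => wb _ _ s (fb 0%N)).
apply: (@Rintegral_dct R _ _ mu (`]0, t[%classic) (mI t) (fun k s => wt (f k) s) (wt phi)
  (fun=> m * K) _ _ iK _).2.
- by move=> k; exact: measurable_funTS (mf k).
- by move=> s _; exact: (wt_cvg fb pb fp).
- by move=> k s _; exact: (wb _ _ s (fb k)).
Qed.

Let null_cvg (f : nat -> 'rV[R]_n -> R) phi K : (forall m, bm (f m) K) -> bm phi K ->
  (forall x, f m x @[m --> \oo] --> phi x) -> (forall m, null (f m)) -> null phi.
Proof.
move=> fb pb fp nf; have mf m : measurable_fun setT (wt (f m)) by have [] := nf m.
split; [by exists K|exact: (wt_measurable_cvg fb pb fp mf)|move=> t tT].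
have h := prim_cvg (t := t) fb pb fp mf.
have e : (fun m => \int[mu]_(s in `]0, t[) wt (f m) s) = (fun=> 0).
  by apply/funext => m; have [_ _] := nf m; exact.
rewrite e in h; exact: (cvg_unique _ h (cvg_cst _)).
Qed.

Let nullD phi psi : null phi -> null psi -> null (fun x => phi x + psi x).
Proof.
move=> [[K pb] mp ip] [[L qb] mq iq].
have e : wt (fun x => phi x + psi x) = (fun t => wt phi t + wt psi t).
  by apply/funext => t; exact: wtD pb qb.
split.
- exists (K + L); split; first exact: measurable_funD pb.1 qb.1.
  by move=> x; apply: le_trans (ler_normD _ _) _; apply: lerD; [exact: pb.2|exact: qb.2].
- by rewrite e; exact: measurable_funD.
move=> t tT; rewrite e; have [m m0 wb] := wt_bound.
have [_ i1] := integrable_bounded_oo 0 t mp (fun s => wb _ _ s pb).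
have [_ i2] := integrable_bounded_oo 0 t mq (fun s => wb _ _ s qb).
by rewrite (RintegralD (mI t) i1 i2) ip// iq// addr0.
Qed.

Let nullZ (a : R) phi : null phi -> null (fun x => a * phi x).
Proof.
move=> [[K pb] mp ip].
have e : wt (fun x => a * phi x) = (fun t => a * wt phi t).
  by apply/funext => t; exact: wtZ pb.
split.
- exists (`|a| * K); split; first exact: measurable_funM (@measurable_cst _ _ _ _ _ a) pb.1.
  by move=> x; rewrite normrM ler_wpM2l//; exact: pb.2.
- by rewrite e; exact: measurable_funM.
move=> t tT; rewrite e; have [m m0 wb] := wt_bound.
have [_ i1] := integrable_bounded_oo 0 t mp (fun s => wb _ _ s pb).
by rewrite (RintegralZl a (mI t) i1) ip// mulr0.
Qed.

(** A wave is an eigenfunction of the Laplacian, and the error caused by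
    cutting it off disappears as the cut-off moves to infinity; there remains
    Abel's equation for the Fourier coefficient. *)
Let null_wave k c : null (wave k c).
Proof.
have [Kc cK] := @cutoff_bound R n.
have [C HC] := laplacian_cutoff_wave k c.
have [m m0 wb] := wt_bound.
pose e (j : nat) : R := j.+1%:R^-1.
have e0 j : 0 < e j by rewrite invr_gt0 ltr0n.
have e1 j : 0 < e j <= 1 by rewrite e0 invf_le1 ?ltr0n// ler1n.
pose f (j : nat) (x : 'rV[R]_n) := wave k c x * cutoff (e j) x.
have tf j : test_function (f j) by exact: test_cutoff_wave.
pose K := Num.max Kc 1.
have wm : bm (wave k c) K.
  split; first exact: (measurable_continuous_row (smooth_continuous (smooth_wave k c))).
  by move=> x; apply: le_trans (wave_le1 k c x) _; rewrite le_max lexx orbT.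
have fb j : bm (f j) K.
  split; first exact: (measurable_continuous_row (smooth_continuous (tf j).1)).
  move=> x; rewrite /f normrM -[K]mul1r; apply: ler_pM => //; first exact: wave_le1.
  by apply: le_trans (cK _ _) _; rewrite le_max lexx.
have fc x : f j x @[j --> \oo] --> wave k c x.
  have h : f j x @[j --> \oo] --> wave k c x * 1.
    by apply: cvgMl_tmp; exact: cvg_cutoff.
  by rewrite mulr1 in h.
have mf j : measurable_fun setT (wt (f j)) by exact: wt_measurable_test.
have mw : measurable_fun setT (wt (wave k c)) by exact: (wt_measurable_cvg fb wm fc mf).
split; [by exists K|exact: mw|move=> t tT].
pose lam := Gamma (1 - alpha) * cnu * sqn k.
apply: (@abel_unique R alpha a01 (wt (wave k c)) (m * K) T lam mw
  (fun s => wb _ _ s wm) (wt_le0 (wave k c)) _ t tT) => {tT}t tT.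
have abound j := fun s => wb _ _ s (fb j).
have ib := @integrable_abel_bound R alpha a01 (m * K) t.
have cA : abel_integral alpha (wt (f j)) t @[j --> \oo] --> abel_integral alpha (wt (wave k c)) t.
  have [_ ->] := @abel_integralE R alpha a01 (wt (wave k c)) (m * K) mw
    (fun s => wb _ _ s wm) (wt_le0 (wave k c)) t.
  have eA : (fun j => abel_integral alpha (wt (f j)) t) =
      (fun j => \int[mu]_s (wt (f j) s * pw (- alpha) (t - s))).
    apply/funext => j; exact: (@abel_integralE R alpha a01 (wt (f j)) (m * K) (mf j)
      (abound j) (wt_le0 (f j)) t).2.
  rewrite eA; apply: (@Rintegral_dct R _ _ mu setT measurableT
    (fun j s => wt (f j) s * pw (- alpha) (t - s)) (fun s => wt (wave k c) s * pw (- alpha) (t - s))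
    _ _ _ ib _).2.
  - move=> j; apply: measurable_funM; first exact: mf.
    by apply: (measurableT_comp (measurable_pw _)); exact: measurable_funB.
  - by move=> s _; apply: cvgMr_tmp; exact: (wt_cvg fb wm fc).
  - by move=> j s _; exact: (abel_kernel_bound alpha (abound j) (wt_le0 (f j))).
have cJ := prim_cvg (t := t) fb wm fc mf.
have /andP[t0 _] := tT.
pose err j (x : 'rV[R]_n) := laplacian (f j) x + sqn k * f j x.
have errb j : bm (err j) (C * e j).
  split; last by move=> x; exact: HC.
  apply: measurable_funD.
    exact: (measurable_continuous_row (smooth_continuous (test_laplacian (tf j)).1)).
  exact: measurable_funM (@measurable_cst _ _ _ _ _ (sqn k)) (fb j).1.
have sumE j : abel_integral alpha (wt (f j)) t + lam * \int[mu]_(s in `]0, t[) wt (f j) s =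
    Gamma (1 - alpha) * cnu * \int[mu]_(s in `]0, t[) wt (err j) s.
  have [L lb] := test_bm (test_laplacian (tf j)).
  have skb : bm (fun x => sqn k * f j x) (sqn k * K).
    split; first exact: measurable_funM (@measurable_cst _ _ _ _ _ (sqn k)) (fb j).1.
    by move=> x; rewrite normrM ger0_norm ?sqn_ge0// ler_wpM2l ?sqn_ge0//; exact: (fb j).2.
  have mL := wt_measurable_test (test_laplacian (tf j)).
  have [_ i1] := integrable_bounded_oo 0 t mL (fun s => wb _ _ s lb).
  have [_ i2] := integrable_bounded_oo 0 t (mf j) (abound j).
  have eE s : wt (err j) s = wt (laplacian (f j)) s + sqn k * wt (f j) s.
    by rewrite /err (wtD s lb skb) (wtZ (sqn k) s (fb j)).
  rewrite (wt_volterra (tf j) tT) (RintegralZl cnu (mI t) i1).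
  have -> : \int[mu]_(s in `]0, t[) wt (err j) s =
      \int[mu]_(s in `]0, t[) wt (laplacian (f j)) s + sqn k * \int[mu]_(s in `]0, t[) wt (f j) s.
    rewrite -(RintegralZl (sqn k) (mI t) i2) -(RintegralD (mI t) i1 (integrableRZ (mI t) (sqn k) i2)).
    by apply: eq_Rintegral => s _; exact: eE.
  have alg (g a b c' d : R) : g * (a * b) + g * a * c' * d = g * a * (b + c' * d) by ring.
  exact: alg.
have cE : abel_integral alpha (wt (f j)) t + lam * \int[mu]_(s in `]0, t[) wt (f j) s
    @[j --> \oo] --> (0 : R).
  have mE j : measurable_fun setT (wt (err j)).
    have [L lb] := test_bm (test_laplacian (tf j)).
    have skb : bm (fun x => sqn k * f j x) (sqn k * K).
      split; first exact: measurable_funM (@measurable_cst _ _ _ _ _ (sqn k)) (fb j).1.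
      by move=> x; rewrite normrM ger0_norm ?sqn_ge0// ler_wpM2l ?sqn_ge0//; exact: (fb j).2.
    have -> : wt (err j) = (fun s => wt (laplacian (f j)) s + sqn k * wt (f j) s).
      by apply/funext => s; rewrite /err (wtD s lb skb) (wtZ (sqn k) s (fb j)).
    apply: measurable_funD; first exact: (wt_measurable_test (test_laplacian (tf j))).
    exact: measurable_funM.
  have eE : (fun j => abel_integral alpha (wt (f j)) t + lam * \int[mu]_(s in `]0, t[) wt (f j) s) =
      (fun j => Gamma (1 - alpha) * cnu * \int[mu]_(s in `]0, t[) wt (err j) s).
    by apply/funext => j; exact: sumE.
  rewrite eE; apply: norm_cvg0.
  pose q := `|Gamma (1 - alpha) * cnu| * (m * C * t).
  have cq : q * e j @[j --> \oo] --> (0 : R).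
    have h : q * e j @[j --> \oo] --> (q * 0 : R) by apply: cvgMl_tmp; exact: cvg_invS.
    by rewrite mulr0 in h.
  apply: (squeeze_cvgr _ (cvg_cst 0) cq).
  near=> j; rewrite normr_ge0/= normrM /q -[leRHS]mulrA; apply: ler_wpM2l => //.
  have [iK i1] := integrable_bounded_oo 0 t (mE j) (fun s => wb _ _ s (errb j)).
  have h := normr_Rintegral_le (mI t) i1 iK (fun s _ => wb _ _ s (errb j)).
  apply: (le_trans h); rewrite (Rintegral_cst_oo _ t0).
  have alg (a b c' d : R) : a * (b * d) * c' = a * b * c' * d by ring.
  by rewrite alg.
have cL : abel_integral alpha (wt (f j)) t + lam * \int[mu]_(s in `]0, t[) wt (f j) s
    @[j --> \oo] --> abel_integral alpha (wt (wave k c)) t + lam * \int[mu]_(s in `]0, t[) wt (wave k c) s.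
  by apply: cvgD => //; apply: cvgMl_tmp.
have h := cvg_unique (@Rhausdorff R) cL cE.
have alg (a b : R) : a + lam * b = 0 -> a = - lam * b.
  by move=> /eqP; rewrite addr_eq0 mulNr => /eqP.
exact: (alg _ _ (h _)).
Unshelve. all: by end_near. Qed.

Let null_trig f : trig f -> null f.
Proof.
elim=> {f} [a k c|f g _ nf _ ng]; last exact: nullD.
exact: nullZ (null_wave k c).
Qed.

Let gauss_bm y m : bm (gauss_at y m) 1.
Proof.
split; last exact: gauss_at_le1.
exact: measurable_continuous_row (@continuous_gauss_at R n y m).
Qed.

(** Gaussians are bounded limits of powers of products of cosines. *)
Let null_gauss y m : null (gauss_at y m).
Proof.
pose th (x : 'rV[R]_n) i := Num.sqrt m%:R * (x 0 i - y 0 i).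
pose f (j : nat) (x : 'rV[R]_n) : R :=
  \prod_(i < n) (cos (th x i * Num.sqrt j.+1%:R^-1) ^+ 2) ^+ j.+1.
have tf j : trig (f j).
  apply: trig_prod => i; do 2 apply: trig_exp.
  pose q : R := Num.sqrt m%:R * Num.sqrt j.+1%:R^-1.
  have -> : (fun x : 'rV[R]_n => cos (th x i * Num.sqrt j.+1%:R^-1)) =
      (fun x => cos (q * x 0 i + - (q * y 0 i))).
    by apply/funext => x; congr cos; rewrite /th /q; ring.
  exact: trig_cos_coord.
have nf j : null (f j) by exact: null_trig.
have fb j : bm (f j) 1.
  have [[K [mp _]] _ _] := nf j; split => // x.
  rewrite /f normr_prod; apply: prodr_ile1 => i _; rewrite normr_ge0/= !normrX.
  by rewrite !exprn_ile1 ?exprn_ge0// ler_norml cos_geN1 cos_le1.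
apply: (null_cvg fb (gauss_bm y m) _ nf) => x.
have -> : gauss_at y m x = \prod_(i < n) expR (- th x i ^+ 2).
  rewrite -expR_sum sumrN /gauss_at /sqn mulr_sumr; congr (expR (- _)).
  by apply: eq_bigr => i _; rewrite /th exprMn sqr_sqrtr// !mxE.
apply: cvg_big; first exact: mul_continuous.
by move=> i _; exact: cvg_cos_gauss.
Qed.

(** By Lebesgue's differentiation theorem, since the primitive vanishes. *)
Let gauss_ae y m : \forall t \ae mu, 0 < t < T -> wt (gauss_at y m) t = 0.
Proof.
have [[K pb] mw iw] := null_gauss y m.
have [C C0 wb] := wt_bound.
pose f := (wt (gauss_at y m)) \_ (`]0, T[%classic : set R).
have [_ i0] := integrable_bounded_oo 0 T mw (fun s => wb _ _ s pb).
have fi : mu.-integrable setT (EFin \o f).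
  have := i0; rewrite (integrable_mkcond _ (mI T)); apply: eq_integrable => // s _.
  by rewrite restrict_EFin.
have fl : locally_integrable setT f by exact: (open_integrable_locally openT fi).
have fiy (y' : R) : mu.-integrable [set` Interval (BRight (0 : R)) (BRight y')] (EFin \o f).
  by apply: integrableST fi; exact: measurable_itv.
have h := FTC1 fiy fl.
apply: (@filterS _ _ (ae_filter_ringOfSetsType mu) _ _ _ h) => t ht /andP[t0 tT].
have [_ h2] := ht t0.
have ft : f t = wt (gauss_at y m) t by rewrite /f patchE mem_setE in_itv /= t0 tT.
rewrite -ft -h2 derive1E.
have near0 : \forall x \near t, cst 0 x = \int[mu]_(s in [set` Interval (BRight (0 : R)) (BRight x)]) f s.
  have n1 : \forall x \near t, 0 < x by exact: lt_nbhsr.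
  have n2 : \forall x \near t, x < T by exact: lt_nbhsl.
  apply: filterS2 n1 n2 => x x0 xT.
  have xT' : 0 < x < T by rewrite x0.
  apply: (etrans (esym (iw x xT'))).
  have mf : measurable_fun setT (EFin \o f) by case/integrableP: fi.
  have mfx : measurable_fun `]0, x[ (EFin \o f) by exact: measurable_funTS.
  have e := integral_itv_bndoo false false mfx.
  transitivity (\int[mu]_(s in `]0, x[) f s); last by rewrite /Rintegral -e.
  apply: eq_Rintegral => s; rewrite mem_setE in_itv /= => /andP[s0 sx].
  by rewrite /f patchE mem_setE in_itv /= s0 (lt_trans sx xT).
have d0 : is_derive t 1 (fun x : R => \int[mu]_(s in [set` Interval (BRight (0 : R)) (BRight x)]) f s) 0.
  exact: (near_eq_is_derive near0 (is_derive_cst (0 : R) t (1 : R))).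
by have [_] := d0.
Qed.

(** Countably many Gaussians share one exceptional set of times. *)
Let W_null_ae y : y != 0 -> \forall t \ae mu, 0 < t < T -> W y t = 0.
Proof.
move=> y0; have h := ae_foralln (gauss_ae y).
apply: (@filterS _ _ (ae_filter_ringOfSetsType mu) _ _ _ h) => t ht tT.
have [m m0 Hm] := W_mass; have /andP[t0 t1] := tT.
have tT' : 0 < t <= T by rewrite t0 ltW.
have [i1 _] := Hm t tT'.
have e k : intRn (fun x => W x t * gauss_at y k x) = 0.
  by have := ht k tT; rewrite /wt t0 min_l// ltW.
have cW : {for y, continuous (W ^~ t)}.
  have [c1 _] := fs_regular sN1 y0 tT'; have [c2 _] := fs_regular sN2 y0 tT'.
  exact: (cvgB c1 c2).
apply/eqP; rewrite eq_le; apply/andP; split; first exact: (gauss_concentration i1 cW e).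
rewrite -oppr_le0.
have i2 : integrableRn (fun x => -1 * W x t) by exact: (integrableRZ measurableT (-1) i1).
have iN : integrableRn (fun x => - W x t).
  by move: i2; congr integrableRn; apply/funext => x; rewrite mulN1r.
apply: (gauss_concentration (V := fun x => - W x t) iN (cvgN cW)) => k.
have [K kb] : exists K, bm (gauss_at y k) K by exists 1.
have i3 := Wphi_int kb tT'.
have -> : intRn (fun x => - W x t * gauss_at y k x) = -1 * intRn (fun x => W x t * gauss_at y k x).
  rewrite -[RHS](RintegralZl (-1) measurableT i3); apply: eq_Rintegral => x _.
  by rewrite mulN1r mulNr.
by rewrite e mulr0.
Qed.

(** Both solutions are continuous in time off the origin, and a continuous function
    that vanishes almost everywhere vanishes. *)
Lemma solution_unique y t : y != 0 -> 0 < t <= T -> N1 y t = N2 y t.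
Proof.
move=> y0 tT; have /andP[t0 t1] := tT.
have [_ c1] := fs_init sN1 y0; have [_ c2] := fs_init sN2 y0.
have cW : {within `[0, T], continuous (W y)} by move=> s; exact: (cvgB (c1 s) (c2 s)).
have ce := continuous_extend T0 cW.
have eE s : 0 < s <= T -> extend T (W y) s = W y s.
  by move=> /andP[s0 sT]; rewrite /extend clamp_id// ltW.
suff : W y t = 0 by move=> /eqP; rewrite subr_eq0 => /eqP.
rewrite -(eE t tT); apply/eqP/negPn/negP => Wt.
have : \forall s \near t, extend T (W y) s != 0.
  have := ce t; move=> /(_ (fun z => z != 0)); apply.
  exact: (open_nbhs_nbhs (conj (@open_neq R 0) Wt)).
move=> [d /= d0 hd].
have [A [mA A0 hA]] := W_null_ae y0.
pose a := Num.max (t - d) 0.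
have at' : a < t by rewrite /a gt_max t0 ltrBlDr ltrDl d0.
have sub : `]a, t[%classic `<=` A.
  move=> s /=; rewrite in_itv /= => /andP[s1 s2]; apply: hA => /= h.
  have [s3 s4] : t - d < s /\ 0 < s by move: s1; rewrite /a gt_max => /andP[].
  have s5 : s < T by exact: lt_le_trans t1.
  have sT : 0 < s <= T by rewrite s4 ltW.
  have : extend T (W y) s != 0.
    by apply: hd; rewrite /= gtr0_norm ?subr_gt0// ltrBlDl -ltrBlDr.
  by rewrite (eE s sT) h ?eqxx// s4.
have mI' : measurable (`]a, t[%classic : set (measurableTypeR R)) by exact: measurable_itv.
have := le_measure mu; move=> /(_ _ _ (mem_set mI') (mem_set mA) sub).
have e : lebesgue_measure (`]a, t[%classic : set R) = (t - a)%:E.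
  by rewrite lebesgue_measure_itv/= lte_fin at' EFinN.
move=> le; have {le} : ((t - a)%:E <= 0)%E by rewrite -A0 -e; exact: le.
by rewrite lee_fin leNgt subr_gt0 at'.
Qed.

End two_solutions.

Theorem theorem5 (R : realType) (n : nat) (alpha T cnu sigma : R)
    (hn : (1 <= n)%N) (halpha : 0 < alpha < 1) (hT : 0 < T) (hcnu : 0 < cnu)
    (hsigma : sigma < Num.min (n%:R / 2) 1) :
  (exists N : 'rV[R]_n -> R -> R, fundamental_solution alpha cnu T N) /\
  (forall N : 'rV[R]_n -> R -> R, fundamental_solution alpha cnu T N ->
    forall (x : 'rV[R]_n) (t : R), x != 0 -> 0 < t <= T ->
      (N x t)%:C =
        ((enorm x ^- n) * pi `^ (- (n%:R / 2)))%:C *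
        foxH2012 sigma 1 alpha (n%:R / 2) 1 1 1
          (enorm x ^+ 2 * t `^ (- alpha) / (4 * cnu))).
Proof.
have /andP[s1 s2] : (sigma < n%:R / 2) && (sigma < 1) by rewrite -lt_min.
have sF := sol_fundamental hn halpha hcnu T.
split; first by exists (sol alpha cnu).
move=> N sN x t x0 tT; have /andP[t0 _] := tT.
rewrite (solution_unique halpha hT sN sF x0 tT).
exact: (sol_foxH halpha hcnu s1 s2 x0 t0).
Qed.
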